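(* Let $\alpha\in\,]\tfrac12,1]$, let $p(\cdot)\in\mathcal{P}^{\log}([0,+\infty[)$ with $2<p^-\le p^+<+\infty$, and let $q\in\,]\tfrac{3}{2\alpha-1},+\infty[$ satisfy $$\frac{\alpha}{p(t)}+\frac{3}{2q}<\alpha-\frac12\qquad\text{for all } t\in[0,+\infty[ .$$ Let $\vec f\in L^1([0,+\infty[,L^q(\mathbb{R}^3))$ be a divergence free external force and let $\vec u_0\in L^q(\mathbb{R}^3)$ be a divergence free initial data. Then there exist a time $0<T<+\infty$ and a unique mild solution $\vec u$ of the fractional Navier-Stokes equations $$\partial_t\vec u=-(-\Delta)^\alpha\vec u-(\vec u\cdot\vec\nabla)\vec u+\vec\nabla P+\vec f,\qquad \mathrm{div}(\vec u)=0,\qquad \vec u(0,\cdot)=\vec u_0,$$ on $[0,T]\times\mathbb{R}^3$ in the space $L^{p(\cdot)}([0,T],L^q(\mathbb{R}^3))$.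
   Context: Vector fields $\vec u,\vec f$ take values in $\mathbb{R}^3$. $(-\Delta)^\alpha$ is the Fourier multiplier with symbol $|\xi|^{2\alpha}$. Variable exponents on $[0,+\infty[$: $\mathcal{P}([0,+\infty[)$ is the set of measurable functions $p(\cdot):[0,+\infty[\to[1,+\infty[$; $p^-=\operatorname{ess\,inf}p$, $p^+=\operatorname{ess\,sup}p$. With $\frac1{p_\infty}=\lim_{t\to+\infty}\frac1{p(t)}$, $p(\cdot)\in\mathcal{P}^{\log}([0,+\infty[)$ means that there is $C>0$ with $\left|\frac1{p(t)}-\frac1{p(s)}\right|\le\frac{C}{\log(e+1/|t-s|)}$ and $\left|\frac1{p(t)}-\frac1{p_\infty}\right|\le\frac{C}{\log(e+|t|)}$ for all $t,s\ge0$. $L^{p(\cdot)}([0,T],L^q(\mathbb{R}^3))$ is the space of measurable $\vec\varphi$ with finite Luxemburg norm $$\inf\Big\{\lambda>0:\ \int_0^T\Big|\frac{\|\vec\varphi(t,\cdot)\|_{L^q(\mathbb{R}^3)}}{\lambda}\Big|^{p(t)}dt\le1\Big\}.$$ Mild solution: $\vec u$ is a mild solution if it satisfies the integral equation $$\vec u(t,x)=\mathfrak g^\alpha_t*\vec u_0(x)+\int_0^t\mathfrak g^\alpha_{t-s}*\vec f(s,x)\,ds-\int_0^t\mathfrak g^\alpha_{t-s}*\mathbb{P}(\mathrm{div}(\vec u\otimes\vec u))(s,x)\,ds,$$ where $\mathfrak g^\alpha_t$ is the fractional heat kernel, i.e. the convolution kernel of $e^{-t(-\Delta)^\alpha}$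 (with Fourier transform $e^{-t|\xi|^{2\alpha}}$), $*$ is convolution in $x$, and $\mathbb{P}=\mathrm{Id}+\vec\nabla(-\Delta)^{-1}\mathrm{div}$ is the Leray projector (matrix Fourier symbol $\delta_{jk}-\xi_j\xi_k/|\xi|^2$). The operator $\mathfrak g^\alpha_{t-s}*\mathbb{P}\,\mathrm{div}(\cdot)$ is understood as convolution with the integrable kernel of $e^{-(t-s)(-\Delta)^\alpha}\mathbb{P}\,\mathrm{div}$. The pressure $P$ is recovered from $\vec u$. *)

(* Defs.v *)
From HB Require Import structures.
From mathcomp Require Import all_boot all_order all_algebra.
From mathcomp Require Import all_classical all_reals all_analysis.
From mathcomp Require Import ess_sup_inf.
From mathcomp Require Import complex.

Set Implicit Arguments.
Unset Strict Implicit.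
Unset Printing Implicit Defensive.

Import Order.TTheory GRing.Theory Num.Theory.
Import numFieldNormedType.Exports.

Local Open Scope classical_set_scope.
Local Open Scope ring_scope.
Local Open Scope complex_scope.

(* Points and vectors of R^3 are triples, so that the product sigma-algebra and
   product measures apply.  The norm inherited from the product type is the sup
   norm; the Euclidean norm is [enorm]. *)
Notation vec3 R := (R * R * R)%type.

Section Euclidean.
Context {R : realType}.
Implicit Types x y : vec3 R.

Definition coord3 (i : 'I_3) x : R := tnth [tuple x.1.1; x.1.2; x.2] i.

Definition basis3 (i : 'I_3) : vec3 R :=
  ((i == 0%N :> nat)%:R, (i == 1%N :> nat)%:R, (i == 2%N :> nat)%:R).

Definition dot x y : R := \sum_(i < 3) coord3 i x * coord3 i y.

Definition enorm x : R := Num.sqrt (dot x x).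

End Euclidean.

(* The library's Lebesgue measure lives on [measurableTypeR R], a copy of R
   carrying the Borel sigma-algebra; functions are still written with R and
   [vec3 R], to which these types are convertible. *)
Notation mplane R := (measurableTypeR R * measurableTypeR R)%type.
Notation mvec3 R := (mplane R * measurableTypeR R)%type.
Notation mtimevec3 R := (measurableTypeR R * mvec3 R)%type.

(* The sigma-finite structure that the library puts on product measures is
   shadowed there by the one on products of subprobabilities. *)
Lemma product_sigma_finite d1 d2 (T1 : measurableType d1)
    (T2 : measurableType d2) (R : realType)
    (m1 : {sigma_finite_measure set T1 -> \bar R})
    (m2 : {sigma_finite_measure set T2 -> \bar R}) :
  sigma_finite setT (m1 \x m2)%E.
Proof.
have /sigma_finiteP[F [TF ndF Foo]] := sigma_finiteT m1.
have /sigma_finiteP[G [TG ndG Goo]] := sigma_finiteT m2.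
exists (fun n => F n `*` G n).
  rewrite -setXTT TF TG predeqE => -[x y]; split.
    move=> [/= [n _ Fnx] [k _ Gky]]; exists (maxn n k) => //; split.
    - by move: x Fnx; exact/subsetPset/ndF/leq_maxl.
    - by move: y Gky; exact/subsetPset/ndG/leq_maxr.
  by move=> [n _ []/= ? ?]; split; exists n.
move=> k; have [? ?] := Foo k; have [? ?] := Goo k.
split; first exact: measurableX.
by rewrite product_measure1E// lte_mul_pinfty// ge0_fin_numE.
Qed.

Notation leb1 R := (@lebesgue_measure R).

Definition leb2 (R : realType) : set (mplane R) -> \bar R :=
  (leb1 R \x leb1 R)%E.
HB.instance Definition _ (R : realType) := Measure.on (@leb2 R).
HB.instance Definition _ (R : realType) :=
  Measure_isSigmaFinite.Build _ _ _ (@leb2 R) (product_sigma_finite _ _).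

Definition leb3 (R : realType) : set (mvec3 R) -> \bar R :=
  (@leb2 R \x leb1 R)%E.
HB.instance Definition _ (R : realType) := Measure.on (@leb3 R).
HB.instance Definition _ (R : realType) :=
  Measure_isSigmaFinite.Build _ _ _ (@leb3 R) (product_sigma_finite _ _).
Arguments leb3 : clear implicits.

Definition leb_spacetime (R : realType) : set (mtimevec3 R) -> \bar R :=
  (leb1 R \x leb3 R)%E.
HB.instance Definition _ (R : realType) := Measure.on (@leb_spacetime R).
HB.instance Definition _ (R : realType) :=
  Measure_isSigmaFinite.Build _ _ _ (@leb_spacetime R)
    (product_sigma_finite _ _).
Arguments leb_spacetime : clear implicits.

Section VariableExponents.
Context {R : realType}.
Implicit Types p : R -> R.

(* Exponents are functions on R whose values matter on [0, +oo[ only. *)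
Definition leb_half : {measure set (measurableTypeR R) -> \bar R} :=
  mrestr (leb1 R) (measurable_itv `[0, +oo[).

Definition variable_exponent p :=
  measurable_fun (`[0, +oo[ : set (measurableTypeR R)) p /\
  (forall t, 0 <= t -> 1 <= p t).

Definition exponent_inf p : \bar R := ess_inf leb_half (EFin \o p).

Definition exponent_sup p : \bar R := ess_sup leb_half (EFin \o p).

(* [l] is 1/p_oo, so that p_oo may be infinite.  For t = s the right-hand side
   is C, since 0^-1 = 0, and the bound holds trivially. *)
Definition log_holder_exponent p :=
  variable_exponent p /\
  exists2 l : R, (p t)^-1 @[t --> +oo] --> l &
  exists2 C : R, 0 < C &
    (forall t s, 0 <= t -> 0 <= s ->
       `|(p t)^-1 - (p s)^-1| <= C / ln (expR 1 + `|t - s|^-1)) /\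
    (forall t, 0 <= t -> `|(p t)^-1 - l| <= C / ln (expR 1 + `|t|)).

End VariableExponents.

Section FunctionSpaces.
Context {R : realType}.
Implicit Types (v : vec3 R -> vec3 R) (u : R -> vec3 R -> vec3 R).

Definition Lq_norm (q : R) v : \bar R :=
  Lnorm (leb3 R) q%:E (fun x => (enorm (v x))%:E).

Definition in_Lq (q : R) v :=
  (forall i, measurable_fun [set: mvec3 R] (fun x => coord3 i (v x))) /\
  (Lq_norm q v < +oo)%E.

Definition jointly_measurable (I : set R) u :=
  forall i, measurable_fun (I `*` setT : set (mtimevec3 R))
                           (fun z => coord3 i (u z.1 z.2)).

Definition in_L1Lq (q : R) u :=
  jointly_measurable `[0, +oo[ u /\
  (\int[leb1 R]_(t in `[0%R, +oo[) Lq_norm q (u t) < +oo)%E.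

Definition luxemburg_norm (p : R -> R) (q T : R) u : \bar R :=
  ereal_inf [set l%:E | l in [set l : R | 0 < l /\
    (\int[leb1 R]_(t in `[0%R, T])
       `| Lq_norm q (u t) * (l^-1)%:E | `^ p t <= 1)%E]].

Definition in_LpLq (p : R -> R) (q T : R) u :=
  jointly_measurable `[0, T] u /\ (luxemburg_norm p q T u < +oo)%E.

End FunctionSpaces.

Section Divergence.
Context {R : realType}.

Definition iterated_partial (s : seq 'I_3) (phi : vec3 R -> R)
    : vec3 R -> R :=
  foldr (fun i g => fun x => 'D_(basis3 i) g x) phi s.

Definition smooth (phi : vec3 R -> R) :=
  forall s : seq 'I_3, continuous (iterated_partial s phi) /\
    forall i x, derivable (iterated_partial s phi) x (basis3 i).

Definition test_function (phi : vec3 R -> R) :=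
  smooth phi /\ compact (closure [set x | phi x != 0]).

(* div v = 0 in the sense of distributions *)
Definition divergence_free (v : vec3 R -> vec3 R) :=
  forall phi, test_function phi ->
    \int[leb3 R]_x (\sum_(i < 3) coord3 i (v x) * 'D_(basis3 i) phi x) = 0.

End Divergence.

Section Kernels.
Context {R : realType}.
Implicit Types (x xi : vec3 R).

(* Fourier convention: F h (xi) = \int e^{-i x.xi} h(x) dx, so that d/dx_k has
   symbol i xi_k and F^-1 m (x) = (2 pi)^-3 \int e^{i x.xi} m(xi) dxi. *)
Definition inverse_fourier (m : vec3 R -> R[i]) x : R[i] :=
  let integrand xi := (cos (dot x xi) +i* sin (dot x xi)) * m xi in
  ((2 * pi) ^- 3)%:C *
  ((\int[leb3 R]_xi complex.Re (integrand xi)) +i*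
   (\int[leb3 R]_xi complex.Im (integrand xi))).

Definition heat_symbol (alpha t : R) xi : R :=
  expR (- (t * enorm xi `^ (2 * alpha))).

Definition leray_symbol (j k : 'I_3) xi : R :=
  (j == k)%:R - coord3 j xi * coord3 k xi / enorm xi ^+ 2.

(* The symbols below satisfy m(-xi) = conj (m(xi)), so their inverse Fourier
   transforms are real and taking real parts loses nothing. *)
Definition heat_kernel (alpha t : R) x : R :=
  complex.Re (inverse_fourier (fun xi => (heat_symbol alpha t xi)%:C) x).

(* The kernel of e^{-t(-Delta)^alpha} P div: it maps a matrix field F to the
   vector field with components sum_(k, l) K_(jkl) * F_(kl), where
   (div F)_k = sum_l d_l F_(kl). *)
Definition oseen_kernel (alpha t : R) (j k l : 'I_3) x : R :=
  complex.Re (inverse_fourier (fun xi =>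
    (heat_symbol alpha t xi * leray_symbol j k xi)%:C * ('i * (coord3 l xi)%:C))
    x).

Definition convolution (g h : vec3 R -> R) x : R :=
  \int[leb3 R]_y (g (x - y) * h y).

End Kernels.

Section MildSolutions.
Context {R : realType}.

(* The integral equation is an identity between classes of functions, required
   almost everywhere.  For u0 in L^q, f in L^1(L^q) and u in L^p(.)(L^q) with
   the exponents under consideration, the integrals converge absolutely for
   almost every (t, x), so the value that the library gives to divergent
   integrals (e.g. at s = t, where the kernels are singular) plays no role. *)
Definition mild_solution (alpha T : R) (f : R -> vec3 R -> vec3 R)
    (u0 : vec3 R -> vec3 R) (u : R -> vec3 R -> vec3 R) :=
  {ae leb_spacetime R, forall z : R * vec3 R, z.1 \in `[0, T] ->
    let t := z.1 in let x := z.2 in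
    forall j : 'I_3,
    coord3 j (u t x) =
      convolution (heat_kernel alpha t) (fun y => coord3 j (u0 y)) x
      + \int[leb1 R]_(s in `[0, t])
          convolution (heat_kernel alpha (t - s))
                      (fun y => coord3 j (f s y)) x
      - \int[leb1 R]_(s in `[0, t])
          \sum_(k < 3) \sum_(l < 3)
            convolution (oseen_kernel alpha (t - s) j k l)
                        (fun y => coord3 k (u s y) * coord3 l (u s y)) x}.

End MildSolutions.

(* Main.v *)
Require Import Defs.
From HB Require Import structures.
From mathcomp Require Import all_boot all_order all_algebra.
From mathcomp Require Import all_classical all_reals all_analysis.
From mathcomp Require Import measurable_realfun complex ring lra.

(** The solution is a fixed point of the map U |-> A - B(U, U), where A is the sum of the
heat flow of the initial data and of the Duhamel integral of the force, and B is the
Duhamel integral of the Oseen kernel, that is, of the kernel of the heat semigroup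
composed with the Leray projector and the divergence.

The kernels are inverse Fourier transforms, and everything needed about them is their
size.  Each derivative of the symbol along the a-th axis multiplies the kernel by the
coordinate x_a (cosT_derive), and is allowed as long as the resulting singularity at
the frequency 0 remains integrable, that is, has degree larger than -3.  The symbol of
the Oseen kernel has degree 1 and affords three derivatives; the heat symbol affords
four, since al > 1/2.  Hence at time 1 the heat kernel is integrable (heat_kernel_L1)
and the Oseen kernel has a finite norm of every exponent r > 1; scaling gives the
dependence on time (oseen_size_Lr).  With r the exponent conjugate to q, Young's and
Hoelder's inequalities yield the bilinear estimate (oseen_bilinear): the L^q norm of
B(U, V) at time t is at most the integral over [0, t] of C (t - s)^(- gam) |U(s)|_q
|V(s)|_q ds, with gam = (1 + 3/q) / (2 al).  The condition q > 3 / (2 al - 1) says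
exactly that gam < 1.

Since A is bounded in L^q uniformly in time, and a factor t^(1 - gam) makes the bilinear
term small on a short interval, Picard's iteration converges (picard_fixed_point).  The
solution is bounded in L^q at all positive times up to T, and bounded fields on a
bounded interval belong to the space with any variable exponent
(bounded_field_in_LpLq).  It is divergence free because A is and because, in Fourier
variables, the Leray symbol is orthogonal to the frequency (mild_field_div_free).

Uniqueness has to be proved in the larger space with variable exponent.  The condition
on p at time 0 reads 1 / p(0) < 1 - gam, and by log-Hoelder continuity some constant P
satisfies 1/P < 1 - gam and P <= p on a short interval (local_exponent); there a field
of the variable space has a norm in L^q whose P-th power is integrable.  The norm n of
the difference of two solutions then satisfies n(t) <= C int_0^t (t - s)^(- gam) H(s)
n(s) ds with H in L^P.  Hoelder's inequality turns it into a linear Volterra inequality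
for the power P / (P - 1) of n, whose kernel is still integrable, and multiplication by
a rapidly decreasing exponential makes that inequality contract: n vanishes
(volterra_zero, field_unique).

All these inequalities are established for integrals of absolute values, with values in
[0, +oo]; convergence of the integrals in the equation itself is deduced almost
everywhere from the finiteness of their norms. *)

Set Implicit Arguments.
Unset Strict Implicit.
Unset Printing Implicit Defensive.

Import Order.TTheory GRing.Theory Num.Theory.
Import numFieldNormedType.Exports.

Local Open Scope classical_set_scope.
Local Open Scope ring_scope.

(** * Nonnegative functions with infinite values *)

Section extended_powers.
Context d (T : measurableType d) (R : realType).
Variable mu : {measure set T -> \bar R}.
Local Open Scope ereal_scope.
Implicit Types f g : T -> \bar R.

Lemma lee_poweR (a b : \bar R) (r : R) : (0 <= r)%R -> 0 <= a -> a <= b ->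
  a `^ r <= b `^ r.
Proof.
move=> r0 a0 ab; apply: gt0_ler_poweR => //.
- by rewrite in_itv/= a0 leey.
- by rewrite in_itv/= (le_trans a0 ab) leey.
Qed.

Lemma emeasurable_poweR f (r : R) : measurable_fun [set: T] f ->
  measurable_fun [set: T] (fun x => f x `^ r).
Proof. by move=> mf; exact: (measurableT_comp (measurable_poweR r) mf). Qed.

Lemma ae_ltey_poweR f (r : R) : (0 < r)%R -> measurable_fun [set: T] f ->
  \int[mu]_x (f x `^ r) < +oo -> {ae mu, forall x, f x < +oo}.
Proof.
move=> r0 mf foo.
have : mu.-integrable [set: T] (fun x => f x `^ r).
  apply/integrableP; split; first exact: emeasurable_poweR.
  by under eq_integral do rewrite gee0_abs ?poweR_ge0//.
move/(integrable_ae measurableT); apply: filterS => x /(_ I) frfin.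
apply: (@lty_poweRy _ _ r); first by rewrite gt_eqF.
by rewrite ltey_eq frfin.
Qed.

Lemma ae_eq0_poweR f (r : R) : (0 < r)%R -> measurable_fun [set: T] f ->
  (forall x, 0 <= f x) ->
  \int[mu]_x (f x `^ r) = 0 -> {ae mu, forall x, f x = 0}.
Proof.
move=> r0 mf f0 int0.
have : \int[mu]_x `|f x `^ r| = 0.
  by under eq_integral do rewrite gee0_abs ?poweR_ge0//.
move/(ae_eq_integral_abs _ measurableT (emeasurable_poweR _ mf)).
by apply: filterS => x /(_ I); exact: poweR_eq0_eq0.
Qed.

Lemma ge0_Lnorm f (r : R) : (forall x, 0 <= f x) ->
  'N[mu]_r%:E[f] = (\int[mu]_x (f x `^ r)) `^ r^-1.
Proof.
move=> f0; rewrite unlock; congr (_ `^ _).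
by apply: eq_integral => x _; rewrite gee0_abs.
Qed.

Lemma ge0_Lnorm_pow f (r : R) : r != 0%R -> (forall x, 0 <= f x) ->
  'N[mu]_r%:E[f] `^ r = \int[mu]_x (f x `^ r).
Proof.
move=> r0 f0; rewrite poweR_Lnorm//.
by apply: eq_integral => x _; rewrite gee0_abs.
Qed.

Lemma ae_le_Lnorm f g (r : R) : (0 < r)%R ->
  measurable_fun [set: T] f -> measurable_fun [set: T] g ->
  {ae mu, forall x, `|f x| <= `|g x|} ->
  'N[mu]_r%:E[f] <= 'N[mu]_r%:E[g].
Proof.
move=> r0 mf mg fg; rewrite unlock.
have mab h : measurable_fun [set: T] h ->
    measurable_fun [set: T] (fun x => `|h x| `^ r).
  by move=> mh; apply: emeasurable_poweR; exact: measurableT_comp.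
apply: lee_poweR; first by rewrite invr_ge0 ltW.
  by apply: integral_ge0 => x _; rewrite poweR_ge0.
apply: ae_ge0_le_integral => //; try exact: mab.
- by move=> x _; rewrite poweR_ge0.
- by move=> x _; rewrite poweR_ge0.
by apply: filterS fg => x fg _; apply: lee_poweR => //; exact: ltW.
Qed.

Lemma le_Lnorm f g (r : R) : (0 < r)%R ->
  measurable_fun [set: T] f -> measurable_fun [set: T] g ->
  (forall x, 0 <= f x <= g x) ->
  'N[mu]_r%:E[f] <= 'N[mu]_r%:E[g].
Proof.
move=> r0 mf mg fg; apply: ae_le_Lnorm => //; apply: aeW => x.
by have /andP[f0 fgx] := fg x; rewrite !gee0_abs// (le_trans f0).
Qed.

(** The functions met below are integrals that may be infinite at some points. When
one of the two norms vanishes or is infinite, the inequality is immediate; otherwise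
both functions are finite almost everywhere and the real-valued case applies. *)
Lemma ge0_hoelder f g (p q : R) :
  measurable_fun [set: T] f -> measurable_fun [set: T] g ->
  (forall x, 0 <= f x) -> (forall x, 0 <= g x) ->
  (0 < p)%R -> (0 < q)%R -> (p^-1 + q^-1 = 1)%R ->
  \int[mu]_x (f x * g x) <=
  (\int[mu]_x (f x `^ p)) `^ p^-1 * (\int[mu]_x (g x `^ q)) `^ q^-1.
Proof.
move=> mf mg f0 g0 p0 q0 pq.
have mfp := emeasurable_poweR p mf; have mgq := emeasurable_poweR q mg.
have mfg : measurable_fun [set: T] (fun x => f x * g x) by exact: emeasurable_funM.
have fg0 x : [set: T] x -> 0 <= f x * g x by rewrite mule_ge0.
have F0 : 0 <= \int[mu]_x (f x `^ p).
  by apply: integral_ge0 => x _; exact: poweR_ge0.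
have G0 : 0 <= \int[mu]_x (g x `^ q).
  by apply: integral_ge0 => x _; exact: poweR_ge0.
have [FE|Fn0] := eqVneq (\int[mu]_x (f x `^ p)) 0.
  rewrite (_ : \int[mu]_x (f x * g x) = 0) ?mule_ge0 ?poweR_ge0//.
  rewrite (@ge0_ae_eq_integral _ _ _ mu setT _ (cst 0))//.
    by rewrite integral0.
  by apply: filterS (ae_eq0_poweR p0 mf f0 FE) => x -> _; rewrite mul0e.
have [GE|Gn0] := eqVneq (\int[mu]_x (g x `^ q)) 0.
  rewrite (_ : \int[mu]_x (f x * g x) = 0) ?mule_ge0 ?poweR_ge0//.
  rewrite (@ge0_ae_eq_integral _ _ _ mu setT _ (cst 0))//.
    by rewrite integral0.
  by apply: filterS (ae_eq0_poweR q0 mg g0 GE) => x -> _; rewrite mule0.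
have Fgt0 : 0 < (\int[mu]_x (f x `^ p)) `^ p^-1 by rewrite poweR_gt0// lt0e Fn0.
have Ggt0 : 0 < (\int[mu]_x (g x `^ q)) `^ q^-1 by rewrite poweR_gt0// lt0e Gn0.
have [FE|Fny] := eqVneq (\int[mu]_x (f x `^ p)) +oo.
  by rewrite FE poweRyr ?invr_eq0 ?gt_eqF// gt0_mulye// leey.
have [GE|Gny] := eqVneq (\int[mu]_x (g x `^ q)) +oo.
  by rewrite GE poweRyr ?invr_eq0 ?gt_eqF// gt0_muley// leey.
have aef : {ae mu, forall x, f x < +oo}.
  by apply: (ae_ltey_poweR p0 mf); rewrite ltey.
have aeg : {ae mu, forall x, g x < +oo}.
  by apply: (ae_ltey_poweR q0 mg); rewrite ltey.
have mff : measurable_fun [set: T] (fine \o f) by exact: measurableT_comp.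
have mfg' : measurable_fun [set: T] (fine \o g) by exact: measurableT_comp.
have := hoelder mu mff mfg' p0 q0 pq.
rewrite Lnorm1 unlock.
have fineE (h : T -> \bar R) : {ae mu, forall x, h x < +oo} -> (forall x, 0 <= h x) ->
    {ae mu, forall x, (fine (h x))%:E = h x}.
  move=> hy h0; apply: filterS hy => x hx.
  by rewrite fineK// ge0_fin_numE.
have powE h r : measurable_fun [set: T] h -> {ae mu, forall x, h x < +oo} ->
    (forall x, 0 <= h x) ->
    \int[mu]_x `|(EFin \o (fine \o h)) x| `^ r = \int[mu]_x (h x `^ r).
  move=> mh hy h0; apply: ge0_ae_eq_integral => //.
  - apply: emeasurable_poweR; apply: measurableT_comp => //.
    by apply/measurable_EFinP; exact: measurableT_comp.
  - exact: emeasurable_poweR.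
  - by move=> x _; rewrite poweR_ge0.
  - by move=> x _; rewrite poweR_ge0.
  - by apply: filterS (fineE h hy h0) => x hx _; rewrite /comp hx gee0_abs.
rewrite !powE//; apply: le_trans.
rewrite le_eqVlt; apply/orP; left; apply/eqP.
apply: ge0_ae_eq_integral => //.
  apply: measurableT_comp => //; apply/measurable_EFinP.
  exact: measurable_funM.
apply: filterS2 (fineE _ aef f0) (fineE _ aeg g0) => x /= fx gx _.
by rewrite -[in LHS]fx -[in LHS]gx -EFinM ger0_norm ?mulr_ge0 ?fine_ge0.
Qed.

(** As for Hoelder's inequality, only the case of finite norms, hence of functions
that are finite almost everywhere, has content. *)
Lemma ge0_minkowski f g (r : R) :
  measurable_fun [set: T] f -> measurable_fun [set: T] g ->
  (forall x, 0 <= f x) -> (forall x, 0 <= g x) -> (1 <= r)%R ->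
  'N[mu]_r%:E[(fun x => f x + g x)] <= 'N[mu]_r%:E[f] + 'N[mu]_r%:E[g].
Proof.
move=> mf mg f0 g0 r1.
have r0 : (0 < r)%R by exact: lt_le_trans r1.
have [->|fny] := eqVneq 'N[mu]_r%:E[f] +oo.
  by rewrite addye ?leey// -ltNye (lt_le_trans _ (Lnorm_ge0 _ _ _)).
have [->|gny] := eqVneq 'N[mu]_r%:E[g] +oo.
  by rewrite addey ?leey// -ltNye (lt_le_trans _ (Lnorm_ge0 _ _ _)).
have aefin h : measurable_fun [set: T] h -> (forall x, 0 <= h x) ->
    'N[mu]_r%:E[h] != +oo -> {ae mu, forall x, (fine (h x))%:E = h x}.
  move=> mh h0 hny.
  have : {ae mu, forall x, h x < +oo}.
    apply: (ae_ltey_poweR r0 mh).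
    by rewrite -ge0_Lnorm_pow ?gt_eqF// poweR_lty// ltey.
  by apply: filterS => x hx; rewrite fineK// ge0_fin_numE.
have mff : measurable_fun [set: T] (fine \o f) by exact: measurableT_comp.
have mfg : measurable_fun [set: T] (fine \o g) by exact: measurableT_comp.
have le1 h : measurable_fun [set: T] h -> (forall x, 0 <= h x) ->
    'N[mu]_r%:E[h] != +oo -> 'N[mu]_r%:E[EFin \o (fine \o h)] <= 'N[mu]_r%:E[h].
  move=> mh h0 hny; apply: ae_le_Lnorm => //.
    by apply/measurable_EFinP; exact: measurableT_comp.
  by apply: filterS (aefin h mh h0 hny) => x hx; rewrite /comp hx.
apply: le_trans (leeD (le1 _ mf f0 fny) (le1 _ mg g0 gny)).
apply: le_trans (minkowski_EFin mu mff mfg r1).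
apply: ae_le_Lnorm => //; first exact: emeasurable_funD.
  by apply/measurable_EFinP; exact: measurable_funD.
apply: filterS2 (aefin _ mf f0 fny) (aefin _ mg g0 gny) => x fx gx.
by rewrite -[in leLHS]fx -[in leLHS]gx -EFinD.
Qed.

End extended_powers.

Section integral_minkowski.
Context d1 d2 (S : measurableType d1) (X : measurableType d2) (R : realType).
Variable nu : {sigma_finite_measure set S -> \bar R}.
Variable mu : {sigma_finite_measure set X -> \bar R}.
Variable G : S * X -> \bar R.
Hypothesis mG : measurable_fun [set: S * X] G.
Hypothesis G0 : forall z, (0 <= G z)%E.
Local Open Scope ereal_scope.

Lemma measurable_section_x s : measurable_fun [set: X] (fun x => G (s, x)).
Proof. exact: measurableT_comp. Qed.

Lemma measurable_section_s x : measurable_fun [set: S] (fun s => G (s, x)).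
Proof. exact: measurableT_comp. Qed.

Lemma measurable_Lnorm_section (r : R) :
  measurable_fun [set: S] (fun s => 'N[mu]_r%:E[(fun x => G (s, x))]).
Proof.
rewrite (_ : (fun s => _) =
    (fun s => (\int[mu]_x (G (s, x) `^ r)) `^ r^-1)); last first.
  by apply/funext => s; rewrite ge0_Lnorm.
apply: emeasurable_poweR.
apply: (measurable_fun_fubini_tonelli_F (fun z => G z `^ r)).
  exact: emeasurable_poweR.
by move=> z; exact: poweR_ge0.
Qed.

(** The weight [w] makes Hoelder's inequality in [s], followed by Tonelli's
theorem, lose nothing; dividing by it requires it to be positive. *)
Lemma weighted_minkowski (r : R) (w : S -> R) : (1 < r)%R ->
  measurable_fun [set: S] w -> (forall s, (0 < w s)%R) ->
  {ae nu, forall s, \int[mu]_x (G (s, x) `^ r) <= ((w s) `^ r)%:E} ->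
  \int[mu]_x ((\int[nu]_s G (s, x)) `^ r) <= (\int[nu]_s (w s)%:E) `^ r.
Proof.
move=> r1 mw w0 Gw.
have r0 : (0 < r)%R by exact: lt_trans r1.
pose r' := (r / (r - 1))%R.
have r10 : (0 < r - 1)%R by rewrite subr_gt0.
have r'0 : (0 < r')%R by rewrite divr_gt0.
have rr' : (r^-1 + r'^-1 = 1)%R.
  by rewrite /r' invf_div; field; rewrite gt_eqF.
have mwp a : measurable_fun [set: S] (fun s => ((w s) `^ a)%:E).
  apply/measurable_EFinP.
  exact: (measurableT_comp (measurable_powR a) mw).
set W := \int[nu]_s (w s)%:E.
have W0 : 0 <= W by apply: integral_ge0 => s _; rewrite lee_fin ltW.
have mGw : measurable_fun [set: S * X]
    (fun z => G z `^ r * ((w z.1) `^ (1 - r))%:E).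
  apply: emeasurable_funM; first exact: emeasurable_poweR.
  by apply: (measurableT_comp (mwp _)).
have Gw0 z : 0 <= G z `^ r * ((w z.1) `^ (1 - r))%:E.
  by rewrite mule_ge0 ?poweR_ge0// lee_fin powR_ge0.
have pointwise x : (\int[nu]_s G (s, x)) `^ r <=
    (\int[nu]_s (G (s, x) `^ r * ((w s) `^ (1 - r))%:E)) * W `^ (r - 1).
  rewrite (_ : \int[nu]_s G (s, x) = \int[nu]_s
      (G (s, x) * ((w s) `^ (- r'^-1))%:E * ((w s) `^ r'^-1)%:E)); last first.
    apply: eq_integral => s _; rewrite -muleA -EFinM -powRD.
      by rewrite addNr powRr0 mule1.
    by rewrite addNr eqxx/= gt_eqF.
  have := @ge0_hoelder _ _ _ nu
     (fun s => G (s, x) * ((w s) `^ (- r'^-1))%:E)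
     (fun s => ((w s) `^ r'^-1)%:E) r r'.
  move=> /(_ _ _ _ _ r0 r'0 rr') H.
  have {}H := H _ _ _ _.
  apply: le_trans.
    apply: lee_poweR; last first.
      apply: H.
      + by apply: emeasurable_funM => //; exact: measurable_section_s.
      + exact: mwp.
      + by move=> s; rewrite mule_ge0// lee_fin powR_ge0.
      + by move=> s; rewrite lee_fin powR_ge0.
    - apply: integral_ge0 => s _.
      by rewrite !mule_ge0// lee_fin powR_ge0.
    - exact: ltW.
  rewrite poweRM ?poweR_ge0// -!poweRrM mulVf ?gt_eqF// poweRe1; last first.
    by apply: integral_ge0 => s _; exact: poweR_ge0.
  rewrite (_ : (r'^-1 * r = r - 1)%R); last first.
    by rewrite /r' invf_div divfK// gt_eqF.
  rewrite le_eqVlt; apply/orP; left; apply/eqP.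
  congr (_ * _ `^ _).
    apply: eq_integral => s _.
    rewrite poweRM// ?lee_fin ?powR_ge0// poweR_EFin -powRrM.
    congr (_ * (_ `^ _)%:E); rewrite /r' invf_div.
    by field; rewrite gt_eqF.
  apply: eq_integral => s _.
  by rewrite poweR_EFin -powRrM mulVf ?gt_eqF// powRr1// ltW.
have mint : measurable_fun [set: X]
    (fun x => \int[nu]_s (G (s, x) `^ r * ((w s) `^ (1 - r))%:E)).
  exact: (measurable_fun_fubini_tonelli_G
    (fun z => G z `^ r * ((w z.1) `^ (1 - r))%:E)).
apply: (@le_trans _ _ (\int[mu]_x
    ((\int[nu]_s (G (s, x) `^ r * ((w s) `^ (1 - r))%:E)) * W `^ (r - 1)))).
  apply: ge0_le_integral => //.
  - by move=> x _; exact: poweR_ge0.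
  - by apply: emeasurable_poweR; exact: measurable_fun_fubini_tonelli_G.
  - by apply: emeasurable_funM.
rewrite ge0_integralZr//; last 2 first.
- by move=> x _; apply: integral_ge0 => s _; exact: (Gw0 (s, x)).
- exact: poweR_ge0.
have -> : W `^ r = W * W `^ (r - 1).
  rewrite -{2}(poweRe1 W0) -poweRD ?subrKC//.
  by apply: add_neq0_poweRD_def; rewrite subrKC gt_eqF.
apply: lee_wpmul2r; first exact: poweR_ge0.
rewrite -(fubini_tonelli
    (fun z => G z `^ r * ((w z.1) `^ (1 - r))%:E) mGw Gw0)/=.
apply: ae_ge0_le_integral => //.
- by move=> s _; apply: integral_ge0 => x _; exact: (Gw0 (s, x)).
- exact: (measurable_fun_fubini_tonelli_F
    (fun z => G z `^ r * ((w z.1) `^ (1 - r))%:E)).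
- by move=> s _; rewrite lee_fin ltW.
- exact/measurable_EFinP.
apply: filterS Gw => s Gs _.
rewrite ge0_integralZr//; last 3 first.
- by apply: emeasurable_poweR; exact: measurable_section_x.
- by move=> x _; exact: poweR_ge0.
- by rewrite lee_fin powR_ge0.
apply: le_trans (lee_wpmul2r _ Gs) _; first by rewrite lee_fin powR_ge0.
by rewrite -EFinM -powRD ?subrKC ?powRr1 ?(ltW (w0 s))// oner_eq0.
Qed.

(** The norm of an integral is at most the integral of the norms.  Here [rho] is any
integrable positive function; adding [e * rho] to the norms of
the sections makes them admissible as a weight, and then [e] tends to 0. *)
Lemma minkowski_integral (r : R) (rho : S -> R) : (1 < r)%R ->
  measurable_fun [set: S] rho -> (forall s, (0 < rho s)%R) ->
  \int[nu]_s (rho s)%:E < +oo ->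
  'N[mu]_r%:E[(fun x => \int[nu]_s G (s, x))] <=
  \int[nu]_s 'N[mu]_r%:E[(fun x => G (s, x))].
Proof.
move=> r1 mrho rho0 rhooo.
have r0 : (0 < r)%R by exact: lt_trans r1.
set N := fun s => 'N[mu]_r%:E[(fun x => G (s, x))].
have mN : measurable_fun [set: S] N := measurable_Lnorm_section r.
have N0 s : 0 <= N s by exact: Lnorm_ge0.
have [->|Nny] := eqVneq (\int[nu]_s N s) +oo; first exact: leey.
have Nfin : {ae nu, forall s, N s \is a fin_num}.
  have : nu.-integrable [set: S] N.
    apply/integrableP; split => //.
    by under eq_integral do rewrite gee0_abs//; rewrite ltey.
  by move/(integrable_ae measurableT); apply: filterS => s /(_ I).
have IN0 : 0 <= \int[nu]_s N s by exact: integral_ge0.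
have Irho0 : 0 <= \int[nu]_s (rho s)%:E.
  by apply: integral_ge0 => s _; rewrite lee_fin ltW.
apply/lee_addgt0Pr => e e0.
set c := (e / (1 + fine (\int[nu]_s (rho s)%:E)))%R.
have den0 : (0 < 1 + fine (\int[nu]_s (rho s)%:E))%R.
  by rewrite ltr_wpDr// fine_ge0.
have c0 : (0 < c)%R by rewrite divr_gt0.
pose w s := (fine (N s) + c * rho s)%R.
have mfN : measurable_fun [set: S] (fine \o N) by exact: measurableT_comp.
have mcr : measurable_fun [set: S] (fun s => c * rho s)%R.
  exact: measurable_funM.
have mw : measurable_fun [set: S] w by exact: measurable_funD.
have w0 s : (0 < w s)%R by rewrite ltr_wpDl ?fine_ge0// mulr_gt0.
have := @weighted_minkowski r w r1 mw w0.
have Gw : {ae nu, forall s, \int[mu]_x (G (s, x) `^ r) <= ((w s) `^ r)%:E}.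
  apply: filterS Nfin => s Ns.
  rewrite -ge0_Lnorm_pow ?gt_eqF// -/(N s) -(fineK Ns) poweR_EFin lee_fin.
  apply: ge0_ler_powR; rewrite ?nnegrE ?fine_ge0 ?(ltW (w0 _)) ?(ltW r0)//.
  by rewrite lerDl mulr_ge0// ltW.
move=> /(_ Gw) H.
rewrite ge0_Lnorm; last by move=> x; exact: integral_ge0.
apply: (@le_trans _ _ (\int[nu]_s (w s)%:E)).
  have -> : \int[nu]_s (w s)%:E = ((\int[nu]_s (w s)%:E) `^ r) `^ r^-1.
    rewrite -poweRrM mulfV ?gt_eqF// poweRe1//.
    by apply: integral_ge0 => s _; rewrite lee_fin ltW.
  apply: lee_poweR => //; first by rewrite invr_ge0 ltW.
  by apply: integral_ge0 => x _; exact: poweR_ge0.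
rewrite (eq_integral (fun s => (fine (N s))%:E + (c * rho s)%:E))//.
rewrite ge0_integralD//=; last 4 first.
- by move=> s _; rewrite lee_fin fine_ge0.
- exact/measurable_EFinP.
- by move=> s _; rewrite lee_fin mulr_ge0// ltW.
- exact/measurable_EFinP.
apply: leeD.
  apply: ae_ge0_le_integral => //.
  - by move=> s _; rewrite lee_fin fine_ge0.
  - exact/measurable_EFinP.
  - by move=> s _; exact: N0.
  - by apply: filterS Nfin => s Ns _; rewrite fineK.
under eq_integral do rewrite EFinM.
rewrite ge0_integralZl_EFin//; last 3 first.
- by move=> s _; rewrite lee_fin ltW.
- exact/measurable_EFinP.
- exact: ltW.
rewrite -[X in _ * X]fineK ?ge0_fin_numE// -EFinM lee_fin /c.
rewrite mulrAC ler_pdivrMr// ler_wpM2l ?(ltW e0)//.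
by rewrite lerDr.
Qed.

End integral_minkowski.

Section parametric_Rintegral.
Context d1 d2 (X : measurableType d1) (Y : measurableType d2) (R : realType).
Variable mu : {sigma_finite_measure set Y -> \bar R}.

(** An integral is the difference of those of the positive and negative parts, even
when it takes a default value. *)
Lemma measurable_fun_Rintegral (f : X * Y -> R) :
  measurable_fun [set: X * Y] f ->
  measurable_fun [set: X] (fun x => \int[mu]_y f (x, y)).
Proof.
move=> mf; apply: measurableT_comp => //.
have mE : measurable_fun [set: X * Y] (EFin \o f) by exact/measurable_EFinP.
rewrite (_ : (fun x => _) = (fun x => \int[mu]_y (EFin \o f)^\+ (x, y) -
                                      \int[mu]_y (EFin \o f)^\- (x, y))%E).
  apply: emeasurable_funB.
  - apply: (measurable_fun_fubini_tonelli_F (EFin \o f)^\+%E) => //.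
    exact: measurable_funepos.
  - apply: (measurable_fun_fubini_tonelli_F (EFin \o f)^\-%E) => //.
    exact: measurable_funeneg.
apply/funext => x; rewrite integralE.
by congr (_ - _)%E; apply: eq_integral => y _; rewrite ?funeposE ?funenegE.
Qed.

End parametric_Rintegral.

(** * Lebesgue measure on the line and on R^3 *)

Section lebesgue_line.
Context {R : realType}.
Local Notation mu := (leb1 R).
Local Open Scope ereal_scope.

Lemma measurable_affine (c a : R) :
  measurable_fun [set: measurableTypeR R]
    (fun x => c * x + a : measurableTypeR R)%R.
Proof. by apply: measurable_funD => //; exact: measurable_funM. Qed.

(** Both sides are measures that agree on intervals. *)
Lemma lebesgue_measure_affine (c a : R) A : (0 < c)%R -> measurable A ->
  mu A = c%:E * mu ((fun x => c * x + a)%R @^-1` A).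
Proof.
move=> c0; pose phi x : measurableTypeR R := (c * x + a)%R.
have mphi : measurable_fun [set: measurableTypeR R] phi := measurable_affine c a.
have [nu nuE] : exists nu : {measure set (measurableTypeR R) -> \bar R},
    forall B, nu B = c%:E * mu (phi @^-1` B).
  by unshelve eexists (mscale (NngNum (ltW c0)) (pushforward mu phi)).
rewrite -nuE; apply: lebesgue_measure_unique => // _ [[u v]] _ <-.
rewrite nuE/=.
rewrite (_ : _ @^-1` _ = `](c^-1 * (u - a))%R, (c^-1 * (v - a))%R]%classic).
  rewrite !lebesgue_measure_itv/= !lte_fin ltr_pM2l ?invr_gt0// ltrD2r.
  case: ifPn => _; last by rewrite mule0.
  rewrite -!EFinB -EFinM; congr EFin.
  by rewrite -mulrBr mulrA mulfV ?gt_eqF// mul1r; ring.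
apply/seteqP; split => x /=; rewrite /phi !in_itv/=.
  move=> /andP[ux xv]; rewrite ltr_pdivrMl// ler_pdivlMl//.
  by rewrite ltrBlDr ux lerBrDr xv.
by rewrite ltr_pdivrMl// ler_pdivlMl// ltrBlDr lerBrDr.
Qed.

Lemma ge0_integral_line_affine_gt0 (c a : R) (F : R -> \bar R) : (0 < c)%R ->
  measurable_fun [set: measurableTypeR R] F -> (forall x, 0 <= F x) ->
  \int[mu]_x F x = c%:E * \int[mu]_x F (c * x + a)%R.
Proof.
move=> c0 mF F0.
have mphi := measurable_affine c a.
have := ge0_integral_pushforward mphi mu measurableT mF (fun x _ => F0 x).
rewrite preimage_setT => <-.
rewrite -(ge0_integral_mscale _ measurableT (NngNum (ltW c0)) mF)//.
by apply: eq_measure_integral => A mA _; exact: lebesgue_measure_affine.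
Qed.

Lemma ge0_integral_line_opp (F : R -> \bar R) :
  measurable_fun [set: measurableTypeR R] F -> (forall x, 0 <= F x) ->
  \int[mu]_x F x = \int[mu]_x F (- x)%R.
Proof.
move=> mF F0.
have mphi : measurable_fun [set: measurableTypeR R]
    (-%R : _ -> measurableTypeR R) by exact: measurable_funN.
have := ge0_integral_pushforward mphi mu measurableT mF (fun x _ => F0 x).
rewrite preimage_setT => <-.
by apply: eq_measure_integral => A mA _; exact/esym/lebesgue_measureN.
Qed.

Lemma ge0_integral_line_affine (c a : R) (F : R -> \bar R) : c != 0%R ->
  measurable_fun [set: measurableTypeR R] F -> (forall x, 0 <= F x) ->
  \int[mu]_x F x = `|c|%:E * \int[mu]_x F (c * x + a)%R.
Proof.
move=> c0 mF F0; have [cp|cn|/eqP] := ltgtP c 0%R; last by rewrite (negbTE c0).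
- rewrite ltr0_norm// (ge0_integral_line_affine_gt0 (c := - c) a)// ?oppr_gt0//.
  congr (_ * _); rewrite [RHS]ge0_integral_line_opp//.
  + by apply: eq_integral => x _; rewrite mulrN mulNr.
  + exact: measurableT_comp mF (measurable_affine c a).
- by rewrite gtr0_norm// -ge0_integral_line_affine_gt0.
Qed.

(** Integrability of a power at the origin. *)
Lemma integral_powR_0 (s t : R) : (s < 1)%R -> (0 < t)%R ->
  \int[mu]_(x in `]0%R, t]) (x `^ (- s))%:E = (t `^ (1 - s) / (1 - s))%:E.
Proof.
move=> s1 t0.
have s10 : (0 < 1 - s)%R by rewrite subr_gt0.
have mf : measurable_fun `]0%R, t] (fun x : R => (x `^ (- s))%:E).
  by apply/measurable_EFinP; exact: measurable_funTS (measurable_powR _).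
pose e n : R := (t / n.+2%:R)%R.
have e0 n : (0 < e n)%R by rewrite divr_gt0.
have et n : (e n < t)%R by rewrite ltr_pdivrMr// ltr_pMr// ltr1n.
have UE : `]0%R, t]%classic = \bigcup_n `[e n, t]%classic.
  apply/seteqP; split => x /=; rewrite in_itv/=.
    move=> /andP[x0 xt]; exists (Num.truncn (t / x)) => //=.
    rewrite in_itv/= xt andbT ler_pdivrMr// mulrC -ler_pdivrMr//.
    by rewrite ltW// (lt_trans (truncnS_gt _))// ltr_nat.
  by move=> [n _]/=; rewrite in_itv/= => /andP[nx ->]; rewrite (lt_le_trans _ nx).
have dpow (x : R) : (0 < x)%R -> is_derive x 1%R
    (fun y => y `^ (1 - s) / (1 - s))%R (x `^ (- s))%R.
  move=> x0.
  have -> : (x `^ (- s) = (1 - s)^-1 * ((1 - s) * x `^ (- s)))%R.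
    by rewrite mulrA mulVf ?mul1r// gt_eqF.
  rewrite (_ : (fun y => _) = (1 - s)^-1 \*: (fun y => y `^ (1 - s)))%R; last first.
    by apply/funext => y; rewrite mulrC.
  apply: is_deriveZ.
  split; first by apply: derivable_powR; rewrite in_itv/= x0.
  by rewrite -derive1E powR_derive1 ?in_itv/= ?x0// addrAC subrr add0r.
have IE n : \int[mu]_(x in `[e n, t]) (x `^ (- s))%:E =
    (t `^ (1 - s) / (1 - s) - e n `^ (1 - s) / (1 - s))%:E.
  rewrite (@continuous_FTC2 R _ (fun y => y `^ (1 - s) / (1 - s))%R (e n) t)//.
  - apply: derivable_within_continuous => x; rewrite in_itv/= => /andP[ex _].
    by apply: derivable_powR; rewrite in_itv/= (lt_le_trans _ ex).
  - split.
    + move=> x; rewrite in_itv/= => /andP[ex _].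
      by have [] := dpow x (lt_trans (e0 n) ex).
    + apply: cvg_at_right_filter; have [/derivable1_diffP d _] := dpow _ (e0 n).
      exact: differentiable_continuous d.
    + apply: cvg_at_left_filter; have [/derivable1_diffP d _] := dpow _ t0.
      exact: differentiable_continuous d.
  - move=> x; rewrite in_itv/= => /andP[ex _].
    by rewrite derive1E; have [_ ->] := dpow x (lt_trans (e0 n) ex).
have c1 : \int[mu]_(x in `[e n, t]) (x `^ (- s))%:E @[n --> \oo] -->
    \int[mu]_(x in `]0%R, t]) (x `^ (- s))%:E.
  rewrite UE; apply: ge0_nondecreasing_set_cvg_integral => //.
  - move=> n m nm; apply/subsetPset => x /=; rewrite !in_itv/= => /andP[nx ->].
    rewrite andbT (le_trans _ nx)// ler_pM2l// lef_pV2 ?posrE//.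
    by rewrite ler_nat.
  - move=> n; apply: measurable_funS mf => // x /=; rewrite !in_itv/=.
    by move=> /andP[nx ->]; rewrite (lt_le_trans _ nx).
  - by move=> n x _; rewrite lee_fin powR_ge0.
have c2 : (t `^ (1 - s) / (1 - s) - e n `^ (1 - s) / (1 - s))%:E @[n --> \oo] -->
    (t `^ (1 - s) / (1 - s))%:E.
  apply: cvg_EFin; first exact: nearW.
  rewrite -[X in _ --> X]subr0; apply: cvgB; first exact: cvg_cst.
  rewrite -[X in _ --> X](mul0r (1 - s)^-1)%R; apply: cvgM; last exact: cvg_cst.
  apply: (@cvg_comp _ _ _ e (fun x => x `^ (1 - s))%R _ (0%R^'+)).
    move=> P [d d0] dP; have : \forall n \near \oo, (e n < d)%R.
      near=> n; rewrite ltr_pdivrMr// mulrC -ltr_pdivrMr//.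
      rewrite (lt_trans (truncnS_gt _))// ltr_nat ltnS.
      by near: n; exists (Num.truncn (t / d)).
    apply: filterS => n end_; apply: dP => //=.
    by rewrite sub0r normrN gtr0_norm.
  exact: powR_cvg0.
by apply: (cvg_unique _ c1) => //; rewrite (funext IE).
Unshelve. all: by end_near. Qed.

Lemma is_derive_powR_1D (s x : R) : (0 < 1 + x)%R ->
  is_derive x 1%R (fun y => (1 + y) `^ s)%R (s * (1 + x) `^ (s - 1))%R.
Proof.
move=> x10; rewrite -[X in is_derive _ _ _ X]mulr1.
apply: (@is_derive1_comp R (fun y => y `^ s)%R (fun y => 1 + y)%R).
  split; first by apply: derivable_powR; rewrite in_itv/= x10.
  by rewrite -derive1E powR_derive1 ?in_itv/= ?x10.
by rewrite -[X in is_derive _ _ _ X]add0r; apply: is_deriveD.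
Qed.

Lemma cvgr_powR_1D (s : R) : (0 < s)%R ->
  ((1 + x) `^ s)%R @[x --> +oo%R] --> +oo%R.
Proof.
move=> s0; apply/cvgryPge => A; near=> x.
have x0 : (`|A| `^ s^-1 <= 1 + x)%R.
  rewrite ler_wpDl//; near: x; exact: nbhs_pinfty_ge.
have -> : (`|A| = (`|A| `^ s^-1) `^ s)%R -> (A <= (1 + x) `^ s)%R = true.
  move=> AE; rewrite (le_trans (ler_norm A))// AE ge0_ler_powR// ?nnegrE ?powR_ge0//.
    exact: ltW.
  exact: le_trans (powR_ge0 _ _) x0.
by [].
by rewrite -powRrM mulVf ?powRr1// gt_eqF.
Unshelve. all: by end_near. Qed.

(** Integrability at infinity of a power less than -1, shifted away from the origin. *)
Lemma integral_powR_y (s : R) : (1 < s)%R ->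
  \int[mu]_(x in `[0%R, +oo[) ((1 + x) `^ (- s))%:E = ((s - 1)^-1)%:E.
Proof.
move=> s1; have s10 : (0 < s - 1)%R by rewrite subr_gt0.
have dpow (x : R) : (0 <= x)%R -> is_derive x 1%R
    (fun y => - ((1 + y) `^ (1 - s) / (s - 1)))%R ((1 + x) `^ (- s))%R.
  move=> x0.
  have x10 : (0 < 1 + x)%R by rewrite ltr_pwDl.
  have -> : ((1 + x) `^ (- s) =
      - (s - 1)^-1 * ((1 - s) * (1 + x) `^ (1 - s - 1)))%R.
    by rewrite addrAC subrr add0r; field; rewrite gt_eqF.
  rewrite (_ : (fun y => _) =
      (- (s - 1)^-1) \*: (fun y => (1 + y) `^ (1 - s)))%R; last first.
    by apply/funext => y; rewrite mulrC -mulNr.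
  by apply: is_deriveZ; exact: is_derive_powR_1D.
rewrite (@ge0_continuous_FTC2y R _
  (fun y => - ((1 + y) `^ (1 - s) / (s - 1)))%R 0%R 0%R).
- by rewrite addr0 powR1 div1r sub0e -EFinN opprK.
- by move=> x x0; rewrite powR_ge0.
- apply: derivable_within_continuous => x; rewrite in_itv/= andbT => x0.
  have x10 : (0 < 1 + x)%R by rewrite ltr_pwDl.
  by have [] := is_derive_powR_1D (- s) x10.
- rewrite -oppr0; apply: cvgN; rewrite -[X in _ --> X](mul0r (s - 1)^-1)%R.
  apply: cvgM; last exact: cvg_cst.
  rewrite (_ : (fun y => _) = (fun y => ((1 + y) `^ (s - 1))^-1))%R; last first.
    by apply/funext => y; rewrite -powRN opprB.
  apply/gtr0_cvgV0; last exact: cvgr_powR_1D.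
  by near=> x; rewrite powR_gt0// ltr_pwDl.
- move=> x x0; by have [] := dpow x (ltW x0).
- apply: cvg_at_right_filter.
  have [/derivable1_diffP d _] := dpow 0%R (lexx _).
  exact: differentiable_continuous d.
- move=> x; rewrite in_itv/= andbT => x0.
  by rewrite derive1E; have [_ ->] := dpow x (ltW x0).
Unshelve. all: by end_near. Qed.

Lemma ge0_integral_even (f : R -> R) : (forall x, (0 <= f x)%R) ->
  measurable_fun [set: measurableTypeR R] f ->
  \int[mu]_x (f `|x|)%:E = 2%:E * \int[mu]_(x in `[0%R, +oo[) (f x)%:E.
Proof.
move=> f0 mf.
have mg : measurable_fun [set: measurableTypeR R] (fun x => (f `|x|)%:E).
  apply/measurable_EFinP; apply: (measurableT_comp mf).
  exact: normr_measurable.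
have mA : measurable (`[0%R, +oo[%classic : set (measurableTypeR R)) by [].
have mB : measurable (`]-oo, 0%R[%classic : set (measurableTypeR R)) by [].
have half : \int[mu]_(x in `[0%R, +oo[) (f `|x|)%:E =
    \int[mu]_(x in `[0%R, +oo[) (f x)%:E.
  by apply: eq_integral => x; rewrite inE/= in_itv/= andbT => x0; rewrite ger0_norm.
rewrite -(setvU (`[0%R, +oo[%classic : set R)) setCitvr.
rewrite ge0_integral_setU//=.
- rewrite half mule_natl mule2n; congr (_ + _); rewrite -half.
  rewrite ge0_integration_by_substitution0//; last by move=> x; rewrite lee_fin.
  rewrite -integral_itv_bndo_bndc; last first.
    exact: measurable_funTS (measurableT_comp mg _).
  by apply: eq_integral => x _; rewrite normrN.
- exact: (measurable_funTS mg).
- by move=> x _; rewrite lee_fin.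
- apply/disj_setPS => x []/=; rewrite !in_itv/= andbT => x0.
  by rewrite leNgt x0.
Qed.

End lebesgue_line.

Section lebesgue_space.
Context {R : realType}.
Implicit Types (x a : vec3 R).
Local Notation mu := (leb1 R).

Local Notation tonelliF F :=
  (@measurable_fun_fubini_tonelli_F _ _ (mplane R) (measurableTypeR R) R mu F).
Local Notation tonelliF2 F :=
  (@measurable_fun_fubini_tonelli_F _ _ (measurableTypeR R) (measurableTypeR R) R mu F).

Lemma measurable_vec3 d (T : measurableType d) (f g h : T -> R) :
  measurable_fun [set: T] f -> measurable_fun [set: T] g ->
  measurable_fun [set: T] h ->
  measurable_fun [set: T] (fun z => ((f z, g z), h z) : mvec3 R).
Proof.
move=> mf mg mh; apply: measurable_fun_pair; last exact: mh.
by apply: measurable_fun_pair; [exact: mf|exact: mg].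
Qed.

Lemma measurable_x11 : measurable_fun [set: mvec3 R] (fun x : mvec3 R => x.1.1 : R).
Proof. exact: (measurableT_comp measurable_fst measurable_fst). Qed.

Lemma measurable_x12 : measurable_fun [set: mvec3 R] (fun x : mvec3 R => x.1.2 : R).
Proof. exact: (measurableT_comp measurable_snd measurable_fst). Qed.

Lemma measurable_x2 : measurable_fun [set: mvec3 R] (fun x : mvec3 R => x.2 : R).
Proof. exact: measurable_snd. Qed.

Lemma measurable_coord3 (i : 'I_3) :
  measurable_fun [set: mvec3 R] (coord3 i : vec3 R -> R).
Proof.
case: i => [[|[|[|//]]] ?].
- exact: measurable_x11.
- exact: measurable_x12.
- exact: measurable_x2.
Qed.

Lemma forall3 (P : 'I_3 -> Prop) :
  P ord0 -> P (inord 1) -> P ord_max -> forall i, P i.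
Proof.
move=> P0 P1 P2 [[|[|[|//]]] i3].
- by rewrite (_ : Ordinal i3 = ord0)//; apply/val_inj.
- by rewrite (_ : Ordinal i3 = inord 1)//; apply/val_inj; rewrite /= inordK.
- by rewrite (_ : Ordinal i3 = ord_max)//; apply/val_inj.
Qed.

(** Dilations, translations and the reflections x |-> a - x at once. *)
Definition affine3 (c : R) a x : vec3 R :=
  ((c * x.1.1 + a.1.1, c * x.1.2 + a.1.2), c * x.2 + a.2).

Lemma measurable_affine3 c a :
  measurable_fun [set: mvec3 R] (affine3 c a : mvec3 R -> mvec3 R).
Proof.
apply: measurable_vec3.
- by apply: measurable_funD => //; apply: measurable_funM => //; exact: measurable_x11.
- by apply: measurable_funD => //; apply: measurable_funM => //; exact: measurable_x12.
- by apply: measurable_funD => //; apply: measurable_funM => //; exact: measurable_x2.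
Qed.

Lemma integral_leb3E (F : vec3 R -> \bar R) :
  measurable_fun [set: mvec3 R] F -> (forall x, 0 <= F x)%E ->
  (\int[leb3 R]_x F x =
   \int[mu]_x1 \int[mu]_x2 \int[mu]_x3 F ((x1, x2), x3))%E.
Proof.
move=> mF F0.
rewrite (@fubini_tonelli1 _ _ _ _ _ (leb2 (R:=R)) mu F mF F0).
rewrite (@fubini_tonelli1 _ _ _ _ _ mu mu)//.
- exact: (tonelliF F).
- by move=> z; exact: integral_ge0.
Qed.

Lemma ge0_integral_affine3 (c : R) a (F : vec3 R -> \bar R) : c != 0 ->
  measurable_fun [set: mvec3 R] F -> (forall x, 0 <= F x)%E ->
  (\int[leb3 R]_x F x = (`|c| ^+ 3)%:E * \int[leb3 R]_x F (affine3 c a x))%E.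
Proof.
move=> c0 mF F0.
have mFa : measurable_fun [set: mvec3 R] (fun x => F (affine3 c a x)).
  exact: (measurableT_comp mF (measurable_affine3 c a)).
have m2 : measurable_fun [set: mplane R] (fun w => \int[mu]_x3 F (w, x3))%E.
  exact: (tonelliF F).
have m20 (w : mplane R) : (0 <= \int[mu]_x3 F (w, x3))%E by exact: integral_ge0.
have m1 : measurable_fun [set: measurableTypeR R]
    (fun x1 : R => \int[mu]_x2 \int[mu]_x3 F ((x1, x2), x3))%E.
  exact: (tonelliF2 (fun w => \int[mu]_x3 F (w, x3))%E).
rewrite !integral_leb3E//.
have m10 (x1 : R) : (0 <= \int[mu]_x2 \int[mu]_x3 F ((x1, x2), x3))%E.
  by apply: integral_ge0 => y _; exact: m20.
apply: etrans; first exact: (@ge0_integral_line_affine R c a.1.1 _ c0 m1 m10).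
have E1 (x1 : R) : (\int[mu]_x2 \int[mu]_x3 F (((c * x1 + a.1.1)%R, x2), x3) =
   (`|c| ^+ 2)%:E * \int[mu]_x2 \int[mu]_x3 F (affine3 c a ((x1, x2), x3)))%E.
  have m21 : measurable_fun [set: measurableTypeR R]
      (fun x2 : R => \int[mu]_x3 F (((c * x1 + a.1.1)%R, x2), x3))%E.
    exact: (measurableT_comp m2 (measurable_pair1 _)).
  apply: etrans; first exact: (@ge0_integral_line_affine R c a.1.2 _ c0 m21 (fun y => m20 _)).
  rewrite expr2 EFinM -muleA; congr (_ * _)%E.
  rewrite -ge0_integralZl_EFin//; last 2 first.
  - move=> y _; exact: integral_ge0.
  - have H := tonelliF (fun x => F (affine3 c a x)) mFa (fun x => F0 _).
    exact: (measurableT_comp H (measurable_pair1 x1)).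
  apply: eq_integral => y _.
  have m3 : measurable_fun [set: measurableTypeR R]
      (fun x3 : R => F (((c * x1 + a.1.1)%R, (c * y + a.1.2)%R), x3))%E.
    exact: (measurableT_comp mF (measurable_pair1 _)).
  exact: (@ge0_integral_line_affine R c a.2 _ c0 m3 (fun y => F0 _)).
under eq_integral do rewrite E1.
rewrite ge0_integralZl_EFin; [|exact: measurableT| | |exact: exprn_ge0].
- by rewrite muleA -EFinM -exprS.
- by move=> y _; apply: integral_ge0 => z _; exact: integral_ge0.
- apply: (tonelliF2 (fun w => \int[mu]_x3 F (affine3 c a (w, x3)))%E).
    exact: (tonelliF (fun x => F (affine3 c a x))).
  by move=> w; exact: integral_ge0.
Qed.

Lemma integral_affine3 (c : R) a (F : vec3 R -> \bar R) : c != 0 ->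
  measurable_fun [set: mvec3 R] F ->
  (\int[leb3 R]_x F x = (`|c| ^+ 3)%:E * \int[leb3 R]_x F (affine3 c a x))%E.
Proof.
move=> c0 mF; rewrite integralE [in RHS]integralE.
rewrite (@ge0_integral_affine3 c a (F^\+)%E)//; last exact: measurable_funepos.
rewrite (@ge0_integral_affine3 c a (F^\-)%E)//; last exact: measurable_funeneg.
under [in RHS]eq_integral do rewrite funeposE -funeposE.
under [X in (_ = _ * (_ - X))%E]eq_integral do rewrite funenegE -funenegE.
rewrite -[in RHS]/(_ \o _).
have k0 : 0 < `|c| ^+ 3 by rewrite exprn_gt0// normr_gt0.
move: (`|c| ^+ 3) k0 => k k0.
set A := (\int[_]_x _^\+ _)%E; set B := (\int[_]_x _^\- _)%E.
have : (0 <= A)%E by exact: integral_ge0.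
have : (0 <= B)%E by exact: integral_ge0.
case: A => [u| |]//; case: B => [v| |]// _ _.
- by rewrite muleBr// fin_num_adde_defl.
- by rewrite gt0_muley ?lte_fin// /= gt0_muleNy ?lte_fin.
- by rewrite gt0_muley ?lte_fin//= gt0_muley ?lte_fin.
- by rewrite gt0_muley ?lte_fin//= gt0_muleNy ?lte_fin.
Qed.

Lemma Rintegral_affine3 (c : R) a (F : vec3 R -> R) : c != 0 ->
  measurable_fun [set: mvec3 R] F ->
  \int[leb3 R]_x F x = `|c| ^+ 3 * \int[leb3 R]_x F (affine3 c a x).
Proof.
move=> c0 mF; rewrite /Rintegral (@integral_affine3 c a)//; last first.
  exact/measurable_EFinP.
have k0 : 0 < `|c| ^+ 3 by rewrite exprn_gt0// normr_gt0.
case: (\int[leb3 R]_x (F (affine3 c a x))%:E)%E => [u| |] //=.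
- by rewrite gt0_muley ?lte_fin//= mulr0.
- by rewrite gt0_muleNy ?lte_fin//= mulr0.
Qed.

(** Integrability on R^3 is always obtained from a bound by such a product. *)
Lemma integral_prod3 (w : R -> R) : (forall r, 0 <= w r) ->
  measurable_fun [set: measurableTypeR R] w ->
  (\int[leb3 R]_x (w x.1.1 * w x.1.2 * w x.2)%:E =
   (\int[mu]_r (w r)%:E) * (\int[mu]_r (w r)%:E) * (\int[mu]_r (w r)%:E))%E.
Proof.
move=> w0 mw.
have mE : measurable_fun [set: measurableTypeR R] (fun r => (w r)%:E).
  exact/measurable_EFinP.
have W0 : (0 <= \int[mu]_r (w r)%:E)%E.
  by apply: integral_ge0 => r _; rewrite lee_fin.
rewrite integral_leb3E; last 2 first.
- apply/measurable_EFinP; apply: measurable_funM.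
    apply: measurable_funM; first exact: (measurableT_comp mw measurable_x11).
    exact: (measurableT_comp mw measurable_x12).
  exact: (measurableT_comp mw measurable_x2).
- by move=> x; rewrite lee_fin !mulr_ge0.
have E3 (x1 x2 : R) : (\int[mu]_x3 (w x1 * w x2 * w x3)%:E =
    (w x1 * w x2)%:E * \int[mu]_r (w r)%:E)%E.
  under eq_integral do rewrite EFinM.
  by rewrite ge0_integralZl_EFin ?mulr_ge0// => r _; rewrite lee_fin.
have E2 (x1 : R) : (\int[mu]_x2 \int[mu]_x3 (w x1 * w x2 * w x3)%:E =
    (w x1)%:E * (\int[mu]_r (w r)%:E * \int[mu]_r (w r)%:E))%E.
  under eq_integral do rewrite E3 EFinM -muleA.
  rewrite ge0_integralZl_EFin//.
  - by rewrite ge0_integralZr// => r _; rewrite lee_fin.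
  - by move=> r _; rewrite mule_ge0// lee_fin.
  - by apply: emeasurable_funM.
under eq_integral do rewrite E2.
rewrite ge0_integralZr//.
- by rewrite muleA.
- by move=> r _; rewrite lee_fin.
- by rewrite mule_ge0.
Qed.

Lemma translate3E x a : x + a = affine3 1 a x.
Proof. by case: x => [[? ?] ?]; rewrite /affine3/= !mul1r. Qed.

Lemma reflect3E x a : a - x = affine3 (-1) a x.
Proof.
by case: x => [[? ?] ?]; case: a => [[? ?] ?]; rewrite /affine3/= !mulN1r;
  congr ((_, _), _) => /=; rewrite addrC.
Qed.

Lemma measurable_sub3 : measurable_fun [set: mvec3 R * mvec3 R]
  (fun z : mvec3 R * mvec3 R => (z.1 : vec3 R) - z.2 : mvec3 R).
Proof.
rewrite (_ : (fun z => _) = (fun z : mvec3 R * mvec3 R =>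
  ((z.1.1.1 - z.2.1.1, z.1.1.2 - z.2.1.2), z.1.2 - z.2.2) : mvec3 R)); last first.
  by apply/funext => -[[[? ?] ?] [[? ?] ?]].
apply: measurable_vec3; apply: measurable_funB.
- exact: (measurableT_comp measurable_x11 measurable_fst).
- exact: (measurableT_comp measurable_x11 measurable_snd).
- exact: (measurableT_comp measurable_x12 measurable_fst).
- exact: (measurableT_comp measurable_x12 measurable_snd).
- exact: (measurableT_comp measurable_x2 measurable_fst).
- exact: (measurableT_comp measurable_x2 measurable_snd).
Qed.

(** Rounding the coordinates down to multiples of 1/n exhibits a continuous function
as a limit of functions that are constant on countably many boxes, which belong to
the product sigma-algebra. *)
Lemma continuous_measurable3 (f : vec3 R -> R) : continuous f ->
  measurable_fun [set: mvec3 R] f.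
Proof.
move=> cf.
pose rnd (n : nat) (r : R) : R := (Num.floor (r * n.+1%:R))%:~R / n.+1%:R.
pose rnd3 n x : vec3 R := ((rnd n x.1.1, rnd n x.1.2), rnd n x.2).
apply: (@measurable_fun_cvg _ (mvec3 R) _ _ (fun n x => f (rnd3 n x))).
- move=> n _ Y mY; rewrite setTI.
  pose v (k : int * int * int) : vec3 R :=
    ((k.1.1%:~R / n.+1%:R, k.1.2%:~R / n.+1%:R), k.2%:~R / n.+1%:R).
  pose cell (k : int) : set (measurableTypeR R) :=
    [set r : R | Num.floor (r * n.+1%:R) = k].
  have mcell k : measurable (cell k).
    rewrite (_ : cell k = `[(k%:~R / n.+1%:R), ((k + 1)%:~R / n.+1%:R)[%classic).
      exact: measurable_itv.
    apply/seteqP; split => r /=; rewrite in_itv/= ler_pdivrMr// ltr_pdivlMr//.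
      by move=> <-; exact: floor_itv.
    exact: floor_def.
  pose box (k : int * int * int) : set (mvec3 R) :=
    if f (v k) \in Y then (cell k.1.1 `*` cell k.1.2) `*` cell k.2 else set0.
  rewrite (_ : _ @^-1` _ = \bigcup_k box k).
    apply: countable_bigcupT_measurable; first exact: countableP.
    move=> k; rewrite /box; case: ifPn => // _.
    by apply: measurableX => //; apply: measurableX.
  apply/seteqP; split => x /=.
    move=> Yx; exists ((Num.floor (x.1.1 * n.+1%:R), Num.floor (x.1.2 * n.+1%:R)),
      Num.floor (x.2 * n.+1%:R)) => //.
    by rewrite /box/= mem_set.
  move=> [[[k1 k2] k3] _]; rewrite /box; case: ifPn => // /set_mem vY [[/= x1 x2] x3].
  by rewrite /rnd3 /rnd x1 x2 x3.
- move=> x _; apply: (@cvg_comp _ _ _ (rnd3^~ x) f _ (nbhs x)); last exact: cf.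
  have crnd (r : R) : rnd n r @[n --> \oo] --> r.
    apply/cvgrPdist_lt => e e0; near=> n.
    have /andP[f1 f2] := floor_itv (r * n.+1%:R).
    rewrite ger0_norm; last by rewrite subr_ge0 ler_pdivrMr.
    rewrite ltrBlDl -ltrBlDr ltr_pdivlMr// mulrBl.
    rewrite ltrBlDr (lt_trans f2)// intrD ltrD2l.
    rewrite (_ : 1%:~R = 1 :> R)// -ltr_pdivrMr// div1r; near: n.
    exact: (near_infty_natSinv_lt (PosNum e0)).
  move: x => [[x1 x2] x3].
  exact: (cvg_pair (cvg_pair (crnd x1) (crnd x2)) (crnd x3)).
Unshelve. all: by end_near. Qed.

End lebesgue_space.

Section almost_everywhere.
Context d (T : measurableType d) (R : realType) (mu : {measure set T -> \bar R}).
Implicit Types P Q : T -> Prop.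

Lemma ae_imp P Q : (forall x, P x -> Q x) ->
  {ae mu, forall x, P x} -> {ae mu, forall x, Q x}.
Proof. by move=> PQ; apply: filterS. Qed.

Lemma ae_and P Q : {ae mu, forall x, P x} -> {ae mu, forall x, Q x} ->
  {ae mu, forall x, P x /\ Q x}.
Proof. by apply: filterS2. Qed.

End almost_everywhere.

(** * Integrals of derivatives along the coordinate axes *)

Section translations.
Context {R : realType}.
Implicit Types (x a : vec3 R).

Lemma integral_translate3 a (F : vec3 R -> \bar R) :
  measurable_fun [set: mvec3 R] F ->
  (\int[leb3 R]_x F (x + a)%R = \int[leb3 R]_x F x)%E.
Proof.
move=> mF; rewrite [RHS](@integral_affine3 _ 1 a) ?oner_eq0// normr1 expr1n mul1e.
by apply: eq_integral => x _; rewrite translate3E.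
Qed.

Lemma integral_reflect3 a (F : vec3 R -> \bar R) :
  measurable_fun [set: mvec3 R] F ->
  (\int[leb3 R]_x F (a - x)%R = \int[leb3 R]_x F x)%E.
Proof.
move=> mF; rewrite [RHS](@integral_affine3 _ (-1) a) ?oppr_eq0 ?oner_eq0//.
rewrite normrN1 expr1n mul1e.
by apply: eq_integral => x _; rewrite reflect3E.
Qed.

Lemma measurable_translate3 a :
  measurable_fun [set: mvec3 R] (fun x : mvec3 R => (x : vec3 R) + a : mvec3 R).
Proof.
rewrite (_ : (fun x => _) = affine3 1 a); first exact: measurable_affine3.
by apply/funext => x; rewrite translate3E.
Qed.

Lemma measurable_reflect3 a :
  measurable_fun [set: mvec3 R] (fun x : mvec3 R => a - (x : vec3 R) : mvec3 R).
Proof.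
rewrite (_ : (fun x => _) = affine3 (-1) a); first exact: measurable_affine3.
by apply/funext => x; rewrite reflect3E.
Qed.

Lemma integrable_translate3 a (F : vec3 R -> \bar R) :
  (leb3 R).-integrable [set: mvec3 R] F ->
  (leb3 R).-integrable [set: mvec3 R] (fun x => F (x + a)).
Proof.
move=> /integrableP[mF Foo]; apply/integrableP; split.
  exact: (measurableT_comp mF (measurable_translate3 a)).
rewrite (@integral_translate3 a (fun x => `|F x|)%E)//.
exact: measurableT_comp.
Qed.

End translations.

Section integral_indicator.
Local Open Scope ereal_scope.
Context d (T : measurableType d) (R : realType) (mu : {measure set T -> \bar R}).

Lemma integral_indicM (D : set T) (f : T -> R) :
  \int[mu]_(x in D) (f x)%:E = \int[mu]_x (\1_D x * f x)%:E.
Proof.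
rewrite integral_mkcond; apply: eq_integral => x _.
by rewrite patchE indicE; case: ifPn => _; rewrite ?mul1r ?mul0r.
Qed.

Lemma integral_eindicM (D : set T) (f : T -> \bar R) :
  \int[mu]_(x in D) f x = \int[mu]_x ((\1_D x)%:E * f x).
Proof.
rewrite integral_mkcond; apply: eq_integral => x _.
by rewrite patchE indicE; case: ifPn => _; rewrite ?mul1e ?mul0e.
Qed.

Lemma Rintegral_indicM (D : set T) (f : T -> R) :
  (\int[mu]_(x in D) f x = \int[mu]_x (\1_D x * f x))%R.
Proof. by rewrite /Rintegral integral_indicM. Qed.

End integral_indicator.

Section coordinate_lines.
Context {R : realType}.
Implicit Types (x xi : vec3 R) (i a : 'I_3).

Lemma coord3_line i a xi (s : R) :
  coord3 i (xi + s *: basis3 a) = coord3 i xi + s * (i == a)%:R.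
Proof.
case: xi => [[u v] w].
by case: i => [[|[|[|//]]] ?]; case: a => [[|[|[|//]]] ?].
Qed.

Lemma dotE x xi : dot x xi =
  x.1.1 * xi.1.1 + x.1.2 * xi.1.2 + x.2 * xi.2.
Proof. by rewrite /dot !big_ord_recl big_ord0 addr0 addrA. Qed.

Lemma dot_line x a xi (s : R) :
  dot x (xi + s *: basis3 a) = dot x xi + s * coord3 a x.
Proof.
rewrite /dot; under eq_bigr do rewrite coord3_line mulrDr.
rewrite big_split/=; congr (_ + _).
rewrite (bigD1 a)//= eqxx mulr1 big1 ?addr0 1?mulrC// => i /negbTE ->.
by rewrite !mulr0.
Qed.

Lemma sqdot_line a xi (s : R) :
  dot (xi + s *: basis3 a) (xi + s *: basis3 a) =
  dot xi xi + 2 * s * coord3 a xi + s ^+ 2.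
Proof.
rewrite dot_line coord3_line eqxx mulr1.
have dotC x y : dot x y = dot y x by apply: eq_bigr => i _; rewrite mulrC.
by rewrite dotC dot_line; ring.
Qed.

Lemma coord3_sqr_le i xi : coord3 i xi ^+ 2 <= dot xi xi.
Proof.
rewrite /dot (bigD1 i)//= -expr2 lerDl; apply: sumr_ge0 => j _.
by rewrite -expr2 sqr_ge0.
Qed.

Lemma dot_ge0 xi : 0 <= dot xi xi.
Proof. by apply: sumr_ge0 => i _; rewrite -expr2 sqr_ge0. Qed.

Lemma is_derive_coord3_line a xi (s : R) :
  is_derive s 1 (fun r : R => coord3 a (xi + r *: basis3 a)) 1.
Proof.
rewrite (_ : (fun r => _) = (fun r : R => coord3 a xi + r)); last first.
  by apply/funext => r; rewrite coord3_line eqxx mulr1.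
by rewrite -[X in is_derive _ _ _ X]add0r; apply: is_deriveD.
Qed.

Lemma is_derive_dot_line x a xi (s : R) :
  is_derive s 1 (fun r : R => dot x (xi + r *: basis3 a)) (coord3 a x).
Proof.
rewrite (_ : (fun r => _) = (fun r : R => dot x xi + coord3 a x *: r)); last first.
  by apply/funext => r; rewrite dot_line mulrC.
rewrite -[X in is_derive _ _ _ X]add0r; apply: is_deriveD.
by rewrite -[X in is_derive _ _ _ X]mulr1; apply: is_deriveZ.
Qed.

Lemma is_derive_sqdot_line a xi (s : R) :
  is_derive s 1 (fun r : R => dot (xi + r *: basis3 a) (xi + r *: basis3 a))
    (2 * coord3 a (xi + s *: basis3 a)).
Proof.
rewrite (_ : (fun r => _) =
  (fun r : R => (dot xi xi + (2 * coord3 a xi) *: r) + r ^+ 2)); last first.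
  by apply/funext => r; rewrite sqdot_line; congr (_ + _ + _);
    rewrite -[RHS]/(_ * _); ring.
rewrite coord3_line eqxx mulr1.
apply: is_derive_eq.
by rewrite /GRing.scale/=; ring.
Qed.

Lemma measurable_dot d (T : measurableType d) (f g : T -> mvec3 R) :
  measurable_fun [set: T] f -> measurable_fun [set: T] g ->
  measurable_fun [set: T] (fun z => dot (f z) (g z)).
Proof.
move=> mf mg; rewrite (_ : (fun z => _) =
  (fun z => (f z).1.1 * (g z).1.1 + (f z).1.2 * (g z).1.2 + (f z).2 * (g z).2)); last first.
  by apply/funext => z; rewrite dotE.
by repeat apply: measurable_funD; apply: measurable_funM;
  [exact: (measurableT_comp measurable_x11 mf)|exact: (measurableT_comp measurable_x11 mg)|
   exact: (measurableT_comp measurable_x12 mf)|exact: (measurableT_comp measurable_x12 mg)|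
   exact: (measurableT_comp measurable_x2 mf)|exact: (measurableT_comp measurable_x2 mg)].
Qed.

Lemma measurable_line a : measurable_fun [set: measurableTypeR R * mvec3 R]
  (fun z : measurableTypeR R * mvec3 R =>
    (z.2 : vec3 R) + (z.1 : R) *: basis3 a : mvec3 R).
Proof.
rewrite (_ : (fun z => _) = (fun z : measurableTypeR R * mvec3 R =>
  ((z.2.1.1 + z.1 * (basis3 a).1.1, z.2.1.2 + z.1 * (basis3 a).1.2),
    z.2.2 + z.1 * (basis3 a).2) : mvec3 R)); last first.
  by apply/funext => -[s [[? ?] ?]].
apply: measurable_vec3; apply: measurable_funD.
- exact: (measurableT_comp measurable_x11 measurable_snd).
- by apply: measurable_funM => //; exact: measurable_fst.
- exact: (measurableT_comp measurable_x12 measurable_snd).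
- by apply: measurable_funM => //; exact: measurable_fst.
- exact: (measurableT_comp measurable_x2 measurable_snd).
- by apply: measurable_funM => //; exact: measurable_fst.
Qed.

(** Translation invariance gives 0 as the integral of H (xi + e) - H xi, and this
difference is the average of the derivative over the segment from xi to xi + e. *)
Lemma integral_derive_line a (H H' : vec3 R -> R) :
  (leb3 R).-integrable [set: mvec3 R] (EFin \o H) ->
  (leb3 R).-integrable [set: mvec3 R] (EFin \o H') ->
  {ae leb3 R, forall xi : vec3 R,
    (forall s : R, is_derive s 1 (fun r : R => H (xi + r *: basis3 a))
                               (H' (xi + s *: basis3 a))) /\
    continuous (fun r : R => H' (xi + r *: basis3 a))} ->
  (\int[leb3 R]_xi (H' xi)%:E = 0)%E.
Proof.
move=> iH iH' dH.
have mH : measurable_fun [set: mvec3 R] H by apply/measurable_EFinP; exact: measurable_int iH.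
have mH' : measurable_fun [set: mvec3 R] H' by apply/measurable_EFinP; exact: measurable_int iH'.
pose I : set (measurableTypeR R) := `[0%R, 1%R]%classic.
pose g (z : measurableTypeR R * mvec3 R) : R :=
  \1_I z.1 * H' ((z.2 : vec3 R) + (z.1 : R) *: basis3 a).
have m01 : measurable I by exact: measurable_itv.
have mI : measurable_fun [set: measurableTypeR R] (\1_I : _ -> R).
  exact: measurable_indic.
have mg : measurable_fun [set: measurableTypeR R * mvec3 R] g.
  apply: measurable_funM.
    exact: (measurableT_comp mI measurable_fst).
  exact: (measurableT_comp mH' (measurable_line a)).
have mgE : measurable_fun [set: measurableTypeR R * mvec3 R] (EFin \o g).
  exact/measurable_EFinP.
have H'oo : (\int[leb3 R]_xi `|(H' xi)%:E| < +oo)%E by case/integrableP : iH'.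
have ind0 (s : R) : 0 <= \1_I s :> R by [].
have normg (s : R) : (\int[leb3 R]_xi `|(g (s, xi))%:E| =
    (\1_I s)%:E * \int[leb3 R]_xi `|(H' xi)%:E|)%E.
  transitivity (\int[leb3 R]_xi ((\1_I s)%:E *
      `|(H' (xi + s *: basis3 a))%:E|))%E.
    by apply: eq_integral => xi _; rewrite /g/= normrM EFinM ger0_norm.
  rewrite ge0_integralZl_EFin//; last first.
    apply/measurable_EFinP/measurableT_comp => //.
    exact: (measurableT_comp mH' (measurable_translate3 _)).
  congr (_ * _)%E.
  rewrite (@integral_translate3 R (s *: basis3 a) (fun xi => `|(H' xi)%:E|%E))//.
  by apply/measurable_EFinP/measurableT_comp.
have ig : (leb1 R \x leb3 R)%E.-integrable [set: measurableTypeR R * mvec3 R] (EFin \o g).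
  apply/integrable12ltyP => //.
  under eq_integral do rewrite normg.
  rewrite ge0_integralZr//; last 2 first.
  - exact/measurable_EFinP.
  - exact: integral_ge0.
  rewrite integral_indic// setIT lte_mul_pinfty//.
  by rewrite /= lebesgue_measure_itv/= lte_fin ltr01 sube0.
have FubiniE := Fubini ig.
have Ifin : (\int[leb3 R]_xi (H' xi)%:E)%E \is a fin_num by exact: integrable_fin_num.
have LHSE : (\int[leb1 R]_s \int[leb3 R]_xi (EFin \o g) (s, xi) =
    \int[leb3 R]_xi (H' xi)%:E)%E.
  have E (s : R) : (\int[leb3 R]_xi (EFin \o g) (s, xi) =
      (\1_I s * fine (\int[leb3 R]_xi (H' xi)%:E))%:E)%E.
    rewrite EFinM fineK// -(@integral_translate3 R (s *: basis3 a) (EFin \o H')); last first.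
      exact/measurable_EFinP.
    rewrite -integralZl//.
    exact: (@integrable_translate3 R (s *: basis3 a) (EFin \o H')).
  under eq_integral do rewrite E.
  rewrite -integral_indicM integral_cst//=.
  by rewrite lebesgue_measure_itv/= lte_fin ltr01 sube0 mule1 fineK.
rewrite LHSE in FubiniE; rewrite FubiniE.
have iHt : (leb3 R).-integrable [set: mvec3 R]
    (fun xi => (H (xi + 1 *: basis3 a))%:E).
  exact: (@integrable_translate3 R (1 *: basis3 a) (EFin \o H)).
transitivity (\int[leb3 R]_xi
   ((H (xi + 1 *: basis3 a))%:E - (H xi)%:E))%E; last first.
  rewrite integralB//.
  rewrite (@integral_translate3 R (1 *: basis3 a) (EFin \o H)); last first.
    exact/measurable_EFinP.
  by rewrite subee//; exact: integrable_fin_num.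
apply: ae_eq_integral => //.
- exact: (measurable_fubini_G ig).
- apply: emeasurable_funB; last exact/measurable_EFinP.
  by case/integrableP : iHt.
apply: ae_imp dH => xi [dH cH'] _.
rewrite -[LHS]/(\int[leb1 R]_s (\1_I s *
  H' (xi + s *: basis3 a))%:E)%E -integral_indicM.
rewrite (@continuous_FTC2 R _ (fun r : R => H (xi + r *: basis3 a)) 0 1)//.
- by rewrite scale0r addr0.
- exact: continuous_subspaceT.
- have cH s : {for s, continuous (fun r : R => H (xi + r *: basis3 a))}.
    have [/derivable1_diffP d _] := dH s.
    exact: differentiable_continuous d.
  split.
  + by move=> s _; have [] := dH s.
  + exact/cvg_at_right_filter/cH.
  + exact/cvg_at_left_filter/cH.
- by move=> s _; rewrite derive1E; have [_ ->] := dH s.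
Qed.

End coordinate_lines.

(** * Symbols with a singularity at the origin *)

Section weights.
Context {R : realType}.
Local Notation mu := (leb1 R).

(** A singularity |xi|^d on R^3 with -3 < d <= 0 is at most the product of the one
dimensional singularities |xi_i|^(d/3), which are integrable at 0; the denominator
provides integrability at infinity. *)
Definition origin_weight (e r : R) : R := `|r| `^ (- e) / (1 + r ^+ 2).

Lemma origin_weight_ge0 e r : 0 <= origin_weight e r.
Proof. by rewrite divr_ge0 ?powR_ge0// addr_ge0// sqr_ge0. Qed.

Lemma measurable_origin_weight e :
  measurable_fun [set: measurableTypeR R] (origin_weight e).
Proof.
apply: measurable_funM.
  by apply: (measurableT_comp (measurable_powR (- e))); exact: normr_measurable.
apply: (@continuous_measurable_fun R) => r.
apply: cvgV; first by rewrite gt_eqF// ltr_pwDl// sqr_ge0.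
by apply: cvgD; [exact: cvg_cst|exact: exprn_continuous].
Qed.

Lemma integral_origin_weight e : 0 <= e < 1 ->
  (\int[mu]_r (origin_weight e r)%:E < +oo)%E.
Proof.
move=> /andP[e0 e1].
have sq2 (u : R) : (1 + u) ^+ 2 <= 2 * (1 + u ^+ 2).
  rewrite -subr_ge0 (_ : _ - _ = (1 - u) ^+ 2) ?sqr_ge0//; ring.
pose f (r : R) : R := r `^ (- e) / (1 + r ^+ 2).
have f0 r : 0 <= f r by rewrite divr_ge0 ?powR_ge0// addr_ge0// sqr_ge0.
have mV : measurable_fun [set: measurableTypeR R] (fun r : R => (1 + r ^+ 2)^-1).
  apply: (@continuous_measurable_fun R) => r.
  apply: cvgV; first by rewrite gt_eqF// ltr_pwDl// sqr_ge0.
  by apply: cvgD; [exact: cvg_cst|exact: exprn_continuous].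
have mf : measurable_fun [set: measurableTypeR R] f.
  by apply: measurable_funM => //; exact: measurable_powR.
rewrite (_ : (\int[mu]_r _)%E = (\int[mu]_r (f `|r|)%:E)%E); last first.
  by apply: eq_integral => r _; rewrite /f real_normK ?num_real.
rewrite ge0_integral_even// lte_mul_pinfty// ?lee_fin//.
pose I : set (measurableTypeR R) := `]0%R, 1%R]%classic.
have mI : measurable I by exact: measurable_itv.
have mg : measurable_fun [set: measurableTypeR R] (fun r : R => \1_I r * r `^ (- e)).
  by apply: measurable_funM; [exact: measurable_indic|exact: measurable_powR].
have mh : measurable_fun [set: measurableTypeR R] (fun r : R => (1 + r) `^ (- 2)).
  apply: (measurableT_comp (measurable_powR _)).
  by apply: measurable_funD => //.
apply: (@le_lt_trans _ _ (\int[mu]_(r in `[0%R, +oo[)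
    ((\1_I r * r `^ (- e))%:E + 2%:E * ((1 + r) `^ (- 2))%:E))%E).
  apply: ge0_le_integral => //.
  - by move=> r _; rewrite lee_fin.
  - exact/measurable_EFinP/measurable_funTS.
  - apply: emeasurable_funD; first exact/measurable_EFinP/measurable_funTS.
    by apply: emeasurable_funM => //; exact/measurable_EFinP/measurable_funTS.
  - move=> r /=; rewrite in_itv/= andbT => r0.
    rewrite -EFinM -EFinD lee_fin indicE.
    have r10 : 0 < 1 + r by rewrite ltr_pwDl.
    have den : (1 + r ^+ 2)^-1 <= 2 * (1 + r) `^ (- 2).
      rewrite powR_invn ?(ltW r10)//.
      rewrite ler_pdivlMr ?exprn_gt0// mulrC ler_pdivrMr; last first.
        by rewrite ltr_pwDl// sqr_ge0.
      exact: sq2.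
    have den1 : (1 + r ^+ 2)^-1 <= 1.
      by rewrite invf_le1 ?lerDl ?sqr_ge0// ltr_pwDl// sqr_ge0.
    case: (boolP (r \in I)) => rI /=.
      rewrite mul1r /f; apply: ler_wpDr; first by rewrite mulr_ge0// powR_ge0.
      by rewrite -[leRHS]mulr1 ler_wpM2l// powR_ge0.
    rewrite mul0r add0r (le_trans _ den)// /f -[leRHS]mul1r.
    rewrite ler_wpM2r ?invr_ge0 ?addr_ge0 ?sqr_ge0//.
    have [->|rn0] := eqVneq r 0.
      have [->|en0] := eqVneq e 0; first by rewrite oppr0 powRr0.
      by rewrite powR0// oppr_eq0.
    have r1 : 1 < r.
      rewrite ltNge; apply: contraNN rI => r1; apply/mem_set; rewrite /I/= in_itv/= r1 andbT.
      by rewrite lt_neqAle eq_sym rn0.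
    rewrite powRN invf_le1 ?powR_gt0 ?(lt_trans ltr01)//.
    by rewrite -[leLHS](powRr0 r) ler_powR// ltW.
rewrite ge0_integralD//=; last 4 first.
- by move=> r _; rewrite lee_fin mulr_ge0// powR_ge0.
- exact/measurable_EFinP/measurable_funTS.
- by move=> r _; rewrite lee_fin mulr_ge0// powR_ge0.
- by apply: emeasurable_funM => //; exact/measurable_EFinP/measurable_funTS.
apply: lte_add_pinfty.
  apply: (@le_lt_trans _ _ (\int[mu]_r (\1_I r * r `^ (- e))%:E)%E).
    apply: ge0_subset_integral => //; first exact/measurable_EFinP.
    by move=> r _; rewrite lee_fin mulr_ge0// powR_ge0.
  by rewrite -integral_indicM integral_powR_0// ltry.
rewrite ge0_integralZl_EFin//; last 2 first.
- by move=> r _; rewrite lee_fin powR_ge0.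
- exact/measurable_EFinP/measurable_funTS.
by rewrite integral_powR_y ?ltr1n// -EFinM ltry.
Qed.

Lemma integral_decay_weight (th : R) : 1 < th ->
  (\int[mu]_r ((1 + `|r|) `^ (- th))%:E < +oo)%E.
Proof.
move=> th1; rewrite (@ge0_integral_even R (fun r => (1 + r) `^ (- th))).
- by rewrite integral_powR_y// -EFinM ltry.
- by move=> r; exact: powR_ge0.
- apply: (measurableT_comp (measurable_powR _)).
  by apply: measurable_funD.
Qed.

Lemma powR_expRN_le (b : R) : 0 <= b ->
  exists C : R, forall z, 0 <= z -> z `^ b * expR (- z) <= C.
Proof.
rewrite le_eqVlt => /predU1P[<-|b0].
  by exists 1 => z z0; rewrite powRr0 mul1r -expR0 ler_expR oppr_le0.
exists (b `^ b) => z z0; rewrite expRN ler_pdivrMr ?expR_gt0//.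
have -> : expR z = expR (z / b) `^ b by rewrite -expRM mulfVK ?gt_eqF.
rewrite -powRM ?(ltW b0) ?expR_ge0// ge0_ler_powR ?nnegrE ?(ltW b0)//.
  by rewrite mulr_ge0 ?(ltW b0)// expR_ge0.
rewrite mulrC -ler_pdivrMr// (le_trans _ (expR_ge1Dx _))//.
by rewrite lerDr.
Qed.

Lemma powR_stretched_expRN_le (al b : R) : 0 < al -> 0 <= b ->
  exists C : R, forall y, 0 <= y -> y `^ b * expR (- (y `^ al)) <= C.
Proof.
move=> al0 b0.
have [C HC] := @powR_expRN_le (b / al) (divr_ge0 b0 (ltW al0)).
exists C => y y0; have := HC (y `^ al) (powR_ge0 _ _).
by rewrite -powRrM (_ : al * (b / al) = b)//; field; rewrite gt_eqF.
Qed.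

Lemma stretched_decay3 (al b : R) : 0 < al -> 0 <= b ->
  exists2 C : R, 0 <= C & forall y, 0 < y ->
    y `^ b * expR (- (y `^ al)) <= C / (1 + y) ^+ 3.
Proof.
move=> al0 b0.
have [C0 H0] := powR_stretched_expRN_le al0 b0.
have [C3 H3] := @powR_stretched_expRN_le al (b + 3) al0 (addr_ge0 b0 (ler0n _ 3)).
have C00 : 0 <= C0 by rewrite (le_trans _ (H0 0 (lexx _)))// mulr_ge0 ?powR_ge0 ?expR_ge0.
have C30 : 0 <= C3 by rewrite (le_trans _ (H3 0 (lexx _)))// mulr_ge0 ?powR_ge0 ?expR_ge0.
exists (4 * (C0 + C3)) => [|y y0]; first by rewrite mulr_ge0// addr_ge0.
have y1 : 0 < 1 + y by rewrite addr_gt0.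
rewrite ler_pdivlMr ?exprn_gt0//.
have h0 := H0 y (ltW y0); have h3 := H3 y (ltW y0).
rewrite powRD ?(gt_eqF y0) ?implybT// powR_mulrn ?(ltW y0)// in h3.
set A := y `^ b * _ in h0 *.
have A0 : 0 <= A by rewrite mulr_ge0 ?powR_ge0 ?expR_ge0.
have {}h3 : A * y ^+ 3 <= C3 by rewrite /A mulrAC.
have cub : (1 + y) ^+ 3 <= 4 * (1 + y ^+ 3).
  rewrite -subr_ge0 (_ : _ - _ = 3 * (1 - y) ^+ 2 * (1 + y)); last by ring.
  by rewrite mulr_ge0 ?(ltW y1)// mulr_ge0 ?sqr_ge0.
apply: (@le_trans _ _ (A * (4 * (1 + y ^+ 3)))); first exact: ler_wpM2l.
by rewrite mulrCA mulrDr mulr1 ler_wpM2l// lerD.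
Qed.

(** The points outside the coordinate planes are those where the product of the
weights is a genuine bound, and where coordinate lines avoid the origin. *)
Lemma ae_coord3_neq0 :
  {ae leb3 R, forall xi : vec3 R, forall i, coord3 i xi != 0}.
Proof.
have one (i : 'I_3) : {ae leb3 R, forall xi : vec3 R, coord3 i xi != 0}.
  exists [set xi : mvec3 R | coord3 i (xi : vec3 R) = 0]; split.
  - rewrite (_ : [set _ | _] = (coord3 i : mvec3 R -> R) @^-1` [set 0])//.
    rewrite -[_ @^-1` _]setTI; apply: measurable_coord3 => //.
  - have m0 : measurable ([set 0] : set (measurableTypeR R)) by exact: measurable_set1.
    have l0 : mu [set 0] = 0%E by exact: lebesgue_measure_set1.
    case: i => [[|[|[|//]]] ?].
    + rewrite (_ : [set _ | _] = ([set 0] `*` setT) `*` setT); last first.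
        by apply/seteqP; split => -[[? ?] ?] //= -[[]].
      have l2 : leb2 (R:=R) ([set 0] `*` setT) = 0%E.
        transitivity (mu [set 0%R] * mu setT)%E; first exact: product_measure1E.
        by rewrite l0 mul0e.
      rewrite /leb3 /= product_measure1E//; last exact: measurableX.
      by apply/eqP; rewrite mule_eq0; apply/orP; left; apply/eqP; exact: l2.
    + rewrite (_ : [set _ | _] = (setT `*` [set 0]) `*` setT); last first.
        by apply/seteqP; split => -[[? ?] ?] //= -[[]].
      have l2 : leb2 (R:=R) (setT `*` [set 0]) = 0%E.
        transitivity (mu setT * mu [set 0%R])%E; first exact: product_measure1E.
        by rewrite l0 mule0.
      rewrite /leb3 /= product_measure1E//; last exact: measurableX.
      by apply/eqP; rewrite mule_eq0; apply/orP; left; apply/eqP; exact: l2.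
    + rewrite (_ : [set _ | _] = setT `*` [set 0]); last first.
        by apply/seteqP; split => -[[? ?] ?] //= -[].
      transitivity (leb2 (R:=R) setT * mu [set 0%R])%E; first exact: product_measure1E.
      by rewrite l0 mule0.
  - by move=> xi /= /negP; rewrite negbK => /eqP.
have := ae_and (ae_and (one ord0) (one (inord 1))) (one ord_max).
by apply: ae_imp => xi [[h0 h1] h2]; exact: forall3.
Qed.

End weights.

Section symbols.
Context {R : realType} (al : R) (al0 : 0 < al) (a : 'I_3).
Implicit Types (xi x : vec3 R) (m Q : vec3 R -> R).

Definition monomial Q (n : nat) (s : R) xi : R :=
  Q xi * coord3 a xi ^+ n * dot xi xi `^ s * expR (- (dot xi xi `^ al)).

(** Linear combinations of products of powers of the coordinates, powers of the
Euclidean norm and the heat symbol, every term having degree at least [d] at the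
origin.  The factor [Q] gathers the powers of the coordinates other than the
[a]-th one, which are constant along the lines of differentiation. *)
Inductive symbol_class : R -> (vec3 R -> R) -> Prop :=
| symbol_monomial (d : R) Q (n : nat) (s k C : R) : measurable_fun [set: mvec3 R] Q ->
    (forall xi r, Q (xi + r *: basis3 a) = Q xi) ->
    (forall xi, 0 < dot xi xi -> `|Q xi| <= C * dot xi xi `^ k) ->
    d <= 2 * k + n%:R + 2 * s -> symbol_class d (monomial Q n s)
| symbol_add (d : R) m1 m2 : symbol_class d m1 -> symbol_class d m2 ->
    symbol_class d (fun xi => m1 xi + m2 xi).

Lemma symbol_scale (d : R) m (c : R) : symbol_class d m ->
  symbol_class d (fun xi => c * m xi).
Proof.
elim=> {d m} [d Q n s k C mQ Qa QC dk|d m1 m2 _ h1 _ h2].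
  rewrite (_ : (fun xi => _) = monomial (fun xi => c * Q xi) n s); last first.
    by apply/funext => xi; rewrite /monomial !mulrA.
  apply: (@symbol_monomial _ _ _ _ k (`|c| * C)) => //.
  - exact: measurable_funM.
  - by move=> xi r; rewrite Qa.
  - by move=> xi xi0; rewrite normrM -mulrA ler_wpM2l// QC.
rewrite (_ : (fun xi => _) = (fun xi => c * m1 xi + c * m2 xi)); last first.
  by apply/funext => xi; rewrite mulrDr.
exact: symbol_add.
Qed.

Lemma norm_coord3_le i xi : `|coord3 i xi| <= dot xi xi `^ 2^-1.
Proof.
rewrite -[leLHS]powRr1// -[X in _ `^ X](mulfV (_ : 2 != 0 :> R))//.
rewrite powRrM -[X in (_ `^ X) `^ _]/(2%:R) powR_mulrn// real_normK ?num_real//.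
by apply: ge0_ler_powR; rewrite ?nnegrE ?sqr_ge0 ?dot_ge0 ?coord3_sqr_le.
Qed.

Lemma symbol_coord3 (d : R) m i : symbol_class d m ->
  symbol_class (d + 1) (fun xi => coord3 i xi * m xi).
Proof.
elim=> {d m} [d Q n s k C mQ Qa QC dk|d m1 m2 _ h1 _ h2]; last first.
  rewrite (_ : (fun xi => _) =
      (fun xi => coord3 i xi * m1 xi + coord3 i xi * m2 xi)); last first.
    by apply/funext => xi; rewrite mulrDr.
  exact: symbol_add.
have [->|ia] := eqVneq i a.
  rewrite (_ : (fun xi => _) = monomial Q n.+1 s); last first.
    by apply/funext => xi; rewrite /monomial exprS; ring.
  apply: (@symbol_monomial _ _ _ _ k C) => //.
  have nS : n.+1%:R = n%:R + 1 :> R by rewrite -natr1.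
  by rewrite nS; lra.
rewrite (_ : (fun xi => _) = monomial (fun xi => coord3 i xi * Q xi) n s); last first.
  by apply/funext => xi; rewrite /monomial !mulrA.
apply: (@symbol_monomial _ _ _ _ (k + 2^-1) C) => //.
- by apply: measurable_funM => //; exact: measurable_coord3.
- by move=> xi r; rewrite Qa coord3_line (negbTE ia) mulr0 addr0.
- move=> xi xi0; rewrite normrM powRD ?(gt_eqF xi0) ?implybT//.
  by rewrite mulrA mulrC ler_pM// ?QC// norm_coord3_le.
- lra.
Qed.

Lemma measurable_sqdot_powR (s : R) :
  measurable_fun [set: mvec3 R] (fun xi : mvec3 R => dot xi xi `^ s).
Proof.
apply: (measurableT_comp (measurable_powR _)).
by apply: measurable_dot; exact: measurable_id.
Qed.

Lemma measurable_symbol (d : R) m : symbol_class d m -> measurable_fun [set: mvec3 R] m.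
Proof.
elim=> {d m} [d Q n s k C mQ Qa QC dk|d m1 m2 _ h1 _ h2]; last first.
  exact: measurable_funD.
apply: measurable_funM; last first.
  apply: (measurableT_comp (continuous_measurable_fun (@continuous_expR R))).
  by apply: measurableT_comp => //; exact: measurable_sqdot_powR.
apply: measurable_funM; last exact: measurable_sqdot_powR.
apply: measurable_funM => //; apply: measurable_funX; exact: measurable_coord3.
Qed.

Lemma is_derive_monomial Q n (s : R) xi (r : R) :
  (forall xi r, Q (xi + r *: basis3 a) = Q xi) ->
  0 < dot (xi + r *: basis3 a) (xi + r *: basis3 a) ->
  is_derive r 1 (fun r : R => monomial Q n s (xi + r *: basis3 a))
   (n%:R * monomial Q n.-1 s (xi + r *: basis3 a) +
    2 * s * monomial Q n.+1 (s - 1) (xi + r *: basis3 a) +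
    - 2 * al * monomial Q n.+1 (s + al - 1) (xi + r *: basis3 a)).
Proof.
move=> Qa rho0.
pose f1 (r : R) : R := coord3 a (xi + r *: basis3 a).
pose rho (r : R) : R := dot (xi + r *: basis3 a) (xi + r *: basis3 a).
have d1 : is_derive r 1 f1 1 := is_derive_coord3_line a xi r.
have drho : is_derive r 1 rho (2 * f1 r) := is_derive_sqdot_line a xi r.
have dpow t : is_derive r 1 (fun r => rho r `^ t)
    (t * rho r `^ (t - 1) * (2 * f1 r)).
  apply: (@is_derive1_comp R (fun y => y `^ t) rho) => //.
  exact: is_derive1_powR.
have dexp : is_derive r 1 (fun r => expR (- (rho r `^ al)))
    (expR (- (rho r `^ al)) * (- (al * rho r `^ (al - 1) * (2 * f1 r)))).
  exact: (is_derive1_comp (is_derive_expR _) (is_deriveN (dpow al))).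
rewrite (_ : (fun r : R => _) =
  (Q xi \*: (f1 ^+ n)) * (fun r => rho r `^ s) *
    (fun r => expR (- (rho r `^ al)))); last first.
  by apply/funext => u; rewrite /monomial Qa !fctE.
apply: (is_derive_eq (is_deriveM (is_deriveM (is_deriveZ _ (is_deriveX n d1)) (dpow s)) dexp)).
rewrite /monomial Qa -/(f1 r) -/(rho r) !fctE /GRing.scale/=.
have -> : rho r `^ (s + al - 1) = rho r `^ s * rho r `^ (al - 1).
  have ne : rho r != 0 by rewrite gt_eqF.
  by rewrite -addrA [LHS]powRD// ne implybT.
rewrite (_ : Q xi *: f1 r ^+ n = Q xi * f1 r ^+ n)//.
rewrite !exprS; ring.
Qed.

(** Differentiation lowers the degree by one, also on the heat symbol: its derivative
brings out the factor coord3 a xi |xi|^(2 al - 2), of degree 2 al - 1 >= -1. *)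
Lemma symbol_derive (d : R) m : symbol_class d m -> exists2 m', symbol_class (d - 1) m' &
  forall xi (r : R), 0 < dot (xi + r *: basis3 a) (xi + r *: basis3 a) ->
    is_derive r 1 (fun r : R => m (xi + r *: basis3 a)) (m' (xi + r *: basis3 a)).
Proof.
elim=> {d m} [d Q n s k C mQ Qa QC dk|d m1 m2 _ [m1' s1 h1] _ [m2' s2 h2]]; last first.
  exists (fun xi => m1' xi + m2' xi); first exact: symbol_add.
  by move=> xi r rho0; apply: is_deriveD; [exact: h1|exact: h2].
exists (fun xi => n%:R * monomial Q n.-1 s xi + 2 * s * monomial Q n.+1 (s - 1) xi +
    - 2 * al * monomial Q n.+1 (s + al - 1) xi); last first.
  by move=> xi r rho0; exact: is_derive_monomial.
have nS : n.+1%:R = n%:R + 1 :> R by rewrite -natr1.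
have sn e : d - 1 <= 2 * k + n.+1%:R + 2 * e -> symbol_class (d - 1) (monomial Q n.+1 e).
  exact: (symbol_monomial mQ Qa QC).
apply: symbol_add; last first.
  apply: symbol_scale; apply: sn.
  rewrite (_ : _ + _ = (2 * k + n%:R + 2 * s) - 1 + 2 * al); last by rewrite nS; ring.
  by rewrite ler_wpDr ?lerB// mulr_ge0// ltW.
apply: symbol_add; last first.
  by apply: symbol_scale; apply: sn; rewrite nS; lra.
case: n dk {sn nS} => [|n] dk; last first.
  have nS : n.+1%:R = n%:R + 1 :> R by rewrite -natr1.
  by apply/symbol_scale/(symbol_monomial mQ Qa QC); rewrite nS in dk; lra.
rewrite (_ : (fun xi => _) = monomial (fun=> 0) 0 s); last first.
  by apply/funext => xi; rewrite /monomial !mul0r.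
apply: (@symbol_monomial _ _ _ _ (k : R) 0) => //.
  by move=> xi xi0; rewrite normr0 mul0r.
by rewrite lerBlDr (le_trans dk)// lerDl.
Qed.

(** Near the origin the degree bounds the symbol by |xi|^(- 3 e), which is distributed
over the three coordinates; far away the heat symbol beats every power. *)
Lemma symbol_bound (d : R) m (e : R) : 0 <= e -> - (3 * e) <= d -> symbol_class d m ->
  exists C : R, forall xi, (forall i, coord3 i xi != 0) ->
    `|m xi| <= C * (origin_weight e xi.1.1 * origin_weight e xi.1.2 *
                    origin_weight e xi.2).
Proof.
move=> e0 + sm; elim: sm => {d m} [d Q n s k C mQ Qa QC dk|d m1 m2 _ h1 _ h2] ed; last first.
  have [C1 {}h1] := h1 ed; have [C2 {}h2] := h2 ed.
  exists (C1 + C2) => xi xi0; rewrite mulrDl (le_trans (ler_normD _ _))//.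
  by rewrite lerD ?h1 ?h2.
pose b : R := k + n%:R / 2 + s + 3 * e / 2.
have b0 : 0 <= b by rewrite /b; lra.
have [C' C'0 HC'] := stretched_decay3 al0 b0.
exists (`|C| * C') => xi xi0.
have r20 : 0 < dot xi xi.
  by rewrite (lt_le_trans _ (coord3_sqr_le ord0 xi))// exprn_even_gt0//= xi0.
set r2 := dot xi xi.
have main : `|monomial Q n s xi| <=
    `|C| * (r2 `^ (- e / 2)) ^+ 3 * (r2 `^ b * expR (- (r2 `^ al))).
  rewrite /monomial !normrM (ger0_norm (expR_ge0 _)) (ger0_norm (powR_ge0 _ _)).
  rewrite [leRHS]mulrA ler_wpM2r ?expR_ge0//.
  have -> : `|C| * (r2 `^ (- e / 2)) ^+ 3 * r2 `^ b =
      (`|C| * r2 `^ k) * (r2 `^ 2^-1) ^+ n * r2 `^ s.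
    rewrite -!powR_mulrn ?powR_ge0// -!powRrM -!mulrA -!powRD ?(gt_eqF r20) ?implybT//.
    by congr (_ * _ `^ _); rewrite /b; field.
  rewrite ler_wpM2r ?powR_ge0// ler_pM//.
    by rewrite (le_trans (QC _ r20))// ler_wpM2r ?powR_ge0// ler_norm.
  by rewrite normrX lerXn2r ?nnegrE ?powR_ge0// norm_coord3_le.
apply: (le_trans main).
have wE (u : R) : u != 0 -> u ^+ 2 <= r2 ->
    r2 `^ (- e / 2) <= `|u| `^ (- e) /\ (1 + r2)^-1 <= (1 + u ^+ 2)^-1.
  move=> u0 ur2; split; last first.
    by rewrite lef_pV2 ?posrE ?lerD2l// ltr_pwDl// ?sqr_ge0// ltW.
  have -> : `|u| `^ (- e) = (u ^+ 2) `^ (- e / 2).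
    rewrite -[u ^+ 2](@real_normK _ u) ?num_real// -powR_mulrn// -powRrM.
    by congr (_ `^ _); field.
  rewrite mulNr !powRN lef_pV2 ?posrE ?powR_gt0 ?exprn_even_gt0//.
  by rewrite ge0_ler_powR ?nnegrE ?divr_ge0 ?sqr_ge0 ?(ltW r20).
have [p1 q1] := wE _ (xi0 ord0) (coord3_sqr_le ord0 xi).
have [p2 q2] := wE _ (xi0 (inord 1)) (coord3_sqr_le (inord 1) xi).
have [p3 q3] := wE _ (xi0 ord_max) (coord3_sqr_le ord_max xi).
rewrite (_ : coord3 ord0 xi = xi.1.1)// in p1 q1.
rewrite (_ : coord3 (inord 1) xi = xi.1.2) in p2 q2; last first.
  by rewrite /coord3 (tnth_nth 0)/= inordK.
rewrite (_ : coord3 ord_max xi = xi.2)// in p3 q3.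
have V0 : 0 <= (1 + r2)^-1 by rewrite invr_ge0 addr_ge0// ltW.
apply: (@le_trans _ _ (`|C| * (r2 `^ (- e / 2)) ^+ 3 * (C' / (1 + r2) ^+ 3))).
  by rewrite ler_wpM2l ?HC'// mulr_ge0// exprn_ge0// powR_ge0.
rewrite (_ : _ * _ = `|C| * C' *
  ((r2 `^ (- e / 2) / (1 + r2)) * (r2 `^ (- e / 2) / (1 + r2)) *
   (r2 `^ (- e / 2) / (1 + r2)))); last by rewrite -exprVn; ring.
have t0 : 0 <= r2 `^ (- e / 2) / (1 + r2) by rewrite mulr_ge0 ?powR_ge0.
rewrite ler_wpM2l ?mulr_ge0// /origin_weight.
by rewrite !ler_pM ?mulr_ge0 ?powR_ge0.
Qed.

Lemma integrable_symbol (d : R) m : - 3 < d -> symbol_class d m ->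
  (leb3 R).-integrable [set: mvec3 R] (EFin \o m).
Proof.
move=> d3 sm.
pose e : R := if 0 <= d then 0 else - d / 3.
have [e0 e1 ed] : [/\ 0 <= e, e < 1 & - (3 * e) <= d].
  by rewrite /e; case: ifPn => [d0|]; [split; lra|rewrite -ltNge => d0; split; lra].
have [C HC] := symbol_bound e0 ed sm.
have mm := measurable_symbol sm.
have mw : measurable_fun [set: mvec3 R] (fun xi : mvec3 R =>
    origin_weight e xi.1.1 * origin_weight e xi.1.2 * origin_weight e xi.2).
  apply: measurable_funM; first apply: measurable_funM.
  - exact: (measurableT_comp (measurable_origin_weight e) measurable_x11).
  - exact: (measurableT_comp (measurable_origin_weight e) measurable_x12).
  - exact: (measurableT_comp (measurable_origin_weight e) measurable_x2).
have w0 xi : 0 <= origin_weight e xi.1.1 * origin_weight e xi.1.2 * origin_weight e xi.2.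
  by apply: mulr_ge0; first apply: mulr_ge0; exact: origin_weight_ge0.
apply/integrableP; split; first exact/measurable_EFinP.
apply: (@le_lt_trans _ _ (\int[leb3 R]_xi ((`|C|)%:E *
    (origin_weight e xi.1.1 * origin_weight e xi.1.2 * origin_weight e xi.2)%:E))%E).
  apply: ae_ge0_le_integral => //.
  - by apply: measurableT_comp => //; exact/measurable_EFinP.
  - by move=> xi _; rewrite mule_ge0// lee_fin.
  - by apply: emeasurable_funM => //; exact/measurable_EFinP.
  apply: ae_imp ae_coord3_neq0 => xi xi0 _ /=.
  by rewrite -EFinM lee_fin (le_trans (HC _ xi0))// ler_wpM2r// ler_norm.
rewrite ge0_integralZl_EFin//; last 2 first.
- by move=> xi _; rewrite lee_fin.
- exact/measurable_EFinP.
rewrite lte_mul_pinfty// integral_prod3; last 2 first.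
- exact: origin_weight_ge0.
- exact: measurable_origin_weight.
have Ioo := @integral_origin_weight R e.
have {}Ioo : (\int[leb1 R]_r (origin_weight e r)%:E < +oo)%E by apply: Ioo; rewrite e0.
have I0 : (0 <= \int[leb1 R]_r (origin_weight e r)%:E)%E.
  by apply: integral_ge0 => r _; rewrite lee_fin origin_weight_ge0.
have Ifin : (\int[leb1 R]_r (origin_weight e r)%:E)%E \is a fin_num.
  by rewrite ge0_fin_numE.
by rewrite -(fineK Ifin) -!EFinM ltry.
Qed.

End symbols.

(** * Decay of Fourier transforms *)

Section cosine_transform.
Context {R : realType}.
Implicit Types (xi x : vec3 R) (m : vec3 R -> R) (th : R).

(** The phase [th] treats the cosine and sine transforms together: a derivative
of the symbol shifts the phase by a quarter turn. *)
Definition cosT th m x : R := \int[leb3 R]_xi (m xi * cos (dot x xi + th)).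

Lemma measurable_dotx x : measurable_fun [set: mvec3 R] (fun xi : mvec3 R => dot x xi).
Proof. by apply: measurable_dot; [exact: measurable_cst|exact: measurable_id]. Qed.

Lemma measurable_cos_dot x th :
  measurable_fun [set: mvec3 R] (fun xi : mvec3 R => cos (dot x xi + th)).
Proof.
apply: (measurableT_comp (continuous_measurable_fun (@continuous_cos R))).
by apply: measurable_funD => //; exact: measurable_dotx.
Qed.

Lemma measurable_sin_dot x th :
  measurable_fun [set: mvec3 R] (fun xi : mvec3 R => sin (dot x xi + th)).
Proof.
apply: (measurableT_comp (continuous_measurable_fun (@continuous_sin R))).
by apply: measurable_funD => //; exact: measurable_dotx.
Qed.

Lemma integrable_mulr_le1 d (T : measurableType d) (mu : {measure set T -> \bar R})
    (f g : T -> R) : mu.-integrable [set: T] (EFin \o f) ->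
  measurable_fun [set: T] g -> (forall z : T, `|g z| <= 1) ->
  mu.-integrable [set: T] (fun z => (f z * g z)%:E).
Proof.
move=> intf mg g1.
have mf : measurable_fun [set: T] f by apply/measurable_EFinP; exact: measurable_int intf.
apply: (le_integrable _ _ _ intf) => //.
  by apply/measurable_EFinP; exact: measurable_funM.
by move=> x _; rewrite lee_fin normrM -[leRHS]mulr1 ler_wpM2l.
Qed.

Lemma cos_norm_le1 (u : R) : `|cos u| <= 1.
Proof. by rewrite ler_norml cos_geN1 cos_le1. Qed.

Lemma sin_norm_le1 (u : R) : `|sin u| <= 1.
Proof. by rewrite ler_norml sin_geN1 sin_le1. Qed.

Lemma cosT_le th m x : (leb3 R).-integrable [set: mvec3 R] (EFin \o m) ->
  `|cosT th m x| <= \int[leb3 R]_xi `|m xi|.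
Proof.
move=> im; have imc := integrable_mulr_le1 im (measurable_cos_dot x th)
  (fun xi => cos_norm_le1 _).
apply: (le_trans (le_normr_Rintegral _ imc)) => //.
apply: le_Rintegral => //.
- exact: (integrable_norm imc).
- exact: (integrable_norm im).
- by move=> xi _; rewrite normrM -[leRHS]mulr1 ler_wpM2l// cos_norm_le1.
Qed.

Lemma ae_line_neq0 (a : 'I_3) : {ae leb3 R, forall xi, forall r : R,
  0 < dot (xi + r *: basis3 a) (xi + r *: basis3 a)}.
Proof.
apply: ae_imp (@ae_coord3_neq0 R) => xi xi0 r.
have [i ia] : exists i : 'I_3, i != a.
  by case: a => [[|[|[|//]]] ?]; [exists ord_max|exists ord0|exists ord0].
apply: lt_le_trans (coord3_sqr_le i _).
by rewrite coord3_line (negbTE ia) mulr0 addr0 exprn_even_gt0//= xi0.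
Qed.

(** Integration by parts, applied to the product of [m] by the sine of the phase. The
derivative of [m] is asked for away from the origin only, since almost every
coordinate line avoids it. *)
Lemma cosT_derive (a : 'I_3) m m' :
  (leb3 R).-integrable [set: mvec3 R] (EFin \o m) ->
  (leb3 R).-integrable [set: mvec3 R] (EFin \o m') ->
  (forall xi (r : R), 0 < dot (xi + r *: basis3 a) (xi + r *: basis3 a) ->
    is_derive r 1 (fun r : R => m (xi + r *: basis3 a)) (m' (xi + r *: basis3 a)) /\
    {for r, continuous (fun r : R => m' (xi + r *: basis3 a))}) ->
  forall th x, coord3 a x * cosT th m x = cosT (th + pi / 2) m' x.
Proof.
move=> im im' dm th x.
pose H xi : R := m xi * sin (dot x xi + th).
pose H' xi : R := m' xi * sin (dot x xi + th) + coord3 a x * (m xi * cos (dot x xi + th)).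
have ims := integrable_mulr_le1 im (measurable_sin_dot x th) (fun=> sin_norm_le1 _).
have im's := integrable_mulr_le1 im' (measurable_sin_dot x th) (fun=> sin_norm_le1 _).
have imc := integrable_mulr_le1 im (measurable_cos_dot x th) (fun=> cos_norm_le1 _).
have ixc : (leb3 R).-integrable [set: mvec3 R]
    (fun xi => (coord3 a x * (m xi * cos (dot x xi + th)))%:E).
  rewrite (_ : (fun xi => _) = (fun xi : mvec3 R => (coord3 a x)%:E *
    (m xi * cos (dot x xi + th))%:E)%E); last by apply/funext => xi; rewrite EFinM.
  exact: integrableZl.
have iH' : (leb3 R).-integrable [set: mvec3 R] (EFin \o H').
  rewrite (_ : EFin \o H' = (fun xi => (m' xi * sin (dot x xi + th))%:E) \+
     (fun xi => (coord3 a x * (m xi * cos (dot x xi + th)))%:E))%E; last first.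
    by apply/funext => xi; rewrite /H'/= EFinD.
  exact: integrableD.
have := @integral_derive_line R a H H' ims iH'.
have dH : {ae leb3 R, forall xi : vec3 R,
    (forall s : R, is_derive s 1 (fun r : R => H (xi + r *: basis3 a))
                               (H' (xi + s *: basis3 a))) /\
    continuous (fun r : R => H' (xi + r *: basis3 a))}.
  apply: ae_imp (ae_line_neq0 a) => xi xi0.
  have dphase (s : R) : is_derive s 1
      (fun r : R => dot x (xi + r *: basis3 a) + th) (coord3 a x).
    rewrite -[X in is_derive _ _ _ X]addr0.
    by apply: is_deriveD; exact: is_derive_dot_line.
  have dsin (s : R) : is_derive s 1
      (fun r : R => sin (dot x (xi + r *: basis3 a) + th))
      (cos (dot x (xi + s *: basis3 a) + th) * coord3 a x).
    exact: (is_derive1_comp (is_derive_sin _) (dphase s)).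
  have dcos (s : R) : is_derive s 1
      (fun r : R => cos (dot x (xi + r *: basis3 a) + th))
      (- sin (dot x (xi + s *: basis3 a) + th) * coord3 a x).
    exact: (is_derive1_comp (is_derive_cos _) (dphase s)).
  have cont (f : R -> R) (s df : R) : is_derive s 1 f df -> {for s, continuous f}.
    by move=> [/derivable1_diffP d _]; exact: differentiable_continuous d.
  split=> s.
    have [dms _] := dm xi s (xi0 s).
    apply: (is_derive_eq (is_deriveM dms (dsin s))).
    by rewrite /H' /GRing.scale/=; ring.
  have [dms cm'] := dm xi s (xi0 s).
  apply: cvgD; first by apply: cvgM; [exact: cm'|exact: cont (dsin s)].
  apply: cvgM; first exact: cvg_cst.
  by apply: cvgM; [exact: cont dms|exact: cont (dcos s)].
move=> /(_ dH) H'0.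
have : \int[leb3 R]_xi (H' xi) = 0 by rewrite /Rintegral H'0.
rewrite (@RintegralD _ _ _ (leb3 R) setT)// RintegralZl// -/(cosT th m x) => /eqP.
rewrite addrC addr_eq0 => /eqP ->; rewrite /cosT.
rewrite -mulN1r -RintegralZl//; apply: eq_Rintegral => xi _.
by rewrite addrA cosDpihalf mulrN mulN1r.
Qed.

End cosine_transform.

Section decay.
Context {R : realType} (al : R) (al0 : 0 < al).
Implicit Types (xi x : vec3 R) (m : vec3 R -> R) (a : 'I_3).

Lemma symbol_continuous_line a (d : R) m : symbol_class al a d m ->
  forall xi (r : R), 0 < dot (xi + r *: basis3 a) (xi + r *: basis3 a) ->
  {for r, continuous (fun r : R => m (xi + r *: basis3 a))}.
Proof.
move=> /(symbol_derive al0)[m' _ dm] xi r xi0.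
have [/derivable1_diffP dd _] := dm xi r xi0.
exact: differentiable_continuous dd.
Qed.

(** Each derivative along the [a]-th axis gains a factor [coord3 a x] and costs
one degree, which the symbol can afford as long as its degree exceeds -3. *)
Lemma symbol_cosT_decay a (N : nat) : forall (d : R) m, symbol_class al a d m ->
  - 3 < d - N%:R ->
  exists C : R, forall th x, `|coord3 a x| ^+ N * `|cosT th m x| <= C.
Proof.
elim: N => [|N IH] d m sm dN.
  exists (\int[leb3 R]_xi `|m xi|) => th x; rewrite expr0 mul1r.
  by apply: cosT_le; apply: (integrable_symbol al0 _ sm); rewrite subr0 in dN.
have NS : N.+1%:R = N%:R + 1 :> R by rewrite -natr1.
have N0 : 0 <= N%:R :> R by [].
have [m' sm' dm] := symbol_derive al0 sm.
have [C HC] : exists C : R, forall th x, `|coord3 a x| ^+ N * `|cosT th m' x| <= C.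
  by apply: (IH (d - 1)) => //; rewrite NS in dN; lra.
exists C => th x.
rewrite exprSr -mulrA -normrM (@cosT_derive _ a m m')//.
- by apply: (integrable_symbol al0 _ sm); rewrite NS in dN; lra.
- by apply: (integrable_symbol al0 _ sm'); rewrite NS in dN; lra.
- by move=> xi r xi0; split; [exact: dm|exact: symbol_continuous_line sm' _ _ xi0].
Qed.

Lemma heat_symbolE xi : heat_symbol al 1 xi = expR (- (dot xi xi `^ al)).
Proof.
rewrite /heat_symbol mul1r /enorm -(powR12_sqrt (dot_ge0 xi)) -powRrM.
by rewrite mulrA mulVf ?mul1r.
Qed.

Lemma heat_symbol_monomial a :
  heat_symbol al 1 = monomial al a (fun=> 1) 0 0.
Proof.
by apply/funext => xi; rewrite heat_symbolE /monomial powRr0 expr0 !mul1r.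
Qed.

Lemma symbol_monomial1 a (s : R) :
  symbol_class al a (2 * s) (monomial al a (fun=> 1) 0 s).
Proof.
apply: (@symbol_monomial _ _ _ _ _ _ _ 0 1) => //.
  by move=> xi _; rewrite normr1 powRr0 mulr1.
by rewrite mulr0 !add0r.
Qed.

Lemma heat_symbol_class a : symbol_class al a 0 (heat_symbol al 1).
Proof. 
rewrite (heat_symbol_monomial a).
by have := symbol_monomial1 a 0; rewrite mulr0.
Qed.

Lemma integrable_heat_symbol1 :
  (leb3 R).-integrable [set: mvec3 R] (EFin \o heat_symbol al 1).
Proof. by apply: (integrable_symbol al0 _ (heat_symbol_class ord0)); rewrite ltrN10 || lra. Qed.

(** The heat symbol has degree 0, but its first derivative has degree 2 al - 1
instead of -1; hence four derivatives are affordable as soon as al > 1/2. *)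
Lemma heat_symbol_decay a : 1 / 2 < al ->
  exists C : R, forall th x, `|coord3 a x| ^+ 4 * `|cosT th (heat_symbol al 1) x| <= C.
Proof.
move=> al2.
pose m' := fun xi => - 2 * al * monomial al a (fun=> 1) 1 (al - 1) xi.
have sm' : symbol_class al a (2 * al - 1) m'.
  apply: symbol_scale; apply: (@symbol_monomial _ _ _ _ _ _ _ 0 1) => //.
    by move=> xi _; rewrite normr1 powRr0 mulr1.
  by rewrite mulr0 add0r; lra.
have [C HC] := @symbol_cosT_decay a 3 _ _ sm' ltac:(lra).
exists C => th x; rewrite exprSr -mulrA -normrM (@cosT_derive _ a _ m')//.
- exact: integrable_heat_symbol1.
- by apply: (integrable_symbol al0 _ sm'); lra.
- move=> xi r xi0; split; last exact: symbol_continuous_line sm' _ _ xi0.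
  have := @is_derive_monomial R al a (fun=> 1) 0 0 xi r (fun _ _ => erefl) xi0.
  rewrite -heat_symbol_monomial => dm; apply: (is_derive_eq dm).
  by rewrite mul0r mulr0 mul0r !add0r.
Qed.

(** Without the factor i of the derivative, which becomes a quarter turn of the phase
in the cosine transform. *)
Definition oseen_symbol (t : R) (j k l : 'I_3) xi : R :=
  heat_symbol al t xi * leray_symbol j k xi * coord3 l xi.

(** The Leray symbol is homogeneous of degree 0, and the divergence adds one degree. *)
Lemma oseen_symbol_class a j k l : symbol_class al a 1 (oseen_symbol 1 j k l).
Proof.
have s1 := symbol_coord3 l (symbol_monomial1 a 0).
have s3 := symbol_coord3 j (symbol_coord3 k (symbol_coord3 l (symbol_monomial1 a (- 1)))).
rewrite (_ : oseen_symbol 1 j k l = (fun xi =>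
   (j == k)%:R * (coord3 l xi * monomial al a (fun=> 1) 0 0 xi) +
   - 1 * (coord3 j xi * (coord3 k xi * (coord3 l xi *
      monomial al a (fun=> 1) 0 (- 1) xi))))).
  apply: symbol_add; first by apply: symbol_scale; rewrite mulr0 add0r in s1.
  have d1 : 2 * - 1 + 1 + 1 + 1 = 1 :> R by ring.
  by apply: symbol_scale; rewrite d1 in s3.
apply/funext => xi; rewrite /oseen_symbol /leray_symbol heat_symbolE /monomial.
rewrite powRr0 powR_inv1 ?dot_ge0// expr0 /enorm sqr_sqrtr ?dot_ge0//.
by ring.
Qed.

Lemma oseen_symbol_decay a j k l (N : nat) : (N < 4)%N ->
  exists C : R, forall th x,
    `|coord3 a x| ^+ N * `|cosT th (oseen_symbol 1 j k l) x| <= C.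
Proof.
move=> N4; apply: (symbol_cosT_decay (oseen_symbol_class a j k l)).
have : N%:R < 4 :> R by rewrite ltr_nat.
lra.
Qed.

(** A bound by the N-th power of each coordinate separately yields one by a
product of functions of one variable, which is integrated by Tonelli. *)
Lemma prod_decay (N : nat) (f : vec3 R -> R) (C : R) :
  (forall x, `|f x| <= C) -> (forall i x, `|coord3 i x| ^+ N * `|f x| <= C) ->
  forall x, `|f x| <= 2 ^+ N * (2 * C) *
    ((1 + `|x.1.1|) `^ (- (N%:R / 3)) * (1 + `|x.1.2|) `^ (- (N%:R / 3)) *
     (1 + `|x.2|) `^ (- (N%:R / 3))).
Proof.
move=> f0 fN x.
have [i Hi] : exists i : 'I_3, forall j, `|coord3 j x| <= `|coord3 i x|.
  case: (arg_maxP (fun i => `|coord3 i x|) (isT : xpredT (ord0 : 'I_3))) => i _ H.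
  by exists i => j; exact: H.
set M := `|coord3 i x| in Hi.
have M0 : 0 <= M by exact: normr_ge0.
have M1 : 0 < 1 + M by rewrite ltr_pwDl.
have MN : (1 + M) ^+ N <= 2 ^+ N * (1 + M ^+ N).
  have [Mle|Mge] := leP M 1.
    apply: (@le_trans _ _ (2 ^+ N * 1)); last by rewrite ler_wpM2l ?exprn_ge0// lerDl exprn_ge0.
    by rewrite mulr1 lerXn2r ?nnegrE ?(ltW M1)//; lra.
  apply: (@le_trans _ _ (2 ^+ N * M ^+ N)); last by rewrite ler_wpM2l ?exprn_ge0// lerDr.
  by rewrite -exprMn lerXn2r ?nnegrE ?(ltW M1) ?mulr_ge0//; lra.
have key : (1 + M) ^+ N * `|f x| <= 2 ^+ N * (2 * C).
  apply: (le_trans (ler_wpM2r _ MN)) => //; rewrite -mulrA ler_wpM2l ?exprn_ge0//.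
  by rewrite mulrDl mul1r mulrDl mul1r lerD// fN.
have p0 (u : R) : 0 < 1 + `|u| by rewrite ltr_pwDl.
have C0 : 0 <= 2 ^+ N * (2 * C).
  by rewrite mulr_ge0 ?exprn_ge0// mulr_ge0// (le_trans _ (f0 x)).
have wle (u : R) : `|u| <= M ->
    (1 + M) `^ (- (N%:R / 3)) <= (1 + `|u|) `^ (- (N%:R / 3)).
  move=> uM; rewrite !powRN lef_pV2 ?posrE ?powR_gt0//.
  by rewrite ge0_ler_powR ?nnegrE ?divr_ge0 ?(ltW (p0 _)) ?(ltW M1)// lerD2l.
have e11 : `|x.1.1| <= M by exact: (Hi ord0).
have e12 : `|x.1.2| <= M.
  by have := Hi (inord 1); rewrite /coord3 (tnth_nth 0)/= inordK.
have e2 : `|x.2| <= M by exact: (Hi ord_max).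
apply: (@le_trans _ _ (2 ^+ N * (2 * C) * ((1 + M) `^ (- (N%:R / 3)) *
  (1 + M) `^ (- (N%:R / 3)) * (1 + M) `^ (- (N%:R / 3))))); last first.
  rewrite ler_wpM2l// ler_pM ?mulr_ge0 ?powR_ge0 ?wle//.
  by rewrite ler_pM ?powR_ge0 ?wle.
rewrite -!powRD ?(gt_eqF M1) ?implybT//.
rewrite (_ : - (N%:R / 3) - N%:R / 3 - N%:R / 3 = - N%:R); last by field.
by rewrite powR_invn ?(ltW M1)// ler_pdivlMr ?exprn_gt0// mulrC.
Qed.

Lemma integral_prod_decay (C b r : R) (f : vec3 R -> R) : 0 < r -> 1 < b * r ->
  measurable_fun [set: mvec3 R] f ->
  (forall x, `|f x| <= C * ((1 + `|x.1.1|) `^ (- b) * (1 + `|x.1.2|) `^ (- b) *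
     (1 + `|x.2|) `^ (- b))) ->
  (\int[leb3 R]_x (`|f x| `^ r)%:E < +oo)%E.
Proof.
move=> r0 br mf fC.
pose w (u : R) : R := (1 + `|u|) `^ (- (b * r)).
have mw : measurable_fun [set: measurableTypeR R] w.
  apply: (measurableT_comp (measurable_powR _)).
  by apply: measurable_funD => //; exact: normr_measurable.
have w0 u : 0 <= w u by exact: powR_ge0.
have m3 : measurable_fun [set: mvec3 R] (fun x : mvec3 R => w x.1.1 * w x.1.2 * w x.2).
  apply: measurable_funM; first apply: measurable_funM.
  - exact: (measurableT_comp mw measurable_x11).
  - exact: (measurableT_comp mw measurable_x12).
  - exact: (measurableT_comp mw measurable_x2).
have www x : 0 <= w x.1.1 * w x.1.2 * w x.2 by rewrite mulr_ge0// mulr_ge0.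
apply: (@le_lt_trans _ _ (\int[leb3 R]_x ((`|C| `^ r)%:E *
    (w x.1.1 * w x.1.2 * w x.2)%:E))%E).
  apply: ge0_le_integral => //.
  - apply/measurable_EFinP; apply: (measurableT_comp (measurable_powR _)).
    exact: measurableT_comp.
  - by apply: emeasurable_funM => //; exact/measurable_EFinP.
  move=> x _; rewrite -EFinM lee_fin.
  have b0 (u : R) : 0 <= (1 + `|u|) `^ (- b) by exact: powR_ge0.
  have bbb : 0 <= (1 + `|x.1.1|) `^ (- b) * (1 + `|x.1.2|) `^ (- b) * (1 + `|x.2|) `^ (- b).
    by rewrite mulr_ge0// mulr_ge0.
  have wE u : w u = ((1 + `|u|) `^ (- b)) `^ r by rewrite -powRrM mulNr.
  have -> : `|C| `^ r * (w x.1.1 * w x.1.2 * w x.2) = (`|C| *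
      ((1 + `|x.1.1|) `^ (- b) * (1 + `|x.1.2|) `^ (- b) * (1 + `|x.2|) `^ (- b))) `^ r.
    rewrite (powRM _ (normr_ge0 C) bbb) (powRM _ (mulr_ge0 (b0 _) (b0 _)) (b0 _)).
    by rewrite (powRM _ (b0 _) (b0 _)) -!wE.
  rewrite ge0_ler_powR ?nnegrE ?(ltW r0) ?mulr_ge0//.
  by rewrite (le_trans (fC x))// ler_wpM2r// ler_norm.
rewrite ge0_integralZl_EFin ?powR_ge0//; last 2 first.
- by move=> x _; rewrite lee_fin.
- exact/measurable_EFinP.
rewrite lte_mul_pinfty ?lee_fin ?powR_ge0// integral_prod3//.
have Ioo := @integral_decay_weight R (b * r) br.
have I0 : (0 <= \int[leb1 R]_u (w u)%:E)%E.
  by apply: integral_ge0 => u _; rewrite lee_fin.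
have Ifin : (\int[leb1 R]_u (w u)%:E)%E \is a fin_num by rewrite ge0_fin_numE.
by rewrite -(fineK Ifin) -!EFinM ltry.
Qed.

End decay.

(** * Size of the heat and Oseen kernels *)

Section kernel_estimates.
Context {R : realType} (al : R) (al2 : 1 / 2 < al).
Implicit Types (xi x : vec3 R) (t : R) (j k l : 'I_3).

Let al0 : 0 < al. Proof. by rewrite (lt_trans _ al2)// divr_gt0. Qed.

Lemma heat_kernelE t x :
  heat_kernel al t x = (2 * pi) ^- 3 * cosT 0 (heat_symbol al t) x.
Proof.
rewrite /heat_kernel /inverse_fourier /= mul0r subr0; congr (_ * _).
by apply: eq_Rintegral => xi _; rewrite mulr0 subr0 addr0 mulrC.
Qed.

Lemma oseen_kernelE t j k l x :
  oseen_kernel al t j k l x =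
  (2 * pi) ^- 3 * cosT (pi / 2) (oseen_symbol al t j k l) x.
Proof.
rewrite /oseen_kernel /inverse_fourier /= [X in _ - X]mul0r subr0.
congr (_ * _).
apply: eq_Rintegral => xi _; rewrite cosDpihalf /oseen_symbol.
by ring.
Qed.

Lemma coord3_scale (c : R) i xi : coord3 i (affine3 c 0 xi) = c * coord3 i xi.
Proof. by case: i => [[|[|[|//]]] ?]; rewrite /coord3 !(tnth_nth 0)/= addr0. Qed.

Lemma dot_scale (c : R) x xi : dot x (affine3 c 0 xi) = dot (affine3 c 0 x) xi.
Proof.
by apply: eq_bigr => i _; rewrite !coord3_scale mulrCA mulrA.
Qed.

Lemma enorm_scale (c : R) xi : 0 <= c -> enorm (affine3 c 0 xi) = c * enorm xi.
Proof.
move=> c0; rewrite /enorm.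
have -> : dot (affine3 c 0 xi) (affine3 c 0 xi) = c ^+ 2 * dot xi xi.
  rewrite /dot mulr_sumr; apply: eq_bigr => i _.
  by rewrite !coord3_scale; ring.
by rewrite sqrtrM ?sqr_ge0// sqrtr_sqr ger0_norm.
Qed.

(** The inverse of the length t^(1/(2 al)) that scaling attaches to the time [t]:
both kernels at time [t] are dilations of those at time 1. *)
Definition inv_length t : R := t `^ (- (2 * al)^-1).

Lemma inv_length_gt0 t : 0 < t -> 0 < inv_length t.
Proof. exact: powR_gt0. Qed.

Lemma inv_length_pow t : 0 < t -> t * inv_length t `^ (2 * al) = 1.
Proof.
move=> t0; rewrite /inv_length -powRrM mulNr mulVf ?gt_eqF ?mulr_gt0//.
by rewrite powR_inv1 ?(ltW t0)// mulfV ?gt_eqF.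
Qed.

Lemma heat_symbol_scale t xi : 0 < t ->
  heat_symbol al t (affine3 (inv_length t) 0 xi) = heat_symbol al 1 xi.
Proof.
move=> t0; have l0 := inv_length_gt0 t0.
rewrite /heat_symbol (enorm_scale _ (ltW l0)).
by rewrite (powRM _ (ltW l0) (sqrtr_ge0 _)) mulrA (inv_length_pow t0).
Qed.

Lemma oseen_symbol_scale t j k l xi : 0 < t ->
  oseen_symbol al t j k l (affine3 (inv_length t) 0 xi) =
  inv_length t * oseen_symbol al 1 j k l xi.
Proof.
move=> t0; have l0 := inv_length_gt0 t0.
rewrite /oseen_symbol heat_symbol_scale// /leray_symbol !coord3_scale.
rewrite enorm_scale ?(ltW l0)//.
have [E0|E0] := eqVneq (enorm xi) 0.
  have c0 i : coord3 i xi = 0.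
    apply/eqP; rewrite -sqrf_eq0 eq_le sqr_ge0 andbT (le_trans (coord3_sqr_le i xi))//.
    by move/eqP : E0; rewrite sqrtr_eq0.
  by rewrite !c0 !mulr0.
have -> : inv_length t * coord3 j xi * (inv_length t * coord3 k xi) /
    (inv_length t * enorm xi) ^+ 2 = coord3 j xi * coord3 k xi / enorm xi ^+ 2.
  by field; rewrite E0 gt_eqF.
ring.
Qed.

Lemma measurable_enorm : measurable_fun [set: mvec3 R] (enorm : mvec3 R -> R).
Proof.
rewrite (_ : enorm = (fun xi : mvec3 R => dot xi xi `^ 2^-1)).
  exact: measurable_sqdot_powR.
by apply/funext => xi; rewrite powR12_sqrt// dot_ge0.
Qed.

Lemma measurable_heat_symbol :
  measurable_fun [set: measurableTypeR R * mvec3 R]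
    (fun z : measurableTypeR R * mvec3 R => heat_symbol al z.1 z.2).
Proof.
apply: (measurableT_comp (continuous_measurable_fun (@continuous_expR R))).
apply: measurableT_comp => //; apply: measurable_funM; first exact: measurable_fst.
apply: (measurableT_comp (measurable_powR _)).
exact: (measurableT_comp measurable_enorm measurable_snd).
Qed.

Lemma measurable_oseen_symbol j k l :
  measurable_fun [set: measurableTypeR R * mvec3 R]
    (fun z : measurableTypeR R * mvec3 R => oseen_symbol al z.1 j k l z.2).
Proof.
apply: measurable_funM; last exact: (measurableT_comp (measurable_coord3 l) measurable_snd).
apply: measurable_funM; first exact: measurable_heat_symbol.
apply: measurable_funB => //; apply: measurable_funM.
  apply: measurable_funM; first exact: (measurableT_comp (measurable_coord3 j) measurable_snd).
  exact: (measurableT_comp (measurable_coord3 k) measurable_snd).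
rewrite (_ : (fun z => _) = (fun z : measurableTypeR R * mvec3 R => dot z.2 z.2 `^ (- 1))).
  exact: (measurableT_comp (measurable_sqdot_powR _) measurable_snd).
by apply/funext => z; rewrite powR_inv1 ?dot_ge0// /enorm sqr_sqrtr ?dot_ge0.
Qed.

Lemma measurable_cosT (th : R) (m : R -> vec3 R -> R) :
  measurable_fun [set: measurableTypeR R * mvec3 R]
    (fun z : measurableTypeR R * mvec3 R => m z.1 z.2) ->
  measurable_fun [set: measurableTypeR R * mvec3 R]
    (fun z : measurableTypeR R * mvec3 R => cosT th (m z.1) z.2).
Proof.
move=> mm.
pose F (w : (measurableTypeR R * mvec3 R) * mvec3 R) : R :=
  m w.1.1 w.2 * cos (dot w.1.2 w.2 + th).
apply: (@measurable_fun_Rintegral _ _ _ _ _ (leb3 R) F).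
apply: measurable_funM.
  have mp : measurable_fun [set: (measurableTypeR R * mvec3 R) * mvec3 R]
      (fun w : (measurableTypeR R * mvec3 R) * mvec3 R =>
         (w.1.1, w.2) : measurableTypeR R * mvec3 R).
    apply: measurable_fun_pair; last exact: measurable_snd.
    exact: (measurableT_comp measurable_fst measurable_fst).
  exact: (measurableT_comp mm mp).
apply: (measurableT_comp (continuous_measurable_fun (@continuous_cos R))).
apply: measurable_funD => //; apply: measurable_dot => //.
exact: (measurableT_comp measurable_snd measurable_fst).
Qed.

Lemma measurable_heat_kernel :
  measurable_fun [set: measurableTypeR R * mvec3 R]
    (fun z : measurableTypeR R * mvec3 R => heat_kernel al z.1 z.2).
Proof.
rewrite (_ : (fun z => _) = (fun z : measurableTypeR R * mvec3 R =>
  (2 * pi) ^- 3 * cosT 0 (heat_symbol al z.1) z.2)); last first.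
  by apply/funext => z; rewrite heat_kernelE.
by apply: measurable_funM => //; apply: measurable_cosT; exact: measurable_heat_symbol.
Qed.

Lemma measurable_oseen_kernel j k l :
  measurable_fun [set: measurableTypeR R * mvec3 R]
    (fun z : measurableTypeR R * mvec3 R => oseen_kernel al z.1 j k l z.2).
Proof.
rewrite (_ : (fun z => _) = (fun z : measurableTypeR R * mvec3 R =>
  (2 * pi) ^- 3 * cosT (pi / 2) (oseen_symbol al z.1 j k l) z.2)); last first.
  by apply/funext => z; rewrite oseen_kernelE.
apply: measurable_funM => //.
apply: (@measurable_cosT _ (fun t => oseen_symbol al t j k l)).
exact: measurable_oseen_symbol.
Qed.

(** The Fourier transform turns a dilation into the inverse dilation. *)
Lemma cosT_scale (th c e : R) (m m1 : vec3 R -> R) x : 0 < c ->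
  measurable_fun [set: mvec3 R] m ->
  (forall xi, m (affine3 c 0 xi) = e * m1 xi) ->
  (leb3 R).-integrable [set: mvec3 R] (EFin \o m1) ->
  cosT th m x = c ^+ 3 * e * cosT th m1 (affine3 c 0 x).
Proof.
move=> c0 mm mE im1.
rewrite {1}/cosT (@Rintegral_affine3 _ c 0) ?gt_eqF//; last first.
  by apply: measurable_funM => //; exact: measurable_cos_dot.
rewrite gtr0_norm// -mulrA; congr (_ * _); rewrite /cosT -RintegralZl//.
  by apply: eq_Rintegral => xi _; rewrite mE dot_scale mulrA.
apply: integrable_mulr_le1 => //; first exact: measurable_cos_dot.
by move=> z; exact: cos_norm_le1.
Qed.

Lemma measurable_at2 t (f : R -> vec3 R -> R) :
  measurable_fun [set: measurableTypeR R * mvec3 R]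
    (fun z : measurableTypeR R * mvec3 R => f z.1 z.2) ->
  measurable_fun [set: mvec3 R] (f t).
Proof. by move=> mf; exact: (measurableT_comp mf (measurable_pair1 t)). Qed.

Lemma heat_kernel_scale t x : 0 < t ->
  heat_kernel al t x =
  inv_length t ^+ 3 * heat_kernel al 1 (affine3 (inv_length t) 0 x).
Proof.
move=> t0; rewrite !heat_kernelE.
rewrite (@cosT_scale 0 (inv_length t) 1 _ (heat_symbol al 1)).
- by rewrite mulr1 mulrCA.
- exact: inv_length_gt0.
- exact: (measurable_at2 t measurable_heat_symbol).
- by move=> xi; rewrite mul1r heat_symbol_scale.
- exact: integrable_heat_symbol1.
Qed.

Lemma oseen_kernel_scale t j k l x : 0 < t ->
  oseen_kernel al t j k l x =
  inv_length t ^+ 4 * oseen_kernel al 1 j k l (affine3 (inv_length t) 0 x).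
Proof.
move=> t0; rewrite !oseen_kernelE.
rewrite (@cosT_scale (pi / 2) (inv_length t) (inv_length t) _ (oseen_symbol al 1 j k l)).
- by rewrite -exprSr mulrCA.
- exact: inv_length_gt0.
- exact: (@measurable_at2 t (fun t => oseen_symbol al t j k l) (measurable_oseen_symbol j k l)).
- by move=> xi; rewrite oseen_symbol_scale.
- by apply: (integrable_symbol al0 _ (oseen_symbol_class al ord0 j k l)); lra.
Qed.

Lemma kernel_constant_ge0 : 0 <= (2 * pi : R) ^- 3.
Proof. by rewrite invr_ge0 exprn_ge0// mulr_ge0// pi_ge0. Qed.

Lemma forall3_bound (P : 'I_3 -> R -> Prop) :
  (forall i C C', P i C -> C <= C' -> P i C') ->
  (forall i, exists C, P i C) -> exists C, forall i, P i C.
Proof.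
move=> mon /choice[C HC]; exists (\big[Order.max/C ord0]_i C i) => i.
by apply: mon (HC i) _; exact: le_bigmax.
Qed.

Lemma cosT_prod_decay (N : nat) (th c : R) (m : vec3 R -> R) :
  0 <= c ->
  (leb3 R).-integrable [set: mvec3 R] (EFin \o m) ->
  (forall i, exists C : R, forall th x, `|coord3 i x| ^+ N * `|cosT th m x| <= C) ->
  exists2 C : R, 0 <= C & forall x, `|c * cosT th m x| <=
    C * ((1 + `|x.1.1|) `^ (- (N%:R / 3)) * (1 + `|x.1.2|) `^ (- (N%:R / 3)) *
         (1 + `|x.2|) `^ (- (N%:R / 3))).
Proof.
move=> c0 im dec.
have [C1 H1] : exists C, forall i : 'I_3, forall x, `|coord3 i x| ^+ N * `|cosT th m x| <= C.
  apply: forall3_bound => [i C C' H CC' x|i]; first exact: le_trans (H x) CC'.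
  by have [C HC] := dec i; exists C.
set C0 := \int[leb3 R]_xi `|m xi|.
pose C := Order.max C0 C1.
have h0 x : `|cosT th m x| <= C by rewrite le_max cosT_le.
have h1 i x : `|coord3 i x| ^+ N * `|cosT th m x| <= C by rewrite le_max H1 orbT.
have C00 : 0 <= C by rewrite (le_trans _ (h0 0)).
exists (c * (2 ^+ N * (2 * C))) => [|x]; first by rewrite !mulr_ge0// exprn_ge0.
rewrite normrM ger0_norm// -[leRHS]mulrA ler_wpM2l//.
exact: prod_decay.
Qed.

(** Decay like |x|^(-4) makes the kernel integrable at time 1; by scaling its norm does
not depend on the time. *)
Lemma heat_kernel_L1 : exists2 C : R, 0 <= C & forall t, 0 < t ->
  (\int[leb3 R]_x (`|heat_kernel al t x|)%:E <= C%:E)%E.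
Proof.
have [C C0 HC] := @cosT_prod_decay 4 0 _ _ kernel_constant_ge0
  (integrable_heat_symbol1 al0) (fun i => heat_symbol_decay al0 i al2).
have m1 := measurable_at2 1 measurable_heat_kernel.
have b1 : 1 < 4 / 3 * 1 :> R by lra.
have fin1 : (\int[leb3 R]_x (`|heat_kernel al 1 x|)%:E < +oo)%E.
  have := @integral_prod_decay R C (4%:R / 3) 1 (heat_kernel al 1) ltr01 b1 m1.
  under eq_integral do rewrite powRr1//.
  by apply => x; rewrite heat_kernelE.
have int0 : (0 <= \int[leb3 R]_x (`|heat_kernel al 1 x|)%:E)%E.
  by apply: integral_ge0 => x _; rewrite lee_fin.
have Ifin : (\int[leb3 R]_x (`|heat_kernel al 1 x|)%:E)%E \is a fin_num.
  by rewrite ge0_fin_numE.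
exists (fine (\int[leb3 R]_x (`|heat_kernel al 1 x|)%:E)); first exact: fine_ge0.
move=> t t0; rewrite (fineK Ifin).
have l0 := inv_length_gt0 t0.
rewrite [leRHS](@ge0_integral_affine3 _ (inv_length t) 0) ?gt_eqF//; last first.
  by apply/measurable_EFinP; exact: measurableT_comp.
rewrite gtr0_norm// -ge0_integralZl_EFin ?exprn_ge0 ?(ltW l0)//; last first.
  apply/measurable_EFinP; apply: measurableT_comp; first exact: normr_measurable.
  exact: (measurableT_comp m1 (measurable_affine3 _ _)).
rewrite le_eqVlt; apply/orP; left; apply/eqP; apply: eq_integral => x _.
by rewrite heat_kernel_scale// normrM ger0_norm ?exprn_ge0 ?(ltW l0)// EFinM.
Qed.

(** One function dominating all the components of the Oseen kernel, which reduces the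
estimates to scalar ones. *)
Definition oseen_size t x : R := \sum_j \sum_k \sum_l `|oseen_kernel al t j k l x|.

Lemma oseen_size_ge0 t x : 0 <= oseen_size t x.
Proof.
by apply: sumr_ge0 => j _; apply: sumr_ge0 => k _; apply: sumr_ge0.
Qed.

Lemma measurable_oseen_size :
  measurable_fun [set: measurableTypeR R * mvec3 R]
    (fun z : measurableTypeR R * mvec3 R => oseen_size z.1 z.2).
Proof.
apply: measurable_sum => j; apply: measurable_sum => k; apply: measurable_sum => l.
by apply: measurableT_comp => //; exact: measurable_oseen_kernel.
Qed.

Lemma oseen_size_scale t x : 0 < t ->
  oseen_size t x = inv_length t ^+ 4 * oseen_size 1 (affine3 (inv_length t) 0 x).
Proof.
move=> t0; rewrite /oseen_size mulr_sumr; apply: eq_bigr => j _.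
rewrite mulr_sumr; apply: eq_bigr => k _; rewrite mulr_sumr; apply: eq_bigr => l _.
by rewrite oseen_kernel_scale// normrM ger0_norm// exprn_ge0// ltW// inv_length_gt0.
Qed.

(** Symbols of degree 1 allow three derivatives, so that the Oseen kernel decays like
|x|^(-3): not enough for integrability, but enough for every exponent r > 1.  The
power of t then follows from scaling. *)
Lemma oseen_size_Lr (r : R) : 1 < r -> exists2 C : R, 0 <= C & forall t, 0 < t ->
  (\int[leb3 R]_x ((oseen_size t x) `^ r)%:E <=
   ((C * inv_length t `^ (4 - 3 / r)) `^ r)%:E)%E.
Proof.
move=> r1; have r0 : 0 < r by rewrite (lt_trans ltr01).
pose W x : R := (1 + `|x.1.1|) `^ (- (3%:R / 3)) * (1 + `|x.1.2|) `^ (- (3%:R / 3)) *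
         (1 + `|x.2|) `^ (- (3%:R / 3)).
have : forall jkl : 'I_3 * 'I_3 * 'I_3, exists C : R, forall x,
    `|oseen_kernel al 1 jkl.1.1 jkl.1.2 jkl.2 x| <= C * W x.
  move=> [[j k] l] /=.
  have iM : (leb3 R).-integrable [set: mvec3 R] (EFin \o oseen_symbol al 1 j k l).
    by apply: (integrable_symbol al0 _ (oseen_symbol_class al ord0 j k l)); lra.
  have [C C0 HC] := @cosT_prod_decay 3 (pi / 2) _ _ kernel_constant_ge0 iM
    (fun i => oseen_symbol_decay al0 i j k l (isT : (3 < 4)%N)).
  by exists C => x; rewrite oseen_kernelE; exact: HC.
move=> /choice[C HC].
have sizeW x : `|oseen_size 1 x| <= (\sum_j \sum_k \sum_l C (j, k, l)) * W x.
  rewrite ger0_norm ?oseen_size_ge0// mulr_suml; apply: ler_sum => j _.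
  rewrite mulr_suml; apply: ler_sum => k _; rewrite mulr_suml; apply: ler_sum => l _.
  exact: (HC (j, k, l)).
have m1 := measurable_at2 1 measurable_oseen_size.
have b1 : 1 < 3%:R / 3 * r by rewrite divff// mul1r.
have fin1 : (\int[leb3 R]_x ((oseen_size 1 x) `^ r)%:E < +oo)%E.
  have := integral_prod_decay r0 b1 m1 sizeW.
  by under eq_integral do rewrite ger0_norm ?oseen_size_ge0//.
have mr : measurable_fun [set: mvec3 R] (fun x => (oseen_size 1 x) `^ r).
  exact: (measurableT_comp (measurable_powR r) m1).
have int0 : (0 <= \int[leb3 R]_x ((oseen_size 1 x) `^ r)%:E)%E.
  by apply: integral_ge0 => x _; rewrite lee_fin powR_ge0.
pose I1 := fine (\int[leb3 R]_x ((oseen_size 1 x) `^ r)%:E).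
have I10 : 0 <= I1 by exact: fine_ge0.
exists (I1 `^ r^-1); first exact: powR_ge0.
move=> t t0; have l0 := inv_length_gt0 t0.
rewrite powRM ?powR_ge0// -(powRrM I1) mulVf ?gt_eqF// powRr1//.
rewrite -(powRrM (inv_length t)).
have -> : (4 - 3 / r) * r = 4 * r - 3 by field; rewrite gt_eqF.
under eq_integral.
  move=> x _; rewrite oseen_size_scale// powRM ?exprn_ge0 ?(ltW l0) ?oseen_size_ge0//.
  rewrite -powR_mulrn ?(ltW l0)// -powRrM EFinM.
  over.
rewrite ge0_integralZl_EFin ?powR_ge0//; last 2 first.
- by move=> x _; rewrite lee_fin powR_ge0.
- apply/measurable_EFinP; exact: (measurableT_comp mr (measurable_affine3 _ _)).
have Ifin : (\int[leb3 R]_x ((oseen_size 1 x) `^ r)%:E)%E \is a fin_num.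
  by rewrite ge0_fin_numE.
rewrite EFinM (fineK Ifin).
rewrite [X in (_ <= X * _)%E](@ge0_integral_affine3 _ (inv_length t) 0) ?gt_eqF//; last 2 first.
- exact/measurable_EFinP.
- by move=> x; rewrite lee_fin powR_ge0.
rewrite gtr0_norm// [leRHS]muleC muleA -EFinM.
rewrite -powR_mulrn ?(ltW l0)// -powRD; last by rewrite (gt_eqF l0) implybT.
by rewrite subrK.
Qed.

End kernel_estimates.

(** * Convolution inequalities *)

Section young.
Context {R : realType}.
Local Open Scope ereal_scope.

Lemma Lnorm_scale d (T : measurableType d) (mu : {measure set T -> \bar R})
    (c : \bar R) (r : R) (f : T -> \bar R) : 0 <= c -> (0 < r)%R ->
  measurable_fun [set: T] f -> (forall x, 0 <= f x) ->
  'N[mu]_r%:E[(fun x => c * f x)] = c * 'N[mu]_r%:E[f].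
Proof.
move=> c0 r0 mf f0; rewrite !ge0_Lnorm//; last first.
  by move=> x; rewrite mule_ge0.
under eq_integral do rewrite poweRM//.
rewrite ge0_integralZl//; last 3 first.
- exact: emeasurable_poweR.
- by move=> x _; exact: poweR_ge0.
- exact: poweR_ge0.
rewrite poweRM ?poweR_ge0//; last first.
  by apply: integral_ge0 => x _; exact: poweR_ge0.
by rewrite -poweRrM mulfV ?gt_eqF// poweRe1.
Qed.

(** Some positive integrable function, as Minkowski's integral inequality asks for. *)
Definition positive_weight (x : vec3 R) : R :=
  (1 + `|x.1.1|) `^ (- 2) * (1 + `|x.1.2|) `^ (- 2) * (1 + `|x.2|) `^ (- 2).

Let mw1 : measurable_fun [set: measurableTypeR R]
  (fun u : R => ((1 + `|u|) `^ (- 2))%R).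
Proof.
apply: (measurableT_comp (measurable_powR _)).
by apply: measurable_funD => //; exact: normr_measurable.
Qed.

Let w1_gt0 (u : R) : (0 < (1 + `|u|) `^ (- 2))%R.
Proof. by rewrite powR_gt0// ltr_pwDl. Qed.

Let w1_fin : (\int[leb1 R]_u ((1 + `|u|) `^ (- 2))%:E < +oo)%E.
Proof. by apply: integral_decay_weight; rewrite ltr1n. Qed.

Lemma measurable_positive_weight : measurable_fun [set: mvec3 R] positive_weight.
Proof.
apply: measurable_funM; first apply: measurable_funM.
- exact: (measurableT_comp mw1 measurable_x11).
- exact: (measurableT_comp mw1 measurable_x12).
- exact: (measurableT_comp mw1 measurable_x2).
Qed.

Lemma positive_weight_gt0 (x : vec3 R) : (0 < positive_weight x)%R.
Proof. by rewrite !mulr_gt0. Qed.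

Lemma integral_positive_weight : \int[leb3 R]_x (positive_weight x)%:E < +oo.
Proof.
rewrite (@integral_prod3 _ (fun u => ((1 + `|u|) `^ (- 2))%R))//.
have I0 : 0 <= \int[leb1 R]_u ((1 + `|u|) `^ (- 2))%:E.
  by apply: integral_ge0 => u _; rewrite lee_fin ltW.
have Ifin : \int[leb1 R]_u ((1 + `|u|) `^ (- 2))%:E \is a fin_num.
  by rewrite ge0_fin_numE.
by rewrite -(fineK Ifin) -!EFinM ltry.
Qed.

(** Integrating over [D] amounts to integrating over the line the product with
the indicator of [D], so that one weight serves for all intervals. *)
Lemma minkowski_time (D : set (measurableTypeR R)) (r : R)
    (G : measurableTypeR R * mvec3 R -> \bar R) : measurable D -> (1 < r)%R ->
  measurable_fun [set: measurableTypeR R * mvec3 R] G -> (forall z, 0 <= G z) ->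
  'N[leb3 R]_r%:E[(fun x => \int[leb1 R]_(s in D) G (s, x))] <=
  \int[leb1 R]_(s in D) 'N[leb3 R]_r%:E[(fun x => G (s, x))].
Proof.
move=> mD r1 mG G0; have r0 : (0 < r)%R by exact: lt_trans r1.
pose H (z : measurableTypeR R * mvec3 R) := (\1_D z.1)%:E * G z.
have mH : measurable_fun [set: measurableTypeR R * mvec3 R] H.
  apply: emeasurable_funM => //; apply/measurable_EFinP.
  exact: (measurableT_comp (measurable_indic mD) measurable_fst).
have H0 z : 0 <= H z by rewrite mule_ge0// lee_fin.
have M : 'N[leb3 R]_r%:E[(fun x => \int[leb1 R]_s H (s, x))] <=
         \int[leb1 R]_s 'N[leb3 R]_r%:E[(fun x => H (s, x))].
  exact: (@minkowski_integral _ _ _ _ R (leb1 R) (leb3 R) H mH H0 r _ r1 mw1 (fun u => w1_gt0 u) w1_fin).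
rewrite [leRHS]integral_eindicM.
rewrite (_ : (fun x => _) = (fun x => \int[leb1 R]_s H (s, x))); last first.
  by apply/funext => x; rewrite integral_eindicM.
apply: (le_trans M).
rewrite le_eqVlt; apply/orP; left; apply/eqP; apply: eq_integral => s _.
apply: (@Lnorm_scale _ _ (leb3 R) (\1_D s)%:E r (fun x => G (s, x))) => //.
exact: measurable_section_x.
Qed.

(** Young's inequality, as Minkowski's inequality for the average of the translates of
[w] with weight [k]. *)
Lemma young_L1 (r : R) (k w : vec3 R -> R) : (1 < r)%R ->
  measurable_fun [set: mvec3 R] k -> measurable_fun [set: mvec3 R] w ->
  (forall x, (0 <= k x)%R) -> (forall x, (0 <= w x)%R) ->
  'N[leb3 R]_r%:E[(fun x => \int[leb3 R]_y (k (x - y)%R * w y)%:E)] <=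
  \int[leb3 R]_x (k x)%:E * 'N[leb3 R]_r%:E[(fun x => (w x)%:E)].
Proof.
move=> r1 mk mw k0 w0; have r0 : (0 < r)%R by exact: lt_trans r1.
pose G (z : mvec3 R * mvec3 R) : \bar R := (k z.1 * w ((z.2 : vec3 R) - z.1)%R)%:E.
have msub : measurable_fun [set: mvec3 R * mvec3 R]
    (fun z : mvec3 R * mvec3 R => (z.2 : vec3 R) - z.1 : mvec3 R)%R.
  apply: (measurableT_comp (@measurable_sub3 R) (g := fun z : mvec3 R * mvec3 R => (z.2, z.1))).
  by apply: measurable_fun_pair; [exact: measurable_snd|exact: measurable_fst].
have mG : measurable_fun [set: mvec3 R * mvec3 R] G.
  apply/measurable_EFinP; apply: measurable_funM.
    exact: (measurableT_comp mk measurable_fst).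
  exact: (measurableT_comp mw msub).
have G0 z : 0 <= G z by rewrite lee_fin mulr_ge0.
have mk' (a : vec3 R) : measurable_fun [set: mvec3 R] (fun x : mvec3 R => k (a - (x : vec3 R))%R).
  exact: (measurableT_comp mk (measurable_reflect3 a)).
have -> : (fun x => \int[leb3 R]_y (k (x - y)%R * w y)%:E) =
          (fun x => \int[leb3 R]_z G (z, x)).
  apply/funext => x.
  rewrite -[RHS](@integral_reflect3 R x (fun z => G (z, x))); last first.
    exact: (measurable_section_s mG).
  by apply: eq_integral => y _; rewrite /G/= opprB addrCA subrr addr0.
have M : 'N[leb3 R]_r%:E[(fun x => \int[leb3 R]_z G (z, x))] <=
         \int[leb3 R]_z 'N[leb3 R]_r%:E[(fun x => G (z, x))].
  exact: (@minkowski_integral _ _ _ _ R (leb3 R) (leb3 R) G mG G0 r _ r1 measurable_positive_weight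
    positive_weight_gt0 integral_positive_weight).
apply: (le_trans M).
have N0 : 0 <= 'N[leb3 R]_r%:E[(fun x => (w x)%:E)] by exact: Lnorm_ge0.
rewrite -ge0_integralZr//; last 2 first.
- exact/measurable_EFinP.
- by move=> x _; rewrite lee_fin.
rewrite le_eqVlt; apply/orP; left; apply/eqP; apply: eq_integral => z _.
rewrite -/(leb3 R).
under [X in Lnorm _ _ X]eq_fun do rewrite /G /= EFinM.
have mwz : measurable_fun [set: mvec3 R] (fun x : mvec3 R => (w ((x : vec3 R) - z)%R)%:E).
  apply/measurable_EFinP; exact: (measurableT_comp mw (measurable_translate3 (- z)%R)).
rewrite Lnorm_scale ?lee_fin//; last by move=> x; rewrite lee_fin.
congr (_ * _); rewrite !ge0_Lnorm; last 2 first.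
- by move=> x; rewrite lee_fin.
- by move=> x; rewrite lee_fin.
apply: (f_equal (fun u : \bar R => u `^ r^-1)).
apply: (@integral_translate3 R (- z)%R (fun x => (w x)%:E `^ r)).
by apply: emeasurable_poweR; exact/measurable_EFinP.
Qed.

Lemma Lnorm_pow_conj (q : R) (a : vec3 R -> R) : (2 < q)%R ->
  (forall x, (0 <= a x)%R) ->
  'N[leb3 R]_(q - 1)%:E[(fun x => (a x `^ (q / (q - 1)))%:E)] =
  'N[leb3 R]_q%:E[(fun x => (a x)%:E)] `^ (q / (q - 1)).
Proof.
move=> q2 a0; have q1 : (0 < q - 1)%R by rewrite subr_gt0 (lt_trans _ q2)// ltr1n.
have q0 : (0 < q)%R by rewrite (lt_trans _ q2).
rewrite !ge0_Lnorm; last first.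
- by move=> x; rewrite lee_fin.
- by move=> x; rewrite lee_fin powR_ge0.
rewrite -poweRrM mulrA mulVf ?gt_eqF// mul1r.
apply: (f_equal (fun u : \bar R => u `^ (q - 1)^-1)).
by apply: eq_integral => x _; rewrite !poweR_EFin -powRrM divfK ?gt_eqF.
Qed.

(** The kernel is measured in the exponent q / (q - 1) conjugate to [q].  Hoelder's
inequality takes the factor [b] out, and what remains is the power (q - 1)/q of a
convolution of L^1 with L^(q-1). *)
Lemma young_bilinear (q c : R) (k a b : vec3 R -> R) : (2 < q)%R -> (0 <= c)%R ->
  measurable_fun [set: mvec3 R] k -> measurable_fun [set: mvec3 R] a ->
  measurable_fun [set: mvec3 R] b ->
  (forall x, (0 <= k x)%R) -> (forall x, (0 <= a x)%R) -> (forall x, (0 <= b x)%R) ->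
  \int[leb3 R]_x (k x `^ (q / (q - 1)))%:E <= (c `^ (q / (q - 1)))%:E ->
  'N[leb3 R]_q%:E[(fun x => \int[leb3 R]_y (k (x - y)%R * (a y * b y))%:E)] <=
  c%:E * ('N[leb3 R]_q%:E[(fun x => (a x)%:E)] * 'N[leb3 R]_q%:E[(fun x => (b x)%:E)]).
Proof.
move=> q2 c0 mk ma mb k0 a0 b0 kc.
have q11 : (1 < q - 1)%R by rewrite ltrBrDr.
have q1 : (0 < q - 1)%R by rewrite (lt_trans ltr01).
have q0 : (0 < q)%R by rewrite (lt_trans _ q2).
set r := (q / (q - 1))%R in kc *.
have r0 : (0 < r)%R by rewrite divr_gt0.
have rq : (r^-1 + q^-1 = 1)%R by rewrite /r invf_div; field; rewrite gt_eqF.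
set Na := 'N[leb3 R]_q%:E[(fun x => (a x)%:E)].
set Nb := 'N[leb3 R]_q%:E[(fun x => (b x)%:E)].
have Na0 : 0 <= Na by exact: Lnorm_ge0.
have Nb0 : 0 <= Nb by exact: Lnorm_ge0.
have mkr : measurable_fun [set: mvec3 R] (fun x => k x `^ r)%R.
  exact: (measurableT_comp (measurable_powR r) mk).
have mar : measurable_fun [set: mvec3 R] (fun x => a x `^ r)%R.
  exact: (measurableT_comp (measurable_powR r) ma).
have mk' (x : vec3 R) : measurable_fun [set: mvec3 R] (fun y : mvec3 R => k (x - (y : vec3 R))%R).
  exact: (measurableT_comp mk (measurable_reflect3 x)).
pose W (x : vec3 R) := \int[leb3 R]_y (k (x - y)%R `^ r * a y `^ r)%:E.
have W0 x : 0 <= W x by apply: integral_ge0 => y _; rewrite lee_fin mulr_ge0 ?powR_ge0.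
have msub := @measurable_sub3 R.
have m2 (k' w' : vec3 R -> R) : measurable_fun [set: mvec3 R] k' ->
    measurable_fun [set: mvec3 R] w' -> (forall x, 0 <= k' x)%R ->
    (forall x, 0 <= w' x)%R -> measurable_fun [set: mvec3 R]
      (fun x : mvec3 R => \int[leb3 R]_y (k' ((x : vec3 R) - y)%R * w' y)%:E).
  move=> mk1 mw1' k10 w10.
  apply: (@measurable_fun_fubini_tonelli_F _ _ _ _ _ (leb3 R)
    (fun z : mvec3 R * mvec3 R => (k' ((z.1 : vec3 R) - z.2)%R * w' z.2)%:E)).
    apply/measurable_EFinP; apply: measurable_funM.
      exact: (measurableT_comp mk1 msub).
    exact: (measurableT_comp mw1' measurable_snd).
  by move=> z; rewrite lee_fin mulr_ge0.
have mW : measurable_fun [set: mvec3 R] W.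
  by apply: (m2 (fun x => k x `^ r)%R (fun x => a x `^ r)%R) => // x; exact: powR_ge0.
have step x : \int[leb3 R]_y (k (x - y)%R * (a y * b y))%:E <= Nb * (W x `^ r^-1).
  under eq_integral do rewrite mulrA EFinM.
  have mka : measurable_fun [set: mvec3 R] (fun y => (k (x - y)%R * a y)%:E).
    by apply/measurable_EFinP; exact: measurable_funM.
  have ka0 (y : vec3 R) : 0 <= (k (x - y)%R * a y)%:E by rewrite lee_fin mulr_ge0.
  have mbE : measurable_fun [set: mvec3 R] (fun y => (b y)%:E) by exact/measurable_EFinP.
  have b0E (y : vec3 R) : 0 <= (b y)%:E by rewrite lee_fin.
  apply: (le_trans (ge0_hoelder (leb3 R) mka mbE ka0 b0E r0 q0 rq)).
  rewrite /Nb ge0_Lnorm// muleC; apply: lee_pmul => //; try exact: poweR_ge0.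
  rewrite le_eqVlt; apply/orP; left; apply/eqP; congr (_ `^ _).
  by apply: eq_integral => y _; rewrite poweR_EFin powRM.
have int0 x : 0 <= \int[leb3 R]_y (k (x - y)%R * (a y * b y))%:E.
  by apply: integral_ge0 => y _; rewrite lee_fin !mulr_ge0.
have mWr : measurable_fun [set: mvec3 R] (fun x => W x `^ r^-1).
  exact: emeasurable_poweR.
have mab : measurable_fun [set: mvec3 R] (fun y => a y * b y)%R by exact: measurable_funM.
apply: (@le_trans _ _ 'N[leb3 R]_q%:E[(fun x => Nb * (W x `^ r^-1))]).
  apply: le_Lnorm => //.
  - by apply: (m2 _ (fun y => a y * b y)%R) => // y; rewrite mulr_ge0.
  - by apply: emeasurable_funM.
  - by move=> x; rewrite int0 step.
rewrite Lnorm_scale//; last by move=> x; exact: poweR_ge0.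
rewrite muleA (muleC _ Nb); apply: lee_pmul => //; first exact: Lnorm_ge0.
have -> : 'N[leb3 R]_q%:E[(fun x => W x `^ r^-1)] = 'N[leb3 R]_(q - 1)%:E[W] `^ r^-1.
  rewrite !ge0_Lnorm//; last by move=> x; exact: poweR_ge0.
  rewrite -poweRrM (_ : (q - 1)^-1 / r = q^-1)%R; last first.
    by rewrite /r; field; rewrite !gt_eqF.
  congr (_ `^ _); apply: eq_integral => x _; rewrite -poweRrM.
  by congr (_ `^ _); rewrite /r; field; rewrite !gt_eqF.
have YW := @young_L1 _ _ _ q11 mkr mar (fun x => powR_ge0 _ _) (fun x => powR_ge0 _ _).
have -> : c%:E * Na = (((c `^ r)%:E) * Na `^ r) `^ r^-1.
  rewrite -poweR_EFin -poweRM ?lee_fin// -poweRrM mulfV ?gt_eqF// poweRe1//.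
  by rewrite mule_ge0 ?lee_fin.
apply: lee_poweR; [by rewrite invr_ge0 ltW|exact: Lnorm_ge0|].
apply: (le_trans YW); rewrite -Lnorm_pow_conj//.
apply: lee_pmul => //; last exact: Lnorm_ge0.
by apply: integral_ge0 => x _; rewrite lee_fin powR_ge0.
Qed.

End young.

(** * Duhamel integrals *)

Section duhamel.
Context {R : realType}.
Implicit Types (K w : R -> vec3 R -> R) (t s : R) (x y : vec3 R).

Definition spacetime_measurable w :=
  measurable_fun [set: mtimevec3 R] (fun z : mtimevec3 R => w z.1 z.2).

Lemma spacetime_measurable_slice w t :
  spacetime_measurable w -> measurable_fun [set: mvec3 R] (w t).
Proof. exact: measurable_at2. Qed.

Definition duhamel K w t x : R :=
  \int[leb1 R]_(s in `[0, t]) convolution (K (t - s)) (w s) x.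

(** With absolute values inside and values in [0, +oo]: this function is measurable and
monotone in all generality, and where it is finite the iterated integral [duhamel]
converges and behaves linearly. *)
Definition duhamel_size K w t x : \bar R :=
  (\int[leb1 R]_(s in `[0%R, t]) \int[leb3 R]_y `|K (t - s) (x - y) * w s y|%:E)%E.

(** The indicator moves the upper bound of the time integral into the integrand, so
that the domain of integration does not depend on the parameter [z]. *)
Definition duhamel_integrand K w (z p : mtimevec3 R) : R :=
  \1_(`[0, z.1] : set R) p.1 * (K (z.1 - p.1) ((z.2 : vec3 R) - p.2) * w p.1 p.2).

Lemma measurable_shifted K : spacetime_measurable K ->
  measurable_fun [set: mtimevec3 R * mtimevec3 R]
    (fun zp : mtimevec3 R * mtimevec3 R =>
       K (zp.1.1 - zp.2.1) ((zp.1.2 : vec3 R) - zp.2.2)).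
Proof.
move=> mK.
have mp : measurable_fun [set: mtimevec3 R * mtimevec3 R]
    (fun zp : mtimevec3 R * mtimevec3 R =>
       (zp.1.1 - zp.2.1, (zp.1.2 : vec3 R) - zp.2.2) : mtimevec3 R).
  apply: measurable_fun_pair.
    apply: measurable_funB.
      exact: (measurableT_comp measurable_fst measurable_fst).
    exact: (measurableT_comp measurable_fst measurable_snd).
  have m2 : measurable_fun [set: mtimevec3 R * mtimevec3 R]
      (fun zp : mtimevec3 R * mtimevec3 R => (zp.1.2, zp.2.2) : mvec3 R * mvec3 R).
    apply: measurable_fun_pair.
      exact: (measurableT_comp measurable_snd measurable_fst).
    exact: (measurableT_comp measurable_snd measurable_snd).
  exact: (measurableT_comp (@measurable_sub3 R) m2).
exact: (measurableT_comp mK mp).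
Qed.

Lemma measurable_duhamel_integrand K w :
  spacetime_measurable K -> spacetime_measurable w ->
  measurable_fun [set: mtimevec3 R * mtimevec3 R]
    (fun zp : mtimevec3 R * mtimevec3 R => duhamel_integrand K w zp.1 zp.2).
Proof.
move=> mK mw; apply: measurable_funM; last first.
  apply: measurable_funM; first exact: measurable_shifted.
  exact: (measurableT_comp mw measurable_snd).
rewrite (_ : (fun zp => _) = (fun zp : mtimevec3 R * mtimevec3 R =>
    if (0 <= zp.2.1) && (zp.2.1 <= zp.1.1) then 1 else 0 : R)); last first.
  apply/funext => zp; rewrite indicE mem_setE in_itv/=.
  by case: ifP.
have m21 : measurable_fun [set: mtimevec3 R * mtimevec3 R]
    (fun zp : mtimevec3 R * mtimevec3 R => zp.2.1 : R).
  exact: (measurableT_comp measurable_fst measurable_snd).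
have m11 : measurable_fun [set: mtimevec3 R * mtimevec3 R]
    (fun zp : mtimevec3 R * mtimevec3 R => zp.1.1 : R).
  exact: (measurableT_comp measurable_fst measurable_fst).
apply: measurable_fun_ifT => //.
by apply: measurable_and; apply: measurable_fun_ler.
Qed.

Lemma measurable_duhamel_integrand1 K w z :
  spacetime_measurable K -> spacetime_measurable w ->
  measurable_fun [set: mtimevec3 R] (duhamel_integrand K w z).
Proof.
move=> mK mw.
exact: (measurableT_comp (measurable_duhamel_integrand mK mw) (measurable_pair1 z)).
Qed.

Lemma duhamel_sizeE K w t x : duhamel_size K w t x =
  (\int[leb1 R]_s \int[leb3 R]_y (`|duhamel_integrand K w (t, x) (s, y)|)%:E)%E.
Proof.
rewrite /duhamel_size integral_eindicM; apply: eq_integral => s _.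
rewrite /duhamel_integrand /= indicE; case: (s \in _).
  by rewrite mul1e; apply: eq_integral => y _; rewrite mul1r.
by rewrite mul0e; under eq_integral do rewrite mul0r normr0; rewrite integral0.
Qed.

Lemma duhamel_size_ge0 K w t x : (0 <= duhamel_size K w t x)%E.
Proof. by apply: integral_ge0 => s _; apply: integral_ge0 => y _; rewrite lee_fin. Qed.

Lemma integrable_duhamel_integrand K w t x :
  spacetime_measurable K -> spacetime_measurable w ->
  (duhamel_size K w t x < +oo)%E ->
  (leb_spacetime R).-integrable [set: mtimevec3 R]
    (EFin \o duhamel_integrand K w (t, x)).
Proof.
move=> mK mw Q.
have mI := measurable_duhamel_integrand1 (t, x) mK mw.
have := @integrable12ltyP _ _ _ _ R (leb1 R) (leb3 R)
  (EFin \o duhamel_integrand K w (t, x)).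
move=> [|_]; first exact/measurable_EFinP.
by apply; rewrite -duhamel_sizeE.
Qed.

Lemma indic_convolution K w t x s :
  \1_(`[0, t] : set R) s * convolution (K (t - s)) (w s) x =
  \int[leb3 R]_y duhamel_integrand K w (t, x) (s, y).
Proof.
rewrite /duhamel_integrand/= indicE; case: (s \in _); last first.
  by rewrite mul0r; under eq_Rintegral do rewrite mul0r; rewrite Rintegral_cst// mul0r.
by rewrite mul1r; apply: eq_Rintegral => y _; rewrite mul1r.
Qed.

Lemma measurable_duhamel_section K w :
  spacetime_measurable K -> spacetime_measurable w ->
  measurable_fun [set: mtimevec3 R * measurableTypeR R]
    (fun zs : mtimevec3 R * measurableTypeR R =>
      \int[leb3 R]_y duhamel_integrand K w zs.1 (zs.2, y)).
Proof.
move=> mK mw.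
apply: (@measurable_fun_Rintegral _ _ _ _ _ (leb3 R)
  (fun v : (mtimevec3 R * measurableTypeR R) * mvec3 R =>
    duhamel_integrand K w v.1.1 (v.1.2, v.2))).
have mp : measurable_fun [set: (mtimevec3 R * measurableTypeR R) * mvec3 R]
    (fun v : (mtimevec3 R * measurableTypeR R) * mvec3 R =>
       (v.1.1, (v.1.2, v.2)) : mtimevec3 R * mtimevec3 R).
  apply: measurable_fun_pair.
    exact: (measurableT_comp measurable_fst measurable_fst).
  apply: measurable_fun_pair; last exact: measurable_snd.
  exact: (measurableT_comp measurable_snd measurable_fst).
exact: (measurableT_comp (measurable_duhamel_integrand mK mw) mp).
Qed.

Lemma duhamelE K w t x : spacetime_measurable K -> spacetime_measurable w ->
  (duhamel_size K w t x < +oo)%E ->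
  (duhamel K w t x)%:E =
    (\int[leb_spacetime R]_p (duhamel_integrand K w (t, x) p)%:E)%E /\
  (leb1 R).-integrable `[0, t]
    (fun s => (convolution (K (t - s)) (w s) x)%:E).
Proof.
move=> mK mw Q; have iI := integrable_duhamel_integrand mK mw Q.
have iF := @integrable_fubini_F _ _ _ _ R (leb1 R) (leb3 R) _ iI.
have aeF := @ae_integrable1 _ _ _ _ R (leb1 R) (leb3 R) _ iI.
set I := EFin \o duhamel_integrand K w (t, x) in iI iF aeF *.
pose c s := (\1_(`[0, t] : set R) s * convolution (K (t - s)) (w s) x)%:E.
have mc : measurable_fun [set: measurableTypeR R] c.
  apply/measurable_EFinP.
  rewrite (_ : (fun s => _) = (fun s => \int[leb3 R]_y
      duhamel_integrand K w (t, x) (s, y))); last first.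
    by apply/funext => s; exact: indic_convolution.
  apply: (@measurable_fun_Rintegral _ _ _ _ _ (leb3 R) (duhamel_integrand K w (t, x))).
  exact: measurable_duhamel_integrand1.
have cE : {ae leb1 R, forall s, c s = fubini_F (leb3 R) I s}.
  apply: filterS aeF => s iIs; rewrite /c /fubini_F /I /=.
  rewrite indic_convolution.
  by rewrite /Rintegral fineK// integrable_fin_num.
have ic : (leb1 R).-integrable [set: measurableTypeR R] c.
  apply/integrableP; split=> //.
  have /integrableP[_] := iF.
  apply: le_lt_trans; rewrite le_eqVlt; apply/orP; left; apply/eqP.
  apply: ge0_ae_eq_integral => //; try exact: measurableT_comp.
    by apply: measurableT_comp => //; exact: measurable_int iF.
  by apply: ae_imp cE => s cs _; rewrite cs.
split; last first.
  have icD : (leb1 R).-integrable `[0, t] c.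
    by apply: (integrableS measurableT) ic => //; exact: measurable_itv.
  have mt : measurable (`[0, t]%classic : set (measurableTypeR R)) by exact: measurable_itv.
  apply: (eq_integrable mt _ _ _ icD) => s st.
  by rewrite /c indicE st mul1r.
transitivity (\int[leb1 R]_s c s)%E.
  rewrite /duhamel Rintegral_indicM /Rintegral fineK// integrable_fin_num//.
transitivity (\int[leb1 R]_s fubini_F (leb3 R) I s)%E.
  apply: ae_eq_integral => //; first exact: measurable_int iF.
  by apply: ae_imp cE => s cs _; rewrite cs.
exact: (@integral12_prod_meas1 _ _ _ _ R (leb1 R) (leb3 R)).
Qed.

Lemma integral_abs_duhamel_integrand K w t x :
  spacetime_measurable K -> spacetime_measurable w ->
  (\int[leb_spacetime R]_p (`|duhamel_integrand K w (t, x) p|)%:E =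
   duhamel_size K w t x)%E.
Proof.
move=> mK mw; rewrite duhamel_sizeE.
apply: (@fubini_tonelli1 _ _ _ _ R (leb1 R) (leb3 R)
  (fun p => (`|duhamel_integrand K w (t, x) p|)%:E)).
  apply/measurable_EFinP; apply: measurableT_comp => //.
  exact: measurable_duhamel_integrand1.
by move=> p; rewrite lee_fin.
Qed.

Lemma norm_duhamel_le K w t x : spacetime_measurable K -> spacetime_measurable w ->
  ((`|duhamel K w t x|)%:E <= duhamel_size K w t x)%E.
Proof.
move=> mK mw; have [Q|] := ltP (duhamel_size K w t x) +oo%E; last first.
  by rewrite leye_eq => /eqP ->; exact: leey.
have [E _] := duhamelE mK mw Q.
rewrite -abse_EFin E -integral_abs_duhamel_integrand//.
apply: le_abse_integral => //.
by apply/measurable_EFinP; exact: measurable_duhamel_integrand1.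
Qed.

(** Additivity holds where both sides converge absolutely. *)
Lemma duhamelB K w1 w2 t x : spacetime_measurable K ->
  spacetime_measurable w1 -> spacetime_measurable w2 ->
  (duhamel_size K w1 t x < +oo)%E -> (duhamel_size K w2 t x < +oo)%E ->
  duhamel K w1 t x - duhamel K w2 t x = duhamel K (fun s y => w1 s y - w2 s y) t x.
Proof.
move=> mK m1 m2 Q1 Q2.
have m12 : spacetime_measurable (fun s y => w1 s y - w2 s y) by exact: measurable_funB.
have IE p : duhamel_integrand K (fun s y => w1 s y - w2 s y) (t, x) p =
    duhamel_integrand K w1 (t, x) p - duhamel_integrand K w2 (t, x) p.
  by rewrite /duhamel_integrand !mulrBr.
have i1 := integrable_duhamel_integrand mK m1 Q1.
have i2 := integrable_duhamel_integrand mK m2 Q2.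
have Q12 : (duhamel_size K (fun s y => (w1 s y - w2 s y)%R) t x < +oo)%E.
  rewrite -integral_abs_duhamel_integrand//.
  have /integrableP[_] := integrableB measurableT i1 i2.
  rewrite (eq_integral (fun p => (`|duhamel_integrand K
    (fun s y => (w1 s y - w2 s y)%R) (t, x) p|)%:E))// => p _.
  by rewrite IE.
have [E1 _] := duhamelE mK m1 Q1; have [E2 _] := duhamelE mK m2 Q2.
have [E12 _] := duhamelE mK m12 Q12.
apply: EFin_inj.
apply: etrans; first exact: EFinB.
apply: etrans; first exact: (f_equal2 (fun a b : \bar R => a - b)%E E1 E2).
apply: etrans; last exact: (esym E12).
apply: etrans; first exact: (esym (integralB measurableT i1 i2)).
by apply: eq_integral => p _; rewrite IE EFinB.
Qed.

Lemma measurable_duhamel K w : spacetime_measurable K -> spacetime_measurable w ->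
  spacetime_measurable (duhamel K w).
Proof.
move=> mK mw.
rewrite /spacetime_measurable (_ : (fun z => _) = (fun z : mtimevec3 R =>
    \int[leb1 R]_s \int[leb3 R]_y duhamel_integrand K w z (s, y))).
  exact: (@measurable_fun_Rintegral _ _ _ _ _ (leb1 R) _ (measurable_duhamel_section mK mw)).
apply/funext => -[t x]; rewrite /duhamel Rintegral_indicM.
by apply: eq_Rintegral => s _; exact: indic_convolution.
Qed.

Lemma measurable_duhamel_size K w : spacetime_measurable K -> spacetime_measurable w ->
  measurable_fun [set: mtimevec3 R] (fun z : mtimevec3 R => duhamel_size K w z.1 z.2).
Proof.
move=> mK mw.
rewrite (_ : (fun z => _) = (fun z : mtimevec3 R =>
  \int[leb_spacetime R]_p (`|duhamel_integrand K w z p|)%:E)%E); last first.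
  by apply/funext => -[t x]; rewrite integral_abs_duhamel_integrand.
apply: (@measurable_fun_fubini_tonelli_F _ _ _ _ _ (leb_spacetime R)
  (fun zp : mtimevec3 R * mtimevec3 R => (`|duhamel_integrand K w zp.1 zp.2|)%:E)).
  apply/measurable_EFinP; apply: measurableT_comp => //.
  exact: measurable_duhamel_integrand.
by move=> zp; rewrite lee_fin.
Qed.

Lemma measurable_duhamel_slice K w t : spacetime_measurable K -> spacetime_measurable w ->
  measurable_fun [set: mtimevec3 R] (fun z : mtimevec3 R =>
    \int[leb3 R]_y (`|K (t - z.1)%R ((z.2 : vec3 R) - y)%R * w z.1 y|)%:E)%E.
Proof.
move=> mK mw.
apply: (@measurable_fun_fubini_tonelli_F _ _ _ _ _ (leb3 R)
  (fun v : mtimevec3 R * mvec3 R =>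
    (`|K (t - v.1.1) ((v.1.2 : vec3 R) - v.2) * w v.1.1 v.2|)%:E)); last first.
  by move=> v; rewrite lee_fin.
apply/measurable_EFinP; apply: measurableT_comp => //; apply: measurable_funM.
  have mp : measurable_fun [set: mtimevec3 R * mvec3 R]
      (fun v : mtimevec3 R * mvec3 R =>
         ((t, v.1.2), (v.1.1, v.2)) : mtimevec3 R * mtimevec3 R).
    apply: measurable_fun_pair.
      apply: measurable_fun_pair; first exact: measurable_cst.
      exact: (measurableT_comp measurable_snd measurable_fst).
    apply: measurable_fun_pair; last exact: measurable_snd.
    exact: (measurableT_comp measurable_fst measurable_fst).
  exact: (measurableT_comp (measurable_shifted mK) mp).
have mp : measurable_fun [set: mtimevec3 R * mvec3 R]
    (fun v : mtimevec3 R * mvec3 R => (v.1.1, v.2) : mtimevec3 R).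
  apply: measurable_fun_pair; last exact: measurable_snd.
  exact: (measurableT_comp measurable_fst measurable_fst).
exact: (measurableT_comp mw mp).
Qed.

Lemma Lnorm_duhamel_size (q : R) K w t : 1 < q ->
  spacetime_measurable K -> spacetime_measurable w ->
  ('N[leb3 R]_q%:E[duhamel_size K w t] <=
   \int[leb1 R]_(s in `[0%R, t])
     'N[leb3 R]_q%:E[(fun x => \int[leb3 R]_y (`|K (t - s)%R (x - y)%R * w s y|)%:E)])%E.
Proof.
move=> q1 mK mw.
pose G (z : mtimevec3 R) : \bar R :=
  (\int[leb3 R]_y (`|K (t - z.1) ((z.2 : vec3 R) - y) * w z.1 y|)%:E)%E.
apply: (@minkowski_time R `[0, t] q G) => //; last first.
  by move=> z; apply: integral_ge0 => y _; rewrite lee_fin.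
exact: measurable_duhamel_slice.
Qed.

End duhamel.

Section duhamel_bounds.
Context {R : realType}.
Implicit Types (K w : R -> vec3 R -> R) (t s : R) (x y : vec3 R).

Lemma le_duhamel_size K1 K2 w1 w2 t x :
  spacetime_measurable K1 -> spacetime_measurable K2 ->
  spacetime_measurable w1 -> spacetime_measurable w2 ->
  (forall s y, `|K1 s y| <= `|K2 s y|) -> (forall s y, `|w1 s y| <= `|w2 s y|) ->
  (duhamel_size K1 w1 t x <= duhamel_size K2 w2 t x)%E.
Proof.
move=> mK1 mK2 mw1 mw2 K12 w12; rewrite -!integral_abs_duhamel_integrand//.
apply: ge0_le_integral => //.
- apply/measurable_EFinP; apply: measurableT_comp => //.
  exact: measurable_duhamel_integrand1.
- apply/measurable_EFinP; apply: measurableT_comp => //.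
  exact: measurable_duhamel_integrand1.
move=> p _; rewrite lee_fin /duhamel_integrand !normrM ler_wpM2l//.
by rewrite ler_pM.
Qed.

Lemma sum_duhamel_size (I : finType) (K : I -> R -> vec3 R -> R) w t x :
  (forall i, spacetime_measurable (K i)) -> spacetime_measurable w ->
  (\sum_i duhamel_size (K i) w t x =
   duhamel_size (fun s y => \sum_i `|K i s y|)%R w t x)%E.
Proof.
move=> mK mw.
have mS : spacetime_measurable (fun s y => \sum_i `|K i s y|).
  apply: measurable_sum => i; apply: measurableT_comp => //; exact: mK.
rewrite -(integral_abs_duhamel_integrand _ _ mS mw).
rewrite (eq_bigr (fun i => \int[leb_spacetime R]_p
    (`|duhamel_integrand (K i) w (t, x) p|)%:E)%E); last first.
  by move=> i _; rewrite (integral_abs_duhamel_integrand _ _ (mK i) mw).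
rewrite -ge0_integral_sum//; last first.
  move=> i; apply/measurable_EFinP; apply: measurableT_comp => //.
  exact: measurable_duhamel_integrand1.
apply: eq_integral => p _; rewrite sumEFin; congr (_%:E).
rewrite /duhamel_integrand !normrM (ger0_norm (sumr_ge0 _ _))// mulr_suml mulr_sumr.
by apply: eq_bigr => i _; rewrite !normrM.
Qed.

Lemma ae_neq_point t : {ae leb1 R, forall s : R, s != t}.
Proof.
exists [set t]; split=> //; first exact: lebesgue_measure_set1.
by move=> s /= /negP; rewrite negbK => /eqP.
Qed.

Lemma measurable_Lnorm_slice (q : R) w : spacetime_measurable w ->
  (forall s y, 0 <= w s y) ->
  measurable_fun [set: measurableTypeR R]
    (fun s => 'N[leb3 R]_q%:E[(fun x => (w s x)%:E)]%E).
Proof.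
move=> mw w0.
apply: (@measurable_Lnorm_section _ _ _ _ _ (leb3 R) (fun z : mtimevec3 R => (w z.1 z.2)%:E)).
  exact/measurable_EFinP.
by move=> z; rewrite lee_fin.
Qed.

Lemma measurable_time_reflect t :
  measurable_fun [set: measurableTypeR R] (fun s : measurableTypeR R => t - (s : R) : measurableTypeR R).
Proof. exact: measurable_funB. Qed.

(** The instant s = t, where the kernels are singular, is negligible. *)
Lemma Lnorm_duhamel_size_le (q : R) K w t (N : R -> \bar R) : 1 < q ->
  spacetime_measurable K -> spacetime_measurable w ->
  measurable_fun [set: measurableTypeR R] N -> (forall s, 0 <= N s)%E ->
  (forall s, (0 <= s)%R -> (s < t)%R ->
    'N[leb3 R]_q%:E[(fun x => \int[leb3 R]_y (`|K (t - s)%R (x - y)%R * w s y|)%:E)]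
    <= N s)%E ->
  ('N[leb3 R]_q%:E[duhamel_size K w t] <= \int[leb1 R]_(s in `[0%R, t]) N s)%E.
Proof.
move=> q1 mK mw mN N0 NK; apply: (le_trans (Lnorm_duhamel_size _ q1 mK mw)).
have mt : measurable (`[0, t]%classic : set (measurableTypeR R)) by exact: measurable_itv.
apply: ae_ge0_le_integral => //.
- by move=> s _; exact: Lnorm_ge0.
- apply: measurable_funTS.
  apply: (@measurable_Lnorm_section _ _ _ _ _ (leb3 R) _
    (measurable_duhamel_slice t mK mw)).
  by move=> z; apply: integral_ge0 => y _; rewrite lee_fin.
- exact: measurable_funTS.
apply: ae_imp (ae_neq_point t) => s st; rewrite /= in_itv/= => /andP[s0 s1].
by apply: NK => //; rewrite lt_neqAle st.
Qed.

Lemma ge0_integral_time_reflect t (F : R -> \bar R) :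
  measurable_fun [set: measurableTypeR R] F -> (forall s, 0 <= F s)%E ->
  (\int[leb1 R]_(s in `[0%R, t]) F (t - s)%R = \int[leb1 R]_(s in `[0%R, t]) F s)%E.
Proof.
move=> mF F0; rewrite (integral_eindicM (leb1 R) _ (fun s => F (t - s)%R)).
rewrite (integral_eindicM (leb1 R) _ F).
rewrite [RHS](@ge0_integral_line_affine _ (-1) t); last 3 first.
- by rewrite oppr_eq0 oner_eq0.
- apply: emeasurable_funM => //; apply/measurable_EFinP.
  by apply: measurable_indic; exact: measurable_itv.
- by move=> s; rewrite mule_ge0// lee_fin.
rewrite normrN1 mul1e; apply: eq_integral => s _.
rewrite mulN1r addrC; congr (_%:E * _)%E; rewrite !indicE; congr (_%:R).
congr nat_of_bool.
by apply/idP/idP => /set_mem/=; rewrite in_itv/= => /andP[? ?];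
  apply/mem_set => /=; rewrite in_itv/=; apply/andP; split; lra.
Qed.

Lemma integral_singular_weight (g t : R) : g < 1 -> 0 < t ->
  (\int[leb1 R]_(s in `[0%R, t]) ((t - s) `^ (- g))%:E = (t `^ (1 - g) / (1 - g))%:E)%E.
Proof.
move=> g1 t0.
have mp : measurable_fun [set: measurableTypeR R] (fun s : R => (s `^ (- g))%:E).
  by apply/measurable_EFinP; exact: measurable_powR.
rewrite (@ge0_integral_time_reflect t (fun s => (s `^ (- g))%:E))//; last first.
  by move=> s; rewrite lee_fin powR_ge0.
rewrite -integral_powR_0//; apply/esym.
by apply: integral_itv_obnd_cbnd; exact: measurable_funTS.
Qed.

End duhamel_bounds.

(** * Estimates of the terms of the integral equation *)

Section finite_sums.
Context d (T : measurableType d) (R : realType) (mu : {measure set T -> \bar R}).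

Lemma integrable_finsum (I : finType) (D : set T) (f : I -> T -> R) : measurable D ->
  (forall i, mu.-integrable D (EFin \o f i)) ->
  mu.-integrable D (EFin \o (fun z => \sum_i f i z)).
Proof.
move=> mD intf.
rewrite (_ : EFin \o _ = (fun z => \sum_i (f i z)%:E)%E); last first.
  by apply/funext => z; rewrite /= -sumEFin.
by apply: (integrable_sum mD) => i _; exact: intf.
Qed.

Lemma Rintegral_finsum (I : finType) (D : set T) (f : I -> T -> R) : measurable D ->
  (forall i, mu.-integrable D (EFin \o f i)) ->
  \int[mu]_(z in D) (\sum_i f i z) = \sum_i \int[mu]_(z in D) f i z.
Proof.
move=> mD intf; rewrite /Rintegral.
under eq_integral do rewrite -sumEFin.
rewrite (integral_sum mD intf) sum_fine// => i _.
by apply: (integrable_fin_num mD); exact: intf.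
Qed.

End finite_sums.

Section fluid_bounds.
Context {R : realType} (al q : R) (al2 : 1 / 2 < al) (q2 : 2 < q).
Implicit Types (w : R -> vec3 R -> R) (t s : R) (x y : vec3 R).

Let q0 : 0 < q. Proof. exact: lt_trans q2. Qed.
Let q1 : 1 < q. Proof. by apply: lt_trans q2; rewrite ltr1n. Qed.
Let al0 : 0 < al. Proof. by rewrite (lt_trans _ al2)// divr_gt0. Qed.

(** The order of the singularity at time 0 of the Oseen kernel, measured in the
norm of the exponent conjugate to [q]. *)
Definition gam : R := (1 + 3 / q) / (2 * al).

Lemma gam_ge0 : 0 <= gam.
Proof. by rewrite divr_ge0 ?mulr_ge0 ?addr_ge0 ?divr_ge0 ?(ltW q0) ?(ltW al0). Qed.

Lemma oseen_size_conj : exists2 C : R, 0 <= C & forall t, 0 < t ->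
  (\int[leb3 R]_x ((oseen_size al t x) `^ (q / (q - 1)))%:E <=
   ((C * t `^ (- gam)) `^ (q / (q - 1)))%:E)%E.
Proof.
have qq : 1 < q / (q - 1) by rewrite ltr_pdivlMr ?mul1r ?gtrBl// subr_gt0.
have [C C0 HC] := oseen_size_Lr al2 qq.
exists C; first exact: C0.
move=> t t0.
apply: (le_trans (HC t t0)); rewrite /inv_length -powRrM.
have -> : - (2 * al)^-1 * (4 - 3 / (q / (q - 1))) = - gam; last by [].
by rewrite /gam; field; rewrite !gt_eqF// subr_gt0.
Qed.

(** The bilinear estimate on which everything rests: its time kernel is
integrable because [gam < 1]. *)
Lemma oseen_bilinear : exists2 C : R, 0 <= C & forall (a b : R -> vec3 R -> R) t,
  spacetime_measurable a -> spacetime_measurable b ->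
  (forall s y, 0 <= a s y) -> (forall s y, 0 <= b s y) ->
  ('N[leb3 R]_q%:E[duhamel_size (oseen_size al) (fun s y => a s y * b s y)%R t] <=
   \int[leb1 R]_(s in `[0%R, t]) ((C * (t - s) `^ (- gam))%:E *
     ('N[leb3 R]_q%:E[(fun x => (a s x)%:E)] * 'N[leb3 R]_q%:E[(fun x => (b s x)%:E)])))%E.
Proof.
have [C C0 HC] := oseen_size_conj; exists C; first exact: C0.
move=> a b t ma mb a0 b0.
have mK : spacetime_measurable (oseen_size al) by exact: measurable_oseen_size.
apply: Lnorm_duhamel_size_le => //.
- exact: measurable_funM.
- apply: emeasurable_funM.
    apply/measurable_EFinP; apply: measurable_funM => //.
    exact: (measurableT_comp (measurable_powR _) (measurable_time_reflect t)).
  by apply: emeasurable_funM; exact: measurable_Lnorm_slice.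
- by move=> s; rewrite !mule_ge0 ?lee_fin ?mulr_ge0 ?powR_ge0 ?Lnorm_ge0.
move=> s s0 st; have ts : 0 < t - s by rewrite subr_gt0.
rewrite (_ : (fun x => _) = (fun x => \int[leb3 R]_y
  (oseen_size al (t - s)%R (x - y)%R * (a s y * b s y))%:E)%E); last first.
  apply/funext => x; apply: eq_integral => y _.
  by rewrite ger0_norm// !mulr_ge0// oseen_size_ge0.
apply: young_bilinear => //.
- by rewrite mulr_ge0 ?powR_ge0.
- exact: spacetime_measurable_slice.
- exact: spacetime_measurable_slice.
- exact: spacetime_measurable_slice.
- by move=> x; exact: oseen_size_ge0.
- exact: HC.
Qed.

Lemma heat_bounds : exists2 C : R, 0 <= C &
  (forall (h : vec3 R -> R) t, 0 < t -> measurable_fun [set: mvec3 R] h ->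
    ('N[leb3 R]_q%:E[(fun x => \int[leb3 R]_y (`|heat_kernel al t (x - y)%R * h y|)%:E)]
     <= C%:E * 'N[leb3 R]_q%:E[(fun x => (`|h x|)%:E)])%E) /\
  (forall w t, spacetime_measurable w ->
    ('N[leb3 R]_q%:E[duhamel_size (heat_kernel al) w t] <=
     \int[leb1 R]_(s in `[0%R, t]) (C%:E * 'N[leb3 R]_q%:E[(fun x => (`|w s x|)%:E)]))%E).
Proof.
have [C C0 HC] := heat_kernel_L1 al2; exists C; first exact: C0.
have mK : spacetime_measurable (heat_kernel al) by exact: measurable_heat_kernel.
have H1 (h : vec3 R -> R) t : 0 < t -> measurable_fun [set: mvec3 R] h ->
    ('N[leb3 R]_q%:E[(fun x => \int[leb3 R]_y (`|heat_kernel al t (x - y)%R * h y|)%:E)]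
     <= C%:E * 'N[leb3 R]_q%:E[(fun x => (`|h x|)%:E)])%E.
  move=> t0 mh.
  rewrite (_ : (fun x => _) = (fun x => \int[leb3 R]_y
    (`|heat_kernel al t (x - y)%R| * `|h y|)%:E)%E); last first.
    by apply/funext => x; apply: eq_integral => y _; rewrite normrM.
  apply: le_trans.
    apply: (@young_L1 R q (fun x => `|heat_kernel al t x|) (fun x => `|h x|)) => //.
      apply: measurableT_comp => //; exact: spacetime_measurable_slice.
    exact: measurableT_comp.
  apply: lee_pmul => //; [|exact: Lnorm_ge0|exact: HC].
  by apply: integral_ge0 => x _; rewrite lee_fin.
split=> // w t mw; apply: Lnorm_duhamel_size_le => //.
- apply: emeasurable_funM => //.
  apply: (@measurable_Lnorm_slice _ q (fun s y => `|w s y|)) => //.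
  exact: measurableT_comp.
- by move=> s; rewrite mule_ge0 ?lee_fin ?Lnorm_ge0.
move=> s s0 st; apply: H1; first by rewrite subr_gt0.
exact: spacetime_measurable_slice.
Qed.

End fluid_bounds.

Section nonlinear_term.
Context {R : realType} (al : R) (al2 : 1 / 2 < al).
Implicit Types (U V : 'I_3 -> R -> vec3 R -> R) (t s : R) (x y : vec3 R).
Implicit Types (j k l : 'I_3).

Definition field_measurable U := forall k, spacetime_measurable (U k).

(** The sum of the absolute values of the components, rather than the Euclidean norm:
its square dominates all the products U_k U_l. *)
Definition field_size U t x : R := \sum_k `|U k t x|.

Definition nonlinear U j t x : R :=
  \int[leb1 R]_(s in `[0, t]) \sum_k \sum_l
    convolution (oseen_kernel al (t - s) j k l) (fun y => U k s y * U l s y) x.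

Lemma field_size_ge0 U t x : 0 <= field_size U t x.
Proof. by apply: sumr_ge0. Qed.

Lemma measurable_field_size U : field_measurable U ->
  spacetime_measurable (field_size U).
Proof.
by move=> mU; apply: measurable_sum => k; apply: measurableT_comp => //; exact: mU.
Qed.

Lemma le_field_size U k t x : `|U k t x| <= field_size U t x.
Proof. by rewrite /field_size (bigD1 k)//= lerDl sumr_ge0. Qed.

Lemma measurable_field_mul U k l : field_measurable U ->
  spacetime_measurable (fun s y => U k s y * U l s y).
Proof. by move=> mU; apply: measurable_funM; exact: mU. Qed.

Lemma le_oseen_size t j k l x : `|oseen_kernel al t j k l x| <= oseen_size al t x.
Proof.
rewrite /oseen_size (bigD1 j)//= (bigD1 k)//= (bigD1 l)//= -!addrA lerDl.
by rewrite !addr_ge0// !sumr_ge0// => *; rewrite !sumr_ge0// => *; rewrite sumr_ge0.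
Qed.

Lemma nonlinear_summable U t x j k l : field_measurable U ->
  (duhamel_size (oseen_size al) (fun s y => field_size U s y * field_size U s y)%R t x
     < +oo)%E ->
  (duhamel_size (fun s => oseen_kernel al s j k l)
    (fun s y => U k s y * U l s y)%R t x < +oo)%E.
Proof.
move=> mU; apply: le_lt_trans; apply: le_duhamel_size.
- exact: measurable_oseen_kernel.
- exact: measurable_oseen_size.
- exact: measurable_field_mul.
- by apply: measurable_funM; exact: measurable_field_size.
- by move=> s y; rewrite [leRHS]ger0_norm ?oseen_size_ge0// le_oseen_size.
- move=> s y; rewrite !normrM !(ger0_norm (field_size_ge0 _ _ _)).
  by apply: ler_pM => //; exact: le_field_size.
Qed.

(** Where the dominating integral converges, the sum over k and l can be taken out of
the time integral. *)
Lemma nonlinearE U j t x : field_measurable U ->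
  (duhamel_size (oseen_size al) (fun s y => field_size U s y * field_size U s y)%R t x
     < +oo)%E ->
  nonlinear U j t x = \sum_k \sum_l
    duhamel (fun s => oseen_kernel al s j k l) (fun s y => U k s y * U l s y) t x.
Proof.
move=> mU Q.
have ic k l := (duhamelE (measurable_oseen_kernel al j k l) (measurable_field_mul k l mU)
  (nonlinear_summable j k l mU Q)).2.
have mt : measurable (`[0, t]%classic : set (measurableTypeR R)) by exact: measurable_itv.
rewrite /nonlinear /duhamel Rintegral_finsum//; last first.
  by move=> k; apply: integrable_finsum => // l; exact: ic.
by apply: eq_bigr => k _; rewrite Rintegral_finsum// => l; exact: ic.
Qed.

Lemma measurable_nonlinear U j : field_measurable U ->
  spacetime_measurable (nonlinear U j).
Proof.
move=> mU.
rewrite /spacetime_measurable (_ : (fun z => _) = (fun z : mtimevec3 R =>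
    \int[leb1 R]_s (\sum_k \sum_l \int[leb3 R]_y
      duhamel_integrand (fun s => oseen_kernel al s j k l)
        (fun s y => U k s y * U l s y) z (s, y)))).
  apply: (@measurable_fun_Rintegral _ _ _ _ _ (leb1 R)
    (fun zs : mtimevec3 R * measurableTypeR R => \sum_k \sum_l \int[leb3 R]_y
      duhamel_integrand (fun s => oseen_kernel al s j k l)
        (fun s y => U k s y * U l s y) zs.1 (zs.2, y))).
  apply: measurable_sum => k; apply: measurable_sum => l.
  apply: measurable_duhamel_section; last exact: measurable_field_mul.
  exact: measurable_oseen_kernel.
apply/funext => -[t x]; rewrite /nonlinear Rintegral_indicM.
apply: eq_Rintegral => s _; rewrite mulr_sumr; apply: eq_bigr => k _.
rewrite mulr_sumr; apply: eq_bigr => l _.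
exact: (@indic_convolution R (fun s => oseen_kernel al s j k l)
  (fun s y => U k s y * U l s y)).
Qed.

(** The identity a a' - b b' = a (a' - b') + (a - b) b', integrated against the kernel. *)
Lemma nonlinear_diff U V t x : field_measurable U -> field_measurable V ->
  (duhamel_size (oseen_size al) (fun s y => field_size U s y * field_size U s y)%R t x
     < +oo)%E ->
  (duhamel_size (oseen_size al) (fun s y => field_size V s y * field_size V s y)%R t x
     < +oo)%E ->
  ((\sum_j `|nonlinear U j t x - nonlinear V j t x|)%:E <=
   duhamel_size (oseen_size al) (fun s y => (field_size U s y + field_size V s y) *
     field_size (fun k s y => U k s y - V k s y) s y)%R t x)%E.
Proof.
move=> mU mV QU QV.
pose W k l s y := U k s y * U l s y - V k s y * V l s y.
pose D k s y := U k s y - V k s y.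
have mD : field_measurable D by move=> k; apply: measurable_funB; [exact: mU|exact: mV].
have mW k l : spacetime_measurable (W k l).
  by apply: measurable_funB; exact: measurable_field_mul.
pose P s y := (field_size U s y + field_size V s y) * field_size D s y.
have mP : spacetime_measurable P.
  by apply: measurable_funM; [apply: measurable_funD|]; exact: measurable_field_size.
have P0 s y : 0 <= P s y by rewrite mulr_ge0 ?addr_ge0 ?field_size_ge0.
have WP k l s y : `|W k l s y| <= P s y.
  have -> : W k l s y = U k s y * D l s y + D k s y * V l s y.
    by rewrite /W /D; ring.
  apply: (le_trans (ler_normD _ _)); rewrite /P [leRHS]mulrDl.
  apply: lerD; rewrite normrM; last rewrite mulrC.
    by apply: ler_pM => //; exact: le_field_size.
  by apply: ler_pM => //; exact: le_field_size.
have mK j k l : spacetime_measurable (fun s => oseen_kernel al s j k l).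
  exact: measurable_oseen_kernel.
apply: (@le_trans _ _ (\sum_j \sum_k \sum_l
    duhamel_size (fun s => oseen_kernel al s j k l) P t x)%E).
  rewrite -sumEFin; apply: lee_sum => j _.
  rewrite !nonlinearE// -sumrB.
  apply: (@le_trans _ _ (\sum_k \sum_l
    `|duhamel (fun s => oseen_kernel al s j k l) (W k l) t x|%:E)%E).
    rewrite (eq_bigr (fun k => (\sum_l
      `|duhamel (fun s => oseen_kernel al s j k l) (W k l) t x|)%:E)); last first.
      by move=> k _; rewrite sumEFin.
    rewrite sumEFin lee_fin (le_trans (ler_norm_sum _ _ _))//; apply: ler_sum => k _.
    rewrite -sumrB (le_trans (ler_norm_sum _ _ _))//; apply: ler_sum => l _.
    have E := duhamelB (mK j k l) (measurable_field_mul k l mU)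
      (measurable_field_mul k l mV) (nonlinear_summable j k l mU QU)
      (nonlinear_summable j k l mV QV).
    by rewrite le_eqVlt; apply/orP; left; apply/eqP; rewrite E.
  apply: lee_sum => k _; apply: lee_sum => l _.
  apply: (le_trans (norm_duhamel_le _ _ (mK j k l) (mW k l))).
  by apply: le_duhamel_size => // s y; rewrite [leRHS]ger0_norm.
rewrite le_eqVlt; apply/orP; left; apply/eqP.
have mKl j k : spacetime_measurable (fun s y => \sum_l `|oseen_kernel al s j k l y|).
  by apply: measurable_sum => l; apply: measurableT_comp => //; exact: mK.
have mKkl j : spacetime_measurable
    (fun s y => \sum_k `|\sum_l `|oseen_kernel al s j k l y| |).
  by apply: measurable_sum => k; apply: measurableT_comp => //; exact: mKl.
under eq_bigr do under eq_bigr do rewrite sum_duhamel_size//.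
under eq_bigr do rewrite sum_duhamel_size//.
apply: etrans; first exact: (sum_duhamel_size _ _ mKkl mP).
rewrite (_ : (fun s y => \sum_j _) = oseen_size al)//.
apply/funext => s; apply/funext => y; rewrite /oseen_size.
apply: eq_bigr => j _; rewrite ger0_norm ?sumr_ge0//.
by apply: eq_bigr => k _; rewrite ger0_norm ?sumr_ge0.
Qed.

End nonlinear_term.

(** * Convergent series in L^q *)

Section series_in_Lnorm.
Context d (T : measurableType d) (R : realType) (mu : {measure set T -> \bar R}).

Lemma Lnorm_sum_le (q : R) (g : nat -> T -> R) (c : nat -> R) (n : nat) : 1 <= q ->
  (forall n, measurable_fun [set: T] (g n)) -> (forall n x, 0 <= g n x) ->
  (forall n, 'N[mu]_q%:E[(fun x => (g n x)%:E)] <= (c n)%:E)%E ->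
  ('N[mu]_q%:E[(fun x => (\sum_(i < n) g i x)%:E)] <= (\sum_(i < n) c i)%:E)%E.
Proof.
move=> q1 mg g0 gc; have q0 : 0 < q by exact: lt_le_trans q1.
elim: n => [|n IH].
  under [X in Lnorm _ _ X]eq_fun do rewrite big_ord0.
  by rewrite big_ord0 Lnorm0// eqe gt_eqF.
under [X in Lnorm _ _ X]eq_fun do rewrite big_ord_recr EFinD /=.
rewrite big_ord_recr /= EFinD; apply: le_trans (leeD IH (gc n)).
apply: ge0_minkowski => //.
- by apply/measurable_EFinP; apply: measurable_sum.
- exact/measurable_EFinP.
- by move=> x; rewrite lee_fin sumr_ge0.
- by move=> x; rewrite lee_fin.
Qed.

Lemma geometric_sum_le (c : R) (n : nat) : 0 <= c ->
  \sum_(i < n) (c / 2 ^+ i) <= 2 * c.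
Proof.
move=> c0; suff -> : \sum_(i < n) (c / 2 ^+ i) = 2 * c - 2 * c / 2 ^+ n.
  by rewrite gerBl divr_ge0 ?mulr_ge0 ?exprn_ge0.
elim: n => [|n IH]; first by rewrite big_ord0 expr0 divr1 subrr.
by rewrite big_ord_recr/= IH exprS; field; rewrite expf_neq0.
Qed.

(** The sum of a geometrically convergent series of nonnegative functions, taken
with values in [0, +oo] so that it needs no exceptional set. *)
Lemma series_Lnorm (q c : R) (g : nat -> T -> R) : 1 <= q -> 0 <= c ->
  (forall n, measurable_fun [set: T] (g n)) -> (forall n x, 0 <= g n x) ->
  (forall n, 'N[mu]_q%:E[(fun x => (g n x)%:E)] <= (c / 2 ^+ n)%:E)%E ->
  exists G : T -> \bar R, [/\ measurable_fun [set: T] G, (forall x, 0 <= G x)%E,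
    (forall n x, (\sum_(i < n) g i x)%:E <= G x)%E &
    ('N[mu]_q%:E[G] <= (2 * c)%:E)%E].
Proof.
move=> q1 c0 mg g0 gc; have q0 : 0 < q by exact: lt_le_trans q1.
pose S n x : \bar R := (\sum_(i < n) g i x)%:E.
have mS n : measurable_fun [set: T] (S n).
  by apply/measurable_EFinP; apply: measurable_sum.
have S0 n x : (0 <= S n x)%E by rewrite lee_fin sumr_ge0.
have ndS x : nondecreasing_seq (fun n => S n x `^ q)%E.
  apply/nondecreasing_seqP => n; apply: lee_poweR => //; first exact: ltW.
  by rewrite lee_fin big_ord_recr/= lerDl.
have mSq n : measurable_fun [set: T] (fun x => S n x `^ q)%E.
  exact: emeasurable_poweR.
pose L x := limn (fun n => S n x `^ q)%E.
have L0 x : (0 <= L x)%E.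
  apply: lime_ge; first exact: ereal_nondecreasing_is_cvgn.
  by apply: nearW => n; exact: poweR_ge0.
have mL : measurable_fun [set: T] L.
  apply: (emeasurable_fun_cvg (fun n x => S n x `^ q)%E) => // x _.
  exact: ereal_nondecreasing_is_cvgn.
have intL : (\int[mu]_x L x <= (2 * c)%:E `^ q)%E.
  rewrite (@monotone_convergence _ _ _ mu _ measurableT)//; last first.
  - by move=> n x _; exact: poweR_ge0.
  apply: lime_le.
    apply: ereal_nondecreasing_is_cvgn => m n mn.
    apply: ge0_le_integral => //.
    - by move=> x _; exact: poweR_ge0.
    - by move=> x _; exact: ndS.
  apply: nearW => n; rewrite -ge0_Lnorm_pow ?gt_eqF//.
  apply: lee_poweR; [exact: ltW|exact: Lnorm_ge0|].
  apply: (le_trans (Lnorm_sum_le n q1 mg g0 gc)).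
  by rewrite lee_fin geometric_sum_le.
exists (fun x => L x `^ q^-1)%E; split.
- exact: emeasurable_poweR.
- by move=> x; exact: poweR_ge0.
- move=> n x; rewrite -/(S n x).
  have -> : S n x = ((S n x `^ q) `^ q^-1)%E.
    by rewrite -poweRrM mulfV ?gt_eqF// poweRe1.
  apply: lee_poweR; [by rewrite invr_ge0 ltW|exact: poweR_ge0|].
  apply: lime_ge; first exact: ereal_nondecreasing_is_cvgn.
  by near=> m; apply: ndS; near: m; exact: nbhs_infty_ge.
rewrite ge0_Lnorm; last by move=> x; exact: poweR_ge0.
have -> : ((2 * c)%:E = ((2 * c)%:E `^ q) `^ q^-1)%E.
  by rewrite -poweRrM mulfV ?gt_eqF// poweRe1// lee_fin mulr_ge0.
apply: lee_poweR; first by rewrite invr_ge0 ltW.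
  by apply: integral_ge0 => x _; exact: poweR_ge0.
under eq_integral do rewrite -poweRrM mulVf ?gt_eqF// poweRe1//.
exact: intL.
Unshelve. all: by end_near. Qed.

Lemma ae_lt_Lnorm (q : R) (G : T -> \bar R) : 0 < q -> measurable_fun [set: T] G ->
  (forall x, 0 <= G x)%E -> ('N[mu]_q%:E[G] < +oo)%E -> {ae mu, forall x, (G x < +oo)%E}.
Proof.
move=> q0 mG G0 NG; apply: (ae_ltey_poweR q0 mG).
by rewrite -ge0_Lnorm_pow ?gt_eqF// poweR_lty.
Qed.

Lemma ae_eq0_Lnorm (q : R) (g : T -> R) : 0 < q -> measurable_fun [set: T] g ->
  (forall x, 0 <= g x) -> ('N[mu]_q%:E[(fun x => (g x)%:E)] <= 0)%E ->
  {ae mu, forall x, g x = 0}.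
Proof.
move=> q0 mg g0 Ng.
have N0 : ('N[mu]_q%:E[(fun x => (g x)%:E)] = 0)%E.
  by apply/eqP; rewrite eq_le Ng Lnorm_ge0.
have mgE : measurable_fun [set: T] (fun x => (g x)%:E) by exact/measurable_EFinP.
have g0E x : (0 <= (g x)%:E)%E by rewrite lee_fin.
have : {ae mu, forall x, (g x)%:E = 0%E}.
  apply: (ae_eq0_poweR q0 mgE g0E).
  by rewrite -ge0_Lnorm_pow ?gt_eqF// N0 poweR0r// gt_eqF.
by apply: ae_imp => x [].
Qed.

End series_in_Lnorm.

Section real_sequences.
Context {R : realType}.

(** The sequence is a telescoping series, which converges absolutely. *)
Lemma cvg_telescope (X d : nat -> R) (G : R) :
  (forall n, `|X n.+1 - X n| <= d n) -> (forall n, \sum_(i < n) d i <= G) ->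
  cvgn X.
Proof.
move=> Xd dG.
have : cvgn (series (telescope X)).
  apply: normed_cvg; apply: nondecreasing_is_cvgn.
    by apply: nondecreasing_series => *; exact: normr_ge0.
  exists G => _ [n _ <-].
  have -> : [normed series (telescope X)] n = \sum_(i < n) `|X i.+1 - X i|.
    by rewrite -(big_mkord xpredT (fun i => `|X i.+1 - X i|)).
  by apply: le_trans (dG n); apply: ler_sum => i _; exact: Xd.
rewrite telescopeK => cX.
have -> : X = (fun n => (X n - X 0%N) + X 0%N) by apply/funext => n; rewrite subrK.
by apply: is_cvgD => //; exact: is_cvg_cst.
Qed.

Lemma telescope_dist (X d : nat -> R) (n m : nat) :
  (forall n, `|X n.+1 - X n| <= d n) ->
  `|X (n + m)%N - X n| <= \sum_(i < m) d (n + i)%N.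
Proof.
move=> Xd; elim: m => [|m IH]; first by rewrite addn0 subrr normr0 big_ord0.
rewrite big_ord_recr/= addnS -[X _.+1](subrK (X (n + m)%N)) -addrA addrC.
by rewrite (le_trans (ler_normD _ _))// lerD.
Qed.

End real_sequences.

(** * Picard iteration *)

Section picard.
Context {R : realType} (al q : R) (al2 : 1 / 2 < al) (q2 : 2 < q).
Hypothesis gap : gam al q < 1.
Implicit Types (U V A : 'I_3 -> R -> vec3 R -> R) (a b : R -> vec3 R -> R).
Implicit Types (t s : R) (x y : vec3 R) (j k l : 'I_3).

Local Notation NE f := ('N[leb3 R]_q%:E[(fun x => (f x)%:E)])%E.

Let q0 : 0 < q. Proof. exact: lt_trans q2. Qed.
Let q1 : 1 <= q. Proof. by rewrite ltW// (lt_trans _ q2)// ltr1n. Qed.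

(** For bounded fields the bilinear estimate gains the positive power 1 - gam of the
time, which makes the nonlinear term small on short intervals. *)
Lemma bilinear_sup : exists2 C : R, 0 <= C & forall a b t (Ma Mb : R), 0 < t ->
  spacetime_measurable a -> spacetime_measurable b ->
  (forall s y, 0 <= a s y) -> (forall s y, 0 <= b s y) ->
  0 <= Ma -> 0 <= Mb ->
  (forall s, 0 < s -> s <= t -> (NE (a s) <= Ma%:E)%E) ->
  (forall s, 0 < s -> s <= t -> (NE (b s) <= Mb%:E)%E) ->
  ('N[leb3 R]_q%:E[duhamel_size (oseen_size al) (fun s y => a s y * b s y)%R t] <=
   (C * t `^ (1 - gam al q) * (Ma * Mb))%:E)%E.
Proof.
have [C C0 HC] := oseen_bilinear al2 q2.
have g0 := gam_ge0 al2 q2.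
have g1 : 0 < 1 - gam al q by rewrite subr_gt0.
exists (C / (1 - gam al q)); first by rewrite divr_ge0// ltW.
move=> a b t Ma Mb t0 ma mb a0 b0 Ma0 Mb0 aM bM.
apply: (le_trans (HC a b t ma mb a0 b0)).
have mw : measurable_fun [set: measurableTypeR R]
    (fun s : R => ((t - s) `^ (- gam al q))%:E).
  apply/measurable_EFinP.
  exact: (measurableT_comp (measurable_powR _) (measurable_time_reflect t)).
have mt : measurable (`[0, t]%classic : set (measurableTypeR R)) by exact: measurable_itv.
have CM0 : 0 <= C * (Ma * Mb) by rewrite mulr_ge0// mulr_ge0.
apply: (@le_trans _ _ (\int[leb1 R]_(s in `[0%R, t])
    ((C * (Ma * Mb))%:E * ((t - s) `^ (- gam al q))%:E))%E); last first.
  rewrite ge0_integralZl_EFin//; last 2 first.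
  - by move=> s _; rewrite lee_fin powR_ge0.
  - exact: measurable_funTS.
  rewrite integral_singular_weight// -EFinM lee_fin le_eqVlt; apply/orP; left.
  by apply/eqP; field; rewrite gt_eqF.
apply: ae_ge0_le_integral => //.
- by move=> s _; rewrite !mule_ge0 ?lee_fin ?mulr_ge0 ?powR_ge0 ?Lnorm_ge0.
- apply: measurable_funTS; apply: emeasurable_funM.
    apply/measurable_EFinP; apply: measurable_funM => //.
    exact: (measurableT_comp (measurable_powR _) (measurable_time_reflect t)).
  by apply: emeasurable_funM; exact: measurable_Lnorm_slice.
- by move=> s _; rewrite mule_ge0 ?lee_fin ?powR_ge0.
- by apply: measurable_funTS; apply: emeasurable_funM.
apply: ae_imp (ae_neq_point 0) => s s0; rewrite /= in_itv/= => /andP[s0' st].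
have {s0 s0'}s0 : 0 < s by rewrite lt_neqAle eq_sym s0.
rewrite -EFinM (_ : C * (Ma * Mb) * _ = C * (t - s) `^ (- gam al q) * (Ma * Mb)); last first.
  by rewrite mulrAC.
rewrite [leRHS]EFinM; apply: lee_pmul => //.
- by rewrite lee_fin mulr_ge0 ?powR_ge0.
- by rewrite mule_ge0// Lnorm_ge0.
by rewrite EFinM; apply: lee_pmul; rewrite ?Lnorm_ge0 ?aM ?bM.
Qed.

Lemma nonlinear0 j t x : nonlinear al (fun _ _ _ => 0) j t x = 0.
Proof.
rewrite /nonlinear (_ : (fun s => _) = (fun=> 0)); first by rewrite Rintegral_cst// ?mul0r//.
apply/funext => s; rewrite big1// => k _; rewrite big1// => l _.
rewrite /convolution (_ : (fun y => _) = (fun=> 0)); first by rewrite Rintegral_cst// mul0r.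
by apply/funext => y; rewrite mulr0 mulr0.
Qed.

Lemma duhamel_size_finite C U t : field_measurable U ->
  ('N[leb3 R]_q%:E[duhamel_size (oseen_size al)
     (fun s y => field_size U s y * field_size U s y)%R t] <= C%:E)%E ->
  {ae leb3 R, forall x, (duhamel_size (oseen_size al)
     (fun s y => field_size U s y * field_size U s y)%R t x < +oo)%E}.
Proof.
move=> mU HC; apply: (@ae_lt_Lnorm _ _ _ (leb3 R) q) => //.
- apply: (@measurableT_comp _ _ _ _ _ _ _ _ (fun x : mvec3 R => (t, x) : mtimevec3 R)
    (measurable_duhamel_size _ _)).
  + exact: measurable_oseen_size.
  + by apply: measurable_funM; exact: measurable_field_size.
  + exact: measurable_pair1.
- by move=> x; exact: duhamel_size_ge0.
by apply: (le_lt_trans HC); rewrite ltry.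
Qed.

Lemma measurable_fieldB U V : field_measurable U -> field_measurable V ->
  field_measurable (fun k s y => U k s y - V k s y).
Proof. by move=> mU mV k; apply: measurable_funB; [exact: mU|exact: mV]. Qed.

Lemma NE_add (f g : vec3 R -> R) :
  measurable_fun [set: mvec3 R] f -> measurable_fun [set: mvec3 R] g ->
  (forall x, 0 <= f x) -> (forall x, 0 <= g x) ->
  (NE (fun x => f x + g x) <= NE f + NE g)%E.
Proof.
move=> mf mg f0 g0; apply: (@ge0_minkowski _ _ _ (leb3 R)
  (fun x => (f x)%:E) (fun x => (g x)%:E) q).
- exact/measurable_EFinP.
- exact/measurable_EFinP.
- by move=> x; rewrite lee_fin.
- by move=> x; rewrite lee_fin.
- exact: q1.
Qed.

Lemma NE_le (f g : vec3 R -> R) :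
  measurable_fun [set: mvec3 R] f -> measurable_fun [set: mvec3 R] g ->
  (forall x, 0 <= f x) -> (forall x, f x <= g x) -> (NE f <= NE g)%E.
Proof.
move=> mf mg f0 fg; apply: (@le_Lnorm _ _ _ (leb3 R)
  (fun x => (f x)%:E) (fun x => (g x)%:E) q q0).
- exact/measurable_EFinP.
- exact/measurable_EFinP.
- by move=> x; rewrite !lee_fin f0 fg.
Qed.

Lemma nonlinear_lipschitz : exists2 C : R, 0 <= C & forall U V t (M D : R), 0 < t ->
  field_measurable U -> field_measurable V -> 0 <= M -> 0 <= D ->
  (forall s, 0 < s -> s <= t -> (NE (field_size U s) <= M%:E)%E) ->
  (forall s, 0 < s -> s <= t -> (NE (field_size V s) <= M%:E)%E) ->
  (forall s, 0 < s -> s <= t ->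
    (NE (field_size (fun k s y => U k s y - V k s y) s) <= D%:E)%E) ->
  {ae leb3 R, forall x, (duhamel_size (oseen_size al)
     (fun s y => field_size U s y * field_size U s y)%R t x < +oo)%E} /\
  (NE (fun x => \sum_j `|nonlinear al U j t x - nonlinear al V j t x|) <=
   (C * t `^ (1 - gam al q) * (2 * M * D))%:E)%E.
Proof.
have [C C0 HC] := bilinear_sup; exists C; first exact: C0.
move=> U V t M D t0 mU mV M0 D0 UM VM UVD.
have fin W : field_measurable W ->
    (forall s, 0 < s -> s <= t -> (NE (field_size W s) <= M%:E)%E) ->
    {ae leb3 R, forall x, (duhamel_size (oseen_size al)
       (fun s y => field_size W s y * field_size W s y)%R t x < +oo)%E}.
  move=> mW WM; have mWs := measurable_field_size mW.
  apply: (duhamel_size_finite mW).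
  by apply: (HC _ _ t M M t0 mWs mWs) => // *; exact: field_size_ge0.
split; first exact: fin.
have mUV := measurable_fieldB mU mV.
have mUs := measurable_field_size mU; have mVs := measurable_field_size mV.
have mS : spacetime_measurable (fun s y => field_size U s y + field_size V s y).
  exact: measurable_funD.
have mP : spacetime_measurable (fun s y => (field_size U s y + field_size V s y) *
     field_size (fun k s y => U k s y - V k s y) s y).
  by apply: measurable_funM => //; exact: measurable_field_size.
apply: (@le_trans _ _ ('N[leb3 R]_q%:E[duhamel_size (oseen_size al)
    (fun s y => (field_size U s y + field_size V s y) *
     field_size (fun k s y => U k s y - V k s y) s y)%R t])%E); last first.
  apply: HC => //.
  - exact: measurable_field_size.
  - by move=> s y; rewrite addr_ge0 ?field_size_ge0.
  - by move=> s y; exact: field_size_ge0.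
  - by rewrite mulr_ge0.
  move=> s s0 st; rewrite mulr_natl mulr2n EFinD.
  apply: le_trans (leeD (UM s s0 st) (VM s s0 st)).
  by apply: NE_add; [exact: spacetime_measurable_slice..|
    exact: field_size_ge0|exact: field_size_ge0].
apply: ae_le_Lnorm => //.
- apply/measurable_EFinP; apply: measurable_sum => j; apply: measurableT_comp => //.
  apply: measurable_funB.
    by apply: spacetime_measurable_slice; exact: measurable_nonlinear.
  by apply: spacetime_measurable_slice; exact: measurable_nonlinear.
- apply: (@measurableT_comp _ _ _ _ _ _ _ _ (fun x : mvec3 R => (t, x) : mtimevec3 R)
    (measurable_duhamel_size _ mP)); last exact: measurable_pair1.
  exact: measurable_oseen_size.
apply: ae_imp (ae_and (fin U mU UM) (fin V mV VM)) => x [QU QV].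
rewrite gee0_abs ?lee_fin ?sumr_ge0// gee0_abs ?duhamel_size_ge0//.
exact: nonlinear_diff.
Qed.

Lemma NE_field_size_triangle U V W t : field_measurable U -> field_measurable V ->
  (forall k s y, W k s y = U k s y + V k s y) ->
  (NE (field_size W t) <= NE (field_size U t) + NE (field_size V t))%E.
Proof.
move=> mU mV WUV.
have mUs := measurable_field_size mU; have mVs := measurable_field_size mV.
have mW : field_measurable W.
  move=> k; rewrite (_ : W k = fun s y => U k s y + V k s y); last first.
    by apply/funext => s; apply/funext => y.
  by apply: measurable_funD; [exact: mU|exact: mV].
have mWs := measurable_field_size mW.
apply: (@le_trans _ _ (NE (fun x => field_size U t x + field_size V t x))); last first.
  by apply: NE_add; [exact: spacetime_measurable_slice..|
    exact: field_size_ge0|exact: field_size_ge0].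
apply: le_Lnorm => //.
- by apply/measurable_EFinP; exact: spacetime_measurable_slice.
- apply/measurable_EFinP; apply: measurable_funD;
    by apply: spacetime_measurable_slice.
move=> x; rewrite !lee_fin field_size_ge0 /field_size -big_split/=.
by apply: ler_sum => k _; rewrite WUV ler_normD.
Qed.

Fixpoint picard_iterate A (n : nat) : 'I_3 -> R -> vec3 R -> R :=
  if n is n.+1 then fun j t x => A j t x - nonlinear al (picard_iterate A n) j t x
  else A.

(** Picard's iterates, started from the linear part [A], contract at rate 1/2 in
the supremum over time of the norm in space as long as the time is short. *)
Lemma picard_fixed_point (A : 'I_3 -> R -> vec3 R -> R) (M : R) :
  field_measurable A -> 0 < M ->
  (forall t, 0 < t -> (NE (field_size A t) <= M%:E)%E) ->
  exists2 T0 : R, 0 < T0 & forall T, 0 < T -> T <= T0 ->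
  exists2 U : 'I_3 -> R -> vec3 R -> R, field_measurable U &
  forall t, 0 < t -> t <= T -> (NE (field_size U t) <= (4 * M)%:E)%E /\
    {ae leb3 R, forall x, forall j, U j t x = A j t x - nonlinear al U j t x}.
Proof.
move=> mA M0 AM; have [C C0 lip] := nonlinear_lipschitz.
have M0' : 0 <= M by exact: ltW.
have M24 : 2 * M <= 4 * M by rewrite ler_wpM2r// ler_nat.
have M12 : M <= 2 * M by rewrite ler_peMl// ler1n.
have M124 : M + 2 * M <= 4 * M by lra.
have g1 : 0 < 1 - gam al q by rewrite subr_gt0.
(* the Lipschitz constant on the ball of radius 4 M becomes at most 1/2 *)
pose e : R := (16 * (C + 1) * M)^-1.
have e0 : 0 < e by rewrite invr_gt0 !mulr_gt0// ltr_wpDl.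
exists (e `^ (1 - gam al q)^-1); first exact: powR_gt0.
move=> T T0 Te.
have small t : 0 < t -> t <= T -> C * t `^ (1 - gam al q) * (16 * M) <= 1.
  move=> t0 tT.
  have te : t `^ (1 - gam al q) <= e.
    have -> : e = (e `^ (1 - gam al q)^-1) `^ (1 - gam al q).
      by rewrite -powRrM mulVf ?gt_eqF// powRr1// ltW.
    by rewrite ge0_ler_powR ?nnegrE ?powR_ge0 ?(ltW t0) ?(ltW g1)// (le_trans tT).
  have H1 : C * t `^ (1 - gam al q) <= (C + 1) * e.
    by rewrite ler_pM ?powR_ge0// lerDl.
  apply: (@le_trans _ _ ((C + 1) * e * (16 * M))).
    by rewrite ler_wpM2r// mulr_ge0.
  rewrite /e le_eqVlt; apply/orP; left; apply/eqP; field.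
  by rewrite !gt_eqF// ltr_wpDl.
pose Z := fun (k : 'I_3) (s : R) (y : vec3 R) => 0 : R.
have mZ : field_measurable Z by move=> k; exact: measurable_cst.
have Z0 s : (NE (field_size Z s) <= 0%:E)%E.
  rewrite (_ : (fun x => _) = cst 0%E); first by rewrite Lnorm0// eqe gt_eqF.
  by apply/funext => x; rewrite /field_size big1// => k _; rewrite normr0.
pose X := picard_iterate A.
have XS n j t x : X n.+1 j t x = A j t x - nonlinear al (X n) j t x by [].
have mX n : field_measurable (X n).
  elim: n => [//|n IH] k /=; apply: measurable_funB; first exact: mA.
  exact: measurable_nonlinear.
(* a perturbation of size D inside the ball of radius 4 M is halved *)
have half U V t (D : R) : 0 < t -> t <= T -> field_measurable U -> field_measurable V ->
    0 <= D ->
    (forall s, 0 < s -> s <= t -> (NE (field_size U s) <= (4 * M)%:E)%E) ->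
    (forall s, 0 < s -> s <= t -> (NE (field_size V s) <= (4 * M)%:E)%E) ->
    (forall s, 0 < s -> s <= t ->
      (NE (field_size (fun k s y => U k s y - V k s y) s) <= D%:E)%E) ->
    (NE (fun x => \sum_j `|nonlinear al U j t x - nonlinear al V j t x|) <=
      (D / 2)%:E)%E.
  move=> t0 tT mU mV D0 UM VM UVD.
  have M40 : 0 <= 4 * M by rewrite mulr_ge0.
  have [_ H] := lip U V t (4 * M) D t0 mU mV M40 D0 UM VM UVD.
  apply: (le_trans H); rewrite lee_fin.
  rewrite (_ : _ * (2 * (4 * M) * D) = C * t `^ (1 - gam al q) * (16 * M) * (D / 2)).
    by rewrite ler_piMl ?divr_ge0// small.
  by field.
have nlZ U j t x : nonlinear al U j t x - nonlinear al Z j t x = nonlinear al U j t x.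
  by rewrite nonlinear0 subr0.
have nl_bound U t : 0 < t -> t <= T -> field_measurable U ->
    (forall s, 0 < s -> s <= t -> (NE (field_size U s) <= (2 * M)%:E)%E) ->
    (NE (fun x => \sum_j `|nonlinear al U j t x|) <= M%:E)%E.
  move=> t0 tT mU UM.
  have := half U Z t (2 * M) t0 tT mU mZ.
  rewrite (_ : 2 * M / 2 = M); last by field.
  under [X in Lnorm _ _ X]eq_fun do under eq_bigr do rewrite nlZ.
  apply.
  - by rewrite mulr_ge0.
  - by move=> s s0 st; apply: (le_trans (UM s s0 st)); rewrite lee_fin.
  - by move=> s s0 st; apply: (le_trans (Z0 s)); rewrite lee_fin mulr_ge0.
  move=> s s0 st; apply: le_trans (UM s s0 st).
  rewrite (_ : (fun k s y => U k s y - Z k s y) = U)//.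
  by apply/funext => k; apply/funext => s'; apply/funext => y; rewrite subr0.
have XM n t : 0 < t -> t <= T -> (NE (field_size (X n) t) <= (2 * M)%:E)%E.
  elim: n t => [|n IH] t t0 tT.
    by apply: (le_trans (AM t t0)); rewrite lee_fin.
  have mN : field_measurable (fun j s y => - nonlinear al (X n) j s y).
    by move=> j; apply: measurableT_comp => //; exact: measurable_nonlinear.
  apply: (le_trans (NE_field_size_triangle t mA mN (fun _ _ _ => erefl))).
  rewrite mulr_natl mulr2n EFinD leeD ?AM//.
  rewrite (_ : (fun x => _) = (fun x => (\sum_j `|nonlinear al (X n) j t x|)%:E)).
    apply: nl_bound => // s s0 st; apply: IH => //; exact: le_trans tT.
  by apply/funext => x; congr (_%:E); apply: eq_bigr => j _; rewrite normrN.
have alg (a b c : R) : `|a - b - (a - c)| = `|b - c|.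
  by rewrite opprB addrC addrA subrK distrC.
have alg' (a b c r : R) : `|a - (b - c)| <= `|a - (b - r)| + `|c - r|.
  rewrite (_ : a - (b - c) = a - (b - r) + (c - r)); first exact: ler_normD.
  by ring.
pose dX n k s y := X n.+1 k s y - X n k s y.
have mdX n : field_measurable (dX n) by exact: measurable_fieldB.
have dXM n t : 0 < t -> t <= T -> (NE (field_size (dX n) t) <= (M / 2 ^+ n)%:E)%E.
  elim: n t => [|n IH] t t0 tT.
    rewrite expr0 divr1.
    rewrite (_ : (fun x => _) = (fun x => (\sum_j `|nonlinear al A j t x|)%:E)).
      apply: nl_bound => // s s0 st; apply: (le_trans (AM s s0)).
      by rewrite lee_fin.
    apply/funext => x; congr (_%:E); apply: eq_bigr => j _.
    by rewrite /dX/= addrC addKr normrN.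
  rewrite (_ : (fun x => _) = (fun x =>
      (\sum_j `|nonlinear al (X n.+1) j t x - nonlinear al (X n) j t x|)%:E)).
    rewrite exprSr invfM mulrA; apply: half => //.
    - by rewrite divr_ge0// exprn_ge0.
    - move=> s s0 st; apply: (le_trans (XM n.+1 s s0 (le_trans st tT))).
      by rewrite lee_fin.
    - move=> s s0 st; apply: (le_trans (XM n s s0 (le_trans st tT))).
      by rewrite lee_fin.
    - by move=> s s0 st; apply: IH => //; exact: le_trans tT.
  apply/funext => x; congr (_%:E); apply: eq_bigr => j _.
  exact: alg.
(* the upper limit is measurable, and is the limit wherever the iterates converge *)
pose U k t x := fine (limn_esup (fun n => (X n k t x)%:E)).
have mU : field_measurable U.
  move=> k; apply: measurableT_comp => //.
  apply: (@measurable_fun_limn_esup _ _ _ _ (fun n (z : mtimevec3 R) => (X n k z.1 z.2)%:E)).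
  by move=> n; apply/measurable_EFinP; exact: mX.
have UX n t : 0 < t -> t <= T ->
    (NE (field_size (fun k s y => U k s y - X n k s y) t) <= (2 * (M / 2 ^+ n))%:E)%E.
  move=> t0 tT.
  have c0 : 0 <= M / 2 ^+ n by rewrite divr_ge0// exprn_ge0.
  have mg i : measurable_fun [set: mvec3 R] (field_size (dX (n + i)%N) t).
    by apply: spacetime_measurable_slice; exact: measurable_field_size.
  have gM i : (NE (field_size (dX (n + i)%N) t) <= (M / 2 ^+ n / 2 ^+ i)%:E)%E.
    by rewrite -mulrA -invfM -exprD dXM.
  have [G [mG G0 Gsum GN]] := @series_Lnorm _ _ _ (leb3 R) q _ _ q1 c0 mg
    (fun i x => field_size_ge0 _ _ _) gM.
  apply: (le_trans _ GN); apply: ae_le_Lnorm => //.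
    apply/measurable_EFinP; apply: spacetime_measurable_slice.
    by apply: measurable_field_size; exact: measurable_fieldB.
  have : {ae leb3 R, forall x, (G x < +oo)%E}.
    apply: (ae_lt_Lnorm q0 mG G0).
    by apply: (le_lt_trans GN); rewrite ltry.
  apply: ae_imp => x Gx; pose gx := fine (G x).
  have Gfin : G x \is a fin_num by rewrite ge0_fin_numE.
  have sum_gx m : \sum_(i < m) field_size (dX (n + i)%N) t x <= gx.
    by rewrite -lee_fin (fineK Gfin).
  have cX k : cvgn (fun m => X (n + m)%N k t x).
    apply: (@cvg_telescope R _ (fun i => field_size (dX (n + i)%N) t x) gx) => // i.
    by rewrite addnS; exact: (le_field_size (dX (n + i)%N)).
  have XU k : X (n + m)%N k t x @[m --> \oo] --> U k t x.
    have cl : X m k t x @[m --> \oo] --> limn (fun m => X (n + m)%N k t x).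
      rewrite -(cvg_shiftn n); under eq_fun do rewrite addnC.
      exact: cX.
    have cl' : (X m k t x)%:E @[m --> \oo] --> (limn (fun m => X (n + m)%N k t x))%:E.
      by apply/fine_cvgP; split; [exact: nearW|exact: cl].
    by rewrite /U (cvg_limn_einf_sup cl').2; exact: cX.
  rewrite gee0_abs ?lee_fin ?field_size_ge0// gee0_abs// -(fineK Gfin) lee_fin.
  have cS : \sum_k `|X (n + m)%N k t x - X n k t x| @[m --> \oo] -->
      \sum_k `|U k t x - X n k t x|.
    apply: cvg_big => [|k _]; first exact: add_continuous.
    apply: cvg_norm; apply: cvgB; [exact: XU|exact: cvg_cst].
  rewrite /field_size -(cvg_lim _ cS)//; apply: limr_le; first by apply/cvg_ex; exists (\sum_k `|U k t x - X n k t x|).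
  apply: nearW => m; apply: (le_trans _ (sum_gx m)); rewrite /field_size exchange_big/=.
  apply: ler_sum => k _.
  apply: (telescope_dist (X := fun m => X m k t x) (d := fun i => `|dX i k t x|)).
  by move=> i.
have NU s : 0 < s -> s <= T -> (NE (field_size U s) <= (4 * M)%:E)%E.
  move=> s0 sT; have mUX := measurable_fieldB mU mA.
  apply: le_trans (NE_field_size_triangle (W := U) s mA mUX _) _.
    by move=> k r y; rewrite addrC subrK.
  apply: le_trans (leeD (AM s s0) (UX 0%N s s0 sT)) _.
  by rewrite -EFinD lee_fin expr0 divr1.
exists U => // t t0 tT; split; first exact: NU.
pose g (x : vec3 R) : R := \sum_j `|U j t x - (A j t x - nonlinear al U j t x)|.
have mg : measurable_fun [set: mvec3 R] g.
  apply: measurable_sum => j; apply: measurableT_comp => //.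
  apply: (@spacetime_measurable_slice _ (fun t x => U j t x - (A j t x - nonlinear al U j t x))).
  apply: measurable_funB; first exact: mU.
  by apply: measurable_funB; [exact: mA|exact: measurable_nonlinear].
have g_ge0 x : 0 <= g x by exact: sumr_ge0.
have gn n : (NE g <= (2 * (M / 2 ^+ n))%:E)%E.
  pose E (x : vec3 R) : R := \sum_j `|nonlinear al U j t x - nonlinear al (X n) j t x|.
  have mE : measurable_fun [set: mvec3 R] E.
    apply: measurable_sum => j; apply: measurableT_comp => //.
    apply: measurable_funB; apply: spacetime_measurable_slice;
      exact: measurable_nonlinear.
  have mUX := measurable_fieldB mU (mX n.+1).
  have mUXs : measurable_fun [set: mvec3 R] (field_size (fun k s y => U k s y - X n.+1 k s y) t).
    by apply: spacetime_measurable_slice; exact: measurable_field_size.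
  have E0 x : 0 <= E x by exact: sumr_ge0.
  apply: (@le_trans _ _ (NE (fun x => field_size (fun k s y => U k s y - X n.+1 k s y) t x + E x))).
    apply: (NE_le mg (measurable_funD mUXs mE)) => // x.
    have -> : g x <= field_size (fun k s y => U k s y - X n.+1 k s y) t x + E x; last by [].
    rewrite /g /E /field_size -big_split/=; apply: ler_sum => j _.
    exact: alg'.
  apply: (le_trans (NE_add mUXs mE (field_size_ge0 _ _) E0)).
  rewrite (_ : 2 * (M / 2 ^+ n) = 2 * (M / 2 ^+ n.+1) + 2 * (M / 2 ^+ n) / 2); last first.
    by rewrite exprS; field; rewrite expf_neq0.
  rewrite EFinD leeD ?UX//; apply: half => //.
  - by rewrite mulr_ge0// divr_ge0// exprn_ge0.
  - by move=> s s0 st; apply: NU => //; exact: le_trans tT.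
  - move=> s s0 st; apply: (le_trans (XM n s s0 (le_trans st tT))).
    by rewrite lee_fin.
  - by move=> s s0 st; apply: UX => //; exact: le_trans tT.
have : {ae leb3 R, forall x, g x = 0}.
  apply: (ae_eq0_Lnorm q0 mg g_ge0); apply/lee_addgt0Pr => eps eps0.
  rewrite add0e.
  have [n Hn] : exists n : nat, 2 * (M / 2 ^+ n) <= eps.
    pose m := (Num.truncn (2 * M / eps)).+1; exists m.
    have H : 2 * M / eps <= 2 ^+ m.
      apply: (le_trans (ltW (truncnS_gt _))).
      by rewrite -[leRHS]natrX ler_nat ltnW// ltn_expl.
    have P2 : 0 < 2 ^+ m :> R by exact: exprn_gt0.
    rewrite (ler_pdivrMr _ _ eps0) in H.
    by rewrite mulrA (ler_pdivrMr _ _ P2) (mulrC eps).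
  by apply: (le_trans (gn n)); rewrite lee_fin.
apply: ae_imp => x gx0 j; apply/eqP; rewrite -subr_eq0 -normr_eq0.
by move/eqP : gx0; rewrite psumr_eq0// => /allP/(_ j (mem_index_enum _)).
Qed.

End picard.

(** * Volterra inequalities with a singular kernel *)

Section volterra.
Context {R : realType}.
Implicit Types (t s T : R).
Local Open Scope ereal_scope.
Local Notation mR := (measurableTypeR R).

Lemma measurable_time_itv T : measurable (`[0%R, T]%classic : set mR).
Proof. exact: measurable_itv. Qed.

Let nonneg : set mR := `[0%R, +oo[.

Definition causal (k : R -> \bar R) (s : R) : \bar R := (\1_nonneg s)%:E * k s.

Lemma measurable_causal k : measurable_fun [set: mR] k -> measurable_fun [set: mR] (causal k).
Proof.
move=> mk; apply: emeasurable_funM => //; apply/measurable_EFinP.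
by apply: measurable_indic; exact: measurable_itv.
Qed.

Lemma causal_ge0 k s : (forall s, 0 <= k s) -> 0 <= causal k s.
Proof. by move=> k0; rewrite mule_ge0// lee_fin. Qed.

(** Extended by 0 to negative times, the functions are convolved on the line. *)
Lemma time_convolutionE t (k m : R -> \bar R) :
  \int[leb1 R]_(s in `[0%R, t]) (k (t - s)%R * m s) =
  \int[leb1 R]_s (causal k (t - s)%R * causal m s).
Proof.
rewrite (integral_eindicM (leb1 R) _ (fun s => k (t - s)%R * m s)).
apply: eq_integral => s _; rewrite /causal muleACA; congr (_ * _).
rewrite -EFinM; congr (_%:E); rewrite !indicE -natrM mulnb; congr (nat_of_bool _)%:R.
apply/idP/idP.
  move=> /set_mem/=; rewrite in_itv/= => /andP[? ?]; apply/andP; split;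
    apply/mem_set; rewrite /nonneg /= in_itv/= andbT; lra.
move=> /andP[/set_mem + /set_mem]; rewrite /nonneg /= !in_itv/= !andbT => ? ?.
by apply/mem_set => /=; rewrite in_itv/=; apply/andP; split; lra.
Qed.

Let mconv (k m : R -> \bar R) : measurable_fun [set: mR] k -> measurable_fun [set: mR] m ->
  measurable_fun [set: mR * mR] (fun z : mR * mR => k (z.1 - z.2)%R * m z.2).
Proof.
move=> mk mm.
apply: emeasurable_funM; last exact: (measurableT_comp mm measurable_snd).
have msub : measurable_fun [set: mR * mR] (fun z : mR * mR => (z.1 - z.2)%R : mR).
  by apply: measurable_funB; [exact: measurable_fst|exact: measurable_snd].
exact: (measurableT_comp mk msub).
Qed.

Lemma measurable_time_convolution (k m : R -> \bar R) :
  measurable_fun [set: mR] k -> measurable_fun [set: mR] m ->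
  (forall s, 0 <= k s) -> (forall s, 0 <= m s) ->
  measurable_fun [set: mR] (fun t => \int[leb1 R]_(s in `[0%R, t]) (k (t - s)%R * m s)).
Proof.
move=> mk mm k0 m0; under eq_fun do rewrite time_convolutionE.
apply: (@measurable_fun_fubini_tonelli_F _ _ _ _ _ (leb1 R)
  (fun z : mR * mR => causal k (z.1 - z.2)%R * causal m z.2)).
  by apply: mconv; exact: measurable_causal.
by move=> z; rewrite mule_ge0 ?causal_ge0.
Qed.

(** Tonelli's theorem for a convolution restricted to the times in [0, T]. *)
Lemma time_convolution_le T (k m : R -> \bar R) :
  measurable_fun [set: mR] k -> measurable_fun [set: mR] m ->
  (forall s, 0 <= k s) -> (forall s, 0 <= m s) ->
  \int[leb1 R]_(t in `[0%R, T]) \int[leb1 R]_(s in `[0%R, t]) (k (t - s)%R * m s) <=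
  (\int[leb1 R]_(s in `[0%R, T]) k s) * (\int[leb1 R]_(s in `[0%R, T]) m s).
Proof.
move=> mk mm k0 m0.
pose I : R -> R := \1_(`[0%R, T] : set mR).
have mI : measurable_fun [set: mR] (fun s => (I s)%:E).
  by apply/measurable_EFinP; apply: measurable_indic; exact: measurable_time_itv.
pose K s := (I s)%:E * k s; pose M s := (I s)%:E * m s.
have mK : measurable_fun [set: mR] K by exact: emeasurable_funM.
have mM : measurable_fun [set: mR] M by exact: emeasurable_funM.
have I0 s : (0 <= I s)%R by rewrite /I indicE.
have K0 s : 0 <= K s by rewrite mule_ge0// lee_fin.
have M0 s : 0 <= M s by rewrite mule_ge0// lee_fin.
have KM0 (z : mR * mR) : 0 <= K (z.1 - z.2)%R * M z.2 by rewrite mule_ge0.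
apply: (@le_trans _ _ (\int[leb1 R]_t \int[leb1 R]_s (K (t - s)%R * M s))).
  have mF : measurable_fun [set: mR] (fun t => \int[leb1 R]_s (K (t - s)%R * M s)).
    by apply: (@measurable_fun_fubini_tonelli_F _ _ _ _ _ (leb1 R)
      (fun z : mR * mR => K (z.1 - z.2)%R * M z.2)); [exact: mconv|exact: KM0].
  have F0 t : 0 <= \int[leb1 R]_s (K (t - s)%R * M s).
    by apply: integral_ge0 => s _; exact: (KM0 (t, s)).
  apply: (@le_trans _ _ (\int[leb1 R]_(t in `[0%R, T]) \int[leb1 R]_s (K (t - s)%R * M s))).
    rewrite le_eqVlt; apply/orP; left; apply/eqP; apply: eq_integral => t /set_mem/=.
    rewrite in_itv/= => /andP[t0 tT].
    rewrite (integral_eindicM (leb1 R) _ (fun s => k (t - s)%R * m s)).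
    apply: eq_integral => s _; rewrite /K /M muleACA; congr (_ * _).
    rewrite -EFinM; congr (_%:E); rewrite /I !indicE -natrM mulnb; congr (nat_of_bool _)%:R.
    apply/idP/idP.
      move=> /set_mem/=; rewrite in_itv/= => /andP[? ?]; apply/andP; split;
        apply/mem_set; rewrite /= in_itv/=; apply/andP; split; lra.
    move=> /andP[/set_mem + /set_mem]; rewrite /= !in_itv/= => /andP[? ?] /andP[? ?].
    by apply/mem_set => /=; rewrite in_itv/=; apply/andP; split; lra.
  apply: ge0_subset_integral => //; exact: measurable_time_itv.
rewrite (@fubini_tonelli _ _ _ _ R (leb1 R) (leb1 R) (fun z => K (z.1 - z.2)%R * M z.2))//=;
  last exact: mconv.
apply: (@le_trans _ _ (\int[leb1 R]_s ((\int[leb1 R]_t K t) * M s))); last first.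
  rewrite ge0_integralZl//; last by apply: integral_ge0 => s _.
  rewrite -(integral_eindicM (leb1 R) _ k) -(integral_eindicM (leb1 R) _ m).
  exact: lexx.
rewrite le_eqVlt; apply/orP; left; apply/eqP; apply: eq_integral => s _.
have mKs : measurable_fun [set: mR] (fun t : mR => K (t - s)%R).
  apply: (measurableT_comp mK (g := fun t : mR => (t - s)%R : mR)).
  exact: measurable_funB.
rewrite ge0_integralZr; [|exact: measurableT|exact: mKs|by move=> t _; exact: K0|exact: M0].
congr (_ * _).
rewrite [in RHS](@ge0_integral_line_affine _ 1 (- s)%R)// normr1 mul1e.
by apply: eq_integral => t _; rewrite mul1r.
Qed.

(** A large rate [lam] makes the integral small, because exp(- lam s) <= C (lam s)^(- eta)
and the singularity is integrable with room to spare for [eta]. *)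
Lemma exponential_weight_small (sg T eps : R) : (0 <= sg < 1)%R -> (0 < T)%R -> (0 < eps)%R ->
  exists lam : R, \int[leb1 R]_(s in `[0%R, T])
    (expR (- (lam * s)) * s `^ (- sg))%:E <= eps%:E.
Proof.
move=> /andP[sg0 sg1] T0 eps0.
pose eta := ((1 - sg) / 2)%R.
have eta0 : (0 < eta)%R by rewrite divr_gt0// subr_gt0.
have [C HC] := powR_expRN_le (ltW eta0).
have C0 : (0 <= C)%R.
  by apply: le_trans (HC 0%R (lexx _)); rewrite mulr_ge0 ?powR_ge0 ?expR_ge0.
have se1 : (sg + eta < 1)%R by rewrite /eta; lra.
pose D := (T `^ (1 - (sg + eta)) / (1 - (sg + eta)))%R.
have D0 : (0 <= D)%R by rewrite divr_ge0 ?powR_ge0// subr_ge0 ltW.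
pose lam := (((C * D + 1) / eps) `^ eta^-1)%R.
have CD0 : (0 < (C * D + 1) / eps)%R by rewrite divr_gt0// ltr_wpDl// mulr_ge0.
have lam0 : (0 < lam)%R by exact: powR_gt0.
exists lam.
have mse : measurable_fun [set: mR] (fun s : R => (s `^ (- (sg + eta)))%:E).
  by apply/measurable_EFinP; exact: measurable_powR.
apply: (@le_trans _ _ (\int[leb1 R]_(s in `[0%R, T])
    ((C / lam `^ eta)%:E * (s `^ (- (sg + eta)))%:E))).
  apply: ae_ge0_le_integral => //.
  - by move=> s _; rewrite lee_fin mulr_ge0 ?expR_ge0 ?powR_ge0.
  - apply: measurable_funTS; apply/measurable_EFinP; apply: measurable_funM.
      apply: (measurableT_comp (continuous_measurable_fun (@continuous_expR R))).
      by apply: measurableT_comp => //; exact: measurable_funM.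
    exact: measurable_powR.
  - by move=> s _; rewrite -EFinM lee_fin mulr_ge0 ?divr_ge0 ?powR_ge0.
  - by apply: measurable_funTS; apply: emeasurable_funM.
  apply: ae_imp (ae_neq_point 0) => s s0; rewrite /= in_itv/= => /andP[s0' sT].
  have {s0 s0'}s0 : (0 < s)%R by rewrite lt_neqAle eq_sym s0.
  rewrite -EFinM lee_fin opprD powRD; last by rewrite (gt_eqF s0) implybT.
  rewrite (mulrC (s `^ (- sg))%R) mulrA ler_wpM2r ?powR_ge0//.
  rewrite powRN -mulrA -invfM -powRM ?(ltW s0) ?(ltW lam0)//.
  rewrite ler_pdivlMr ?powR_gt0 ?mulr_gt0// mulrC.
  by apply: HC; rewrite mulr_ge0 ?(ltW s0) ?(ltW lam0).
rewrite ge0_integralZl_EFin//; last 3 first.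
- by move=> s _; rewrite lee_fin powR_ge0.
- exact: measurable_funTS.
- by rewrite divr_ge0// powR_ge0.
have -> : \int[leb1 R]_(s in `[0%R, T]) (s `^ (- (sg + eta)))%:E = D%:E.
  rewrite -integral_powR_0//; apply/esym.
  by apply: integral_itv_obnd_cbnd; exact: measurable_funTS.
rewrite -EFinM lee_fin /lam -powRrM mulVf ?gt_eqF// powRr1 ?(ltW CD0)//.
rewrite mulrAC invf_div mulrA ler_pdivrMr; last by rewrite ltr_wpDl// mulr_ge0.
by rewrite mulrC ler_wpM2l ?(ltW eps0)// lerDl.
Qed.

Lemma lee_poweR_1D (a : \bar R) (r P : R) : (0 < r)%R -> (r <= P)%R -> 0 <= a ->
  a `^ r <= 1 + a `^ P.
Proof.
move=> r0 rP a0; have P0 : (0 < P)%R by exact: lt_le_trans rP.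
have aP : 0 <= a `^ P by exact: poweR_ge0.
have [a1|a1] := leP a 1.
  apply: (@le_trans _ _ 1); last by rewrite leeDl.
  by apply: (le_trans (lee_poweR (ltW r0) a0 a1)); rewrite poweR_EFin powR1.
apply: (@le_trans _ _ (a `^ P)); last by rewrite leeDr.
case: a a0 a1 {aP} => [a| |]//; rewrite ?lee_fin ?lte_fin => a0 a1.
  by rewrite ler_powR// ltW.
by rewrite !poweRyr ?gt_eqF.
Qed.

(** Hoelder's inequality in time turns the linear inequality with a coefficient
[H] in L^P into one for the power [P'] of [n] with a constant coefficient; the
kernel stays integrable because 1/P < 1 - g. *)
Lemma volterra_hoelder (g P T C : R) (n H : R -> \bar R) (t : R) :
  (1 < P)%R -> (0 <= C)%R -> (t <= T)%R ->
  measurable_fun [set: mR] n -> measurable_fun [set: mR] H ->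
  (forall s, 0 <= n s) -> (forall s, 0 <= H s) ->
  n t <= \int[leb1 R]_(s in `[0%R, t]) ((C * (t - s) `^ (- g))%:E * (H s * n s)) ->
  n t `^ (P / (P - 1)) <=
    (C%:E * (\int[leb1 R]_(s in `[0%R, T]) (H s `^ P)) `^ P^-1) `^ (P / (P - 1)) *
    \int[leb1 R]_(s in `[0%R, t])
      (((t - s) `^ (- (g * (P / (P - 1)))))%:E * (n s `^ (P / (P - 1)))).
Proof.
move=> P1 C0 tT mn mH n0 H0 nt; set P' := (P / (P - 1))%R.
have P10 : (0 < P - 1)%R by rewrite subr_gt0.
have P0 : (0 < P)%R by exact: lt_trans P1.
have P'0 : (0 < P')%R by rewrite divr_gt0.
have PP' : (P'^-1 + P^-1 = 1)%R by rewrite /P' invf_div; field; rewrite gt_eqF.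
have ind0 (A : set mR) s : (0 <= \1_A s :> R)%R by rewrite indicE.
have indX (A : set mR) s (r : R) : r != 0%R -> ((\1_A s)%:E `^ r = (\1_A s)%:E :> \bar R).
  by move=> r0; rewrite indicE; case: (_ \in _); rewrite poweR_EFin ?powR1// powR0.
have mpow (r : R) : measurable_fun [set: mR] (fun s : mR => ((t - s) `^ (- r))%:E).
  apply/measurable_EFinP.
  exact: (measurableT_comp (measurable_powR _) (measurable_time_reflect t)).
have mind a : measurable_fun [set: mR] (fun s => (\1_(`[0%R, a] : set mR) s)%:E : \bar R).
  by apply/measurable_EFinP; apply: measurable_indic; exact: measurable_time_itv.
pose f s := (\1_(`[0%R, t] : set mR) s)%:E * (((t - s) `^ (- g))%:E * n s).
pose h s := (\1_(`[0%R, T] : set mR) s)%:E * H s.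
have mf : measurable_fun [set: mR] f.
  by apply: emeasurable_funM => //; exact: emeasurable_funM.
have mh : measurable_fun [set: mR] h by exact: emeasurable_funM.
have f0 s : 0 <= f s by rewrite !mule_ge0 ?lee_fin ?powR_ge0.
have h0 s : 0 <= h s by rewrite !mule_ge0 ?lee_fin.
have fh0 s : 0 <= f s * h s by exact: mule_ge0.
have E1 : \int[leb1 R]_(s in `[0%R, t]) ((C * (t - s) `^ (- g))%:E * (H s * n s)) =
    C%:E * \int[leb1 R]_s (f s * h s).
  rewrite -ge0_integralZl_EFin//; last exact: emeasurable_funM.
  rewrite (integral_eindicM (leb1 R) _ (fun s => (C * (t - s) `^ (- g))%:E * (H s * n s))).
  apply: eq_integral => s _; rewrite /f /h EFinM !indicE.
  have [/set_mem/=|] := boolP (s \in (`[0%R, t]%classic : set mR)); last by rewrite !mul0e mule0.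
  rewrite in_itv/= => /andP[s0 st].
  rewrite mem_set ?mul1e; last by rewrite /= in_itv/= s0 (le_trans st).
  by rewrite -!muleA; congr (_ * (_ * _)); rewrite muleC.
have E2 : \int[leb1 R]_s (f s `^ P') = \int[leb1 R]_(s in `[0%R, t])
      (((t - s) `^ (- (g * P')))%:E * (n s `^ P')).
  rewrite (integral_eindicM (leb1 R) _ (fun s => ((t - s) `^ (- (g * P')))%:E * (n s `^ P'))).
  apply: eq_integral => s _; rewrite /f poweRM ?mule_ge0 ?lee_fin ?powR_ge0//.
  rewrite indX ?gt_eqF// poweRM ?lee_fin ?powR_ge0// poweR_EFin -powRrM.
  by rewrite mulNr.
have E3 : \int[leb1 R]_s (h s `^ P) = \int[leb1 R]_(s in `[0%R, T]) (H s `^ P).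
  rewrite (integral_eindicM (leb1 R) _ (fun s => H s `^ P)).
  by apply: eq_integral => s _; rewrite /h poweRM ?lee_fin// indX ?gt_eqF.
have Ho := ge0_hoelder (leb1 R) mf mh f0 h0 P'0 P0 PP'.
rewrite E2 E3 in Ho; rewrite E1 in nt.
set I2 := \int[leb1 R]_(s in `[0%R, t]) _ in Ho *.
set IH := \int[leb1 R]_(s in `[0%R, T]) _ in Ho *.
have I20 : 0 <= I2.
  by apply: integral_ge0 => s _; rewrite mule_ge0 ?lee_fin ?powR_ge0 ?poweR_ge0.
have IH0 : 0 <= IH by apply: integral_ge0 => s _; exact: poweR_ge0.
have -> : I2 = (I2 `^ P'^-1) `^ P' by rewrite -poweRrM mulVf ?gt_eqF// poweRe1.
rewrite -poweRM ?mule_ge0 ?lee_fin ?poweR_ge0//.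
apply: lee_poweR => //; first exact: ltW.
apply: (le_trans nt); rewrite -muleA; apply: lee_pmul => //.
  by apply: integral_ge0.
by rewrite muleC.
Qed.

End volterra.

Section volterra_uniqueness.
Context {R : realType}.
Implicit Types (t s T : R).
Local Open Scope ereal_scope.
Local Notation mR := (measurableTypeR R).

(** A homogeneous Volterra inequality forces [n] to vanish: after multiplication
by a rapidly decreasing exponential its integral is at most half of itself. *)
Lemma volterra_zero (g P T C : R) (n H : R -> \bar R) :
  (0 <= g)%R -> (2 <= P)%R -> (P^-1 < 1 - g)%R -> (0 <= C)%R -> (0 < T)%R ->
  measurable_fun [set: mR] n -> measurable_fun [set: mR] H ->
  (forall s, 0 <= n s) -> (forall s, n s <= H s) ->
  \int[leb1 R]_(s in `[0%R, T]) (H s `^ P) < +oo ->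
  {ae leb1 R, forall t : R, t \in `[0%R, T] ->
    n t <= \int[leb1 R]_(s in `[0%R, t]) ((C * (t - s) `^ (- g))%:E * (H s * n s))} ->
  {ae leb1 R, forall t : R, t \in `[0%R, T] -> n t = 0}.
Proof.
move=> g0 P2 Pg C0 T0 mn mH n0 nH HP nV.
have H0 s : 0 <= H s by exact: le_trans (n0 s) (nH s).
have P1 : (1 < P)%R by rewrite (lt_le_trans _ P2)// ltr1n.
have P0 : (0 < P)%R by exact: lt_trans P1.
have P10 : (0 < P - 1)%R by rewrite subr_gt0.
set P' := (P / (P - 1))%R.
have P'0 : (0 < P')%R by rewrite divr_gt0.
have P'P : (P' <= P)%R by rewrite /P' ler_pdivrMr// ler_peMr ?(ltW P0)//; lra.
pose sg := (g * P')%R.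
have sg01 : (0 <= sg < 1)%R.
  rewrite mulr_ge0 ?(ltW P'0)//= /sg /P' mulrA ltr_pdivrMr// mul1r.
  have := Pg; rewrite -(ltr_pM2r P0) mulVf ?gt_eqF// mulrBl mul1r => ?; lra.
set IH := \int[leb1 R]_(s in `[0%R, T]) _ in HP.
have IH0 : 0 <= IH by apply: integral_ge0 => s _; exact: poweR_ge0.
pose A := fine ((C%:E * IH `^ P^-1) `^ P').
have Afin : (C%:E * IH `^ P^-1) `^ P' \is a fin_num.
  rewrite ge0_fin_numE ?poweR_ge0//; apply: poweR_lty.
  by apply: lte_mul_pinfty; rewrite ?lee_fin//; exact: poweR_lty.
have A0 : (0 <= A)%R by rewrite fine_ge0// poweR_ge0.
(* with the coefficient [A], the weighted kernel has integral at most 1/2 *)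
have [lam small] := @exponential_weight_small R sg T (2 * (A + 1))^-1 sg01 T0
  ltac:(by rewrite invr_gt0 mulr_gt0// ltr_wpDl).
pose w s : R := expR (- (lam * s)).
have w0 s : (0 < w s)%R by exact: expR_gt0.
have mw : measurable_fun [set: mR] (fun s => (w s)%:E).
  apply/measurable_EFinP.
  apply: (measurableT_comp (continuous_measurable_fun (@continuous_expR R))).
  by apply: measurableT_comp => //; exact: measurable_funM.
pose m s := (w s)%:E * n s `^ P'.
have mnP : measurable_fun [set: mR] (fun s => n s `^ P') by exact: emeasurable_poweR.
have mm : measurable_fun [set: mR] m by exact: emeasurable_funM.
have m0 s : 0 <= m s by rewrite mule_ge0 ?lee_fin ?poweR_ge0// ltW.
pose k s := (w s * s `^ (- sg))%:E.
have mk : measurable_fun [set: mR] k.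
  rewrite /k; under eq_fun do rewrite EFinM.
  by apply: emeasurable_funM => //; apply/measurable_EFinP; exact: measurable_powR.
have k0 s : 0 <= k s by rewrite lee_fin mulr_ge0 ?powR_ge0// ltW.
pose V t := \int[leb1 R]_(s in `[0%R, t]) (k (t - s)%R * m s).
have mV : measurable_fun [set: mR] V by exact: measurable_time_convolution.
have V0 t : 0 <= V t by apply: integral_ge0 => s _; exact: mule_ge0.
have mVle : {ae leb1 R, forall t : R, t \in `[0%R, T] -> m t <= A%:E * V t}.
  apply: ae_imp nV => t nV tT; have tT' : (t <= T)%R by move: tT; rewrite in_itv/= => /andP[].
  have := volterra_hoelder P1 C0 tT' mn mH n0 H0 (nV tT).
  rewrite -/P' -/IH -/sg -(fineK Afin) -/A => nP.
  have mF : measurable_fun [set: mR] (fun s => ((t - s) `^ (- sg))%:E * n s `^ P').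
    apply: emeasurable_funM => //; apply/measurable_EFinP.
    exact: (measurableT_comp (measurable_powR _) (measurable_time_reflect t)).
  have -> : V t = (w t)%:E * \int[leb1 R]_(s in `[0%R, t])
      (((t - s) `^ (- sg))%:E * n s `^ P').
    rewrite -ge0_integralZl_EFin//; last 3 first.
    - by move=> s _; rewrite mule_ge0 ?lee_fin ?powR_ge0 ?poweR_ge0.
    - exact: measurable_funTS.
    - exact: ltW.
    apply: eq_integral => s _; rewrite /k /m muleCA muleA -EFinM.
    rewrite muleA -EFinM mulrA; congr ((_ * _)%:E * _).
    rewrite /w -expRD; congr expR; ring.
  rewrite muleCA; apply: lee_pmul => //; first by rewrite lee_fin ltW.
  exact: poweR_ge0.
set W := \int[leb1 R]_(s in `[0%R, T]) m s.
have W0 : 0 <= W by exact: integral_ge0.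
have mT := @measurable_time_itv R T.
have muT : leb1 R (`[0%R, T]%classic : set mR) < +oo.
  by rewrite lebesgue_measure_itv/= lte_fin T0 -EFinB ltry.
have Wfin : W < +oo.
  apply: (@le_lt_trans _ _ (\int[leb1 R]_(s in `[0%R, T])
      ((expR (`|lam| * T))%:E * (1 + H s `^ P)))).
    apply: ge0_le_integral => //.
    - exact: measurable_funTS.
    - apply: measurable_funTS; apply: emeasurable_funM => //; apply: emeasurable_funD => //.
      exact: emeasurable_poweR.
    move=> s; rewrite /= in_itv/= => /andP[s0 sT]; apply: lee_pmul => //.
    - by rewrite lee_fin ltW.
    - exact: poweR_ge0.
    - rewrite lee_fin ler_expR -mulNr (le_trans (ler_norm _))// normrM normrN.
      by rewrite ler_wpM2l// ger0_norm.
    apply: (le_trans (lee_poweR (ltW P'0) (n0 s) (nH s))).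
    exact: lee_poweR_1D.
  rewrite ge0_integralZl_EFin ?expR_ge0//; last 2 first.
  - by move=> s _; rewrite adde_ge0 ?poweR_ge0.
  - apply: measurable_funTS; apply: emeasurable_funD => //; exact: emeasurable_poweR.
  rewrite ge0_integralD//; last 2 first.
  - by move=> s _; exact: poweR_ge0.
  - by apply: measurable_funTS; exact: emeasurable_poweR.
  apply: lte_mul_pinfty; rewrite ?lee_fin ?expR_ge0//.
  by rewrite integral_cst// mul1e -/IH lte_add_pinfty.
have WW : W <= (2^-1)%:E * W.
  apply: (@le_trans _ _ (\int[leb1 R]_(t in `[0%R, T]) (A%:E * V t))).
    apply: ae_ge0_le_integral => //.
    - exact: measurable_funTS.
    - by move=> s _; rewrite mule_ge0 ?lee_fin.
    - by apply: measurable_funTS; exact: emeasurable_funM.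
  rewrite ge0_integralZl_EFin//; last exact: measurable_funTS.
  apply: (@le_trans _ _ (A%:E * ((2 * (A + 1))^-1%:E * W))).
    apply: lee_pmul => //; first by apply: integral_ge0 => s _.
    apply: (le_trans (time_convolution_le T mk mm k0 m0)).
    by apply: lee_pmul => //; apply: integral_ge0.
  rewrite muleA -EFinM; apply: lee_pmul => //.
    by rewrite lee_fin mulr_ge0// invr_ge0 mulr_ge0// addr_ge0.
  rewrite lee_fin invfM mulrCA ler_piMr// ler_pdivrMr ?mul1r ?lerDl//.
  by rewrite ltr_wpDl.
have W00 : W = 0.
  move: Wfin WW W0; case: (W) => [W'| |]//; rewrite -EFinM !lee_fin => _ WW W'0.
  by congr (_%:E); apply/eqP; rewrite eq_le W'0 andbT; lra.
have : ae_eq (leb1 R) (`[0%R, T]%classic : set mR) m (cst 0).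
  apply/(ae_eq_integral_abs _ mT (measurable_funTS mm)).
  by under eq_integral do rewrite gee0_abs//.
apply: ae_imp => t mt0 tT; have {mt0} := mt0 tT; rewrite /cst /m.
move=> /eqP; rewrite mule_eq0 eqe gt_eqF//= => /eqP.
exact: poweR_eq0_eq0.
Qed.

End volterra_uniqueness.

(** * Uniqueness of solutions that are integrable in time *)

Section slices.
Context {R : realType}.
Implicit Types (t : R) (x : vec3 R).

(** Tonelli's theorem: almost every slice of a null set is null. *)
Lemma ae_slices (Q : R * vec3 R -> Prop) :
  {ae leb_spacetime R, forall z : R * vec3 R, Q z} ->
  {ae leb1 R, forall t : R, {ae leb3 R, forall x : vec3 R, Q (t, x)}}.
Proof.
move=> [A [mA A0 QA]].
have mphi : measurable_fun [set: measurableTypeR R] (leb3 R \o xsection A).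
  exact: (@measurable_fun_xsection _ _ _ _ R (leb3 R)).
have : (\int[leb1 R]_t `|(leb3 R \o xsection A) t| = 0)%E.
  by under eq_integral do rewrite gee0_abs//; exact: A0.
move/(ae_eq_integral_abs _ measurableT mphi).
apply: ae_imp => t /(_ I)/= At0; exists (xsection A t); split => //.
  exact: measurable_xsection.
by move=> x /= Qtx; rewrite /xsection/= inE; exact: QA.
Qed.

(** The converse, for the set where a measurable function is not 0; measurability is
what makes it hold. *)
Lemma ae_of_slices (T : R) (f : R -> vec3 R -> R) : spacetime_measurable f ->
  {ae leb1 R, forall t : R, t \in `[0, T] -> {ae leb3 R, forall x : vec3 R, f t x = 0}} ->
  {ae leb_spacetime R, forall z : R * vec3 R, z.1 \in `[0, T] -> f z.1 z.2 = 0}.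
Proof.
move=> mf H.
pose A : set (mtimevec3 R) := (fst @^-1` `[0, T]) `&` (fun z => f z.1 z.2) @^-1` [set~ 0].
have mA : measurable A.
  apply: measurableI.
    rewrite -[X in measurable X]setTI.
    by apply: measurable_fst => //; exact: measurable_itv.
  rewrite -[X in measurable X]setTI; apply: mf => //.
  exact: measurableC.
exists A; split => //; last first.
  move=> z /= /not_implyP[zT fz]; split=> //.
have -> : leb_spacetime R A = (\int[leb1 R]_t (leb3 R \o xsection A) t)%E by [].
have mphi : measurable_fun [set: measurableTypeR R] (leb3 R \o xsection A).
  exact: (@measurable_fun_xsection _ _ _ _ R (leb3 R)).
transitivity (\int[leb1 R]_t (cst 0%E t))%E; last exact: integral0.
apply: ae_eq_integral => //.
apply: ae_imp H => t Ht _ /=.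
have [tT|tT] := boolP (t \in `[0, T]); last first.
  rewrite (_ : xsection A t = set0) ?measure0// -subset0 => x.
  by rewrite /xsection/= inE => -[/= tT']; rewrite tT' in tT.
have [B [mB B0 HB]] := Ht tT.
apply/eqP; rewrite eq_le measure_ge0 andbT -B0; apply: le_measure.
- by rewrite inE; exact: measurable_xsection.
- by rewrite inE.
by move=> x; rewrite /xsection/= inE => -[/= _ fx]; exact: HB.
Qed.

End slices.

Section field_uniqueness.
Context {R : realType} (al q : R) (al2 : 1 / 2 < al) (q2 : 2 < q).
Hypothesis gap : gam al q < 1.
Implicit Types (U V : 'I_3 -> R -> vec3 R -> R).
Local Notation NE f := ('N[leb3 R]_q%:E[(fun x => (f x)%:E)])%E.
Local Notation mR := (measurableTypeR R).

Let q0 : 0 < q. Proof. exact: lt_trans q2. Qed.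

Lemma measurable_NE_field U : field_measurable U ->
  measurable_fun [set: mR] (fun t => NE (field_size U t)).
Proof.
move=> mU; apply: measurable_Lnorm_slice; first exact: measurable_field_size.
exact: field_size_ge0.
Qed.

Lemma poweR_add_le (a b : \bar R) (P : R) : 0 < P -> (0 <= a -> 0 <= b ->
  (a + b) `^ P <= (2 `^ P)%:E * (a `^ P + b `^ P))%E.
Proof.
move=> P0 a0 b0; pose c := maxe a b.
have c0 : (0 <= c)%E by rewrite le_max a0.
apply: (@le_trans _ _ ((2%:E * c) `^ P)%E).
  apply: lee_poweR; [exact: ltW|exact: adde_ge0|].
  rewrite mule_natl mule2n leeD// /c ?le_max ?lexx ?orbT//.
rewrite poweRM// poweR_EFin; apply: lee_pmul => //.
- exact: poweR_ge0.
rewrite /c; have [ab|ab] := leP a b.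
  by rewrite leeDr// poweR_ge0.
by rewrite leeDl// poweR_ge0.
Qed.

Lemma square_le_poweR (P : R) (h : R -> \bar R) (T : R) : 2 <= P -> 0 < T ->
  measurable_fun [set: mR] h -> (forall t, 0 <= h t)%E ->
  (\int[leb1 R]_(t in `[0%R, T]) (h t `^ P) < +oo)%E ->
  (\int[leb1 R]_(t in `[0%R, T]) (h t * h t) < +oo)%E.
Proof.
move=> P2 T0 mh h0 hP.
have mT := @measurable_time_itv R T.
have mhP : measurable_fun [set: mR] (fun t => h t `^ P)%E by exact: emeasurable_poweR.
apply: (@le_lt_trans _ _ (\int[leb1 R]_(t in `[0%R, T]) (1 + h t `^ P))%E).
  apply: ge0_le_integral => //.
  - by move=> t _; exact: mule_ge0.
  - by apply: measurable_funTS; exact: emeasurable_funM.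
  - by apply: measurable_funTS; exact: emeasurable_funD.
  move=> t _; have -> : (h t * h t = h t `^ 2)%E.
    case: (h t) (h0 t) => [r| |]// r0; last by rewrite mulyy poweRyr.
    by rewrite poweR_EFin -EFinM -[2]/(2%:R) powR_mulrn// -expr2.
  by apply: lee_poweR_1D.
have muT : (leb1 R (`[0%R, T]%classic : set mR) < +oo)%E.
  by rewrite lebesgue_measure_itv/= lte_fin T0 -EFinB ltry.
rewrite ge0_integralD//; last 2 first.
- by move=> t _; exact: poweR_ge0.
- exact: measurable_funTS.
by rewrite integral_cst// mul1e lte_add_pinfty.
Qed.

(** The bilinear estimate bounds the norm in space by a convolution in time of two
integrable functions, which is finite almost everywhere. *)
Lemma ae_duhamel_finite (P T : R) U : 2 <= P -> 0 < T -> field_measurable U ->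
  (\int[leb1 R]_(t in `[0%R, T]) (NE (field_size U t) `^ P) < +oo)%E ->
  {ae leb1 R, forall t : R, t \in `[0, T] -> {ae leb3 R, forall x : vec3 R,
    (duhamel_size (oseen_size al)
       (fun s y => field_size U s y * field_size U s y)%R t x < +oo)%E}}.
Proof.
move=> P2 T0 mU UP.
have [C C0 HC] := oseen_bilinear al2 q2.
have mh := measurable_NE_field mU.
have h0 t : (0 <= NE (field_size U t))%E by exact: Lnorm_ge0.
have mUs := measurable_field_size mU.
have hh := square_le_poweR P2 T0 mh h0 UP.
have mT := @measurable_time_itv R T.
pose k (s : R) := (C * s `^ (- gam al q))%:E.
have mk : measurable_fun [set: mR] k.
  by apply/measurable_EFinP; apply: measurable_funM => //; exact: measurable_powR.
have k0 s : (0 <= k s)%E by rewrite lee_fin mulr_ge0 ?powR_ge0.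
pose m s := (NE (field_size U s) * NE (field_size U s))%E.
have mm : measurable_fun [set: mR] m by exact: emeasurable_funM.
have m0 s : (0 <= m s)%E by exact: mule_ge0.
pose F t := (\int[leb1 R]_(s in `[0%R, t]) (k (t - s)%R * m s))%E.
have mF : measurable_fun [set: mR] F by exact: measurable_time_convolution.
have F0 t : (0 <= F t)%E by apply: integral_ge0 => s _; exact: mule_ge0.
have IF : (\int[leb1 R]_(t in `[0%R, T]) F t < +oo)%E.
  apply: (le_lt_trans (time_convolution_le T mk mm k0 m0)).
  have mp : measurable_fun [set: mR] (fun s : R => (s `^ (- gam al q))%:E).
    by apply/measurable_EFinP; exact: measurable_powR.
  have -> : (\int[leb1 R]_(s in `[0%R, T]) k s =
      C%:E * (T `^ (1 - gam al q) / (1 - gam al q))%:E)%E.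
    rewrite /k; under eq_integral do rewrite EFinM.
    rewrite ge0_integralZl_EFin//; last 2 first.
    - by move=> s _; rewrite lee_fin powR_ge0.
    - exact: measurable_funTS.
    congr (_ * _)%E; rewrite -integral_powR_0//; apply/esym.
    by apply: integral_itv_obnd_cbnd; exact: measurable_funTS.
  rewrite -EFinM; apply: lte_mul_pinfty => //.
  by rewrite lee_fin mulr_ge0// divr_ge0 ?powR_ge0// subr_ge0 ltW.
have : (leb1 R).-integrable (`[0, T]%classic : set mR) F.
  apply/integrableP; split; first exact: measurable_funTS.
  by under eq_integral do rewrite gee0_abs//.
move/(integrable_ae mT); apply: ae_imp => t Ft tT.
have {}Ft : (F t < +oo)%E by rewrite ltey_eq Ft.
have Ffin : F t \is a fin_num by rewrite ge0_fin_numE.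
apply: (@duhamel_size_finite R al q q2 (fine (F t)) U t mU).
rewrite (fineK Ffin); apply: HC => //; exact: field_size_ge0.
Qed.

(** The bilinear estimate, applied to the difference of the two equations, gives a
homogeneous Volterra inequality for the norm of the difference, with a coefficient
in L^P. *)
Lemma field_unique (P T : R) U V : 2 <= P -> P^-1 < 1 - gam al q -> 0 < T ->
  field_measurable U -> field_measurable V ->
  (\int[leb1 R]_(t in `[0%R, T]) (NE (field_size U t) `^ P) < +oo)%E ->
  (\int[leb1 R]_(t in `[0%R, T]) (NE (field_size V t) `^ P) < +oo)%E ->
  {ae leb1 R, forall t : R, t \in `[0, T] -> {ae leb3 R, forall x : vec3 R,
    forall j, U j t x - V j t x = nonlinear al V j t x - nonlinear al U j t x}} ->
  {ae leb1 R, forall t : R, t \in `[0, T] -> {ae leb3 R, forall x : vec3 R,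
    forall j, U j t x = V j t x}}.
Proof.
move=> P2 Pg T0 mU mV UP VP UV.
have P0 : 0 < P by rewrite (lt_le_trans _ P2).
have [C C0 HC] := oseen_bilinear al2 q2.
have mUs := measurable_field_size mU; have mVs := measurable_field_size mV.
pose D k s y := U k s y - V k s y.
have mD : field_measurable D by exact: measurable_fieldB.
have mDs := measurable_field_size mD.
pose n t := NE (field_size D t).
pose H t := (NE (field_size U t) + NE (field_size V t))%E.
have n0 t : (0 <= n t)%E by exact: Lnorm_ge0.
have hU0 t : (0 <= NE (field_size U t))%E by exact: Lnorm_ge0.
have hV0 t : (0 <= NE (field_size V t))%E by exact: Lnorm_ge0.
have mn : measurable_fun [set: mR] n by exact: measurable_NE_field.
have mhU := measurable_NE_field mU; have mhV := measurable_NE_field mV.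
have mH : measurable_fun [set: mR] H by exact: emeasurable_funD.
have nH t : (n t <= H t)%E.
  have mN : field_measurable (fun k s y => - V k s y).
    by move=> k; apply: measurableT_comp => //; exact: mV.
  apply: (le_trans (NE_field_size_triangle q2 t mU mN (fun _ _ _ => erefl))).
  rewrite /H leeD// le_eqVlt; apply/orP; left; apply/eqP.
  congr (Lnorm _ _ _); apply/funext => x; congr (_%:E).
  by apply: eq_bigr => j _; rewrite normrN.
have mT := @measurable_time_itv R T.
have HP : (\int[leb1 R]_(t in `[0%R, T]) (H t `^ P) < +oo)%E.
  have mpU : measurable_fun [set: mR] (fun t => NE (field_size U t) `^ P)%E by exact: emeasurable_poweR.
  have mpV : measurable_fun [set: mR] (fun t => NE (field_size V t) `^ P)%E by exact: emeasurable_poweR.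
  apply: (@le_lt_trans _ _ (\int[leb1 R]_(t in `[0%R, T]) ((2 `^ P)%:E *
      (NE (field_size U t) `^ P + NE (field_size V t) `^ P)))%E).
    apply: ge0_le_integral => //.
    - by move=> t _; exact: poweR_ge0.
    - by apply: measurable_funTS; exact: emeasurable_poweR.
    - by apply: measurable_funTS; apply: emeasurable_funM => //; exact: emeasurable_funD.
    by move=> t _; exact: poweR_add_le.
  rewrite ge0_integralZl_EFin ?powR_ge0//; last 2 first.
  - by move=> t _; rewrite adde_ge0 ?poweR_ge0.
  - by apply: measurable_funTS; exact: emeasurable_funD.
  apply: lte_mul_pinfty; rewrite ?lee_fin ?powR_ge0//.
  rewrite ge0_integralD//; last 4 first.
  - by move=> t _; exact: poweR_ge0.
  - exact: measurable_funTS.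
  - by move=> t _; exact: poweR_ge0.
  - exact: measurable_funTS.
  exact: lte_add_pinfty.
have nV : {ae leb1 R, forall t : R, t \in `[0%R, T] ->
    (n t <= \int[leb1 R]_(s in `[0%R, t]) ((C * (t - s) `^ (- gam al q))%:E * (H s * n s)))%E}.
  have aeU := ae_duhamel_finite P2 T0 mU UP.
  have aeV := ae_duhamel_finite P2 T0 mV VP.
  apply: ae_imp (ae_and UV (ae_and aeU aeV)) => t [UVt [Ut Vt]] tT.
  have mS : spacetime_measurable (fun s y => field_size U s y + field_size V s y).
    exact: measurable_funD.
  have mP : spacetime_measurable (fun s y =>
      (field_size U s y + field_size V s y) * field_size D s y).
    exact: measurable_funM.
  have sum0 s y : 0 <= field_size U s y + field_size V s y.
    by rewrite addr_ge0 ?field_size_ge0.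
  have distle (a b : R) : `|a - b| <= `|b - a| by rewrite distrC.
  have D0 s y : 0 <= field_size D s y by exact: field_size_ge0.
  apply: (@le_trans _ _ ('N[leb3 R]_q%:E[duhamel_size (oseen_size al)
      (fun s y => (field_size U s y + field_size V s y) * field_size D s y)%R t])%E).
    apply: ae_le_Lnorm => //.
    - by apply/measurable_EFinP; exact: spacetime_measurable_slice.
    - apply: (@measurableT_comp _ _ _ _ _ _ _ _ (fun x : mvec3 R => (t, x) : mtimevec3 R)
        (measurable_duhamel_size _ mP)); last exact: measurable_pair1.
      exact: measurable_oseen_size.
    apply: ae_imp (ae_and (UVt tT) (ae_and (Ut tT) (Vt tT))) => x [Dx [QU QV]].
    rewrite gee0_abs ?lee_fin ?field_size_ge0// gee0_abs ?duhamel_size_ge0//.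
    apply: le_trans (nonlinear_diff mU mV QU QV).
    rewrite lee_fin; apply: ler_sum => j _.
    have -> : D j t x = nonlinear al V j t x - nonlinear al U j t x by exact: Dx.
    exact: distle.
  apply: (le_trans (HC _ _ t mS mDs sum0 D0)).
  have mw : measurable_fun [set: mR] (fun s : mR => (C * (t - s) `^ (- gam al q))%:E).
    apply/measurable_EFinP; apply: measurable_funM => //.
    exact: (measurableT_comp (measurable_powR _) (measurable_time_reflect t)).
  have w0 s : (0 <= (C * (t - s) `^ (- gam al q))%:E)%E.
    by rewrite lee_fin mulr_ge0 ?powR_ge0.
  have NS0 s : (0 <= NE (fun x => field_size U s x + field_size V s x)%R)%E by exact: Lnorm_ge0.
  have mNS : measurable_fun [set: mR]
      (fun s => NE (fun x => field_size U s x + field_size V s x)%R).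
    exact: (@measurable_Lnorm_slice _ q (fun s x => field_size U s x + field_size V s x)).
  apply: ge0_le_integral => //.
  - move=> s _; apply: mule_ge0 => //; apply: mule_ge0 => //; exact: n0.
  - apply: measurable_funTS; apply: emeasurable_funM => //; exact: emeasurable_funM.
  - apply: measurable_funTS; apply: emeasurable_funM => //; exact: emeasurable_funM.
  move=> s _; apply: lee_pmul => //; first by apply: mule_ge0 => //; exact: n0.
  apply: lee_pmul => //; [exact: n0|]; apply: (@NE_add R q q2).
  - exact: spacetime_measurable_slice.
  - exact: spacetime_measurable_slice.
  - exact: field_size_ge0.
  - exact: field_size_ge0.
have := volterra_zero (gam_ge0 al2 q2) P2 Pg C0 T0 mn mH n0 nH HP nV.
apply: ae_imp => t nt0 tT.
have : {ae leb3 R, forall x : vec3 R, field_size D t x = 0}.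
  apply: (ae_eq0_Lnorm q0).
  - exact: spacetime_measurable_slice.
  - exact: field_size_ge0.
  - by rewrite -/(n t) nt0.
apply: ae_imp => x Dx0 j; apply/eqP; rewrite -subr_eq0 -normr_eq0.
by move/eqP : Dx0; rewrite psumr_eq0// => /allP/(_ j (mem_index_enum _)).
Qed.

End field_uniqueness.

(** * Test functions *)

Section real_fubini.
Context d1 d2 (T1 : measurableType d1) (T2 : measurableType d2) (R : realType).
Variable m1 : {sigma_finite_measure set T1 -> \bar R}.
Variable m2 : {sigma_finite_measure set T2 -> \bar R}.

Let Rintegral_iterated (G : T1 * T2 -> R) : (m1 \x m2)%E.-integrable [set: T1 * T2] (EFin \o G) ->
  measurable_fun [set: T1] (fun x => \int[m2]_y G (x, y)) ->
  m1.-integrable [set: T1] (EFin \o (fun x => \int[m2]_y G (x, y))) /\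
  (\int[m1]_x (\int[m2]_y G (x, y)) = \int[(m1 \x m2)%E]_z G z)%R.
Proof.
move=> iG mi.
have iF := integrable_fubini_F iG; have aeF := ae_integrable1 iG.
have E : {ae m1, forall x, (\int[m2]_y G (x, y))%:E = fubini_F m2 (EFin \o G) x}.
  apply: ae_imp aeF => x ix; rewrite /fubini_F /Rintegral fineK//.
  exact: integrable_fin_num.
have mE : measurable_fun [set: T1] (fun x => (\int[m2]_y G (x, y))%:E).
  exact/measurable_EFinP.
have ii : m1.-integrable [set: T1] (EFin \o (fun x => \int[m2]_y G (x, y))).
  apply/integrableP; split=> //.
  have /integrableP[mF] := iF; apply: le_lt_trans.
  rewrite le_eqVlt; apply/orP; left; apply/eqP.
  apply: ge0_ae_eq_integral => //; try exact: measurableT_comp.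
  by apply: ae_imp E => x Ex _; apply: (f_equal abse); exact: Ex.
split=> //; rewrite /Rintegral; congr fine.
rewrite -(integral12_prod_meas1 iG); apply: ae_eq_integral => //.
  exact: measurable_int iF.
by apply: ae_imp E => x Ex _; exact: Ex.
Qed.

Lemma integrable_prod (G : T1 * T2 -> R) : measurable_fun [set: T1 * T2] G ->
  (\int[m1]_x \int[m2]_y (`|G (x, y)|)%:E < +oo)%E ->
  (m1 \x m2)%E.-integrable [set: T1 * T2] (EFin \o G).
Proof. by move=> mG Goo; apply/integrable12ltyP => //; exact/measurable_EFinP. Qed.

Lemma Rintegral_fubini1 (G : T1 * T2 -> R) : measurable_fun [set: T1 * T2] G ->
  (\int[m1]_x \int[m2]_y (`|G (x, y)|)%:E < +oo)%E ->
  m1.-integrable [set: T1] (EFin \o (fun x => \int[m2]_y G (x, y))) /\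
  (\int[m1]_x (\int[m2]_y G (x, y)) = \int[(m1 \x m2)%E]_z G z)%R.
Proof.
move=> mG Goo; apply: Rintegral_iterated; first exact: integrable_prod.
exact: measurable_fun_Rintegral.
Qed.

End real_fubini.

Section real_fubini_swap.
Context d1 d2 (T1 : measurableType d1) (T2 : measurableType d2) (R : realType).
Variable m1 : {sigma_finite_measure set T1 -> \bar R}.
Variable m2 : {sigma_finite_measure set T2 -> \bar R}.

(** Fubini's theorem for the real-valued integral, whose inner integrals may take
default values on null sets. *)
Lemma Rintegral_fubini (G : T1 * T2 -> R) : measurable_fun [set: T1 * T2] G ->
  (\int[m1]_x \int[m2]_y (`|G (x, y)|)%:E < +oo)%E ->
  [/\ m1.-integrable [set: T1] (EFin \o (fun x => \int[m2]_y G (x, y))),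
      m2.-integrable [set: T2] (EFin \o (fun y => \int[m1]_x G (x, y))) &
  \int[m1]_x (\int[m2]_y G (x, y)) = \int[m2]_y (\int[m1]_x G (x, y))].
Proof.
move=> mG Goo; have iG := integrable_prod mG Goo.
have [i1 E1] := Rintegral_fubini1 mG Goo.
pose G' (z : T2 * T1) := G (z.2, z.1).
have mG' : measurable_fun [set: T2 * T1] G'.
  have mp : measurable_fun [set: T2 * T1] (fun z : T2 * T1 => (z.2, z.1)).
    by apply: measurable_fun_pair; [exact: measurable_snd|exact: measurable_fst].
  exact: (measurableT_comp mG mp).
have G'oo : (\int[m2]_y \int[m1]_x (`|G' (y, x)|)%:E < +oo)%E.
  rewrite (_ : (\int[m2]_y _)%E = (\int[m1]_x \int[m2]_y (`|G (x, y)|)%:E)%E)//.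
  apply/esym; apply: (@fubini_tonelli _ _ _ _ R m1 m2 (fun z => (`|G z|)%:E)).
    by apply/measurable_EFinP; exact: measurableT_comp.
  by move=> z; rewrite lee_fin.
have [i2 E2] := Rintegral_fubini1 mG' G'oo.
split=> //; rewrite E1 (_ : \int[m2]_y _ = \int[m2]_y (\int[m1]_x G' (y, x)))//.
rewrite E2 /Rintegral; congr fine.
rewrite -(integral12_prod_meas1 iG) -(integral12_prod_meas1 (integrable_prod mG' G'oo)).
rewrite /fubini_F /=; exact: (@Fubini _ _ _ _ R m1 m2 (EFin \o G) iG).
Qed.

End real_fubini_swap.

Section test_functions.
Context {R : realType}.
Implicit Types (phi psi : vec3 R -> R) (x a : vec3 R) (j : 'I_3).

(** What the estimates use of test functions and of their derivatives, and what makes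
them integrable against any function in L^q. *)
Definition box_bounded psi := exists M B : R, 0 <= B /\ forall x,
  `|psi x| <= B * (\1_(`[- M, M] : set R) x.1.1 * \1_(`[- M, M] : set R) x.1.2 *
                   \1_(`[- M, M] : set R) x.2).

Lemma box_bounded_powR psi (r : R) : 0 < r -> measurable_fun [set: mvec3 R] psi ->
  box_bounded psi -> (\int[leb3 R]_x (`|psi x| `^ r)%:E < +oo)%E.
Proof.
move=> r0 mpsi [M [B [B0 psiB]]].
pose w : R -> R := \1_(`[- M, M] : set (measurableTypeR R)).
have w0 u : 0 <= w u by rewrite /w indicE.
have mw : measurable_fun [set: measurableTypeR R] w.
  by apply: measurable_indic; exact: measurable_itv.
have wr u : w u `^ r = w u.
  by rewrite /w indicE; case: (_ \in _); rewrite ?powR1// powR0// gt_eqF.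
have mwww : measurable_fun [set: mvec3 R] (fun x : mvec3 R => (w x.1.1 * w x.1.2 * w x.2)%:E).
  apply/measurable_EFinP; apply: measurable_funM; first apply: measurable_funM.
  - exact: (measurableT_comp mw measurable_x11).
  - exact: (measurableT_comp mw measurable_x12).
  - exact: (measurableT_comp mw measurable_x2).
apply: (@le_lt_trans _ _ (\int[leb3 R]_x ((B `^ r)%:E * (w x.1.1 * w x.1.2 * w x.2)%:E))%E).
  apply: ge0_le_integral => //.
  - apply/measurable_EFinP; apply: (measurableT_comp (measurable_powR _)).
    exact: measurableT_comp.
  - exact: emeasurable_funM.
  move=> x _; rewrite -EFinM lee_fin.
  have -> : B `^ r * (w x.1.1 * w x.1.2 * w x.2) = (B * (w x.1.1 * w x.1.2 * w x.2)) `^ r.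
    rewrite (powRM _ B0) ?mulr_ge0// (powRM _ (mulr_ge0 (w0 _) (w0 _)) (w0 _)).
    by rewrite (powRM _ (w0 _) (w0 _)) !wr.
  by rewrite ge0_ler_powR ?nnegrE ?mulr_ge0 ?(ltW r0)//; exact: psiB.
rewrite ge0_integralZl_EFin ?powR_ge0//; last by move=> x _; rewrite lee_fin !mulr_ge0.
apply: lte_mul_pinfty; rewrite ?lee_fin ?powR_ge0// integral_prod3//.
have Iw : (\int[leb1 R]_u (w u)%:E = leb1 R (`[(- M)%R, M]%classic : set (measurableTypeR R)))%E.
  by rewrite integral_indic//= ?setIT//; exact: measurable_itv.
have Ifin : (\int[leb1 R]_u (w u)%:E)%E \is a fin_num.
  by rewrite Iw lebesgue_measure_itv/=; case: ifP.
by rewrite -(fineK Ifin) -!EFinM ltry.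
Qed.

Lemma box_bounded_integrable psi : measurable_fun [set: mvec3 R] psi ->
  box_bounded psi -> (leb3 R).-integrable [set: mvec3 R] (EFin \o psi).
Proof.
move=> mpsi /(box_bounded_powR ltr01 mpsi) H.
apply/integrableP; split; first exact/measurable_EFinP.
apply: le_lt_trans H; rewrite le_eqVlt; apply/orP; left; apply/eqP.
by apply: eq_integral => x _; rewrite powRr1.
Qed.

(** The compact set and its image by [psi] are bounded; the balls of the sup norm are
cubes. *)
Lemma compact_support_box psi (K : set (vec3 R)) : compact K -> continuous psi ->
  (forall x, ~ K x -> psi x = 0) -> box_bounded psi.
Proof.
move=> cK cpsi psi0.
have [M [_ HM]] := compact_bounded cK.
have cpK : compact (psi @` K).
  by apply: continuous_compact => //; exact: continuous_subspaceT.
have [B [_ HB]] := compact_bounded cpK.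
exists (`|M| + 1), (`|B| + 1); split=> [|x]; first by rewrite addr_ge0.
have [Kx|nKx] := pselect (K x); last first.
  by rewrite psi0// normr0 mulr_ge0 ?addr_ge0// !mulr_ge0// indicE.
have xM : `|x| <= `|M| + 1.
  by apply: (HM (`|M| + 1)) => //; rewrite (le_lt_trans (ler_norm M))// ltrDl.
have pB : `|psi x| <= `|B| + 1.
  apply: (HB (`|B| + 1)); last by exists x.
  by rewrite (le_lt_trans (ler_norm B))// ltrDl.
have in1 (u : R) : `|u| <= `|x| -> \1_(`[- (`|M| + 1), `|M| + 1] : set R) u = 1.
  move=> ux; rewrite indicE mem_set//= in_itv/= -ler_norml.
  exact: le_trans ux xM.
have x1 : `|x.1| <= `|x| by rewrite prod_normE le_max lexx.
have x2 : `|x.2| <= `|x| by rewrite prod_normE le_max lexx orbT.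
have x11 : `|x.1.1| <= `|x| by rewrite (le_trans _ x1)// prod_normE le_max lexx.
have x12 : `|x.1.2| <= `|x| by rewrite (le_trans _ x1)// prod_normE le_max lexx orbT.
by rewrite !in1// !mulr1.
Qed.

Lemma test_function_continuous phi : test_function phi -> continuous phi.
Proof. by move=> [/(_ [::])[]]. Qed.

Lemma test_function_partial_continuous phi j : test_function phi ->
  continuous (fun x => 'D_(basis3 j) phi x).
Proof. by move=> [/(_ [:: j])[]]. Qed.

Lemma test_function_box phi : test_function phi -> box_bounded phi.
Proof.
move=> tphi; apply: (compact_support_box tphi.2 (test_function_continuous tphi)).
move=> x Kx; apply: contra_notP Kx => /eqP phix; exact: subset_closure.
Qed.

Lemma test_function_partial_box phi j : test_function phi ->
  box_bounded (fun x => 'D_(basis3 j) phi x).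
Proof.
move=> tphi.
apply: (@compact_support_box (fun x => 'D_(basis3 j) phi x) _ tphi.2) => [|x Kx].
  exact: test_function_partial_continuous.
rewrite (@near_eq_derive _ _ _ phi (cst 0)) ?derive_cst//.
have : open (~` closure [set x | phi x != 0]) by apply: closed_openC; exact: closed_closure.
rewrite openE => /(_ x Kx); apply: filterS => y Ky.
by apply: contra_notP Ky => /eqP phix; exact: subset_closure.
Qed.

Lemma measurable_test phi : test_function phi -> measurable_fun [set: mvec3 R] phi.
Proof. by move=> tphi; apply: continuous_measurable3; exact: test_function_continuous. Qed.

Lemma measurable_test_partial phi j : test_function phi ->
  measurable_fun [set: mvec3 R] (fun x => 'D_(basis3 j) phi x).
Proof.
by move=> tphi; apply: continuous_measurable3; exact: test_function_partial_continuous.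
Qed.

Let quotient_translate (f : vec3 R -> R) a (v : vec3 R) x :
  (fun h : R => h^-1 *: (((fun y : vec3 R => f (y + a)) \o shift x) (h *: v) - f (x + a))) =
  (fun h : R => h^-1 *: ((f \o shift (x + a)) (h *: v) - f (x + a))).
Proof. by apply/funext => h /=; rewrite addrA. Qed.

Lemma derive_translate (f : vec3 R -> R) a (v : vec3 R) x :
  'D_v (fun y : vec3 R => f (y + a)) x = 'D_v f (x + a).
Proof. by rewrite /derive quotient_translate. Qed.

Lemma derivable_translate (f : vec3 R -> R) a (v : vec3 R) x :
  derivable f (x + a) v -> derivable (fun y : vec3 R => f (y + a)) x v.
Proof. by rewrite /derivable quotient_translate. Qed.

Lemma test_function_translate phi a : test_function phi ->
  test_function (fun x => phi (x + a)).
Proof.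
move=> [sphi cphi].
have cont_a (b : vec3 R) : continuous (fun x : vec3 R => x + b).
  by move=> x; apply: cvgD; [exact: cvg_id|exact: cvg_cst].
have iterE s : iterated_partial s (fun x => phi (x + a)) =
    (fun x => iterated_partial s phi (x + a)).
  elim: s => [//|i s IH] /=; rewrite IH; apply/funext => x; exact: derive_translate.
split=> [s|].
  have [cs ds] := sphi s; rewrite iterE; split=> [x|i x].
    exact: (continuous_comp (cont_a a x) (cs (x + a))).
  exact: derivable_translate.
pose K := (fun x => x - a) @` closure [set x | phi x != 0].
have cK : compact K.
  apply: continuous_compact => //; apply: continuous_subspaceT; exact: cont_a.
apply: (subclosed_compact _ cK); first exact: closed_closure.
have clK : closed K.
  by apply: compact_closed => //; exact: norm_hausdorff.
rewrite [X in _ `<=` X](closure_id K).1//; apply: closure_subset => x /= phix.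
exists (x + a); last by rewrite addrK.
exact: subset_closure.
Qed.

Lemma is_derive_test_line phi j x (s : R) : test_function phi ->
  is_derive s 1 (fun r : R => phi (x + r *: basis3 j))
    ('D_(basis3 j) phi (x + s *: basis3 j)).
Proof.
move=> [/(_ [::])[_ /(_ j (x + s *: basis3 j))/= dphi] _].
have E : (fun h : R => h^-1 *: ((fun r : R => phi (x + r *: basis3 j)) (h *: (1 : R^o) + s) -
    phi (x + s *: basis3 j))) =
  (fun h : R => h^-1 *: (phi (h *: basis3 j + (x + s *: basis3 j)) - phi (x + s *: basis3 j))).
  apply/funext => h; congr (_ *: (phi _ - _)).
  by rewrite scalerDl -scalerA scale1r addrCA.
split; first by rewrite /derivable /= E.
by rewrite /derive /= E.
Qed.

End test_functions.

(** * Divergence of the Oseen kernel *)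

Section total_Rintegral.
Context d (T : measurableType d) (R : realType) (mu : {measure set T -> \bar R}).

(** The integral of a measurable function that is not integrable is infinite, and
hence 0 as a real number. *)
Lemma Rintegral_nonintegrable (f : T -> R) : measurable_fun [set: T] f ->
  ~ mu.-integrable [set: T] (EFin \o f) -> \int[mu]_x f x = 0.
Proof.
move=> mf nif.
have [fin|nfin] := boolP ((\int[mu]_x (f x)%:E)%E \is a fin_num); last first.
  by move: nfin; rewrite /Rintegral; case: (\int[mu]_x (f x)%:E)%E.
exfalso; apply: nif; apply/integrableP; split; first exact/measurable_EFinP.
move: fin; rewrite integralE fin_numB => /andP[finp finn].
have mE : measurable_fun [set: T] (EFin \o f) by exact/measurable_EFinP.
rewrite (_ : (fun x => `|(EFin \o f) x|%E) = (EFin \o f)^\+ \+ (EFin \o f)^\-)%E; last first.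
  by rewrite -fune_abse.
rewrite ge0_integralD//; [|exact: measurable_funepos|exact: measurable_funeneg].
by apply: lte_add_pinfty; rewrite ltey_eq ?finp ?finn.
Qed.

Lemma Rintegral_mulc (c : R) (f : T -> R) : measurable_fun [set: T] f ->
  \int[mu]_x (c * f x) = c * \int[mu]_x f x.
Proof.
move=> mf; have [intf|nintf] := pselect (mu.-integrable [set: T] (EFin \o f)).
  exact: RintegralZl.
have [->|c0] := eqVneq c 0.
  by rewrite mul0r; under eq_Rintegral do rewrite mul0r; rewrite Rintegral_cst// mul0r.
rewrite !Rintegral_nonintegrable ?mulr0//; first exact: measurable_funM.
move=> intcf; apply: nintf.
have -> : EFin \o f = (fun x => (c^-1)%:E * (c * f x)%:E)%E.
  by apply/funext => x; rewrite -EFinM mulrA mulVf// mul1r.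
exact: integrableZl.
Qed.

End total_Rintegral.

Section trigonometric_ibp.
Context {R : realType}.
Implicit Types (phi : vec3 R -> R) (x y xi : vec3 R) (j : 'I_3).

(** The formula for the derivative of a cosine transform, with the roles of the
position and the frequency exchanged. *)
Lemma test_ibp phi j xi (c : R) : test_function phi ->
  \int[leb3 R]_x ('D_(basis3 j) phi x * cos (dot xi x + c)) =
  coord3 j xi * \int[leb3 R]_x (phi x * sin (dot xi x + c)).
Proof.
move=> tphi.
have iphi := box_bounded_integrable (measurable_test tphi) (test_function_box tphi).
have idphi := box_bounded_integrable (measurable_test_partial j tphi)
  (test_function_partial_box j tphi).
have dphi x (r : R) : 0 < dot (x + r *: basis3 j) (x + r *: basis3 j) ->
    is_derive r 1 (fun r : R => phi (x + r *: basis3 j))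
      ('D_(basis3 j) phi (x + r *: basis3 j)) /\
    {for r, continuous (fun r : R => 'D_(basis3 j) phi (x + r *: basis3 j))}.
  move=> _; split; first exact: is_derive_test_line.
  have cl : {for r, continuous (fun r : R => x + r *: basis3 j)}.
    by apply: cvgD; [exact: cvg_cst|apply: cvgZr_tmp; exact: cvg_id].
  apply: (@continuous_comp _ _ _ (fun r : R => x + r *: basis3 j)
    (fun y => 'D_(basis3 j) phi y) r cl).
  exact: test_function_partial_continuous.
have := cosT_derive iphi idphi dphi (c - pi / 2) xi.
rewrite /cosT subrK => <-; congr (_ * _); apply: eq_Rintegral => x _.
by rewrite addrA cosBpihalf.
Qed.

Lemma dot_subl x y xi : dot (x - y) xi = dot xi x - dot xi y.
Proof. by rewrite !dotE; case: x => -[? ?] ?; case: y => -[? ?] ? /=; ring. Qed.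

Lemma sum_coord3_sqr xi : \sum_j coord3 j xi ^+ 2 = enorm xi ^+ 2.
Proof. by rewrite /enorm sqr_sqrtr ?dot_ge0//; apply: eq_bigr => j _; rewrite expr2. Qed.

(** The Leray symbol is the matrix of the projection on the orthogonal of [xi]. *)
Lemma leray_symbol_orthogonal (k : 'I_3) xi :
  \sum_j leray_symbol j k xi * coord3 j xi = 0.
Proof.
rewrite /leray_symbol; under eq_bigr do rewrite mulrBl.
rewrite big_split/= (bigD1 k)//= eqxx mul1r big1 ?addr0; last first.
  by move=> j /negbTE ->; rewrite mul0r.
rewrite sumrN.
have -> : \sum_j coord3 j xi * coord3 k xi / enorm xi ^+ 2 * coord3 j xi =
    coord3 k xi / enorm xi ^+ 2 * \sum_j coord3 j xi ^+ 2.
  by rewrite mulr_sumr; apply: eq_bigr => j _; ring.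
rewrite sum_coord3_sqr; have [E0|E0] := eqVneq (enorm xi) 0.
  have ck0 : coord3 k xi = 0.
    apply/eqP; rewrite -sqrf_eq0 eq_le sqr_ge0 andbT (le_trans (coord3_sqr_le k xi))//.
    by move/eqP : E0; rewrite sqrtr_eq0.
  by rewrite ck0 !mul0r subrr.
by rewrite divfK ?subrr// expf_neq0.
Qed.

End trigonometric_ibp.

Section divergence.
Context {R : realType} (al q : R) (al2 : 1 / 2 < al) (q2 : 2 < q).
Implicit Types (phi psi : vec3 R -> R) (x y xi : vec3 R) (t : R) (j k l : 'I_3).
Local Notation NE f := ('N[leb3 R]_q%:E[(fun x => (f x)%:E)])%E.

Let al0 : 0 < al. Proof. by rewrite (lt_trans _ al2)// divr_gt0. Qed.
Let q0 : 0 < q. Proof. exact: lt_trans q2. Qed.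

Lemma integrable_oseen_symbol t j k l : 0 < t ->
  (leb3 R).-integrable [set: mvec3 R] (EFin \o oseen_symbol al t j k l).
Proof.
move=> t0; have l0 := inv_length_gt0 al t0.
have mO := @measurable_at2 R t (fun t => oseen_symbol al t j k l)
  (measurable_oseen_symbol al j k l).
have i1 : (leb3 R).-integrable [set: mvec3 R] (EFin \o oseen_symbol al 1 j k l).
  by apply: (integrable_symbol al0 _ (oseen_symbol_class al ord0 j k l)); lra.
apply/integrableP; split; first exact/measurable_EFinP.
rewrite (@ge0_integral_affine3 _ (inv_length al t) 0) ?gt_eqF//; last first.
  by apply: measurableT_comp => //; exact/measurable_EFinP.
apply: lte_mul_pinfty; rewrite ?lee_fin ?exprn_ge0//.
rewrite (_ : (fun x => _) = (fun x => (inv_length al t)%:E *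
    `|(oseen_symbol al 1 j k l x)%:E|)%E); last first.
  apply/funext => x; rewrite /= oseen_symbol_scale// normrM ger0_norm ?(ltW l0)//.
rewrite ge0_integralZl_EFin ?(ltW l0)//; last first.
  by apply: measurableT_comp => //; exact: measurable_int i1.
apply: lte_mul_pinfty; rewrite ?lee_fin ?(ltW l0)//.
by have /integrableP[] := i1.
Qed.

(** In Fourier variables the divergence of a column of the Oseen kernel is the
inner product of the frequency with a column of the Leray symbol, which is 0. *)
Lemma oseen_kernel_div_free phi t k l y : 0 < t -> test_function phi ->
  \sum_j \int[leb3 R]_x (oseen_kernel al t j k l (x - y) * 'D_(basis3 j) phi x) = 0.
Proof.
move=> t0 tphi; pose c0 : R := (2 * pi) ^- 3.
pose S xi : R := \int[leb3 R]_x (phi x * sin (dot xi x + (pi / 2 - dot xi y))).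
pose G j (z : mvec3 R * mvec3 R) : R := oseen_symbol al t j k l z.2 *
  ('D_(basis3 j) phi z.1 * cos (dot z.2 z.1 + (pi / 2 - dot z.2 y))).
have mO j := @measurable_at2 R t (fun t => oseen_symbol al t j k l)
  (measurable_oseen_symbol al j k l).
have mG j : measurable_fun [set: mvec3 R * mvec3 R] (G j).
  apply: measurable_funM; first exact: (measurableT_comp (mO j) measurable_snd).
  apply: measurable_funM.
    exact: (measurableT_comp (measurable_test_partial j tphi) measurable_fst).
  apply: (measurableT_comp (continuous_measurable_fun (@continuous_cos R))).
  apply: measurable_funD.
    by apply: measurable_dot; [exact: measurable_snd|exact: measurable_fst].
  apply: measurable_funB => //.
  by apply: measurable_dot; [exact: measurable_snd|exact: measurable_cst].
have nle (a b c : R) : `|c| <= 1 -> `|a * (b * c)| <= `|b| * `|a|.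
  by move=> c1; rewrite !normrM mulrCA ler_wpM2l// ler_piMr.
have idphi j := box_bounded_integrable (measurable_test_partial j tphi)
  (test_function_partial_box j tphi).
have Goo j : (\int[leb3 R]_x \int[leb3 R]_xi (`|G j (x, xi)|)%:E < +oo)%E.
  apply: (@le_lt_trans _ _ (\int[leb3 R]_x ((`|'D_(basis3 j) phi x|)%:E *
      \int[leb3 R]_xi (`|oseen_symbol al t j k l xi|)%:E))%E).
    apply: ge0_le_integral; first exact: measurableT.
    - by move=> x _; apply: integral_ge0 => xi _; rewrite lee_fin.
    - apply: (@measurable_fun_fubini_tonelli_F _ _ _ _ _ (leb3 R) (fun z => (`|G j z|)%:E)).
        by apply/measurable_EFinP; exact: measurableT_comp.
      by move=> z; rewrite lee_fin.
    - apply: emeasurable_funM => //; apply/measurable_EFinP.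
      by apply: measurableT_comp => //; exact: measurable_test_partial.
    move=> x _; rewrite -ge0_integralZl_EFin//; last first.
      by apply/measurable_EFinP; exact: measurableT_comp.
    apply: ge0_le_integral => //.
    - apply/measurable_EFinP; apply: measurableT_comp => //.
      exact: (measurableT_comp (mG j) (measurable_pair1 x)).
    - by apply: emeasurable_funM => //; apply/measurable_EFinP; exact: measurableT_comp.
    by move=> xi _; rewrite -EFinM lee_fin /G; apply: nle; exact: cos_norm_le1.
  rewrite ge0_integralZr//; last 2 first.
  - apply/measurable_EFinP; apply: measurableT_comp => //; exact: measurable_test_partial.
  - by apply: integral_ge0 => xi _; rewrite lee_fin.
  have /integrableP[_ i1] := idphi j.
  have /integrableP[_ i2] := integrable_oseen_symbol j k l t0.
  apply: lte_mul_pinfty => //.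
    by apply: integral_ge0 => xi _; rewrite lee_fin.
  by rewrite ge0_fin_numE//; apply: integral_ge0 => xi _; rewrite lee_fin.
have fub j := Rintegral_fubini (mG j) (Goo j).
have GE j xi : \int[leb3 R]_x G j (x, xi) =
    oseen_symbol al t j k l xi * coord3 j xi * S xi.
  rewrite /G/= Rintegral_mulc; last first.
    apply: measurable_funM; first exact: measurable_test_partial.
    exact: measurable_cos_dot.
  rewrite -[RHS]mulrA.
  by apply: (f_equal (fun u => oseen_symbol al t j k l xi * u)); exact: test_ibp.
have E j : \int[leb3 R]_x (oseen_kernel al t j k l (x - y) * 'D_(basis3 j) phi x) =
    c0 * \int[leb3 R]_xi (oseen_symbol al t j k l xi * coord3 j xi * S xi).
  have [_ _ fubE] := fub j.
  transitivity (\int[leb3 R]_x (c0 * \int[leb3 R]_xi G j (x, xi))).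
    apply: eq_Rintegral => x _; rewrite oseen_kernelE -/c0 -mulrA; congr (_ * _).
    rewrite /cosT mulrC -Rintegral_mulc; last first.
      exact: (measurable_funM (mO j) (measurable_cos_dot (x - y) (pi / 2))).
    apply: eq_Rintegral => xi _; rewrite /G/= dot_subl mulrCA.
    by congr (_ * (_ * cos _)); ring.
  rewrite Rintegral_mulc; last first.
    exact: (@measurable_fun_Rintegral _ _ _ _ _ (leb3 R)).
  apply: (f_equal (fun u => c0 * u)); apply: (etrans fubE).
  by apply: eq_Rintegral => xi _; exact: GE.
under eq_bigr do rewrite E.
rewrite -mulr_sumr -Rintegral_finsum//; last first.
  move=> j; have [_ i2 _] := fub j; apply: (eq_integrable _ _ _ _ i2) => // xi _.
  by apply: (f_equal EFin); exact: GE.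
rewrite (_ : (fun xi => _) = cst 0); first by rewrite Rintegral_cst// mul0r mulr0.
apply/funext => xi; rewrite -mulr_suml.
have -> : \sum_j oseen_symbol al t j k l xi * coord3 j xi =
    heat_symbol al t xi * coord3 l xi * \sum_j leray_symbol j k xi * coord3 j xi.
  by rewrite mulr_sumr; apply: eq_bigr => j _; rewrite /oseen_symbol; ring.
by rewrite leray_symbol_orthogonal mulr0 mul0r.
Qed.

Lemma Lnorm_test_lty (G : vec3 R -> \bar R) psi :
  measurable_fun [set: mvec3 R] G -> (forall x, 0 <= G x)%E ->
  ('N[leb3 R]_q%:E[G] < +oo)%E ->
  measurable_fun [set: mvec3 R] psi -> box_bounded psi ->
  (\int[leb3 R]_x (G x * (`|psi x|)%:E) < +oo)%E.
Proof.
move=> mG G0 NG mpsi bpsi; pose r := q / (q - 1).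
have q10 : 0 < q - 1 by rewrite subr_gt0 (lt_trans _ q2)// ltr1n.
have r0 : 0 < r by rewrite divr_gt0.
have qr : q^-1 + r^-1 = 1 by rewrite /r invf_div; field; rewrite gt_eqF.
have mpE : measurable_fun [set: mvec3 R] (fun x => (`|psi x|)%:E).
  by apply/measurable_EFinP; exact: measurableT_comp.
have p0 x : (0 <= (`|psi x|)%:E)%E by rewrite lee_fin.
apply: (le_lt_trans (ge0_hoelder (leb3 R) mG mpE G0 p0 q0 r0 qr)).
rewrite -ge0_Lnorm//.
have fin1 : ('N[leb3 R]_q%:E[G])%E \is a fin_num by rewrite ge0_fin_numE ?Lnorm_ge0.
have : ((\int[leb3 R]_x ((`|psi x|)%:E `^ r)) `^ r^-1 < +oo)%E.
  by apply: poweR_lty; apply: box_bounded_powR.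
by move=> fin2; rewrite -(fineK fin1); apply: lte_mul_pinfty; rewrite ?lee_fin ?fine_ge0 ?Lnorm_ge0.
Qed.

Lemma integrable_test_mul (c : vec3 R -> R) psi :
  measurable_fun [set: mvec3 R] c -> (NE (fun x => `|c x|) < +oo)%E ->
  measurable_fun [set: mvec3 R] psi -> box_bounded psi ->
  (leb3 R).-integrable [set: mvec3 R] (fun x => (c x * psi x)%:E).
Proof.
move=> mc Nc mpsi bpsi; apply/integrableP; split.
  by apply/measurable_EFinP; exact: measurable_funM.
have mcE : measurable_fun [set: mvec3 R] (fun x => (`|c x|)%:E).
  by apply/measurable_EFinP; exact: measurableT_comp.
have := @Lnorm_test_lty (fun x => (`|c x|)%:E) psi mcE _ Nc mpsi bpsi.
move=> /(_ (fun=> _)) H; apply: le_lt_trans (H _); last by move=> x; rewrite lee_fin.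
by rewrite le_eqVlt; apply/orP; left; apply/eqP; apply: eq_integral => x _; rewrite /= normrM.
Qed.

End divergence.

(** * Divergence of the terms of the integral equation *)

Section convolution_pairing.
Context {R : realType}.
Implicit Types (x y z : vec3 R).
Variables (K w psi : vec3 R -> R).
Hypotheses (mK : measurable_fun [set: mvec3 R] K) (mw : measurable_fun [set: mvec3 R] w)
  (mpsi : measurable_fun [set: mvec3 R] psi).
Hypothesis summable : (\int[leb3 R]_x ((\int[leb3 R]_y (`|K (x - y)%R * w y|)%:E) *
  (`|psi x|)%:E) < +oo)%E.

Let mKs : measurable_fun [set: mvec3 R * mvec3 R]
  (fun p : mvec3 R * mvec3 R => K ((p.1 : vec3 R) - p.2)).
Proof. exact: (measurableT_comp mK (@measurable_sub3 R)). Qed.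

Let mws : measurable_fun [set: mvec3 R * mvec3 R]
  (fun p : mvec3 R * mvec3 R => w ((p.1 : vec3 R) - p.2)).
Proof. exact: (measurableT_comp mw (@measurable_sub3 R)). Qed.

Let mKr x : measurable_fun [set: mvec3 R] (fun y : mvec3 R => K (x - (y : vec3 R))).
Proof. exact: (measurableT_comp mK (measurable_reflect3 x)). Qed.

Let mwr x : measurable_fun [set: mvec3 R] (fun y : mvec3 R => w (x - (y : vec3 R))).
Proof. exact: (measurableT_comp mw (measurable_reflect3 x)). Qed.

(** Two ways to carry a test function over a convolution: onto the convolved function
here, and onto the kernel in the next lemma. *)
Lemma pairing_source :
  [/\ (leb3 R).-integrable [set: mvec3 R] (fun x => (convolution K w x * psi x)%:E),
    (leb3 R).-integrable [set: mvec3 R]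
      (fun y => (w y * \int[leb3 R]_x (K (x - y) * psi x))%:E) &
    \int[leb3 R]_x (convolution K w x * psi x) =
    \int[leb3 R]_y (w y * \int[leb3 R]_x (K (x - y) * psi x))].
Proof.
pose G (p : mvec3 R * mvec3 R) : R := psi p.1 * (K ((p.1 : vec3 R) - p.2) * w p.2).
have mG : measurable_fun [set: mvec3 R * mvec3 R] G.
  apply: measurable_funM; first exact: (measurableT_comp mpsi measurable_fst).
  by apply: measurable_funM; [exact: mKs|exact: (measurableT_comp mw measurable_snd)].
have Goo : (\int[leb3 R]_x \int[leb3 R]_y (`|G (x, y)|)%:E < +oo)%E.
  rewrite (_ : (\int[leb3 R]_x _)%E = (\int[leb3 R]_x ((\int[leb3 R]_y
    (`|K (x - y)%R * w y|)%:E) * (`|psi x|)%:E))%E)//.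
  apply: eq_integral => x _; rewrite muleC -ge0_integralZl_EFin//; last first.
    apply/measurable_EFinP; apply: measurableT_comp => //.
    exact: (measurable_funM (mKr x) mw).
  by apply: eq_integral => y _; rewrite /G normrM EFinM.
have [i1 i2 E] := Rintegral_fubini mG Goo.
have E1 x : \int[leb3 R]_y G (x, y) = convolution K w x * psi x.
  rewrite /G/= Rintegral_mulc; last exact: (measurable_funM (mKr x) mw).
  exact: mulrC.
have E2 y : \int[leb3 R]_x G (x, y) = w y * \int[leb3 R]_x (K (x - y) * psi x).
  rewrite -Rintegral_mulc; last first.
    apply: measurable_funM; last exact: mpsi.
    exact: (measurableT_comp mK (measurable_translate3 (- y))).
  by apply: eq_Rintegral => x _; rewrite /G/=; ring.
split.
- by apply: (eq_integrable measurableT _ _ _ i1) => x _; apply: (f_equal EFin); exact: E1.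
- by apply: (eq_integrable measurableT _ _ _ i2) => y _; apply: (f_equal EFin); exact: E2.
transitivity (\int[leb3 R]_x \int[leb3 R]_y G (x, y)).
  by apply: eq_Rintegral => x _; exact: (esym (E1 x)).
apply: (etrans E); apply: eq_Rintegral => y _; exact: E2.
Qed.

Lemma pairing_kernel :
  (leb3 R).-integrable [set: mvec3 R]
    (fun z => (K z * \int[leb3 R]_y (w y * psi (y + z)))%:E) /\
  \int[leb3 R]_x (convolution K w x * psi x) =
  \int[leb3 R]_z (K z * \int[leb3 R]_y (w y * psi (y + z))).
Proof.
pose G (p : mvec3 R * mvec3 R) : R := psi p.1 * (K p.2 * w ((p.1 : vec3 R) - p.2)).
have mG : measurable_fun [set: mvec3 R * mvec3 R] G.
  apply: measurable_funM; first exact: (measurableT_comp mpsi measurable_fst).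
  by apply: measurable_funM; [exact: (measurableT_comp mK measurable_snd)|exact: mws].
have subK x y : x - (x - y) = y by rewrite opprB addrCA subrr addr0.
have Goo : (\int[leb3 R]_x \int[leb3 R]_y (`|G (x, y)|)%:E < +oo)%E.
  rewrite (_ : (\int[leb3 R]_x _)%E = (\int[leb3 R]_x ((\int[leb3 R]_y
    (`|K (x - y)%R * w y|)%:E) * (`|psi x|)%:E))%E)//.
  apply: eq_integral => x _.
  have mH : measurable_fun [set: mvec3 R] (fun z => (`|K z * w (x - z)%R|)%:E).
    apply/measurable_EFinP; apply: measurableT_comp => //.
    exact: (measurable_funM mK (mwr x)).
  have <- : (\int[leb3 R]_z (`|K z * w (x - z)%R|)%:E =
      \int[leb3 R]_y (`|K (x - y)%R * w y|)%:E)%E.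
    rewrite -(@integral_reflect3 R x (fun z => (`|K z * w (x - z)%R|)%:E) mH).
    by apply: eq_integral => y _; rewrite subK.
  rewrite muleC -ge0_integralZl_EFin//.
  by apply: eq_integral => y _; rewrite /G normrM EFinM.
have [i1 i2 E] := Rintegral_fubini mG Goo.
have E1 x : \int[leb3 R]_z G (x, z) = convolution K w x * psi x.
  rewrite /G/= Rintegral_mulc; last exact: (measurable_funM mK (mwr x)).
  rewrite mulrC; congr (_ * _); rewrite /convolution /Rintegral; congr fine.
  rewrite -(@integral_reflect3 R x (fun z => (K z * w (x - z)%R)%:E)); last first.
    by apply/measurable_EFinP; exact: (measurable_funM mK (mwr x)).
  by apply: eq_integral => y _; rewrite subK.
have E2 z : \int[leb3 R]_x G (x, z) = K z * \int[leb3 R]_y (w y * psi (y + z)).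
  have mH : measurable_fun [set: mvec3 R] (fun y => w y * psi (y + z)).
    apply: measurable_funM; first exact: mw.
    exact: (measurableT_comp mpsi (measurable_translate3 z)).
  rewrite -Rintegral_mulc; last exact: mH.
  rewrite /Rintegral; congr fine.
  rewrite -(@integral_translate3 R z (fun x => (G (x, z))%:E)); last first.
    by apply/measurable_EFinP; exact: (measurableT_comp mG (measurable_pair2 z)).
  by apply: eq_integral => y _; rewrite /G/= addrK; congr (_%:E); ring.
split.
  by apply: (eq_integrable measurableT _ _ _ i2) => y _; apply: (f_equal EFin); exact: E2.
transitivity (\int[leb3 R]_x \int[leb3 R]_y G (x, y)).
  by apply: eq_Rintegral => x _; exact: (esym (E1 x)).
apply: (etrans E); apply: eq_Rintegral => y _; exact: E2.
Qed.

End convolution_pairing.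

Section divergence_of_terms.
Context {R : realType} (al q : R) (al2 : 1 / 2 < al) (q2 : 2 < q).
Implicit Types (phi : vec3 R -> R) (x y z : vec3 R) (t : R) (j k l : 'I_3).
Local Notation NE f := ('N[leb3 R]_q%:E[(fun x => (f x)%:E)])%E.

(** Components of a divergence free field; the sum stands outside the integral
because the terms below are treated one by one. *)
Definition weakly_div_free (h : 'I_3 -> vec3 R -> R) := forall phi, test_function phi ->
  \sum_j \int[leb3 R]_x (h j x * 'D_(basis3 j) phi x) = 0.

Lemma weakly_div_freeP (v : vec3 R -> vec3 R) :
  (forall j, measurable_fun [set: mvec3 R] (fun x => coord3 j (v x))) ->
  (forall j, (NE (fun x => `|coord3 j (v x)|) < +oo)%E) ->
  divergence_free v <-> weakly_div_free (fun j x => coord3 j (v x)).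
Proof.
move=> mv Nv.
have E phi : test_function phi ->
    \int[leb3 R]_x (\sum_(i < 3) coord3 i (v x) * 'D_(basis3 i) phi x) =
    \sum_j \int[leb3 R]_x (coord3 j (v x) * 'D_(basis3 j) phi x).
  move=> tphi; rewrite Rintegral_finsum// => j.
  apply: (integrable_test_mul q2 (mv j) (Nv j)).
    exact: measurable_test_partial.
  exact: test_function_partial_box.
by split=> H phi tphi; have := H phi tphi; rewrite E.
Qed.

Lemma measurable_convolution_size (K w : vec3 R -> R) :
  measurable_fun [set: mvec3 R] K -> measurable_fun [set: mvec3 R] w ->
  measurable_fun [set: mvec3 R]
    (fun x : mvec3 R => \int[leb3 R]_y (`|K ((x : vec3 R) - y)%R * w y|)%:E)%E.
Proof.
move=> mK mw.
apply: (@measurable_fun_fubini_tonelli_F _ _ _ _ _ (leb3 R)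
  (fun p : mvec3 R * mvec3 R => (`|K ((p.1 : vec3 R) - p.2) * w p.2|)%:E)).
  apply/measurable_EFinP; apply: measurableT_comp => //; apply: measurable_funM.
    exact: (measurableT_comp mK (@measurable_sub3 R)).
  exact: (measurableT_comp mw measurable_snd).
by move=> p; rewrite lee_fin.
Qed.

Lemma summable_pairing (K w psi : vec3 R -> R) :
  measurable_fun [set: mvec3 R] K -> measurable_fun [set: mvec3 R] w ->
  ('N[leb3 R]_q%:E[(fun x => \int[leb3 R]_y (`|K (x - y)%R * w y|)%:E)] < +oo)%E ->
  measurable_fun [set: mvec3 R] psi -> box_bounded psi ->
  (\int[leb3 R]_x ((\int[leb3 R]_y (`|K (x - y)%R * w y|)%:E) * (`|psi x|)%:E) < +oo)%E.
Proof.
move=> mK mw NKw mpsi bpsi; apply: (Lnorm_test_lty q2) => //.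
  exact: measurable_convolution_size.
by move=> x; apply: integral_ge0 => y _; rewrite lee_fin.
Qed.

(** Tested against [phi], the convolution is the average, weighted by the kernel, of the
pairings of [h] with the translates of [phi], and these vanish. *)
Lemma heat_div_free t (h : 'I_3 -> vec3 R -> R) : 0 < t ->
  (forall j, measurable_fun [set: mvec3 R] (h j)) ->
  (forall j, (NE (fun x => `|h j x|) < +oo)%E) ->
  weakly_div_free h -> weakly_div_free (fun j => convolution (heat_kernel al t) (h j)).
Proof.
move=> t0 mh Nh dh phi tphi.
have [C C0 [HC _]] := heat_bounds al2 q2.
have mK : measurable_fun [set: mvec3 R] (heat_kernel al t).
  exact: spacetime_measurable_slice (measurable_heat_kernel al).
have sum j : (\int[leb3 R]_x ((\int[leb3 R]_y (`|heat_kernel al t (x - y)%R * h j y|)%:E) *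
    (`|'D_(basis3 j) phi x|)%:E) < +oo)%E.
  apply: summable_pairing => //.
  - apply: (le_lt_trans (HC (h j) t t0 (mh j))).
    by apply: lte_mul_pinfty; rewrite ?lee_fin.
  - exact: measurable_test_partial.
  - exact: test_function_partial_box.
have P j := pairing_kernel mK (mh j) (measurable_test_partial j tphi) (sum j).
under eq_bigr do rewrite (P _).2.
rewrite -Rintegral_finsum//; last by move=> j; exact: (P j).1.
rewrite (_ : (fun z => _) = cst 0); first by rewrite Rintegral_cst// mul0r.
apply/funext => z; rewrite -mulr_sumr.
rewrite (_ : \sum_j _ = 0) ?mulr0//.
rewrite -[RHS](dh _ (test_function_translate z tphi)); apply: eq_bigr => j _.
by apply: eq_Rintegral => y _; rewrite derive_translate.
Qed.

(** Here the condition comes from the kernel, whatever [w] is. *)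
Lemma oseen_div_free t k l (w : vec3 R -> R) : 0 < t ->
  measurable_fun [set: mvec3 R] w ->
  ('N[leb3 R]_q%:E[(fun x => \int[leb3 R]_y (`|oseen_size al t (x - y)%R * w y|)%:E)]
    < +oo)%E ->
  weakly_div_free (fun j => convolution (oseen_kernel al t j k l) w).
Proof.
move=> t0 mw Nw phi tphi.
have mK j : measurable_fun [set: mvec3 R] (oseen_kernel al t j k l).
  exact: (@measurable_at2 R t (fun t => oseen_kernel al t j k l) (measurable_oseen_kernel al j k l)).
have mS : measurable_fun [set: mvec3 R] (oseen_size al t).
  exact: (@measurable_at2 R t (oseen_size al) (measurable_oseen_size al)).
have sum j : (\int[leb3 R]_x ((\int[leb3 R]_y (`|oseen_kernel al t j k l (x - y)%R * w y|)%:E) *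
    (`|'D_(basis3 j) phi x|)%:E) < +oo)%E.
  apply: summable_pairing => //; [|exact: measurable_test_partial|
    exact: test_function_partial_box].
  apply: le_lt_trans Nw; apply: (@le_Lnorm _ _ _ (leb3 R)).
  - exact: lt_trans q2.
  - exact: measurable_convolution_size.
  - exact: measurable_convolution_size.
  move=> x; apply/andP; split; first by apply: integral_ge0 => y _; rewrite lee_fin.
  apply: ge0_le_integral => //.
  - apply/measurable_EFinP; apply: measurableT_comp => //; apply: measurable_funM; last exact: mw.
    exact: (measurableT_comp (mK j) (measurable_reflect3 x)).
  - apply/measurable_EFinP; apply: measurableT_comp => //; apply: measurable_funM; last exact: mw.
    exact: (measurableT_comp mS (measurable_reflect3 x)).
  move=> y _; rewrite lee_fin !normrM ler_wpM2r// [leRHS]ger0_norm ?oseen_size_ge0//.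
  exact: le_oseen_size.
have P j := pairing_source (mK j) mw (measurable_test_partial j tphi) (sum j).
under eq_bigr => j _ do have [_ _ ->] := P j.
rewrite -Rintegral_finsum//; last by move=> j; have [] := P j.
rewrite (_ : (fun y => _) = cst 0); first by rewrite Rintegral_cst// mul0r.
apply/funext => y; rewrite -mulr_sumr.
by rewrite (oseen_kernel_div_free al2) ?mulr0.
Qed.

(** The pairing with a test function commutes with the time integral. *)
Lemma duhamel_div_free t (K w : 'I_3 -> R -> vec3 R -> R) :
  (forall j, spacetime_measurable (K j)) -> (forall j, spacetime_measurable (w j)) ->
  (forall j, ('N[leb3 R]_q%:E[duhamel_size (K j) (w j) t] < +oo)%E) ->
  {ae leb1 R, forall s : R, s \in `[0, t] ->
     weakly_div_free (fun j => convolution (K j (t - s)) (w j s))} ->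
  weakly_div_free (fun j => duhamel (K j) (w j) t).
Proof.
move=> mK mw NQ dK phi tphi.
pose I (s : R) : R := \1_(`[0, t] : set R) s.
pose c j (p : mvec3 R * measurableTypeR R) : R :=
  I p.2 * convolution (K j (t - p.2)) (w j p.2) p.1.
have mc j : measurable_fun [set: mvec3 R * measurableTypeR R] (c j).
  have mp : measurable_fun [set: mvec3 R * measurableTypeR R]
      (fun p : mvec3 R * measurableTypeR R => ((t, p.1), p.2) : mtimevec3 R * measurableTypeR R).
    apply: measurable_fun_pair; last exact: measurable_snd.
    by apply: measurable_fun_pair; [exact: measurable_cst|exact: measurable_fst].
  have := measurableT_comp (measurable_duhamel_section (mK j) (mw j)) mp.
  rewrite (_ : _ \o _ = c j)//; apply/funext => -[x s] /=.
  by rewrite /c /I/= indic_convolution.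
pose G j (p : mvec3 R * measurableTypeR R) : R := 'D_(basis3 j) phi p.1 * c j p.
have mG j : measurable_fun [set: mvec3 R * measurableTypeR R] (G j).
  apply: measurable_funM; last exact: mc.
  exact: (measurableT_comp (measurable_test_partial j tphi) measurable_fst).
have mc1 j x : measurable_fun [set: measurableTypeR R] (fun s => c j (x, s)).
  exact: (measurableT_comp (mc j) (measurable_pair1 x)).
have mc2 j s : measurable_fun [set: mvec3 R] (fun x => c j (x, s)).
  exact: (measurableT_comp (mc j) (measurable_pair2 s)).
have Goo j : (\int[leb3 R]_x \int[leb1 R]_s (`|G j (x, s)|)%:E < +oo)%E.
  have mQ : measurable_fun [set: mvec3 R] (duhamel_size (K j) (w j) t).
    exact: (measurableT_comp (measurable_duhamel_size (mK j) (mw j)) (measurable_pair1 t)).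
  have Q := Lnorm_test_lty q2 mQ (duhamel_size_ge0 _ _ _) (NQ j)
    (measurable_test_partial j tphi) (test_function_partial_box j tphi).
  apply: le_lt_trans Q; apply: ge0_le_integral => //.
  - by move=> x _; apply: integral_ge0 => s _; rewrite lee_fin.
  - apply: (@measurable_fun_fubini_tonelli_F _ _ _ _ _ (leb1 R) (fun p => (`|G j p|)%:E)).
      by apply/measurable_EFinP; exact: measurableT_comp.
    by move=> p; rewrite lee_fin.
  - apply: emeasurable_funM => //; apply/measurable_EFinP; apply: measurableT_comp => //.
    exact: measurable_test_partial.
  move=> x _; rewrite muleC.
  have -> : (\int[leb1 R]_s (`|G j (x, s)|)%:E = (`|'D_(basis3 j) phi x|)%:E *
      \int[leb1 R]_s (`|c j (x, s)|)%:E)%E.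
    rewrite -ge0_integralZl_EFin//; last first.
      by apply/measurable_EFinP; apply: measurableT_comp.
    by apply: eq_integral => s _; rewrite /G normrM EFinM.
  apply: lee_pmul => //; first by apply: integral_ge0 => s _; rewrite lee_fin.
  rewrite duhamel_sizeE; apply: ge0_le_integral => //.
  - by apply/measurable_EFinP; apply: measurableT_comp.
  - apply: (@measurable_fun_fubini_tonelli_F _ _ _ _ _ (leb3 R)
      (fun p => (`|duhamel_integrand (K j) (w j) (t, x) p|)%:E)).
      apply/measurable_EFinP; apply: measurableT_comp => //.
      exact: measurable_duhamel_integrand1.
    by move=> p; rewrite lee_fin.
  move=> s _; rewrite /c /I/= indic_convolution /Rintegral.
  have mi : measurable_fun [set: mvec3 R]
      (fun y => (duhamel_integrand (K j) (w j) (t, x) (s, y))%:E).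
    apply/measurable_EFinP.
    exact: (measurableT_comp (measurable_duhamel_integrand1 (t, x) (mK j) (mw j)) (measurable_pair1 s)).
  apply: le_trans (le_abse_integral _ measurableT mi).
  by case: (integral _ _ _) => [r| |]//=; rewrite normr0 leey.
have fub j := Rintegral_fubini (mG j) (Goo j).
have E1 j x : \int[leb1 R]_s G j (x, s) = duhamel (K j) (w j) t x * 'D_(basis3 j) phi x.
  rewrite /G/= Rintegral_mulc// mulrC; congr (_ * _).
  by rewrite /duhamel [RHS]Rintegral_indicM.
have E2 j s : \int[leb3 R]_x G j (x, s) =
    I s * \int[leb3 R]_x (convolution (K j (t - s)) (w j s) x * 'D_(basis3 j) phi x).
  rewrite /G /c /I/= indicE; case: (s \in _).
    by rewrite mul1r; apply: eq_Rintegral => x _; rewrite mul1r mulrC.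
  rewrite mul0r; under eq_Rintegral do rewrite mul0r mulr0.
  by rewrite Rintegral_cst// mul0r.
transitivity (\sum_j \int[leb1 R]_s \int[leb3 R]_x G j (x, s)).
  apply: eq_bigr => j _; have [_ _ <-] := fub j.
  by apply: eq_Rintegral => x _; exact: (esym (E1 j x)).
have iS j : (leb1 R).-integrable [set: measurableTypeR R]
    (EFin \o (fun s => \int[leb3 R]_x G j (x, s))) by have [] := fub j.
rewrite -Rintegral_finsum//.
suff E : (\int[leb1 R]_s (\sum_j \int[leb3 R]_x G j (x, s))%:E = 0)%E.
  by rewrite /Rintegral E.
transitivity (\int[leb1 R]_s (cst 0%E s))%E; last exact: integral0.
apply: ae_eq_integral => //.
  exact: measurable_int (integrable_finsum measurableT iS).
apply: ae_imp dK => s ds _; apply: (f_equal EFin).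
rewrite (eq_bigr (fun j => I s * \int[leb3 R]_x
  (convolution (K j (t - s)) (w j s) x * 'D_(basis3 j) phi x))); last first.
  by move=> j _; exact: E2.
rewrite -mulr_sumr /I indicE.
have [/set_mem st|] := boolP (s \in (`[0, t]%classic : set R)); last by rewrite mul0r.
by rewrite (ds st _ tphi) mulr0.
Qed.

End divergence_of_terms.

(** * Velocity fields and variable exponents *)

Section integrals_without_measurability.
Context d (T : measurableType d) (R : realType) (mu : {measure set T -> \bar R}).
Local Open Scope ereal_scope.

(** The integral of a nonnegative function is a supremum over the simple functions
below it, hence monotone even when the larger function is not measurable. *)
Lemma ge0_integral_mono (D E : set T) (f g : T -> \bar R) : D `<=` E ->
  (forall x, D x -> 0 <= f x) -> (forall x, E x -> 0 <= g x) ->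
  (forall x, D x -> f x <= g x) ->
  \int[mu]_(x in D) f x <= \int[mu]_(x in E) g x.
Proof.
move=> DE f0 g0 fg; rewrite (integral_mkcond D) (integral_mkcond E).
rewrite !ge0_integralTE; last 2 first.
- by move=> x; exact: erestrict_ge0.
- by move=> x; exact: erestrict_ge0.
apply: le_ereal_sup => _ [h hf <-]; exists h => // x.
apply: (le_trans (hf x)); rewrite /patch.
have [/set_mem Dx|] := boolP (x \in D); first by rewrite mem_set ?fg//; exact: DE.
by move=> _; case: ifPn => // /set_mem Ex; exact: g0.
Qed.

(** The positive part of f - 1 is a measurable function below [g]. *)
Lemma ge0_integral_le_cstD (D : set T) (f g : T -> \bar R) : measurable D ->
  measurable_fun [set: T] f -> (forall x, 0 <= f x) ->
  (forall x, D x -> 0 <= g x) -> (forall x, D x -> f x <= 1 + g x) ->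
  \int[mu]_(x in D) f x <= mu D + \int[mu]_(x in D) g x.
Proof.
move=> mD mf f0 g0 fg.
pose h x := maxe (f x - 1) 0.
have mh : measurable_fun [set: T] h by apply: measurable_maxe => //; exact: emeasurable_funB.
have h0 x : 0 <= h x by rewrite le_max lexx orbT.
apply: (@le_trans _ _ (\int[mu]_(x in D) (1 + h x))).
  apply: ge0_le_integral => //.
  - exact: measurable_funTS.
  - by apply: measurable_funTS; exact: emeasurable_funD.
  by move=> x _; rewrite -leeBlDl// le_max lexx.
rewrite ge0_integralD//; last exact: measurable_funTS.
rewrite integral_cst// mul1e leeD2l//; apply: ge0_integral_mono => // x Dx.
by rewrite /h ge_max g0// leeBlDl// fg.
Qed.

End integrals_without_measurability.

Section cutoff.
Context {R : realType}.
Implicit Types (u : R -> vec3 R -> vec3 R) (i : interval R) (j : 'I_3) (x y : vec3 R).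

(** Makes a field that is measurable on an interval of times measurable on the whole of
space-time. *)
Definition cutoff i u j (s : R) y : R := if s \in i then coord3 j (u s y) else 0.

Lemma measurable_cutoff i u : jointly_measurable [set` i] u ->
  forall j, spacetime_measurable (cutoff i u j).
Proof.
move=> mu j.
have mi : measurable ([set` i] `*` [set: vec3 R] : set (mtimevec3 R)).
  by apply: measurableX => //; exact: measurable_itv.
rewrite /spacetime_measurable (_ : (fun z => _) = (fun z : mtimevec3 R =>
    (fun z : mtimevec3 R => coord3 j (u z.1 z.2)) \_ ([set` i] `*` setT) z)); last first.
  apply/funext => z; rewrite /cutoff /patch.
  case: ifPn => zi; first by rewrite mem_set.
  by case: ifPn => // /set_mem[/= zi' _]; rewrite zi' in zi.
apply/(measurable_restrictT _ mi); exact: mu.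
Qed.

Lemma norm_coord3_enorm j x : `|coord3 j x| <= enorm x.
Proof.
rewrite -[leLHS]ger0_norm// -sqrtr_sqr /enorm ler_wsqrtr//.
by rewrite real_normK ?num_real// coord3_sqr_le.
Qed.

Lemma enorm_le_sum x : enorm x <= \sum_j `|coord3 j x|.
Proof.
have s0 : 0 <= \sum_j `|coord3 j x| by exact: sumr_ge0.
rewrite -[leRHS]ger0_norm// -sqrtr_sqr /enorm ler_wsqrtr// /dot.
rewrite !big_ord_recl !big_ord0 !addr0.
set a := coord3 _ x; set b := coord3 _ x; set c := coord3 _ x.
have -> : a * a + (b * b + c * c) = `|a| ^+ 2 + (`|b| ^+ 2 + `|c| ^+ 2).
  by rewrite !real_normK ?num_real// !expr2.
have := normr_ge0 a; have := normr_ge0 b; have := normr_ge0 c.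
move: `|a| `|b| `|c| => a' b' c' c0 b0 a0.
rewrite -subr_ge0 (_ : _ - _ = 2 * (a' * b' + a' * c' + b' * c')); last by ring.
by rewrite mulr_ge0// !addr_ge0// mulr_ge0.
Qed.

Definition vec_of (c : 'I_3 -> R) : vec3 R := ((c ord0, c (inord 1)), c ord_max).

Lemma coord3_vec_of (c : 'I_3 -> R) j : coord3 j (vec_of c) = c j.
Proof.
move: j; apply: forall3; rewrite /coord3 (tnth_nth 0)//=.
by rewrite inordK.
Qed.

Lemma coord3_inj x y : (forall j, coord3 j x = coord3 j y) -> x = y.
Proof.
move=> E; have := E ord0; have := E (inord 1); have := E ord_max.
rewrite /coord3 !(tnth_nth 0)/= !inordK//=.
by case: x {E} => -[a b] c; case: y => -[a' b'] c' /= -> -> ->.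
Qed.

End cutoff.

Section exponents.
Context {R : realType}.

(** By the regularity of the exponent at time 0, a constant exponent below it still
satisfies the strict condition on a short interval. *)
Lemma local_exponent (p : R -> R) (b : R) : log_holder_exponent p ->
  (p 0)^-1 < b -> exists P T1 : R, [/\ 0 < P^-1, P^-1 < b, 0 < T1 &
    forall t, 0 <= t -> t <= T1 -> P <= p t].
Proof.
move=> [[_ p1] [l _ [C C0 [HC _]]]] p0b.
pose e := (b - (p 0)^-1) / 2.
have e0 : 0 < e by rewrite divr_gt0// subr_gt0.
have p00 : 0 < (p 0)^-1 by rewrite invr_gt0 (lt_le_trans ltr01)// p1.
pose P := ((p 0)^-1 + e)^-1.
have PE : P^-1 = (p 0)^-1 + e by rewrite /P invrK.
exists P, (expR (- (C / e))); rewrite PE; split.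
- exact: addr_gt0.
- by rewrite /e; lra.
- exact: expR_gt0.
move=> t t0 tT; have pt0 : 0 < p t by rewrite (lt_le_trans ltr01)// p1.
rewrite /P invf_ple ?posrE ?addr_gt0//.
have [->|tn0] := eqVneq t 0; first by rewrite lerDl ltW.
have tp : 0 < t by rewrite lt_neqAle eq_sym tn0.
have := HC t 0 t0 (lexx _); rewrite subr0 (gtr0_norm tp) => H.
rewrite -lerBlDl (le_trans (ler_norm _))// (le_trans H)//.
have big : expR (C / e) <= expR 1 + t^-1.
  rewrite (@le_trans _ _ t^-1) ?lerDr ?expR_ge0// -[leLHS]invrK -expRN.
  by rewrite lef_pV2 ?posrE ?expR_gt0.
have Ce : C / e <= ln (expR 1 + t^-1).
  by rewrite -[leLHS]expRK ler_ln ?posrE ?addr_gt0 ?expR_gt0 ?invr_gt0.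
have ln0 : 0 < ln (expR 1 + t^-1) by rewrite (lt_le_trans _ Ce)// divr_gt0.
by rewrite ler_pdivrMr// mulrC -ler_pdivrMr.
Qed.

End exponents.

(** * The linear part *)

Section divergence_free_combinations.
Context {R : realType} (q : R) (q2 : 2 < q).
Implicit Types (h : 'I_3 -> vec3 R -> R) (phi : vec3 R -> R) (x : vec3 R).
Local Notation NE f := ('N[leb3 R]_q%:E[(fun x => (f x)%:E)])%E.

Lemma weakly_div_free_ae h1 h2 :
  (forall j, measurable_fun [set: mvec3 R] (h1 j)) ->
  (forall j, measurable_fun [set: mvec3 R] (h2 j)) ->
  {ae leb3 R, forall x : vec3 R, forall j, h1 j x = h2 j x} ->
  weakly_div_free h2 -> weakly_div_free h1.
Proof.
move=> m1 m2 h12 H phi tphi; rewrite -[RHS](H phi tphi); apply: eq_bigr => j _.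
rewrite /Rintegral; congr fine; apply: ae_eq_integral => //.
- apply/measurable_EFinP; apply: measurable_funM; first exact: m1.
  exact: measurable_test_partial.
- apply/measurable_EFinP; apply: measurable_funM; first exact: m2.
  exact: measurable_test_partial.
by apply: ae_imp h12 => x hx _ /=; rewrite hx.
Qed.

Lemma weakly_div_free_sum (I : finType) (h : I -> 'I_3 -> vec3 R -> R) :
  (forall i j, measurable_fun [set: mvec3 R] (h i j)) ->
  (forall i j, (NE (fun x => `|h i j x|) < +oo)%E) ->
  (forall i, weakly_div_free (h i)) -> weakly_div_free (fun j x => \sum_i h i j x).
Proof.
move=> mh Nh dh phi tphi.
have ih i j : (leb3 R).-integrable [set: mvec3 R]
    (EFin \o (fun x => h i j x * 'D_(basis3 j) phi x)).
  apply: (integrable_test_mul q2 (mh i j) (Nh i j)).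
    exact: measurable_test_partial.
  exact: test_function_partial_box.
transitivity (\sum_j \sum_i \int[leb3 R]_x (h i j x * 'D_(basis3 j) phi x)).
  apply: eq_bigr => j _; rewrite -(Rintegral_finsum measurableT (fun i => ih i j)).
  by apply: eq_Rintegral => x _; rewrite mulr_suml.
by rewrite exchange_big big1// => i _; exact: dh.
Qed.

Lemma weakly_div_freeD h1 h2 :
  (forall j, measurable_fun [set: mvec3 R] (h1 j)) ->
  (forall j, measurable_fun [set: mvec3 R] (h2 j)) ->
  (forall j, (NE (fun x => `|h1 j x|) < +oo)%E) ->
  (forall j, (NE (fun x => `|h2 j x|) < +oo)%E) ->
  weakly_div_free h1 -> weakly_div_free h2 -> weakly_div_free (fun j x => h1 j x + h2 j x).
Proof.
move=> m1 m2 N1 N2 d1 d2.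
have := @weakly_div_free_sum bool (fun b => if b then h1 else h2).
have -> : (fun j x => \sum_b (if b then h1 else h2) j x) = (fun j x => h1 j x + h2 j x).
  by apply/funext => j; apply/funext => x; rewrite big_bool.
by apply=> -[].
Qed.

Lemma weakly_div_freeN h : (forall j, measurable_fun [set: mvec3 R] (h j)) ->
  weakly_div_free h -> weakly_div_free (fun j x => - h j x).
Proof.
move=> mh dh phi tphi; rewrite -[RHS](mulr0 (-1)) -{2}(dh phi tphi) mulr_sumr.
apply: eq_bigr => j _; rewrite -Rintegral_mulc; last first.
  by apply: measurable_funM; [exact: mh|exact: measurable_test_partial].
by apply: eq_Rintegral => x _; rewrite mulNr mulN1r.
Qed.

End divergence_free_combinations.

Section linear_part.
Context {R : realType} (al q : R) (al2 : 1 / 2 < al) (q2 : 2 < q).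
Implicit Types (t s : R) (x y : vec3 R) (j k : 'I_3).
Local Notation NE f := ('N[leb3 R]_q%:E[(fun x => (f x)%:E)])%E.
Local Notation mR := (measurableTypeR R).
Let q0 : 0 < q. Proof. exact: lt_trans q2. Qed.

Lemma norm_convolution_le (K w : vec3 R -> R) x :
  measurable_fun [set: mvec3 R] K -> measurable_fun [set: mvec3 R] w ->
  ((`|convolution K w x|)%:E <= \int[leb3 R]_y (`|K (x - y)%R * w y|)%:E)%E.
Proof.
move=> mK mw.
have mi : measurable_fun [set: mvec3 R] (fun y => (K (x - y) * w y)%:E).
  apply/measurable_EFinP; apply: measurable_funM => //.
  exact: (measurableT_comp mK (measurable_reflect3 x)).
apply: le_trans (le_abse_integral _ measurableT mi); rewrite /convolution /Rintegral.
by case: (integral _ _ _) => [r| |]//=; rewrite normr0 leey.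
Qed.

Lemma NE_field_size_sum (W : 'I_3 -> R -> vec3 R -> R) t : field_measurable W ->
  (NE (field_size W t) <= \sum_j NE (fun x => (`|W j t x|)%R))%E.
Proof.
move=> mW.
have mj j : measurable_fun [set: mvec3 R] (fun x => `|W j t x|).
  by apply: measurableT_comp => //; exact: spacetime_measurable_slice.
rewrite !big_ord_recl big_ord0 adde0.
rewrite (_ : (fun x => (field_size W t x)%:E) = (fun x => (`|W ord0 t x| +
  (`|W (lift ord0 ord0) t x| + `|W (lift ord0 (lift ord0 ord0)) t x|))%:E)); last first.
  by apply/funext => x; rewrite /field_size !big_ord_recl big_ord0 addr0.
apply: (le_trans (@NE_add R q q2 _ _ _ _ _ _)) => //.
  exact: measurable_funD.
by rewrite leeD2l//; exact: NE_add.
Qed.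

Definition linear_part (a : 'I_3 -> vec3 R -> R) (F : 'I_3 -> R -> vec3 R -> R) j t x : R :=
  convolution (heat_kernel al t) (a j) x + duhamel (heat_kernel al) (F j) t x.

Variables (a : 'I_3 -> vec3 R -> R) (F : 'I_3 -> R -> vec3 R -> R).
Hypotheses (ma : forall j, measurable_fun [set: mvec3 R] (a j)) (mF : field_measurable F).
Hypothesis Na : forall j, (NE (fun x => `|a j x|) < +oo)%E.

Let mK : spacetime_measurable (heat_kernel al).
Proof. exact: measurable_heat_kernel. Qed.

Let mKt t : measurable_fun [set: mvec3 R] (heat_kernel al t).
Proof. exact: spacetime_measurable_slice. Qed.

Let mconv j : spacetime_measurable (fun t => convolution (heat_kernel al t) (a j)).
Proof.
apply: (@measurable_fun_Rintegral _ _ _ _ _ (leb3 R)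
  (fun p : mtimevec3 R * mvec3 R => heat_kernel al p.1.1 ((p.1.2 : vec3 R) - p.2) * a j p.2)).
apply: measurable_funM; last exact: (measurableT_comp (ma j) measurable_snd).
have mp : measurable_fun [set: mtimevec3 R * mvec3 R]
    (fun p : mtimevec3 R * mvec3 R => (p.1.1, (p.1.2 : vec3 R) - p.2) : mtimevec3 R).
  apply: measurable_fun_pair; first exact: (measurableT_comp measurable_fst measurable_fst).
  have mp' : measurable_fun [set: mtimevec3 R * mvec3 R]
      (fun p : mtimevec3 R * mvec3 R => (p.1.2, p.2) : mvec3 R * mvec3 R).
    apply: measurable_fun_pair; last exact: measurable_snd.
    exact: (measurableT_comp measurable_snd measurable_fst).
  exact: (measurableT_comp (@measurable_sub3 R) mp').
exact: (measurableT_comp mK mp).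
Qed.

Lemma measurable_linear_part : field_measurable (linear_part a F).
Proof. by move=> j; apply: measurable_funD; [exact: mconv|exact: measurable_duhamel]. Qed.

Let NEconv : exists2 C : R, 0 <= C & forall j t, 0 < t ->
  (NE (fun x => `|convolution (heat_kernel al t) (a j) x|) <= C%:E * NE (fun x => `|a j x|))%E.
Proof.
have [C C0 [HC _]] := heat_bounds al2 q2; exists C; first exact: C0.
move=> j t t0; apply: le_trans (HC (a j) t t0 (ma j)).
apply: le_Lnorm => //.
- apply/measurable_EFinP; apply: measurableT_comp => //.
  exact: (@spacetime_measurable_slice R (fun t => convolution (heat_kernel al t) (a j))).
- exact: measurable_convolution_size.
by move=> x; rewrite lee_fin normr_ge0/= norm_convolution_le.
Qed.

Let NEduhamel : exists2 C : R, 0 <= C & forall j t,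
  (NE (fun x => `|duhamel (heat_kernel al) (F j) t x|) <=
   'N[leb3 R]_q%:E[duhamel_size (heat_kernel al) (F j) t])%E /\
  ('N[leb3 R]_q%:E[duhamel_size (heat_kernel al) (F j) t] <=
   C%:E * \int[leb1 R]_(s in `[0%R, t]) NE (fun x => (`|F j s x|)%R))%E.
Proof.
have [C C0 [_ HC]] := heat_bounds al2 q2; exists C; first exact: C0.
move=> j t; split.
  apply: le_Lnorm => //.
  - apply/measurable_EFinP; apply: measurableT_comp => //.
    by apply: spacetime_measurable_slice; exact: measurable_duhamel.
  - exact: (measurableT_comp (measurable_duhamel_size mK (mF j)) (measurable_pair1 t)).
  by move=> x; rewrite lee_fin normr_ge0/= norm_duhamel_le.
apply: (le_trans (HC (F j) t (mF j))).
rewrite ge0_integralZl_EFin//; first by move=> s _; exact: Lnorm_ge0.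
apply: measurable_funTS.
apply: (@measurable_Lnorm_slice _ q (fun s x => `|F j s x|)) => //.
by apply: measurableT_comp => //; exact: mF.
Qed.

Variable B : R.
Hypothesis FB : forall j t,
  (\int[leb1 R]_(s in `[0%R, t]) NE (fun x => (`|F j s x|)%R) <= B%:E)%E.

Lemma linear_part_bound : exists2 M : R, 0 < M & forall t, 0 < t ->
  (NE (field_size (linear_part a F) t) <= M%:E)%E.
Proof.
have [C C0 HC] := NEconv; have [D D0 HD] := NEduhamel.
have afin j : NE (fun x => `|a j x|) \is a fin_num by rewrite ge0_fin_numE ?Lnorm_ge0.
have a0 j : 0 <= fine (NE (fun x => `|a j x|)) by rewrite fine_ge0// Lnorm_ge0.
have B0 : 0 <= B.
  rewrite -lee_fin; apply: le_trans (FB ord0 0).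
  by apply: integral_ge0 => s _; exact: Lnorm_ge0.
pose M j := C * fine (NE (fun x => `|a j x|)) + D * B.
have M0 j : 0 <= M j by rewrite addr_ge0 ?mulr_ge0.
exists (1 + \sum_j M j); first by rewrite ltr_pwDl// sumr_ge0.
move=> t t0; apply: (le_trans (NE_field_size_sum t measurable_linear_part)).
apply: (@le_trans _ _ (\sum_j M j)%:E); last by rewrite lee_fin lerDr.
rewrite -sumEFin; apply: lee_sum => j _.
have m1 : measurable_fun [set: mvec3 R] (fun x => `|convolution (heat_kernel al t) (a j) x|).
  apply: measurableT_comp => //.
  exact: (@spacetime_measurable_slice R (fun t => convolution (heat_kernel al t) (a j))).
have m2 : measurable_fun [set: mvec3 R] (fun x => `|duhamel (heat_kernel al) (F j) t x|).
  apply: measurableT_comp => //.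
  by apply: spacetime_measurable_slice; exact: measurable_duhamel.
apply: (@le_trans _ _ (NE (fun x => `|convolution (heat_kernel al t) (a j) x| +
  `|duhamel (heat_kernel al) (F j) t x|)%R)).
  apply: NE_le => //.
  - apply: measurableT_comp => //.
    by apply: spacetime_measurable_slice; exact: measurable_linear_part.
  - exact: measurable_funD.
  by move=> x; exact: ler_normD.
apply: (le_trans (NE_add q2 _ _ _ _)) => //.
rewrite /M EFinD leeD//; first by rewrite EFinM fineK//; exact: HC.
have [H1 H2] := HD j t; apply: (le_trans H1); apply: (le_trans H2).
by rewrite EFinM lee_wpmul2l.
Qed.

Lemma linear_part_div_free t : 0 < t -> weakly_div_free a ->
  {ae leb1 R, forall s : R, s \in `[0, t] ->
    (forall j, (NE (fun x => `|F j s x|) < +oo)%E) -> weakly_div_free (fun j => F j s)} ->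
  weakly_div_free (fun j => linear_part a F j t).
Proof.
move=> t0 da dF.
have [C C0 HC] := NEconv; have [D D0 HD] := NEduhamel.
have NQ j : ('N[leb3 R]_q%:E[duhamel_size (heat_kernel al) (F j) t] < +oo)%E.
  apply: (le_lt_trans (HD j t).2); apply: lte_mul_pinfty; rewrite ?lee_fin//.
  by apply: (le_lt_trans (FB j t)); exact: ltry.
apply: (@weakly_div_freeD R q q2).
- move=> j; exact: (@spacetime_measurable_slice R (fun t => convolution (heat_kernel al t) (a j))).
- by move=> j; apply: spacetime_measurable_slice; exact: measurable_duhamel.
- move=> j; apply: (le_lt_trans (HC j t t0)); apply: lte_mul_pinfty; rewrite ?lee_fin//.
- by move=> j; exact: (le_lt_trans (HD j t).1).
- exact: (heat_div_free al2 q2).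
apply: (@duhamel_div_free R q q2 t (fun=> heat_kernel al) F) => //.
have Ffin : {ae leb1 R, forall s : R, s \in `[0, t] ->
    forall j, (NE (fun x => `|F j s x|) < +oo)%E}.
  have Fj j : {ae leb1 R, forall s : R, s \in `[0, t] -> (NE (fun x => `|F j s x|) < +oo)%E}.
    have : (leb1 R).-integrable (`[0, t]%classic : set mR) (fun s => NE (fun x => `|F j s x|)).
      apply/integrableP; split.
        apply: measurable_funTS.
        apply: (@measurable_Lnorm_slice _ q (fun s x => `|F j s x|)) => //.
        by apply: measurableT_comp => //; exact: mF.
      under eq_integral do rewrite gee0_abs ?Lnorm_ge0//.
      by apply: (le_lt_trans (FB j t)); exact: ltry.
    move/(integrable_ae (measurable_time_itv t)); apply: ae_imp => s H st.
    by rewrite ltey_eq H.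
  apply: ae_imp (ae_and (Fj ord0) (ae_and (Fj (inord 1)) (Fj ord_max))).
  by move=> s [H0 [H1 H2]] st; apply: forall3; auto.
apply: ae_imp (ae_and dF (ae_and Ffin (ae_neq_point t))) => s [ds [Ns sn]] st.
apply: (heat_div_free al2 q2).
- move: st; rewrite in_itv/= => /andP[_ st].
  by rewrite subr_gt0 lt_neqAle sn.
- by move=> j; exact: spacetime_measurable_slice.
- exact: Ns.
- exact: ds st (Ns st).
Qed.

End linear_part.

(** * The nonlinear part is divergence free *)

Section mild_field_divergence.
Context {R : realType} (al q : R) (al2 : 1 / 2 < al) (q2 : 2 < q).
Hypothesis gap : gam al q < 1.
Implicit Types (U : 'I_3 -> R -> vec3 R -> R) (t s : R) (x y : vec3 R) (j k l : 'I_3).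
Local Notation NE f := ('N[leb3 R]_q%:E[(fun x => (f x)%:E)])%E.
Let q0 : 0 < q. Proof. exact: lt_trans q2. Qed.

Lemma nonlinear_div_free (N t : R) U : 0 < t -> field_measurable U ->
  (forall s, 0 < s -> s <= t -> (NE (field_size U s) <= N%:E)%E) ->
  weakly_div_free (fun j => nonlinear al U j t).
Proof.
move=> t0 mU UN.
have mUs := measurable_field_size mU.
have N0 : 0 <= N by rewrite -lee_fin; apply: le_trans (UN t t0 (lexx t)); exact: Lnorm_ge0.
have mUU : spacetime_measurable (fun s y => field_size U s y * field_size U s y).
  exact: measurable_funM.
have mS : spacetime_measurable (oseen_size al) by exact: measurable_oseen_size.
have mO j k l : spacetime_measurable (fun s => oseen_kernel al s j k l).
  exact: measurable_oseen_kernel.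
have U0 s y : 0 <= field_size U s y by exact: field_size_ge0.
have [C C0 HC] := bilinear_sup al2 q2 gap.
have NQ := HC _ _ t N N t0 mUs mUs U0 U0 N0 N0 UN UN.
pose w k l s y := U k s y * U l s y.
have mw k l : spacetime_measurable (w k l) by exact: measurable_field_mul.
have NQkl j k l : ('N[leb3 R]_q%:E[
    duhamel_size (fun s => oseen_kernel al s j k l) (w k l) t] < +oo)%E.
  apply: (@le_lt_trans _ _ ('N[leb3 R]_q%:E[duhamel_size (oseen_size al)
      (fun s y => field_size U s y * field_size U s y)%R t])%E); last first.
    by apply: (le_lt_trans NQ); exact: ltry.
  apply: le_Lnorm => //.
  - exact: (measurableT_comp (measurable_duhamel_size (mO j k l) (mw k l)) (measurable_pair1 t)).
  - exact: (measurableT_comp (measurable_duhamel_size mS mUU) (measurable_pair1 t)).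
  move=> x; rewrite duhamel_size_ge0/=; apply: le_duhamel_size => // s y.
    by rewrite [leRHS]ger0_norm ?oseen_size_ge0// le_oseen_size.
  by rewrite !normrM ![`|field_size _ _ _|]ger0_norm// ler_pM// le_field_size.
pose D k l j x := duhamel (fun s => oseen_kernel al s j k l) (w k l) t x.
have mD k l j : measurable_fun [set: mvec3 R] (D k l j).
  by apply: (@spacetime_measurable_slice R (duhamel _ _)); exact: measurable_duhamel.
have dD k l : weakly_div_free (D k l).
  apply: (@duhamel_div_free R q q2 t (fun j s => oseen_kernel al s j k l) (fun=> w k l)) => //.
  apply: ae_imp (ae_and (ae_neq_point 0) (ae_neq_point t)) => s [s0 st].
  rewrite in_itv/= => /andP[s0' st'].
  have {}s0 : 0 < s by rewrite lt_neqAle eq_sym s0.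
  have {}st : 0 < t - s by rewrite subr_gt0 lt_neqAle st.
  apply: (@oseen_div_free R al q al2 q2) => //; first exact: spacetime_measurable_slice.
  have [c c0 Hc] := oseen_size_conj al2 q2.
  have mUt := spacetime_measurable_slice s mUs.
  have mSt := spacetime_measurable_slice (t - s) mS.
  apply: (@le_lt_trans _ _ ('N[leb3 R]_q%:E[(fun x => \int[leb3 R]_y
      (oseen_size al (t - s) (x - y)%R * (field_size U s y * field_size U s y))%:E)])%E).
    apply: (@le_Lnorm _ _ _ (leb3 R)); first exact: q0.
    - apply: measurable_convolution_size => //; exact: spacetime_measurable_slice.
    - have := measurable_convolution_size mSt (spacetime_measurable_slice s mUU).
      congr measurable_fun; apply/funext => x; apply: eq_integral => y _.
      by rewrite ger0_norm// mulr_ge0 ?oseen_size_ge0 ?mulr_ge0.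
    move=> x; apply/andP; split; first by apply: integral_ge0 => y _; rewrite lee_fin.
    have mSx : measurable_fun [set: mvec3 R] (fun y : mvec3 R => oseen_size al (t - s) (x - (y : vec3 R))).
      exact: (measurableT_comp mSt (measurable_reflect3 x)).
    apply: ge0_le_integral => //.
    - apply/measurable_EFinP; apply: measurableT_comp => //; apply: measurable_funM => //.
      exact: spacetime_measurable_slice.
    - apply/measurable_EFinP; apply: measurable_funM => //; exact: measurable_funM.
    move=> y _; rewrite lee_fin normrM ger0_norm ?oseen_size_ge0// ler_wpM2l ?oseen_size_ge0//.
    by rewrite normrM ler_pM// le_field_size.
  apply: le_lt_trans (young_bilinear q2 _ mSt mUt mUt _ _ _ (Hc _ st)) _ => //.
  - by rewrite mulr_ge0 ?powR_ge0.
  - by move=> x; exact: oseen_size_ge0.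
  have NU := UN s s0 st'.
  have Us0 : (0 <= NE (field_size U s))%E by exact: Lnorm_ge0.
  apply: (@le_lt_trans _ _ ((c * (t - s) `^ (- gam al q))%:E * (N%:E * N%:E))%E).
    apply: lee_pmul => //; first by rewrite lee_fin mulr_ge0 ?powR_ge0.
    - exact: mule_ge0.
    - exact: lee_pmul.
  by rewrite -!EFinM ltry.
have aeQ := duhamel_size_finite q2 mU NQ.
apply: (@weakly_div_free_ae R _ (fun j x => \sum_(kl : 'I_3 * 'I_3) D kl.1 kl.2 j x)).
- by move=> j; apply: spacetime_measurable_slice; exact: measurable_nonlinear.
- by move=> j; apply: measurable_sum => kl; exact: mD.
- apply: ae_imp aeQ => x Q j; rewrite (nonlinearE j mU Q).
  by rewrite (pair_bigA _ (fun k l => D k l j x)).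
apply: (weakly_div_free_sum q2) => //.
move=> [k l] j /=; apply: le_lt_trans (NQkl j k l); apply: le_Lnorm => //.
- by apply/measurable_EFinP; apply: measurableT_comp => //; exact: mD.
- exact: (measurableT_comp (measurable_duhamel_size (mO j k l) (mw k l)) (measurable_pair1 t)).
by move=> x; rewrite lee_fin normr_ge0/= norm_duhamel_le.
Qed.

Lemma NE_component (N t : R) U j : field_measurable U ->
  (NE (field_size U t) <= N%:E)%E -> (NE (fun x => `|U j t x|) < +oo)%E.
Proof.
move=> mU UN; apply: (@le_lt_trans _ _ (NE (field_size U t))); last first.
  by apply: (le_lt_trans UN); exact: ltry.
apply: (NE_le q2) => //.
- by apply: measurableT_comp => //; exact: spacetime_measurable_slice.
- by apply: spacetime_measurable_slice; exact: measurable_field_size.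
by move=> x; exact: le_field_size.
Qed.

(** The integral equation itself transmits the divergence condition: the linear
part keeps it and the range of the Oseen operator satisfies it. *)
Lemma mild_field_div_free (N t : R) (A U : 'I_3 -> R -> vec3 R -> R) : 0 < t ->
  field_measurable A -> field_measurable U ->
  (NE (field_size A t) <= N%:E)%E ->
  (forall s, 0 < s -> s <= t -> (NE (field_size U s) <= N%:E)%E) ->
  {ae leb3 R, forall x : vec3 R, forall j, U j t x = A j t x - nonlinear al U j t x} ->
  weakly_div_free (fun j => A j t) -> weakly_div_free (fun j => U j t).
Proof.
move=> t0 mA mU NA NU UA dA.
have mUt j : measurable_fun [set: mvec3 R] (U j t) by exact: spacetime_measurable_slice.
have mAt j : measurable_fun [set: mvec3 R] (A j t) by exact: spacetime_measurable_slice.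
have mN j : measurable_fun [set: mvec3 R] (nonlinear al U j t).
  by apply: spacetime_measurable_slice; exact: measurable_nonlinear.
have mN' j : measurable_fun [set: mvec3 R] (fun x => - nonlinear al U j t x).
  by apply: measurableT_comp => //; exact: mN.
apply: (weakly_div_free_ae mUt _ UA); first by move=> j; exact: measurable_funB.
have NUj j := NE_component j mU (NU t t0 (lexx t)).
have NAj j := NE_component j mA NA.
apply: (@weakly_div_freeD R q q2 (fun j => A j t) (fun j x => - nonlinear al U j t x)) => //.
  move=> j; apply: (@le_lt_trans _ _ (NE (fun x => `|A j t x| + `|U j t x|))).
    apply: (@ae_le_Lnorm _ _ _ (leb3 R)) => //.
    - by apply/measurable_EFinP; exact: measurableT_comp.
    - by apply/measurable_EFinP; apply: measurable_funD; exact: measurableT_comp.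
    apply: ae_imp UA => x /(_ j) Ux; rewrite !abse_EFin lee_fin.
    rewrite normr_id [leRHS]ger0_norm ?addr_ge0//.
    rewrite (_ : - nonlinear al U j t x = U j t x - A j t x); last by rewrite Ux; ring.
    by rewrite [leRHS]addrC; exact: ler_normB.
  apply: le_lt_trans (NE_add q2 _ _ _ _) _ => //; [exact: measurableT_comp..|].
  exact: lte_add_pinfty.
by apply: (weakly_div_freeN mN); exact: (nonlinear_div_free t0 mU NU).
Qed.

End mild_field_divergence.

(** * Variable Lebesgue spaces *)

Section Lq_norm_components.
Context {R : realType} (q : R) (q2 : 2 < q).
Implicit Types (v : vec3 R -> vec3 R) (j : 'I_3) (t : R) (x : vec3 R).
Local Notation NE f := ('N[leb3 R]_q%:E[(fun x => (f x)%:E)])%E.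
Local Notation mR := (measurableTypeR R).

Lemma measurable_enorm_comp v :
  (forall j, measurable_fun [set: mvec3 R] (fun x => coord3 j (v x))) ->
  measurable_fun [set: mvec3 R] (fun x => enorm (v x)).
Proof.
move=> mv.
have mv' : measurable_fun [set: mvec3 R] (v : mvec3 R -> mvec3 R).
  rewrite (_ : v = fun x => ((coord3 ord0 (v x), coord3 (inord 1) (v x)), coord3 ord_max (v x))).
    exact: (measurable_fun_pair (measurable_fun_pair (mv _) (mv _)) (mv _)).
  apply/funext => x; apply: coord3_inj => j.
  exact: (esym (coord3_vec_of (fun j => coord3 j (v x)) j)).
exact: (measurableT_comp (@measurable_enorm R) mv').
Qed.

Lemma NE_coord3_le v j :
  (forall j, measurable_fun [set: mvec3 R] (fun x => coord3 j (v x))) ->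
  (NE (fun x => `|coord3 j (v x)|) <= Lq_norm q v)%E.
Proof.
move=> mv; apply: (NE_le q2) => //.
- exact: measurableT_comp.
- exact: measurable_enorm_comp.
by move=> x; exact: norm_coord3_enorm.
Qed.

Lemma Lq_norm_le (U : 'I_3 -> R -> vec3 R -> R) v t : field_measurable U ->
  (forall x j, coord3 j (v x) = U j t x) -> (Lq_norm q v <= NE (field_size U t))%E.
Proof.
move=> mU vU; apply: (NE_le q2).
- apply: measurable_enorm_comp => j.
  by rewrite (funext (vU^~ j)); exact: spacetime_measurable_slice.
- by apply: spacetime_measurable_slice; exact: measurable_field_size.
- by move=> x; exact: sqrtr_ge0.
by move=> x; apply: (le_trans (enorm_le_sum _)); apply: ler_sum => j _; rewrite vU.
Qed.

Lemma NE_field_size_le (U : 'I_3 -> R -> vec3 R -> R) v t : field_measurable U ->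
  (forall x j, coord3 j (v x) = U j t x) -> (NE (field_size U t) <= 3%:E * Lq_norm q v)%E.
Proof.
move=> mU vU; apply: (le_trans (NE_field_size_sum q2 t mU)).
have mv j : measurable_fun [set: mvec3 R] (fun x => coord3 j (v x)).
  by rewrite (funext (vU^~ j)); exact: spacetime_measurable_slice.
apply: (@le_trans _ _ (\sum_(j < 3) Lq_norm q v)%E); last first.
  by rewrite !big_ord_recl big_ord0 adde0 mule_natl.
apply: lee_sum => j _.
rewrite (_ : (fun x => _) = (fun x => (`|coord3 j (v x)|)%:E)); last first.
  by apply/funext => x; rewrite vU.
exact: NE_coord3_le.
Qed.

End Lq_norm_components.

Section luxemburg.
Context {R : realType} (q : R) (q2 : 2 < q).
Implicit Types (p : R -> R) (u v : R -> vec3 R -> vec3 R) (t T : R).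
Local Notation NE f := ('N[leb3 R]_q%:E[(fun x => (f x)%:E)])%E.
Local Notation mR := (measurableTypeR R).

Lemma luxemburg_norm_lty p T u : (luxemburg_norm p q T u < +oo)%E ->
  exists2 l : R, 0 < l & (\int[leb1 R]_(t in `[0%R, T])
    (`| Lq_norm q (u t) * (l^-1)%:E | `^ p t) <= 1)%E.
Proof. by move=> /ereal_inf_lt[_ [l [l0 Hl] <-] _]; exists l. Qed.

(** With N as the scaling factor in the Luxemburg norm, the integrand is at most 1 at
every positive time, whatever the exponent.  Nothing is known at time 0, so the
majorant is infinite there. *)
Lemma bounded_field_in_LpLq p T N (U : 'I_3 -> R -> vec3 R -> R) u :
  (forall t, 0 <= t -> 0 <= p t) -> 0 < T -> T <= 1 -> 0 < N -> field_measurable U ->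
  (forall t x j, coord3 j (u t x) = U j t x) ->
  (forall t, 0 < t -> t <= T -> (NE (field_size U t) <= N%:E)%E) -> in_LpLq p q T u.
Proof.
move=> p0 T0 T1 N0 mU uU NU; split.
  move=> j; apply: measurable_funTS.
  rewrite (_ : (fun z => _) = (fun z : mtimevec3 R => U j z.1 z.2)); first exact: mU.
  by apply/funext => z; exact: uU.
apply: (@le_lt_trans _ _ N%:E); last exact: ltry.
apply: ereal_inf_lbound; exists N => //; split => //.
have mT := @measurable_time_itv R T.
pose G (t : mR) := (1 + +oo * (\1_[set 0%R] t)%:E)%E : \bar R.
have G1 t : t != 0 -> G t = 1%E.
  by move=> t0; rewrite /G indicE memNset ?mule0 ?adde0// => /eqP; rewrite (negbTE t0).
have mG : measurable_fun [set: mR] G.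
  apply: emeasurable_funD => //; apply: emeasurable_funM => //.
  by apply/measurable_EFinP; apply: measurable_indic; exact: measurable_set1.
apply: (@le_trans _ _ (\int[leb1 R]_(t in `[0%R, T]) G t)%E).
  apply: ge0_integral_mono => //.
  - by move=> t _; exact: poweR_ge0.
  - by move=> t _; rewrite /G adde_ge0// mule_ge0// lee_fin.
  move=> t; rewrite /= in_itv/= => /andP[t0 tT].
  have [->|tn0] := eqVneq t 0.
    by rewrite /G indicE mem_set// mule1 addey// leey.
  have {tn0}t1 : 0 < t by rewrite lt_neqAle eq_sym tn0.
  rewrite (G1 t) ?gt_eqF// (_ : 1%E = 1%E `^ p t)%E; last first.
    by rewrite poweR_EFin powR1.
  apply: lee_poweR; [exact: p0|exact: abse_ge0|].
  have L0 : (0 <= Lq_norm q (u t))%E by exact: Lnorm_ge0.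
  rewrite gee0_abs; last by rewrite mule_ge0// lee_fin invr_ge0 ltW.
  rewrite muleC -lee_pdivlMl ?invr_gt0// invrK mule1.
  by apply: le_trans (NU t t1 tT); apply: Lq_norm_le => // x j; exact: uU.
rewrite (_ : (\int[leb1 R]_(t in `[0%R, T]) G t)%E = (\int[leb1 R]_(t in `[0%R, T]) 1)%E).
  have muT : (leb1 R (`[0%R, T]%classic : set mR) <= 1)%E.
    by rewrite lebesgue_measure_itv/= lte_fin T0 -EFinB subr0 lee_fin.
  by rewrite integral_cst// mul1e.
apply: ae_eq_integral => //; first exact: measurable_funTS.
by apply: ae_imp (ae_neq_point 0) => t t0 _; exact: G1.
Qed.

(** If P <= p t, then y^P <= 1 + y^(p t); on a bounded interval the constant 1 is
integrable. *)
Lemma luxemburg_constant_exponent p T P (V : 'I_3 -> R -> vec3 R -> R) v :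
  0 < P -> 0 < T -> (forall t, 0 <= t -> t <= T -> P <= p t) -> field_measurable V ->
  (forall t x j, t \in `[0, T] -> coord3 j (v t x) = V j t x) ->
  (luxemburg_norm p q T v < +oo)%E ->
  (\int[leb1 R]_(t in `[0%R, T]) (NE (field_size V t) `^ P) < +oo)%E.
Proof.
move=> P0 T0 Pp mV vV /luxemburg_norm_lty[l l0 Hl].
have mT := @measurable_time_itv R T.
have l30 : 0 < 3 * l by rewrite mulr_gt0.
pose h t := (((3 * l)^-1)%:E * NE (field_size V t))%E.
have NV0 t : (0 <= NE (field_size V t))%E by exact: Lnorm_ge0.
have h0 t : (0 <= h t)%E by rewrite mule_ge0// lee_fin invr_ge0 ltW.
have mNV := measurable_NE_field q mV.
have mh : measurable_fun [set: mR] h by apply: emeasurable_funM.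
have mhP : measurable_fun [set: mR] (fun t => h t `^ P)%E by exact: emeasurable_poweR.
have NVE t : (NE (field_size V t) `^ P = ((3 * l) `^ P)%:E * h t `^ P)%E.
  rewrite -poweR_EFin -poweRM ?lee_fin ?(ltW l30)// /h muleA -EFinM divff ?mul1e//.
  by rewrite gt_eqF.
under eq_integral do rewrite NVE.
rewrite ge0_integralZl_EFin ?powR_ge0//; last 2 first.
- by move=> t _; exact: poweR_ge0.
- exact: measurable_funTS.
apply: lte_mul_pinfty; rewrite ?lee_fin ?powR_ge0//.
apply: (@le_lt_trans _ _ (leb1 R (`[0%R, T]%classic : set mR) + 1)%E); last first.
  by rewrite lebesgue_measure_itv/= lte_fin T0 -EFinB -EFinD ltry.
apply: le_trans (leeD (lexx _) Hl).
apply: ge0_integral_le_cstD => //.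
- by move=> t; exact: poweR_ge0.
- by move=> t _; exact: poweR_ge0.
move=> t; rewrite /= in_itv/= => /andP[t0 tT].
have tI : t \in `[0, T] by rewrite in_itv/= t0 tT.
apply: (le_trans (lee_poweR_1D P0 (Pp t t0 tT) (h0 t))); rewrite leeD2l//.
have L0 : (0 <= Lq_norm q (v t))%E by exact: Lnorm_ge0.
apply: lee_poweR => //; first exact: (le_trans (ltW P0) (Pp t t0 tT)).
rewrite gee0_abs; last by rewrite mule_ge0// lee_fin invr_ge0 ltW.
have -> : (Lq_norm q (v t) * (l^-1)%:E = ((3 * l)^-1)%:E * (3%:E * Lq_norm q (v t)))%E.
  by rewrite muleA -EFinM invfM mulrAC mulVf// mul1r muleC.
apply: lee_wpmul2l; first by rewrite lee_fin invr_ge0 ltW.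
by apply: (NE_field_size_le q2 mV) => x j; exact: vV.
Qed.

End luxemburg.

Section mild_fields.
Context {R : realType} (al T : R) (f : R -> vec3 R -> vec3 R) (u0 : vec3 R -> vec3 R).
Implicit Types (v : R -> vec3 R -> vec3 R) (t : R) (x : vec3 R) (j : 'I_3).

(** The integral equation at time t sees the force and the solution between the
times 0 and t only. *)
Lemma mild_equationE v (F V : 'I_3 -> R -> vec3 R -> R) t x j : t \in `[0, T] ->
  (forall s y i, 0 <= s -> F i s y = coord3 i (f s y)) ->
  (forall s y i, s \in `[0, T] -> V i s y = coord3 i (v s y)) ->
  convolution (heat_kernel al t) (fun y => coord3 j (u0 y)) x
    + \int[leb1 R]_(s in `[0, t])
        convolution (heat_kernel al (t - s)) (fun y => coord3 j (f s y)) x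
    - \int[leb1 R]_(s in `[0, t]) \sum_(k < 3) \sum_(l < 3)
        convolution (oseen_kernel al (t - s) j k l)
          (fun y => coord3 k (v s y) * coord3 l (v s y)) x =
  linear_part al (fun i y => coord3 i (u0 y)) F j t x - nonlinear al V j t x.
Proof.
rewrite in_itv/= => /andP[t0 tT] Ff Vv; rewrite /linear_part /nonlinear /duhamel.
have alg (a b c b' c' : R) : b = b' -> c = c' -> a + b - c = a + b' - c' by move=> -> ->.
apply: alg.
  apply: eq_Rintegral => s; rewrite inE/= in_itv/= => /andP[s0 _].
  by apply: eq_Rintegral => y _; rewrite Ff.
apply: eq_Rintegral => s; rewrite inE/= in_itv/= => /andP[s0 st].
have sT : s \in `[0, T] by rewrite in_itv/= s0 (le_trans st).
apply: eq_bigr => k _; apply: eq_bigr => l _; apply: eq_Rintegral => y _.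
by rewrite !Vv.
Qed.

End mild_fields.

Section exponent_arithmetic.
Context {R : realType}.

Lemma exponent_gap (al q : R) : 1 / 2 < al <= 1 -> 3 / (2 * al - 1) < q ->
  [/\ 2 < q, gam al q < 1 & 1 / 2 <= gam al q].
Proof.
move=> /andP[al2 al1] hq.
have d0 : 0 < 2 * al - 1 by lra.
have al0 : 0 < 2 * al by lra.
have q3 : 3 < q.
  by apply: le_lt_trans hq; rewrite ler_pdivlMr//; lra.
have q0 : 0 < q by lra.
have hq' : 3 / q < 2 * al - 1 by rewrite ltr_pdivrMr// mulrC -ltr_pdivrMr.
split; first by lra.
  by rewrite /gam ltr_pdivrMr// mul1r; lra.
have : 0 < 3 / q by rewrite divr_gt0.
by rewrite /gam ler_pdivlMr// => h; lra.
Qed.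

Lemma time_exponent_gap (al q p0 : R) : 1 / 2 < al <= 1 -> 2 < q ->
  al / p0 + 3 / (2 * q) < al - 1 / 2 -> p0^-1 < 1 - gam al q.
Proof.
move=> /andP[al2 _] q2 h; have al0 : 0 < al by lra.
have q0 : q != 0 by rewrite gt_eqF//; lra.
have E : al * (1 - gam al q) = al - 1 / 2 - 3 / (2 * q).
  by rewrite /gam; field; rewrite q0 gt_eqF.
by rewrite -(ltr_pM2l al0) E; lra.
Qed.

End exponent_arithmetic.

(** * Local existence and uniqueness *)

Unset Implicit Arguments.

Theorem theorem1 (R : realType) (alpha : R) (p : R -> R) (q : R)
    (f : R -> vec3 R -> vec3 R) (u0 : vec3 R -> vec3 R)
    (halpha : 1 / 2 < alpha <= 1)
    (hp : log_holder_exponent p)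
    (hp_inf : (2%:E < exponent_inf p)%E)
    (hp_sup : (exponent_sup p < +oo)%E)
    (hq : 3 / (2 * alpha - 1) < q)
    (hpq : forall t : R, 0 <= t ->
       alpha / p t + 3 / (2 * q) < alpha - 1 / 2)
    (hf : in_L1Lq q f)
    (hf_div : {ae leb1 R, forall t : R, 0 <= t -> divergence_free (f t)})
    (hu0 : in_Lq q u0)
    (hu0_div : divergence_free u0) :
  exists T : R, 0 < T /\
  exists u : R -> vec3 R -> vec3 R,
    [/\ in_LpLq p q T u,
        mild_solution alpha T f u0 u,
        {ae leb1 R, forall t : R, t \in `[0, T] -> divergence_free (u t)} &
        forall v : R -> vec3 R -> vec3 R,
          in_LpLq p q T v -> mild_solution alpha T f u0 v ->
          {ae leb_spacetime R, forall z : R * vec3 R,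
             z.1 \in `[0, T] -> v z.1 z.2 = u z.1 z.2}].
Proof.
have [q2 gap gam2] := exponent_gap halpha hq.
have al2 : 1 / 2 < alpha by case/andP: halpha.
have p1 t : 0 <= t -> 1 <= p t by case: hp => [[_ +] _]; exact.
have [P [T1 [P0 Pg T10 Pp]]] := local_exponent hp
  (time_exponent_gap halpha q2 (hpq 0 (lexx 0))).
have {}P0 : 0 < P by rewrite -invr_gt0.
have P2 : 2 <= P.
  have : P^-1 <= 2^-1 by lra.
  by rewrite lef_pV2 ?posrE.
pose a j y := coord3 j (u0 y).
pose F := cutoff `[0, +oo[ f.
have ma j : measurable_fun [set: mvec3 R] (a j) by case: hu0 => mu0 _; exact: mu0.
have Na j : ('N[leb3 R]_q%:E[(fun x => (`|a j x|)%:E)] < +oo)%E.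
  by apply: le_lt_trans hu0.2; exact: NE_coord3_le.
have mF : field_measurable F by move=> j; apply: measurable_cutoff; exact: hf.1.
have Ff s y i : 0 <= s -> F i s y = coord3 i (f s y).
  by move=> s0; rewrite /F /cutoff in_itv/= s0.
have Fmeas s : 0 <= s -> forall j, measurable_fun [set: mvec3 R] (fun x => coord3 j (f s x)).
  move=> s0 j; rewrite (_ : (fun x => _) = F j s); last by apply/funext => x; rewrite Ff.
  exact: spacetime_measurable_slice.
have NF s j : 0 <= s ->
    ('N[leb3 R]_q%:E[(fun x => (`|F j s x|)%:E)] <= Lq_norm q (f s))%E.
  move=> s0; rewrite (_ : (fun x => _) = (fun x => (`|coord3 j (f s x)|)%:E)); last first.
    by apply/funext => x; rewrite Ff.
  by apply: NE_coord3_le => //; exact: Fmeas.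
have fL0 t : (0 <= Lq_norm q (f t))%E by exact: Lnorm_ge0.
pose B := fine (\int[leb1 R]_(t in `[0%R, +oo[) Lq_norm q (f t))%E.
have FB j t : (\int[leb1 R]_(s in `[0%R, t]) 'N[leb3 R]_q%:E[(fun x => (`|F j s x|)%:E)]
    <= B%:E)%E.
  rewrite /B fineK; last first.
    by rewrite ge0_fin_numE; [exact: hf.2|apply: integral_ge0].
  apply: ge0_integral_mono.
  - by move=> s; rewrite /= !in_itv/= => /andP[-> _].
  - by move=> s _; exact: Lnorm_ge0.
  - by move=> s _.
  - by move=> s; rewrite /= in_itv/= => /andP[s0 _]; exact: NF.
pose A := linear_part alpha a F.
have mA : field_measurable A by exact: measurable_linear_part.
have [M M0 AM] := linear_part_bound al2 q2 ma mF Na FB.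
have [T0 T00 HT0] := picard_fixed_point al2 q2 gap mA M0 AM.
(* an interval of measure at most 1, as bounded_field_in_LpLq asks for *)
pose T := Num.min (Num.min T0 T1) 1.
have T_gt0 : 0 < T by rewrite !lt_min T00 T10 ltr01.
have TT0 : T <= T0 by rewrite !ge_min lexx.
have TT1 : T <= T1 by rewrite !ge_min lexx orbT.
have TT : T <= 1 by rewrite !ge_min lexx !orbT.
have [U mU HU] := HT0 T T_gt0 TT0.
pose u t x := vec_of (fun j => U j t x).
have uU t x j : coord3 j (u t x) = U j t x by exact: coord3_vec_of.
have NU t : 0 < t -> t <= T ->
    ('N[leb3 R]_q%:E[(fun x => (field_size U t x)%:E)] <= (4 * M)%:E)%E.
  by move=> t0 tT; exact: (HU t t0 tT).1.
have M4 : 0 < 4 * M by exact: mulr_gt0.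
have eqU : {ae leb1 R, forall t : R, t \in `[0, T] -> {ae leb3 R, forall x : vec3 R,
    forall j, U j t x = A j t x - nonlinear alpha U j t x}}.
  apply: ae_imp (ae_neq_point 0) => t t0; rewrite in_itv/= => /andP[t0' tT].
  by apply: (HU t _ tT).2; rewrite lt_neqAle eq_sym t0.
exists T; split; first exact: T_gt0.
exists u; split.
- apply: (bounded_field_in_LpLq q2 _ T_gt0 TT M4 mU uU NU) => t t0.
  by rewrite (le_trans ler01)// p1.
- pose D t x := \sum_j `|U j t x - (A j t x - nonlinear alpha U j t x)|.
  have mD : spacetime_measurable D.
    apply: measurable_sum => j; apply: measurableT_comp => //.
    apply: measurable_funB; first exact: mU.
    by apply: measurable_funB; [exact: mA|exact: measurable_nonlinear].
  have D0 : {ae leb1 R, forall t : R, t \in `[0, T] -> {ae leb3 R, forall x : vec3 R,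
      D t x = 0}}.
    apply: ae_imp eqU => t eqt /eqt; apply: ae_imp => x eqx.
    by apply: big1 => j _; rewrite -eqx subrr normr0.
  have := ae_of_slices mD D0; apply: ae_imp => -[t x] /= + tT j => /(_ tT) /eqP.
  rewrite psumr_eq0// => /allP/(_ j (mem_index_enum _)) /=.
  rewrite normr_eq0 subr_eq0 => /eqP eqx; rewrite uU eqx.
  exact: (esym (@mild_equationE R alpha T f u0 u F U t x j tT Ff
    (fun s y i _ => esym (uU s y i)))).
- have adiv : weakly_div_free a by exact/(weakly_div_freeP q2 ma Na).
  apply: ae_imp (ae_neq_point 0) => t t0; rewrite in_itv/= => /andP[t0' tT].
  have {t0 t0'}t0 : 0 < t by rewrite lt_neqAle eq_sym t0.
  have AN : ('N[leb3 R]_q%:E[(fun x => (field_size A t x)%:E)] <= (4 * M)%:E)%E.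
    by apply: (le_trans (AM t t0)); rewrite lee_fin ler_peMl ?(ltW M0)// ler1n.
  have uUt : (fun j x => coord3 j (u t x)) = (fun j => U j t).
    by apply/funext => j; apply/funext => x; exact: uU.
  apply/(weakly_div_freeP q2).
  + move=> j; rewrite (_ : (fun x => _) = U j t); first exact: spacetime_measurable_slice.
    by apply/funext => x; exact: uU.
  + move=> j; rewrite (_ : (fun x => _) = (fun x => (`|U j t x|)%:E)).
      exact: (NE_component q2 j mU (NU t t0 tT)).
    by apply/funext => x; rewrite uU.
  rewrite uUt.
  apply: (mild_field_div_free al2 q2 gap t0 mA mU AN _ (HU t t0 tT).2).
    by move=> s s0 st; apply: NU => //; exact: le_trans tT.
  apply: (linear_part_div_free al2 q2 ma mF Na FB t0 adiv).
  apply: ae_imp hf_div => s ds; rewrite in_itv/= => /andP[s0 _] Ns.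
  have Fs j : (fun x => coord3 j (f s x)) = F j s by apply/funext => x; rewrite Ff.
  have -> : (fun j => F j s) = (fun j x => coord3 j (f s x)) by apply/funext => j; rewrite Fs.
  apply/(weakly_div_freeP q2); [exact: Fmeas| |exact: ds].
  move=> j; rewrite (_ : (fun x => _) = (fun x => (`|F j s x|)%:E)); first exact: Ns.
  by apply/funext => x; rewrite -Fs.
move=> v [mv lv] eqv.
pose V := cutoff `[0, T] v.
have mV : field_measurable V by move=> j; exact: measurable_cutoff.
have vV t x j : t \in `[0, T] -> coord3 j (v t x) = V j t x.
  by move=> tT; rewrite /V /cutoff tT.
have PT t : 0 <= t -> t <= T -> P <= p t.
  by move=> t0 tT; apply: Pp => //; exact: le_trans TT1.
have VP := luxemburg_constant_exponent q2 P0 T_gt0 PT mV vV lv.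
have UP : (\int[leb1 R]_(t in `[0%R, T])
    ('N[leb3 R]_q%:E[(fun x => (field_size U t x)%:E)] `^ P) < +oo)%E.
  apply: (@le_lt_trans _ _ (\int[leb1 R]_(t in `[0%R, T]) ((4 * M) `^ P)%:E)%E).
    apply: ae_ge0_le_integral => //.
    - by move=> t _; exact: poweR_ge0.
    - by apply: measurable_funTS; apply: emeasurable_poweR; exact: measurable_NE_field.
    - by move=> t _; rewrite lee_fin powR_ge0.
    apply: ae_imp (ae_neq_point 0) => t t0; rewrite /= in_itv/= => /andP[t0' tT].
    rewrite -poweR_EFin; apply: lee_poweR; [exact: ltW|exact: Lnorm_ge0|].
    by apply: NU => //; rewrite lt_neqAle eq_sym t0.
  have muT : (leb1 R (`[0%R, T]%classic : set (measurableTypeR R)) < +oo)%E.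
    by rewrite lebesgue_measure_itv/= lte_fin T_gt0 -EFinB ltry.
  by rewrite integral_cst// lte_mul_pinfty// lee_fin powR_ge0.
have eqV : {ae leb1 R, forall t : R, t \in `[0, T] -> {ae leb3 R, forall x : vec3 R,
    forall j, V j t x = A j t x - nonlinear alpha V j t x}}.
  apply: ae_imp (ae_slices eqv) => t eqt tT; apply: ae_imp eqt => x /= eqx j.
  rewrite -vV// (eqx tT j).
  exact: (@mild_equationE R alpha T f u0 v F V t x j tT Ff
    (fun s y i sT => esym (vV s y i sT))).
have UV : {ae leb1 R, forall t : R, t \in `[0, T] -> {ae leb3 R, forall x : vec3 R,
    forall j, U j t x = V j t x}}.
  apply: (field_unique al2 q2 gap P2 Pg T_gt0 mU mV UP VP).
  apply: ae_imp (ae_and eqU eqV) => t [eU eV] tT.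
  apply: ae_imp (ae_and (eU tT) (eV tT)) => x [Ux Vx] j.
  have alg (b m n : R) : b - m - (b - n) = n - m by ring.
  exact: (etrans (f_equal2 (fun b c => b - c) (Ux j) (Vx j)) (alg _ _ _)).
pose D t x := \sum_j `|U j t x - V j t x|.
have mD : spacetime_measurable D.
  apply: measurable_sum => j; apply: measurableT_comp => //.
  by apply: measurable_funB; [exact: mU|exact: mV].
have D0 : {ae leb1 R, forall t : R, t \in `[0, T] -> {ae leb3 R, forall x : vec3 R,
    D t x = 0}}.
  apply: ae_imp UV => t eqt /eqt; apply: ae_imp => x eqx.
  by apply: big1 => j _; rewrite eqx subrr normr0.
have := ae_of_slices mD D0; apply: ae_imp => -[t x] /= + tT => /(_ tT) /eqP.
rewrite psumr_eq0// => /allP H; apply: coord3_inj => j; rewrite uU vV//.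
by have := H j (mem_index_enum _); rewrite /= normr_eq0 subr_eq0 => /eqP ->.
Qed.
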